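(* Fix an integer $r \ge 2$ and a constant $\varepsilon > 0$. Let $X$ be the number of copies of the star $K_{1,r}$ in the binomial random graph $\mathbb{G}(n,p)$, and let $\mu = \mathbb{E} X = n\binom{n-1}{r}p^r$. If $p = p(n) \to 0$ is such that $\mu \gg \log n$, then, as $n \to \infty$, \[ -\log \mathbb{P}\left(X \ge (1+\varepsilon)\mu\right) \sim \begin{cases} I_r(c,\varepsilon)\,\mu & \text{if } \mu/(\log n)^{r/(r-1)} \to c \in [0,\infty),\\ \psi_r(\varepsilon)\,\mu^{1/r}\log n & \text{if } (\log n)^{r/(r-1)} \ll \mu \ll n^r,\\ \frac{1}{r}\left(\{\varepsilon\rho\}^{1/r} + \lfloor \varepsilon\rho\rfloor\right) n\log n & \text{if } \mu/\binom{n}{r} \to \rho \in (0,\infty),\\ \varepsilon n^2 p^r \log\frac{1}{p} & \text{if } \mu \gg n^r. \end{cases} \]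
   Context: $\mathbb{G}(n,p)$ is the random graph on vertex set $[n]=\{1,\dots,n\}$ in which each of the $\binom n2$ possible edges is present independently with probability $p$. The number of copies of $K_{1,r}$ ($r$-armed stars) equals $\sum_{i\in[n]} \binom{X_i}{r}$, where $X_i$ is the degree of vertex $i$. $\log$ is the natural logarithm; $\lfloor x\rfloor$ is the floor of $x$ and $\{x\} := x - \lfloor x\rfloor$ is its fractional part. All asymptotics are as $n\to\infty$: $a_n \ll b_n$ (equivalently $b_n \gg a_n$) means $a_n/b_n \to 0$, and $a_n\sim b_n$ means $a_n/b_n \to 1$. Define $\phi(x) := (1+x)\log(1+x) - x$ for $x \ge 0$ and $\psi_r(\delta) := r^{-1}(r!\,\delta)^{1/r}$ for $\delta\ge 0$. For $c,\varepsilon>0$ let \[ I_r(c,\varepsilon) := \min_{\delta\in[0,\varepsilon]}\left(\phi(\varepsilon-\delta) + \psi_r(\delta)\,c^{1/r-1}\right), \] and set $I_r(0,\varepsilon) := \phi(\varepsilon)$. *)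

(* Defs.v *)
From HB Require Import structures.
From mathcomp Require Import all_boot all_order all_algebra.
From mathcomp Require Import all_classical all_reals all_analysis.

Set Implicit Arguments.
Unset Strict Implicit.
Unset Printing Implicit Defensive.

Import Order.TTheory GRing.Theory Num.Theory.
Import numFieldNormedType.Exports.

Local Open Scope classical_set_scope.
Local Open Scope ring_scope.

(* A simple graph on the vertex set 'I_n is its edge set, a subset of
   [edges n]. *)
Definition edges (n : nat) : {set {set 'I_n}} := [set e : {set 'I_n} | #|e| == 2]%SET.

Definition graphs (n : nat) : {set {set {set 'I_n}}} := powerset (edges n).

Definition degree (n : nat) (G : {set {set 'I_n}}) (v : 'I_n) : nat :=
  #|[set w | (w != v) && ([set v; w] \in G)]%SET|.

Definition star (n : nat) (v : 'I_n) (L : {set 'I_n}) : {set {set 'I_n}} :=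
  [set [set v; w] | w in L]%SET.

(* Copies are subgraphs, not embeddings; for r >= 1 a copy of K_{1,r} has no
   isolated vertex, so that it is determined by its edge set. *)
Definition is_star (n r : nat) (H : {set {set 'I_n}}) : bool :=
  [exists v : 'I_n, exists L : {set 'I_n},
     [&& v \notin L, #|L| == r & H == star v L]].

Definition nb_stars (n r : nat) (G : {set {set 'I_n}}) : nat :=
  #|[set H : {set {set 'I_n}} | (H \subset G) && is_star r H]%SET|.

Lemma star_inj (n r : nat) (v v' : 'I_n) (L L' : {set 'I_n}) :
  (1 < r)%N -> v \notin L -> v' \notin L' -> #|L| = r -> #|L'| = r ->
  star v L = star v' L' -> v = v' /\ L = L'.
Proof.
have leaf (u : 'I_n) (M : {set 'I_n}) : u \notin M ->
    forall w, ([set u; w]%SET \in star u M) = (w \in M).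
  move=> uM w; apply/imsetP/idP => [[x xM /setP E]|wM]; last by exists w.
  have := E x; rewrite !inE eqxx orbT.
  by case/orP => /eqP ex; [move: uM; rewrite -ex xM | rewrite -ex].
move=> r1 vL vL' cL cL' E.
have ev : v = v'.
  apply/eqP/negPn/negP => vv'.
  have only w : w \in L -> w = v'.
    rewrite -(leaf _ _ vL) E => /imsetP[x _ /setP F].
    have := F v'; rewrite !inE eqxx /= => /orP[/eqP e|/eqP//].
    by rewrite e eqxx in vv'.
  have : (#|L| <= #|[set v']%SET|)%N.
    by apply/subset_leq_card/fintype.subsetP => w /only ->; rewrite inE.
  by rewrite cards1 cL leqNgt r1.
split=> //; apply/setP => w.
by rewrite -(leaf _ _ vL) E ev leaf.
Qed.

Lemma card_star (n : nat) (v : 'I_n) (L : {set 'I_n}) :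
  v \notin L -> #|star v L| = #|L|.
Proof.
move=> vL; apply: card_in_imset => x y xL yL /setP E.
have := E x; rewrite !inE eqxx orbT.
by case/esym/orP => /eqP // e; move: vL; rewrite -e xL.
Qed.

Lemma nb_starsE_pairs (n r : nat) (G : {set {set 'I_n}}) : (1 < r)%N ->
  nb_stars r G =
  (\sum_(v : 'I_n) \sum_(L : {set 'I_n} | (v \notin L) && (#|L| == r))
     (star v L \subset G))%N.
Proof.
move=> r1.
pose P := [set q : 'I_n * {set 'I_n} |
  [&& q.1 \notin q.2, #|q.2| == r & star q.1 q.2 \subset G]]%SET.
have -> : nb_stars r G = #|[set star q.1 q.2 | q in P]%SET|.
  rewrite /nb_stars; apply: eq_card => H; rewrite !inE.
  apply/andP/imsetP => [[HG /existsP[v /existsP[L /and3P[vL cL /eqP eH]]]]|].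
    by exists (v, L); rewrite //= inE /= vL cL -eH HG.
  move=> [[v L]]; rewrite inE /= => /and3P[vL cL sG] ->; split=> //.
  by apply/existsP; exists v; apply/existsP; exists L; rewrite vL cL eqxx.
rewrite card_in_imset => [|[v L] [v' L']]; last first.
  rewrite !inE /= => /and3P[vL /eqP cL _] /and3P[vL' /eqP cL' _] E.
  by have [-> ->] := star_inj r1 vL vL' cL cL' E.
rewrite pair_big_dep /= -sum1_card big_mkcond [RHS]big_mkcond /=.
apply: eq_bigr => -[v L] _; rewrite inE /= andbA.
by case: (v \notin L); case: (#|L| == r); case: (star v L \subset G).
Qed.

Lemma nb_starsE (n r : nat) (G : {set {set 'I_n}}) : (1 < r)%N ->
  nb_stars r G = (\sum_(v : 'I_n) 'C(degree G v, r))%N.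
Proof.
move=> r1; rewrite nb_starsE_pairs //; apply: eq_bigr => v _.
rewrite /degree -cards_draws -sum1_card big_mkcond [RHS]big_mkcond /=.
apply: eq_bigr => L _; rewrite inE.
have -> : L \subset [set w | (w != v) && ([set v; w] \in G)]%SET =
    (v \notin L) && (star v L \subset G).
  apply/fintype.subsetP/andP => [LG|[vL /fintype.subsetP sG] w wL].
    split; first by apply/negP => /LG; rewrite inE eqxx.
    by apply/fintype.subsetP => e /imsetP[w /LG]; rewrite inE => /andP[_ h] ->.
  rewrite inE (sG _ (imset_f _ wL)) andbT.
  by apply: contraNneq vL => <-.
by case: (v \notin L); case: (#|L| == r); case: (star v L \subset G).
Qed.

Section Gnp.
Context {R : realType}.
Variables (n : nat) (p : R).

(* The law of the random graph: the product over all possible edges of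
   Bernoulli(p) laws. *)
Definition gnp_mass (G : {set {set 'I_n}}) : R :=
  \prod_(e in edges n) (if e \in G then p else 1 - p).

Definition gnp_prob (A : pred {set {set 'I_n}}) : R :=
  \sum_(G in graphs n | A G) gnp_mass G.

Definition gnp_expectation (f : {set {set 'I_n}} -> R) : R :=
  \sum_(G in graphs n) gnp_mass G * f G.

Lemma gnp_sub (S : {set {set 'I_n}}) : S \subset edges n ->
  \sum_(G in graphs n) gnp_mass G * (S \subset G)%:R = p ^+ #|S|.
Proof.
move=> SE.
pose F (e : {set 'I_n}) : R := if e \in edges n then p else 0.
pose H (e : {set 'I_n}) : R :=
  if e \in edges n then (if e \in S then 0 else 1 - p) else 1.
transitivity (\sum_(G : {set {set 'I_n}}) \prod_e (if e \in G then F e else H e)).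
  rewrite big_mkcond /=; apply: eq_bigr => G _; rewrite inE.
  case: ifP => [GE|/negbT/fintype.subsetPn[e eG eE]]; last first.
    by rewrite (bigD1 e) //= eG /F (negbTE eE) mul0r.
  have [SG|/fintype.subsetPn[e eS eG]] := boolP (S \subset G); last first.
    rewrite mulr0 (bigD1 e) //= (negbTE eG) /H eS.
    by rewrite (fintype.subsetP SE) // mul0r.
  rewrite mulr1 /gnp_mass big_mkcond /=; apply: eq_bigr => e _; rewrite /F /H.
  case: ifP => eE; last by case: ifP => // eG; rewrite (fintype.subsetP GE _ eG) in eE.
  by case: ifP => // eG; case: ifP => // /(fintype.subsetP SG); rewrite eG.
rewrite -bigA_distr -prodr_const [RHS]big_mkcond /=; apply: eq_bigr => e _.
rewrite /F /H; case: ifP => eE; last first.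
  by rewrite add0r; case: ifP => // /(fintype.subsetP SE); rewrite eE.
by case: ifP; rewrite ?addr0 // addrC subrK.
Qed.

Lemma gnp_mass_sum : \sum_(G in graphs n) gnp_mass G = 1.
Proof.
have := gnp_sub (finset.sub0set _); rewrite cards0 expr0 => <-.
by apply: eq_bigr => G _; rewrite finset.sub0set mulr1.
Qed.

Lemma gnp_nb_stars (r : nat) : (1 < r)%N ->
  gnp_expectation (fun G => (nb_stars r G)%:R) =
  n%:R * ('C(n.-1, r))%:R * p ^+ r.
Proof.
move=> r1; rewrite /gnp_expectation.
transitivity (\sum_(v : 'I_n)
   \sum_(L : {set 'I_n} | (v \notin L) && (#|L| == r)) p ^+ r).
  transitivity (\sum_(G in graphs n) \sum_(v : 'I_n)
   \sum_(L : {set 'I_n} | (v \notin L) && (#|L| == r))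
     gnp_mass G * (star v L \subset G)%:R).
    apply: eq_bigr => G _; rewrite nb_starsE_pairs // natr_sum mulr_sumr.
    by apply: eq_bigr => v _; rewrite natr_sum mulr_sumr.
  rewrite exchange_big /=; apply: eq_bigr => v _.
  rewrite exchange_big /=; apply: eq_bigr => L /andP[vL /eqP cL].
  rewrite gnp_sub ?card_star ?cL //.
  apply/fintype.subsetP => e /imsetP[w wL ->]; rewrite inE cards2.
  by rewrite (_ : v != w) //; apply: contraNneq vL => ->.
have sub v (L : {set 'I_n}) : (v \notin L) && (#|L| == r) =
    (L \in [set L : {set 'I_n} | (L \subset [set~ v]) && (#|L| == r)]%SET).
  by rewrite inE finset.subsetC finset.sub1set inE.
under eq_bigr => v _.
  rewrite (eq_bigl _ _ (sub v)) sumr_const cards_draws cardsC1 card_ord.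
  over.
by rewrite sumr_const card_ord -mulrnA -[LHS]mulr_natl mulnC natrM.
Qed.

End Gnp.

Section Rates.
Context {R : realType}.

Definition mean_stars (r : nat) (p : nat -> R) (n : nat) : R :=
  gnp_expectation (p n) (fun G : {set {set 'I_n}} => (nb_stars r G)%:R).

Lemma mean_starsE (r : nat) (p : nat -> R) (n : nat) : (1 < r)%N ->
  mean_stars r p n = n%:R * ('C(n.-1, r))%:R * p n ^+ r.
Proof. exact: gnp_nb_stars. Qed.

Definition upper_tail (r : nat) (eps : R) (p : nat -> R) (n : nat) : R :=
  gnp_prob (p n)
    (fun G : {set {set 'I_n}} =>
       (1 + eps) * mean_stars r p n <= (nb_stars r G)%:R).

Definition phi (x : R) : R := (1 + x) * ln (1 + x) - x.

Definition psi (r : nat) (delta : R) : R :=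
  r%:R^-1 * ((r`!)%:R * delta) `^ r%:R^-1.

Definition rate_fun (r : nat) (c eps delta : R) : R :=
  phi (eps - delta) + psi r delta * c `^ (r%:R^-1 - 1).

(* For c > 0 the infimum is a minimum, see [rate_min] below. *)
Definition rate (r : nat) (c eps : R) : R :=
  if c == 0 then phi eps else inf [set rate_fun r c eps d | d in `[0, eps]].

Lemma rate_min (r : nat) (c eps : R) : (0 < r)%N -> 0 < c -> 0 < eps ->
  exists2 d, d \in `[0, eps]%R & rate r c eps = rate_fun r c eps d /\
    forall d', d' \in `[0, eps]%R -> rate_fun r c eps d <= rate_fun r c eps d'.
Proof.
move=> r0 c0 e0.
have rV0 : 0 < r%:R^-1 :> R by rewrite invr_gt0 ltr0n.
have cphi d : d <= eps -> {for d, continuous (fun d => phi (eps - d))}.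
  move=> de.
  have clin : (1 + (eps - x)) @[x --> d] --> 1 + (eps - d).
    by apply: cvgD; [exact: cvg_cst|apply: cvgB; [exact: cvg_cst|exact: cvg_id]].
  have cln : {for 1 + (eps - d), continuous (@ln R)}.
    by apply: continuous_ln; rewrite ltr_pwDl // subr_ge0.
  apply: cvgB; last by apply: cvgB; [exact: cvg_cst|exact: cvg_id].
  apply: cvgM; first exact: clin.
  exact: (continuous_comp (f := fun x : R => 1 + (eps - x)) clin cln).
have cpsi d : 0 < d ->
    {for d, continuous (fun d => psi r d * c `^ (r%:R^-1 - 1))}.
  move=> d0.
  have clin : (r`!)%:R * x @[x --> d] --> (r`!)%:R * d.
    by apply: cvgM; [exact: cvg_cst|exact: cvg_id].
  have cpow : {for (r`!)%:R * d, continuous (fun x : R => x `^ r%:R^-1)}.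
    apply: differentiable_continuous; apply/derivable1_diffP.
    by apply: derivable_powR; rewrite in_itv /= andbT mulr_gt0 // ltr0n fact_gt0.
  apply: cvgM; last exact: cvg_cst.
  apply: cvgM; first exact: cvg_cst.
  exact: (continuous_comp (f := fun x : R => (r`!)%:R * x) clin cpow).
have cF : {within `[0, eps], continuous (rate_fun r c eps)}.
  apply/continuous_within_itvP => //; split.
  - move=> d; rewrite in_itv /= => /andP[d0 de].
    by apply: cvgD; [exact/cphi/ltW|exact: cpsi].
  - apply: cvgD; first exact/cvg_at_right_filter/cphi/ltW.
    apply: cvgM; last exact: cvg_cst.
    apply: cvgM; first exact: cvg_cst.
    rewrite mulr0 powR0 ?gt_eqF // -[X in _ --> X](mulr0 ((r`!)%:R `^ r%:R^-1)).
    apply: (@cvg_trans _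
        ((r`!)%:R `^ r%:R^-1 * d `^ r%:R^-1 @[d --> (0 : R)^'+])).
      by apply: near_eq_cvg; near=> d; rewrite powRM.
    by apply: cvgM; [exact: cvg_cst|exact: powR_cvg0].
  - apply: cvgD; first exact/cvg_at_left_filter/cphi.
    exact/cvg_at_left_filter/cpsi.
have [d dI dmin] := EVT_min (ltW e0) cF.
exists d => //; split=> //; rewrite /rate gt_eqF //.
apply/eqP; rewrite eq_le; apply/andP; split.
  apply: ge_inf; last by exists d.
  by exists (rate_fun r c eps d) => _ [d' d'I <-]; exact: dmin.
apply: lb_le_inf; first by exists (rate_fun r c eps d), d.
by move=> _ [d' d'I <-]; exact: dmin.
Unshelve. all: end_near. Qed.

Definition frac_part (x : R) : R := x - (Num.floor x)%:~R.

(* The first clause matters because x / 0 = 0 by convention: it makes the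
   quotients genuine ones. *)
Definition much_less (a b : nat -> R) : Prop :=
  (\forall n \near \oo, b n != 0) /\ a n / b n @[n --> \oo] --> (0 : R).

(* No such clause is needed here: as 1 != 0, the limit forces b n != 0
   eventually. *)
Definition asymp_eq (a b : nat -> R) : Prop :=
  a n / b n @[n --> \oo] --> (1 : R).

End Rates.

(* Main.v *)
Require Import Defs.
From HB Require Import structures.
From mathcomp Require Import all_boot all_order all_algebra.
From mathcomp Require Import all_classical all_reals all_analysis.
From mathcomp Require Import ring lra zify.

Set Implicit Arguments.
Unset Strict Implicit.
Unset Printing Implicit Defensive.

Import Order.TTheory GRing.Theory Num.Theory.
Import numFieldNormedType.Exports.

Local Open Scope classical_set_scope.
Local Open Scope ring_scope.

(** Write d = n p for the mean degree and mu for the mean number of stars.  There are two ways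
to obtain many more stars than expected: some vertices of exceptionally large degree, or
exceptionally many stars elsewhere.

A degree x much larger than d has probability exp (- cost d x), where cost d x is about
x * ln (x / d), and the degrees of different vertices are nearly independent: their joint
exponential moments are those of independent variables up to a term of second order, due to
the edges between two such vertices ([degree_tilt]).  A union bound over the configurations
of large degrees then shows that degrees of total cost t occur with probability about
exp (- t) ([big_tail]).  The stars at vertices of moderate degree share edges with few others,
and their number has exponential tails ([bulk_tail]).  When mu is much larger than
(ln n) ^ (r / (r - 1)), these tails are negligible, so that the excess is due to large degrees
and its price is the minimal cost of degrees that carry eps * mu stars ([upper_by_cost]).
Since x ^ r grows faster than cost d x, few large degrees are better than many small ones
([cost_linear]).  If mu is much smaller than n ^ r, then one vertex is enough.  If mu is of
order n ^ r, then its degree would have to be of order n, and the degrees u i * n, with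
0 <= u i <= 1, have to satisfy a condition on the sum of the u i ^ r and to minimise the sum of
the u i; full vertices and one more vertex are optimal ([floor_root_sum]).  If mu is much
larger than n ^ r, then the number of full vertices is unbounded and its fractional part no
longer matters.

When mu is at most of order (ln n) ^ (r / (r - 1)), d is at most n ^ (- 1 / r) up to
logarithmic factors.  Away from the large degrees almost all stars then are isolated, because
a star with a further edge has an expected number of order d * mu ([flawed_tail]).  Isolated
stars are disjoint, their number has the upper tail of a Poisson variable, and this price is
added to that of the large degrees because different edges are involved
([isolated_joint_tail]).  One vertex that carries the share delta of mu costs about
psi r delta * mu ^ (1 / r) * ln n, and the other stars cost phi (eps - delta) * mu; the minimum
over delta is the rate ([sparse_config_cost]).

For the lower bounds, the edges at the vertices of large degree are revealed first
([plant]).  The remaining graph contributes nearly its mean at a polynomial price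
([crude_lower]) or, in the Poisson regime, an excess: the factorial moments of the number of
isolated stars are close to powers of mu, and they bound the upper tail from below by that
of a Poisson variable ([poisson_lower]). *)

(** * The random graph as a product measure *)

Section Basics.
Context {R : realType}.
Variables (n : nat) (p : R).
Hypothesis hp : 0 <= p <= 1.

Lemma gnp_mass_ge0 (G : {set {set 'I_n}}) : 0 <= gnp_mass p G.
Proof.
have /andP[p0 p1] := hp; apply: prodr_ge0 => e _.
by case: ifP; rewrite ?subr_ge0.
Qed.

Lemma gnp_probE (A : pred {set {set 'I_n}}) :
  gnp_prob p A = gnp_expectation p (fun G => (A G)%:R).
Proof.
rewrite /gnp_prob /gnp_expectation big_mkcondr; apply: eq_bigr => G _.
by case: ifP; rewrite ?mulr1 ?mulr0.
Qed.

Lemma gnp_expectation_le (f g : {set {set 'I_n}} -> R) :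
  (forall G, G \in graphs n -> f G <= g G) ->
  gnp_expectation p f <= gnp_expectation p g.
Proof.
by move=> fg; apply: ler_sum => G GE; rewrite ler_wpM2l ?gnp_mass_ge0 ?fg.
Qed.

Lemma gnp_expectationZ (a : R) (f : {set {set 'I_n}} -> R) :
  gnp_expectation p (fun G => a * f G) = a * gnp_expectation p f.
Proof.
by rewrite /gnp_expectation mulr_sumr; apply: eq_bigr => G _; rewrite mulrCA.
Qed.

Lemma gnp_expectationD (f g : {set {set 'I_n}} -> R) :
  gnp_expectation p (fun G => f G + g G) =
  gnp_expectation p f + gnp_expectation p g.
Proof.
by rewrite /gnp_expectation -big_split; apply: eq_bigr => G _; rewrite mulrDr.
Qed.

Lemma gnp_expectation_sum (I : finType) (P : pred I)
    (f : I -> {set {set 'I_n}} -> R) :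
  gnp_expectation p (fun G => \sum_(i | P i) f i G) =
  \sum_(i | P i) gnp_expectation p (f i).
Proof.
rewrite /gnp_expectation exchange_big; apply: eq_bigr => G _.
by rewrite mulr_sumr.
Qed.

Lemma gnp_expectation_cst (a : R) : gnp_expectation p (fun _ : {set {set 'I_n}} => a) = a.
Proof. by rewrite /gnp_expectation -mulr_suml gnp_mass_sum mul1r. Qed.

Lemma gnp_prob_ge0 (A : pred {set {set 'I_n}}) : 0 <= gnp_prob p A.
Proof. by apply: sumr_ge0 => G _; exact: gnp_mass_ge0. Qed.

Lemma gnp_prob_le (A B : pred {set {set 'I_n}}) :
  (forall G, G \in graphs n -> A G -> B G) -> gnp_prob p A <= gnp_prob p B.
Proof.
move=> AB; rewrite !gnp_probE; apply: gnp_expectation_le => G GE.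
by rewrite ler_nat; case: (boolP (A G)) => // /(AB _ GE) ->.
Qed.

Lemma gnp_probU (A B C : pred {set {set 'I_n}}) :
  (forall G, G \in graphs n -> A G -> B G || C G) ->
  gnp_prob p A <= gnp_prob p B + gnp_prob p C.
Proof.
move=> ABC; rewrite !gnp_probE -gnp_expectationD; apply: gnp_expectation_le => G GE.
rewrite -natrD ler_nat; case: (boolP (A G)) => // /(ABC _ GE).
by case: (B G); case: (C G).
Qed.

(** Independence of the edges: functions of the individual edge indicators
multiply under the expectation. *)
Lemma gnp_prod (w : {set 'I_n} -> bool -> R) :
  gnp_expectation p (fun G => \prod_(e in edges n) w e (e \in G)) =
  \prod_(e in edges n) (p * w e true + (1 - p) * w e false).
Proof.
pose F e : R := if e \in edges n then p * w e true else 0.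
pose H e : R := if e \in edges n then (1 - p) * w e false else 1.
transitivity (\sum_(G : {set {set 'I_n}}) \prod_e (if e \in G then F e else H e)).
  rewrite /gnp_expectation big_mkcond /=; apply: eq_bigr => G _; rewrite inE.
  case: ifP => [GE|/negbT/fintype.subsetPn[e eG eE]]; last first.
    by rewrite (bigD1 e) //= eG /F (negbTE eE) mul0r.
  rewrite /gnp_mass -big_split /= big_mkcond /=; apply: eq_bigr => e _.
  rewrite /F /H; case: ifP => eE; first by case: (e \in G).
  by case: ifP => // eG; rewrite (fintype.subsetP GE _ eG) in eE.
rewrite -bigA_distr [RHS]big_mkcond /=; apply: eq_bigr => e _.
by rewrite /F /H; case: ifP; rewrite // add0r.
Qed.

End Basics.

(** * Disjoint packings of edge sets *)

Lemma exp_series_le {R : realType} (x : R) (k : nat) : 0 <= x ->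
  \sum_(i < k) x ^+ i / i`!%:R <= expR x.
Proof.
move=> x0; have := nondecreasing_cvgn_le (u_ := series (exp_coeff x)).
move=> /(_ _ (is_cvg_series_exp_coeff x) k).
rewrite /expR /series /= big_mkord; apply.
by apply/nondecreasing_series => n _ _; exact: exp_coeff_ge0.
Qed.

Lemma disjointsUr (T : finType) (A B C : {set T}) :
  [disjoint A & B :|: C]%B = [disjoint A & B] && [disjoint A & C].
Proof. by rewrite -!finset.setI_eq0 finset.setIUr finset.setU_eq0. Qed.

Section Packing.
Variables (I T : finType) (P : pred I) (A : I -> {set T}) (G : {set T}).

(** The number of ordered m-tuples of members of the family that lie in G, are
pairwise disjoint and are disjoint from B. *)
Fixpoint npack (m : nat) (B : {set T}) : nat :=
  if m is m'.+1 then
    (\sum_(i | [&& P i, A i \subset G & [disjoint A i & B]]) npack m' (B :|: A i))%N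
  else 1%N.

(** Each choice of a member excludes at most C of the others. *)
Lemma npack_ge (J : {set I}) (C k m : nat) (B : {set T}) :
  (forall i, i \in J -> P i && (A i \subset G)) ->
  (forall i, i \in J -> #|[set j in J | ~~ [disjoint A i & A j]]| <= C)%N ->
  (C * k <= #|[set j in J | [disjoint A j & B]]|)%N ->
  (C ^ m * k ^_ m <= npack m B)%N.
Proof.
move=> JP JC; elim: m k B => [|m IH] k B; first by rewrite expn0 ffactn0.
case: k => [|k] kB /=; first by rewrite ffact0n muln0.
set JB := [set j in J | _]%SET in kB.
apply: (@leq_trans (\sum_(i in JB) (C ^ m * k ^_ m))); last first.
  rewrite [leqRHS]big_mkcond [leqLHS]big_mkcond /=; apply: leq_sum => i _.
  rewrite inE; case: (boolP (i \in J)) => //= iJ.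
  have /andP[-> ->] := JP _ iJ; rewrite /=; case: ifP => // iB.
  apply: IH; rewrite -(leq_add2l C) -mulnS; apply: (leq_trans kB).
  have /subset_leq_card : JB \subset
      [set j in J | ~~ [disjoint A i & A j]] :|:
      [set j in J | [disjoint A j & (B :|: A i)]].
    apply/fintype.subsetP => j; rewrite !inE disjointsUr => /andP[-> ->].
    by rewrite /= [in X in _ || X]disjoint_sym; case: (disjoint _ _).
  move=> /leq_trans; apply; apply: (leq_trans (leq_card_setU _ _)).
  by rewrite leq_add2r JC.
by rewrite sum_nat_const ffactnS /= expnS mulnACA leq_mul2r kB orbT.
Qed.

End Packing.

Section PackingTail.
Context {R : realType}.
Variables (n : nat) (p : R).
Hypothesis hp : 0 <= p <= 1.
Variables (I : finType) (P : pred I) (A : I -> {set {set 'I_n}}).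
Variables (W : {set {set 'I_n}} -> R) (M : R) (D : {set {set 'I_n}}).
Hypothesis W0 : forall G, 0 <= W G.
Hypothesis WD : forall B : {set {set 'I_n}}, B \subset D ->
  gnp_expectation p (fun G => W G * (B \subset G)%:R) <= M * p ^+ #|B|.
Hypothesis AD : forall i, P i -> A i \subset D.

Lemma npack_expectation_le m (B : {set {set 'I_n}}) : B \subset D ->
  gnp_expectation p (fun G => W G * (B \subset G)%:R * (npack P A G m B)%:R) <=
  M * p ^+ #|B| * (\sum_(i | P i) p ^+ #|A i|) ^+ m.
Proof.
have /andP[p0 p1] := hp.
elim: m B => [|m IH] B BD /=.
  rewrite expr0 mulr1; apply: le_trans (WD BD).
  by apply: gnp_expectation_le => // G _; rewrite mulr1.
have -> : (fun G => W G * (B \subset G)%:R *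
    (\sum_(i | [&& P i, A i \subset G & [disjoint A i & B]])
        npack P A G m (B :|: A i))%:R) =
    (fun G => \sum_(i | P i) (([disjoint A i & B]%B)%:R *
      (W G * (B :|: A i \subset G)%:R * (npack P A G m (B :|: A i))%:R))).
  apply/funext => G; rewrite natr_sum mulr_sumr big_mkcond [RHS]big_mkcond /=.
  apply: eq_bigr => i _; rewrite finset.subUset; case: (P i) => //=.
  by case: (B \subset G); case: (A i \subset G); case: (disjoint _ _);
    rewrite /= ?(mulr0, mul0r, mulr1, mul1r).
rewrite gnp_expectation_sum exprS mulrA mulr_sumr mulr_suml; apply: ler_sum => i Pi.
rewrite gnp_expectationZ; have [AB|_] := boolP ([disjoint A i & B]%B); last first.
  rewrite mul0r !mulr_ge0 ?exprn_ge0 ?sumr_ge0 // => [|j _]; last exact: exprn_ge0.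
  have := WD (finset.sub0set D); rewrite cards0 expr0 mulr1; apply: le_trans.
  by apply: sumr_ge0 => G _; rewrite !mulr_ge0 ?gnp_mass_ge0.
rewrite mul1r; apply: (le_trans (IH _ _)); first by rewrite finset.subUset BD AD.
have /eqP-> : #|B :|: A i| == (#|B| + #|A i|)%N.
  by rewrite leq_card_setU disjoint_sym.
by rewrite exprD !mulrA.
Qed.

(** The generating function of the numbers of tuples: on the event there are at
least C ^ m * k ^_ m of them for every m, whence a factor (1 + s) ^ k. *)
Lemma packing_tail (ev : pred {set {set 'I_n}}) (C k : nat) (s : R) :
  (0 < C)%N -> 0 <= s ->
  (forall G, G \in graphs n -> ev G -> exists J : {set I},
    [/\ forall i, i \in J -> P i && (A i \subset G),
        forall i, i \in J ->
          (#|[set j in J | ~~ [disjoint A i & A j]]%SET| <= C)%N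
      & (C * k <= #|J|)%N]) ->
  gnp_expectation p (fun G => W G * (ev G)%:R) * (1 + s) ^+ k <=
  M * expR (s / C%:R * \sum_(i | P i) p ^+ #|A i|).
Proof.
have /andP[p0 p1] := hp; move=> C0 s0 evJ.
set mu := \sum_(i | P i) _; set E := gnp_expectation p _.
have mu0 : 0 <= mu by apply: sumr_ge0 => i _; exact: exprn_ge0.
have M0 : 0 <= M.
  have := WD (finset.sub0set D); rewrite cards0 expr0 mulr1; apply: le_trans.
  by apply: sumr_ge0 => G _; rewrite !mulr_ge0 ?gnp_mass_ge0.
have Em m : E * (C ^ m * k ^_ m)%:R <= M * mu ^+ m.
  have := npack_expectation_le m (finset.sub0set D).
  rewrite cards0 expr0 mulr1; apply: le_trans.
  rewrite mulrC -gnp_expectationZ; apply: gnp_expectation_le => // G GE.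
  rewrite finset.sub0set mulr1 mulrCA ler_wpM2l //.
  case: (boolP (ev G)) => [evG|_]; last by rewrite mulr0.
  rewrite mulr1 ler_nat; have [J [JP JC Jk]] := evJ _ GE evG.
  apply: (npack_ge (J := J)); [exact: JP|exact: JC|]; apply: (leq_trans Jk); apply: subset_leq_card.
  apply/fintype.subsetP => j jJ; rewrite inE jJ /= -finset.setI_eq0.
  by rewrite finset.setI0.
rewrite exprDn mulr_sumr.
apply: (@le_trans _ _ (\sum_(i < k.+1) M * ((s / C%:R * mu) ^+ i / i`!%:R))).
  apply: ler_sum => m _; rewrite expr1n mul1r.
  have -> : E * (s ^+ m *+ 'C(k, m)) =
      (s / C%:R) ^+ m / m`!%:R * (E * (C ^ m * k ^_ m)%:R).
    rewrite -bin_ffact -mulr_natr !natrM natrX expr_div_n.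
    have Cm : C%:R ^+ m != 0 :> R by rewrite expf_neq0 // pnatr_eq0 -lt0n.
    have fm : m`!%:R != 0 :> R by rewrite pnatr_eq0 -lt0n fact_gt0.
    by field; rewrite Cm fm.
  have -> : M * ((s / C%:R * mu) ^+ m / m`!%:R) =
      (s / C%:R) ^+ m / m`!%:R * (M * mu ^+ m).
    by rewrite exprMn; ring.
  by rewrite ler_wpM2l ?Em // divr_ge0 // exprn_ge0 // divr_ge0.
rewrite -mulr_sumr ler_wpM2l //; apply: exp_series_le.
by rewrite mulr_ge0 // divr_ge0.
Qed.

End PackingTail.

(** * Degrees *)

Section Degrees.
Variable n : nat.
Implicit Types (G B : {set {set 'I_n}}) (i v : 'I_n).

Lemma edges_at i :
  [set e in edges n | i \in e]%SET = [set [set i; j] | j in [set~ i]]%SET.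
Proof.
apply/setP => e; rewrite !inE; apply/andP/imsetP => [[/cards2P[x [y [xy ->]]]]|].
  rewrite !inE => /orP[]/eqP->.
    by exists y => //; rewrite !inE eq_sym.
  by exists x; rewrite ?inE // finset.setUC.
move=> [j]; rewrite !inE => ji ->; split; last by rewrite !inE eqxx.
by rewrite cards2 [i == j]eq_sym ji.
Qed.

Lemma set2_inj i : {in [set~ i]%SET &, injective (fun j => [set i; j]%SET)}.
Proof.
move=> j k; rewrite !inE => ji ki /setP/(_ j); rewrite !inE eqxx orbT.
by rewrite (negbTE ji) /= => /esym/eqP.
Qed.

Lemma big_edges_at {T : Type} (idx : T) (op : Monoid.com_law idx) i
    (F : {set 'I_n} -> T) :
  \big[op/idx]_(e in edges n | i \in e) F e =
  \big[op/idx]_(j | j != i) F [set i; j]%SET.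
Proof.
transitivity (\big[op/idx]_(e in [set [set i; j] | j in [set~ i]]%SET) F e).
  by apply: eq_bigl => e; rewrite -edges_at !inE.
rewrite big_imset; last exact: set2_inj.
by apply: eq_bigl => j; rewrite !inE.
Qed.

Lemma degreeE G i : degree G i = (\sum_(e in edges n | i \in e) (e \in G))%N.
Proof.
rewrite big_edges_at /degree -sum1_card big_mkcond [RHS]big_mkcond /=.
by apply: eq_bigr => j _; rewrite !inE; case: (_ != _) => //; case: (_ \in G).
Qed.

Lemma degree_lt G i : (degree G i < n)%N.
Proof.
rewrite -[ltnRHS](card_ord n) -cardsT; apply: proper_card.
by apply/properP; split; [exact/fintype.subsetP|exists i; rewrite ?inE ?eqxx].
Qed.

Context {R : realType}.

Lemma sum_edges_pairs (F : {set 'I_n} -> R) :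
  2 * \sum_(e in edges n) F e = \sum_i \sum_(j | j != i) F [set i; j]%SET.
Proof.
rewrite mulr_sumr.
transitivity (\sum_(e in edges n) \sum_(i in e) F e).
  by apply: eq_bigr => e; rewrite inE => /eqP e2; rewrite sumr_const e2 mulr_natl.
rewrite (exchange_big_dep predT) //=; apply: eq_bigr => i _.
by rewrite -big_edges_at.
Qed.

Lemma sum_edges_tilt (y : 'I_n -> R) : (forall i, 1 <= y i) ->
  \sum_(e in edges n) (\prod_(i in e) y i - 1) <=
  n%:R * \sum_i (y i - 1) + (\sum_i (y i - 1)) ^+ 2 / 2.
Proof.
move=> y1; rewrite -(ler_pM2l (ltr0n R 2)) sum_edges_pairs.
apply: (@le_trans _ _ (\sum_i \sum_j (y i * y j - 1))).
  apply: ler_sum => i _; rewrite big_mkcond; apply: ler_sum => j _; case: ifP.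
    by move=> ji; rewrite big_setU1 ?big_set1 // inE eq_sym ji.
  by rewrite subr_ge0 => _; rewrite mulr_ege1.
set u := \sum_i (y i - 1).
have -> : \sum_i \sum_j (y i * y j - 1) = \sum_i ((y i - 1) * n%:R + (u + (y i - 1) * u)).
  apply: eq_bigr => i _.
  transitivity (\sum_(j < n) ((y i - 1) + ((y j - 1) + (y i - 1) * (y j - 1)))).
    by apply: eq_bigr => j _; ring.
  rewrite big_split /= sumr_const card_ord mulr_natr; congr (_ + _).
  by rewrite big_split /= -mulr_sumr.
rewrite big_split /= -mulr_suml -/u big_split /= -mulr_suml -/u.
rewrite sumr_const card_ord -mulr_natr.
by rewrite le_eqVlt; apply/orP; left; apply/eqP; field.
Qed.

Variable p : R.
Hypothesis hp : 0 <= p <= 1.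

(** The joint exponential moment of the degrees: an edge meets at most two
vertices, so that the deviation from independence is only of second order. *)
Lemma degree_tilt (y : 'I_n -> R) B : (forall i, 1 <= y i) -> B \subset edges n ->
  (forall e i, e \in B -> i \in e -> y i = 1) ->
  gnp_expectation p (fun G => \prod_i y i ^+ degree G i * (B \subset G)%:R) <=
  p ^+ #|B| * expR (p * (n%:R * \sum_i (y i - 1) + (\sum_i (y i - 1)) ^+ 2 / 2)).
Proof.
have /andP[p0 p1] := hp; move=> y1 BE yB.
pose Y (e : {set 'I_n}) := \prod_(i in e) y i.
have Y1 e : 1 <= Y e by rewrite /Y; elim/big_ind: _ => // *; exact: mulr_ege1.
pose w e b : R := (if b then Y e else 1) * (if (e \in B) && ~~ b then 0 else 1).
have -> : gnp_expectation p (fun G => \prod_i y i ^+ degree G i * (B \subset G)%:R) =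
    gnp_expectation p (fun G => \prod_(e in edges n) w e (e \in G)).
  congr gnp_expectation; apply/funext => G; rewrite big_split /=; congr (_ * _).
    under eq_bigr do rewrite degreeE -prodrXr.
    rewrite (exchange_big_dep (fun e => e \in edges n)) /=; last by move=> i e _ /andP[].
    apply: eq_bigr => e eE.
    case: ifP => eG; first by apply: eq_big => i; rewrite ?eE // expr1.
    by rewrite big1 // => i _; rewrite expr0.
  have [BG|/fintype.subsetPn[e eB eG]] := boolP (B \subset G).
    rewrite big1 // => e _; case: ifP => // /andP[eB].
    by rewrite (fintype.subsetP BG _ eB).
  by rewrite (bigD1 e) ?(fintype.subsetP BE) //= eB eG mul0r.
rewrite gnp_prod /w.
apply: (@le_trans _ _ (\prod_(e in edges n)
   ((if e \in B then p else 1) * expR (p * (Y e - 1))))).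
  apply: ler_prod => e eE; rewrite andbF andbT mulr1 mul1r.
  have pY : 0 <= p * Y e by rewrite mulr_ge0 // (le_trans _ (Y1 e)).
  have := expR_ge1Dx (p * (Y e - 1)).
  case: ifP => eB; last first.
    by rewrite mulr1 mul1r => h; rewrite addr_ge0 ?subr_ge0 //=; apply: le_trans h; lra.
  have -> : Y e = 1 by rewrite /Y big1 // => i ie; rewrite (yB e).
  rewrite !(subrr, mulr0, mulr1, addr0, expR0). by rewrite p0 !lexx.
rewrite big_split /= -expR_sum; apply: ler_pM.
- by apply: prodr_ge0 => e _; case: ifP.
- exact: expR_ge0.
- rewrite -big_mkcondr /= (eq_bigl (fun e => e \in B)) ?prodr_const // => e.
  by case: (boolP (e \in B)) => [/(fintype.subsetP BE) ->|]; rewrite ?andbF.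
- by rewrite ler_expR -mulr_sumr ler_wpM2l // sum_edges_tilt.
Qed.

End Degrees.

(** * The price of large degrees *)

Section Cost.
Context {R : realType}.
Implicit Types x y d K : R.

Lemma ln_ge1BV x : 0 < x -> 1 - x^-1 <= ln x.
Proof.
move=> x0; have xV0 : 0 < x^-1 by rewrite invr_gt0.
have := @le_ln1Dx R (x^-1 - 1).
have -> : 1 + (x^-1 - 1) = x^-1 by ring.
rewrite lnV ?posrE // => h.
have : -1 < x^-1 - 1 by lra.
by move=> /h; lra.
Qed.

(** The large deviation rate at x of a Poisson variable of mean d. *)
Definition cost d x : R := x * ln (x / d) - x + d.

Lemma cost_ge0 d x : 0 < d -> 0 < x -> 0 <= cost d x.
Proof.
move=> d0 x0; have := ln_ge1BV (divr_gt0 x0 d0); rewrite invf_div => h.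
have : x * (1 - d / x) <= x * ln (x / d) by rewrite ler_pM2l.
have -> : x * (1 - d / x) = x - d by field; lra.
by rewrite /cost; lra.
Qed.

Lemma ln_divD K d x : 0 < d -> 0 < K -> 0 < x -> ln (x / d) = ln (x / K) + ln (K / d).
Proof.
move=> d0 K0 x0; rewrite -lnM ?posrE ?divr_gt0 //; congr ln.
by field; lra.
Qed.

Lemma cost_le d K x : 0 < d -> d <= K -> K <= x -> cost d K <= cost d x.
Proof.
move=> d0 dK Kx; have K0 : 0 < K by lra.
have x0 : 0 < x by lra.
have := cost_ge0 K0 x0; rewrite /cost (ln_divD d0 K0 x0) => h.
have : 0 <= (x - K) * ln (K / d).
  by rewrite mulr_ge0 ?subr_ge0 // ln_ge0 // ler_pdivlMr // mul1r.
by lra.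
Qed.

(** By convexity the price per edge increases with the degree. *)
Lemma cost_ratio d K x : 0 < d -> d <= K -> K <= x -> x * cost d K <= K * cost d x.
Proof.
move=> d0 dK Kx; have K0 : 0 < K by lra.
have x0 : 0 < x by lra.
have := cost_ge0 K0 x0; rewrite /cost (ln_divD d0 K0 x0) => h.
have : 0 <= K * (x * ln (x / K) - x + K) by rewrite mulr_ge0 // ltW.
have : 0 <= (K - d) * (x - K) by rewrite mulr_ge0 ?subr_ge0.
by lra.
Qed.

(** The value 0 stands for the absence of a constraint, which is free; [cost] would charge d
for a degree 0. *)
Definition dcost d (x : nat) : R := if x == 0%N then 0 else cost d x%:R.

Lemma dcost_ge0 d (x : nat) : 0 < d -> 0 <= dcost d x.
Proof.
by rewrite /dcost => d0; case: x => //= x; rewrite cost_ge0 // ltr0n.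
Qed.

(** Elements are added one at a time, so that the total overshoots t by one weight at
most. *)
Lemma minimal_subset (I : finType) (w : I -> R) (S : {set I}) (t M : R) :
  0 <= t -> 0 <= M -> (forall i, i \in S -> 0 <= w i <= M) -> t <= \sum_(i in S) w i ->
  exists S' : {set I}, S' \subset S /\ t <= \sum_(i in S') w i <= t + M.
Proof.
move=> t0 M0; have [k] := ubnP #|S|; elim: k S => // k IH S Sk wM tS.
have [SM|MS] := leP (\sum_(i in S) w i) (t + M); first by exists S; rewrite tS SM.
have [S0|/set0Pn[i iS]] := eqVneq S finset.set0.
  move: tS MS; rewrite S0 !big_set0 => tS MS.
  by exists finset.set0; rewrite finset.sub0set !big_set0 tS /=; split=> //; lra.
have := wM _ iS => /andP[wi0 wiM].
move: MS; rewrite (big_setD1 i) //= => MS.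
have [|j||S' [S'S h]] := IH (S :\ i).
- by move: Sk; rewrite (cardsD1 i) iS.
- by rewrite inE => /andP[_ /wM].
- by lra.
- by exists S'; split=> //; apply: (fintype.subset_trans S'S); exact: subD1set.
Qed.

End Cost.

Section BigTail.
Context {R : realType}.
Variables (n : nat) (p : R).
Hypothesis n0 : (0 < n)%N.
Hypothesis hp : 0 < p <= 1.
Let d := n%:R * p.

Let p0 : 0 < p. Proof. by case/andP: hp. Qed.
Let d0 : 0 < d. Proof. by rewrite mulr_gt0 // ltr0n. Qed.
Let hp' : 0 <= p <= 1. Proof. by case/andP: hp => /ltW-> ->. Qed.

(** Markov's inequality for the tilts (x i) / d, which are optimal for each degree
separately. The quadratic term is due to the edges between two tilted vertices, which are
tilted twice. *)
Lemma degree_tail (x : 'I_n -> nat) (B : {set {set 'I_n}}) :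
  (forall i, x i != 0%N -> d <= (x i)%:R) -> B \subset edges n ->
  (forall e i, e \in B -> i \in e -> x i = 0%N) ->
  gnp_expectation p (fun G => [forall i, x i <= degree G i]%N%:R * (B \subset G)%:R)
  <= p ^+ #|B| *
     expR ((\sum_i (x i)%:R) ^+ 2 / (2 * (n%:R * d)) - \sum_i dcost d (x i)).
Proof.
move=> xd BE xB.
pose y i : R := if x i == 0%N then 1 else (x i)%:R / d.
have y1 i : 1 <= y i.
  rewrite /y; case: ifPn => // xi.
  by rewrite ler_pdivlMr // mul1r xd.
have y0 i : 0 < y i by apply: lt_le_trans (y1 i).
have yB e i : e \in B -> i \in e -> y i = 1 by move=> eB ie; rewrite /y (xB e).
have xy0 : 0 <= \prod_i (y i ^+ x i)^-1.
  by apply: prodr_ge0 => i _; rewrite invr_ge0 exprn_ge0 // ltW.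
apply: (@le_trans _ _ (\prod_i (y i ^+ x i)^-1 *
   gnp_expectation p (fun G => \prod_i y i ^+ degree G i * (B \subset G)%:R))).
  rewrite -gnp_expectationZ; apply: gnp_expectation_le => // G GE.
  rewrite mulrA ler_wpM2r // -big_split /=; case: forallP => [h|_].
    elim/big_ind: _ => [//||i _]; first by move=> *; exact: mulr_ege1.
    by rewrite mulrC ler_pdivlMr ?exprn_gt0 // mul1r ler_weXn2l.
  by apply: prodr_ge0 => i _; rewrite mulr_ge0 ?invr_ge0 ?exprn_ge0 // ltW.
apply: (le_trans (ler_wpM2l xy0 (degree_tilt hp' y1 BE yB))).
rewrite mulrCA ler_wpM2l ?exprn_ge0 ?(ltW p0) //.
have -> : \prod_i (y i ^+ x i)^-1 = expR (\sum_i (- ((x i)%:R * ln (y i)))).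
  rewrite expR_sum; apply: eq_bigr => i _.
  by rewrite expRN expRM_natl lnK // posrE.
rewrite -expRD ler_expR mulrDr mulrA [p * _]mulrC -/d mulr_sumr addrA -big_split /=.
rewrite addrC lerD //; last first.
  rewrite -sumrN; apply: ler_sum => i _; rewrite /dcost /y; case: ifPn => [/eqP->|xi].
    by rewrite mul0r subrr mulr0 oppr0 addr0.
  rewrite /cost le_eqVlt; apply/orP; left; apply/eqP; field; exact: lt0r_neq0.
have u0 i : 0 <= y i - 1 by rewrite subr_ge0.
have ux : \sum_i (y i - 1) <= (\sum_i (x i)%:R) / d.
  rewrite mulr_suml; apply: ler_sum => i _; rewrite /y; case: ifPn => [_|_].
    by rewrite subrr divr_ge0 // ltW.
  by rewrite lerBlDr lerDl.
have -> : (\sum_i (x i)%:R) ^+ 2 / (2 * (n%:R * d)) =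
    p * (((\sum_i (x i)%:R) / d) ^+ 2 / 2).
  by rewrite /d; field; rewrite (lt0r_neq0 p0) pnatr_eq0 -lt0n n0.
rewrite ler_wpM2l ?(ltW p0) // ler_wpM2r // ler_sqr ?nnegrE //.
  exact: sumr_ge0.
by rewrite divr_ge0 ?(ltW d0) // sumr_ge0.
Qed.

(** An entry takes at most n positive values at one of n places: with a factor 1 / n ^ 2 per
positive entry, all configurations of degrees can be summed over. *)
Lemma sum_configs_le :
  \sum_(x : {ffun 'I_n -> 'I_n.+1})
     \prod_i (if x i == 0 :> nat then 1 else (n%:R ^+ 2)^-1) <= expR 1 :> R.
Proof.
have nR : n%:R != 0 :> R by rewrite pnatr_eq0 -lt0n.
rewrite -(bigA_distr_bigA (fun (_ : 'I_n) (v : 'I_n.+1) =>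
   if v == 0 :> nat then 1 else (n%:R ^+ 2)^-1)) /=.
have -> : \prod_(i < n) \sum_(v < n.+1) (if v == 0 :> nat then 1 else (n%:R ^+ 2)^-1)
   = (1 + n%:R^-1) ^+ n :> R.
  transitivity (\prod_(i < n) (1 + n%:R^-1 : R)); last by rewrite prodr_const card_ord.
  apply: eq_bigr => i _.
  rewrite big_ord_recl /=; congr (_ + _); rewrite sumr_const card_ord.
  by rewrite -[LHS]mulr_natl; field.
apply: (@le_trans _ _ (expR n%:R^-1 ^+ n)).
  by rewrite ler_pXn2r ?nnegrE ?addr_ge0 ?invr_ge0 ?expR_ge0 // expR_ge1Dx.
by rewrite -expRM_natl divff.
Qed.

Lemma config_cost_le (x : 'I_n -> nat) (h K : R) :
  d <= K -> (forall i, x i != 0%N -> K <= (x i)%:R) -> 2 * ln n%:R <= h * cost d K ->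
  0 <= h ->
  expR (- (h * \sum_i dcost d (x i))) <=
  \prod_i (if x i == 0 :> nat then 1 else (n%:R ^+ 2)^-1).
Proof.
move=> dK xK nK h0; rewrite mulr_sumr -sumrN expR_sum; apply: ler_prod => i _.
rewrite expR_ge0 /= /dcost; case: ifPn => [_|xi]; first by rewrite mulr0 oppr0 expR0.
have nR : 0 < n%:R :> R by rewrite ltr0n.
rewrite -[n%:R in leRHS](lnK nR) -expRM_natl -expRN ler_expR lerN2.
by apply: (le_trans nK); rewrite ler_wpM2l // cost_le // xK.
Qed.

(** The interaction between large degrees is negligible against their own cost as long as
the number of edges that they take is small against n d. *)
Lemma config_quadratic_le (x : 'I_n -> nat) (h K t : R) :
  d <= K -> (forall i, x i != 0%N -> K <= (x i)%:R) -> 0 < cost d K ->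
  \sum_i dcost d (x i) <= t ->
  K ^+ 2 * t <= 2 * h * cost d K ^+ 2 * (n%:R * d) ->
  (\sum_i (x i)%:R) ^+ 2 / (2 * (n%:R * d)) <= h * \sum_i dcost d (x i).
Proof.
move=> dK xK cK xt tK.
set s := \sum_i dcost d (x i); have s0 : 0 <= s by apply: sumr_ge0 => i _; exact: dcost_ge0.
have xs : (\sum_i (x i)%:R) * cost d K <= K * s.
  rewrite mulr_suml mulr_sumr; apply: ler_sum => i _; rewrite /dcost.
  by case: ifPn => [/eqP->|xi]; rewrite ?mul0r ?mulr0 // cost_ratio // xK.
have X0 : 0 <= \sum_i (x i)%:R :> R by exact: sumr_ge0.
have nR : 0 < n%:R :> R by rewrite ltr0n.
have nd : 0 < n%:R * d by rewrite mulr_gt0.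
have K0 : 0 < K by apply: lt_le_trans dK.
rewrite ler_pdivrMr ?mulr_gt0 //.
have c2 : 0 < cost d K ^+ 2 by exact: exprn_gt0.
rewrite -(ler_pM2r c2) -exprMn.
apply: (@le_trans _ _ ((K * s) ^+ 2)).
  by rewrite ler_sqr ?nnegrE // mulr_ge0 // ltW.
apply: (@le_trans _ _ (K ^+ 2 * t * s)).
  have -> : (K * s) ^+ 2 = K ^+ 2 * s * s by ring.
  by rewrite ler_wpM2r // ler_wpM2l // exprn_ge0 // ltW.
by apply: (le_trans (ler_wpM2r s0 tK)); rewrite le_eqVlt; apply/orP; left; apply/eqP; ring.
Qed.

(** Vertices of degree at least K are unlikely to have total cost t.  Degrees
are truncated at x1 and only a minimal set of vertices of total cost t is
retained: this keeps the interaction term in [degree_tail] small. *)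
Lemma big_tail (h K t : R) (x1 : nat) :
  0 <= h -> 2 * h <= 1 -> d <= K -> K <= x1%:R -> (x1 <= n)%N -> 0 <= t -> 0 < cost d K ->
  2 * ln n%:R <= h * cost d K ->
  K ^+ 2 * (t + cost d x1%:R) <= 2 * h * cost d K ^+ 2 * (n%:R * d) ->
  gnp_prob p (fun G : {set {set 'I_n}} => t <= \sum_(i | K <= (degree G i)%:R)
                               cost d (minn (degree G i) x1)%:R)
  <= expR (1 - (1 - 2 * h) * t).
Proof.
move=> h0 h1 dK Kx1 x1n t0 cK nK tK.
have K0 : 0 < K by apply: lt_le_trans dK.
pose conf (x : {ffun 'I_n -> 'I_n.+1}) :=
  [forall i, (x i != 0 :> nat) ==> (K <= (x i)%:R)] &&
  (t <= \sum_i dcost d (x i) <= t + cost d x1%:R).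
pose pen (x : {ffun 'I_n -> 'I_n.+1}) : R :=
  \prod_i (if x i == 0 :> nat then 1 else (n%:R ^+ 2)^-1).
have pen0 x : 0 <= pen x.
  by apply: prodr_ge0 => i _; case: ifP => // _; rewrite invr_ge0 exprn_ge0.
rewrite gnp_probE.
apply: (@le_trans _ _ (gnp_expectation p (fun G => \sum_(x | conf x)
    [forall i, x i <= degree G i]%N%:R * (finset.set0 \subset G)%:R))).
  apply: gnp_expectation_le => // G GE; case: (boolP (t <= _)) => [tG|_]; last first.
    by apply: sumr_ge0 => x _; rewrite mulr_ge0.
  have [] := @minimal_subset R _ (fun i => cost d (minn (degree G i) x1)%:R)
     [set i | K <= (degree G i)%:R]%SET t (cost d x1%:R) t0.
  - by rewrite cost_ge0 // (lt_le_trans K0).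
  - move=> i; rewrite inE => Ki; rewrite cost_ge0 ?cost_le ?ler_nat ?geq_minr //=.
      by apply: (le_trans dK); rewrite natr_min le_min Ki.
    by apply: (lt_le_trans K0); rewrite natr_min le_min Ki.
  - by under eq_bigl do rewrite inE.
  move=> S [SK /andP[tS St]].
  pose x : {ffun 'I_n -> 'I_n.+1} :=
    [ffun i => if i \in S then inord (minn (degree G i) x1) else ord0].
  have xE i : x i = (if i \in S then minn (degree G i) x1 else 0%N) :> nat.
    rewrite ffunE; case: ifP => // _; rewrite inordK // ltnS.
    by rewrite (leq_trans (geq_minr _ _)).
  have KS i : i \in S -> K <= (minn (degree G i) x1)%:R.
    by move/(fintype.subsetP SK); rewrite inE natr_min le_min Kx1 => ->.
  have sumE : \sum_i dcost d (x i) = \sum_(i in S) cost d (minn (degree G i) x1)%:R.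
    rewrite [RHS]big_mkcond; apply: eq_bigr => i _; rewrite xE /dcost.
    case: (boolP (i \in S)) => // iS; have := lt_le_trans K0 (KS _ iS).
    by rewrite ltr0n lt0n => /negbTE->.
  have cx : conf x.
    rewrite /conf sumE tS St !andbT; apply/forallP => i; apply/implyP.
    by rewrite xE; case: (boolP (i \in S)) => // /KS.
  rewrite (bigD1 x) //= finset.sub0set mulr1.
  have -> : [forall i, x i <= degree G i]%N.
    by apply/forallP => i; rewrite xE; case: ifP => // _; exact: geq_minl.
  by rewrite lerDl; apply: sumr_ge0 => y _; rewrite mulr_ge0.
rewrite gnp_expectation_sum.
apply: (@le_trans _ _ (\sum_(x | conf x) expR (- ((1 - 2 * h) * t)) * pen x)).
  apply: ler_sum => x /andP[/forallP xK /andP[tx xt]].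
  have {}xK i : x i != 0%N :> nat -> K <= (x i)%:R by move: (xK i) => /implyP.
  have := @degree_tail (fun i => x i : nat) finset.set0; rewrite cards0 expr0 mul1r.
  move=> /(_ _ (finset.sub0set _) _)/le_trans; apply.
  - by move=> i /xK; apply: le_trans.
  - by move=> e i; rewrite inE.
  apply: (@le_trans _ _ (expR (- ((1 - 2 * h) * t)) * expR (- (h * \sum_i dcost d (x i))))).
    rewrite -expRD ler_expR.
    have := config_quadratic_le dK xK cK xt tK.
    have : 0 <= (1 - 2 * h) * (\sum_i dcost d (x i) - t).
      by rewrite mulr_ge0 // subr_ge0.
    lra.
  by rewrite ler_wpM2l ?expR_ge0 // (config_cost_le dK).
rewrite -mulr_sumr expRD mulrC ler_wpM2r ?expR_ge0 //.
apply: le_trans sum_configs_le; rewrite [leRHS](bigID conf) /= lerDl.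
by apply: sumr_ge0 => x _; exact: pen0.
Qed.

End BigTail.

(** * Stars *)

Section Stars.
Variables (n r : nat).
Implicit Types (G : {set {set 'I_n}}) (v w : 'I_n) (L : {set 'I_n}).
Implicit Types q : 'I_n * {set 'I_n}.

Definition star_shape q := (q.1 \notin q.2) && (#|q.2| == r).

Lemma star_sub_edges v L : v \notin L -> star v L \subset edges n.
Proof.
move=> vL; apply/fintype.subsetP => e /imsetP[w wL ->]; rewrite inE cards2.
by rewrite (_ : v != w) //; apply: contraNneq vL => ->.
Qed.

Lemma star_center v L (e : {set 'I_n}) : e \in star v L -> v \in e.
Proof. by case/imsetP => w _ ->; rewrite !inE eqxx. Qed.

Lemma star_vertices v L (e : {set 'I_n}) : e \in star v L -> e \subset v |: L.
Proof.
case/imsetP => w wL ->; apply/fintype.subsetP => x; rewrite !inE.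
by case/orP => /eqP->; rewrite ?eqxx // wL orbT.
Qed.

Lemma star_sub_nbhd G v L : (L \subset [set w | (w != v) && ([set v; w] \in G)]%SET)
  = (v \notin L) && (star v L \subset G).
Proof.
apply/fintype.subsetP/andP => [LG|[vL /fintype.subsetP sG] w wL].
  split; first by apply/negP => /LG; rewrite inE eqxx.
  by apply/fintype.subsetP => e /imsetP[w /LG]; rewrite inE => /andP[_ h] ->.
rewrite inE (sG _ (imset_f _ wL)) andbT.
by apply: contraNneq vL => <-.
Qed.

Lemma card_stars_at G v :
  #|[set L | star_shape (v, L) && (star v L \subset G)]%SET| = 'C(degree G v, r).
Proof.
rewrite /degree -cards_draws; apply: eq_card => L; rewrite !inE star_sub_nbhd.
by rewrite /star_shape /= -!andbA; congr andb; rewrite andbC.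
Qed.

Lemma card_stars (D : pred 'I_n) G :
  #|[set q | [&& star_shape q, star q.1 q.2 \subset G & D q.1]]%SET| =
  (\sum_(v | D v) 'C(degree G v, r))%N.
Proof.
under [RHS]eq_bigr do rewrite -card_stars_at -sum1_card.
rewrite pair_big_dep /= -sum1_card; apply: eq_bigl => -[v L].
by rewrite !inE /= andbA andbC.
Qed.

Lemma card_stars_le (U : {set 'I_n}) (c : nat) (J : {set 'I_n * {set 'I_n}}) G :
  (forall q, q \in J -> [/\ star_shape q, star q.1 q.2 \subset G &
     ('C(degree G q.1, r) <= c)%N]) ->
  (#|[set q in J | q.1 \in U]%SET| <= #|U| * c)%N.
Proof.
move=> JG; pose D v := (v \in U) && ('C(degree G v, r) <= c)%N.
apply: (@leq_trans (\sum_(v | D v) 'C(degree G v, r))%N).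
  rewrite -card_stars; apply: subset_leq_card; apply/fintype.subsetP => q.
  by rewrite !inE => /andP[/JG[-> -> qc] qU]; rewrite /D qU.
rewrite -sum_nat_const [leqLHS]big_mkcond [leqRHS]big_mkcond /=.
by apply: leq_sum => v _; rewrite /D; case: (v \in U) => //=; case: ifP.
Qed.

Context {R : realType}.
Variable p : R.

Definition mu_stars : R := n%:R * 'C(n.-1, r)%:R * p ^+ r.

Lemma sum_star_shape : \sum_(q | star_shape q) p ^+ #|star q.1 q.2| = mu_stars.
Proof.
transitivity (\sum_(q | star_shape q) p ^+ r).
  by apply: eq_bigr => q /andP[qL /eqP qr]; rewrite card_star // qr.
rewrite sumr_const -[LHS]mulr_natl /mu_stars -natrM; congr (_%:R * _).
have -> : #|(fun q => star_shape q)| = #|[set q | star_shape q]%SET|.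
  by apply: eq_card => q; rewrite inE.
transitivity (\sum_(v : 'I_n) #|[set L | star_shape (v, L)]%SET|)%N.
  under [RHS]eq_bigr do rewrite -sum1_card.
  by rewrite pair_big_dep /= -sum1_card; apply: eq_bigl => -[v L]; rewrite !inE.
transitivity (\sum_(v : 'I_n) 'C(n.-1, r))%N; last by rewrite sum_nat_const card_ord.
apply: eq_bigr => v _; rewrite -[n in n.-1](card_ord n) -(cardsC1 v) -cards_draws.
apply: eq_card => L; rewrite !inE /star_shape /=; congr andb.
by rewrite finset.subsetC finset.sub1set inE.
Qed.

Hypothesis hp : 0 <= p <= 1.

Lemma mu_stars_ge0 : 0 <= mu_stars.
Proof. by have /andP[p0 _] := hp; rewrite !mulr_ge0 // exprn_ge0. Qed.

(** A star centred at a vertex of degree below K has r + 1 vertices, each of which is the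
centre of at most c of the others: the packing bound applies to all stars of this kind. *)
Lemma bulk_tail (h K : R) (c : nat) : 0 <= h -> (0 < c)%N ->
  (forall x : nat, x%:R < K -> ('C(x, r) <= c)%N) ->
  gnp_prob p (fun G : {set {set 'I_n}} => (1 + h) * mu_stars <=
     (\sum_(v | ((degree G v)%:R < K)%R) 'C(degree G v, r))%N%:R) <=
  (1 + h) * expR (- (mu_stars / (r.+1 * c)%:R * phi h)).
Proof.
move=> h0 c0 Kc; set C := (r.+1 * c)%N; set ev := fun G => _.
have C0 : (0 < C)%N by rewrite muln_gt0.
have CR : 0 < C%:R :> R by rewrite ltr0n.
have mu0 := mu_stars_ge0.
have x0 : 0 <= (1 + h) * mu_stars / C%:R by apply: divr_ge0; [apply: mulr_ge0 => //; lra|exact: ltW].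
pose k := Num.truncn ((1 + h) * mu_stars / C%:R).
have [k1 k2] : k%:R <= (1 + h) * mu_stars / C%:R /\ (1 + h) * mu_stars / C%:R - 1 < k%:R.
  by have /andP[k1 k2] := truncn_itv x0; rewrite ltrBlDr natr1.
have := @packing_tail R n p hp _ star_shape (fun q => star q.1 q.2) (fun=> 1) 1 (edges n).
move=> /(_ _ _ _ ev C k h C0 h0) H.
have {}H : gnp_prob p ev * (1 + h) ^+ k <= expR (h / C%:R * mu_stars).
  have := H; rewrite mul1r sum_star_shape gnp_probE.
  under eq_fun do rewrite mul1r.
  apply=> //.
  - move=> B BE; rewrite mul1r; under eq_fun do rewrite mul1r.
    by rewrite /gnp_expectation gnp_sub.
  - by move=> q /andP[qL _]; exact: star_sub_edges.
  move=> G GE evG.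
  pose J := [set q | [&& star_shape q, star q.1 q.2 \subset G &
    (degree G q.1)%:R < K]]%SET.
  exists J; split.
  - by move=> q; rewrite inE => /and3P[-> ->].
  - move=> q; rewrite inE => /and3P[/andP[qL /eqP qr] qG qK].
    have -> : C = (#|q.1 |: q.2| * c)%N by rewrite cardsU1 qL qr.
    apply: leq_trans (@card_stars_le (q.1 |: q.2) c J G _).
      apply: subset_leq_card; apply/fintype.subsetP => q'; rewrite !inE => /andP[->] /=.
      rewrite -finset.setI_eq0 => /set0Pn[e]; rewrite inE => /andP[e1 e2].
      have := fintype.subsetP (star_vertices e1) _ (star_center e2).
      by rewrite !inE.
    by move=> q'; rewrite inE => /and3P[-> -> /Kc].
  - rewrite /J (card_stars (fun v => (degree G v)%:R < K)) -(ler_nat R); apply: le_trans evG.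
    by rewrite natrM mulrC -ler_pdivlMr.
have h1 : 0 < 1 + h by lra.
rewrite -(ler_pM2r (exprn_gt0 k h1)); apply: (le_trans H).
rewrite -(lnK (x := 1 + h)) ?posrE // -expRM_natl -!expRD ler_expR /phi.
have : 0 <= (k%:R - ((1 + h) * mu_stars / C%:R - 1)) * ln (1 + h).
  by rewrite mulr_ge0 ?ln_ge0 //; lra.
have -> : (1 + h) * mu_stars / C%:R = (1 + h) * (mu_stars / C%:R) by rewrite mulrA.
have -> : h / C%:R * mu_stars = h * (mu_stars / C%:R) by rewrite mulrAC mulrA.
set y := mu_stars / C%:R; lra.
Qed.

End Stars.

(** * Isolated stars *)

Lemma bin_le_expn (m k : nat) : ('C(m, k) <= m ^ k)%N.
Proof.
apply: (@leq_trans (m ^_ k)).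
  by rewrite -bin_ffact leq_pmulr // fact_gt0.
by elim: k => // k IH; rewrite ffactnSr expnSr leq_mul // leq_subr.
Qed.

Lemma card_exists_le (T1 T2 : finType) (U : {set T1}) (Q : T1 -> pred T2) (c : nat) :
  (forall a, a \in U -> #|[set y | Q a y]%SET| <= c)%N ->
  (#|[set y | [exists a in U, Q a y]]%SET| <= #|U| * c)%N.
Proof.
move=> Uc; rewrite -sum_nat_const.
apply: (@leq_trans (\sum_(a in U) #|[set y | Q a y]%SET|)); last exact: leq_sum.
under [leqRHS]eq_bigr do rewrite -sum1_card big_mkcond.
rewrite exchange_big /= -sum1_card big_mkcond; apply: leq_sum => y _.
rewrite inE; case: exists_inP => // -[a aU Qa].
by rewrite (bigD1 a) //= inE Qa.
Qed.

Section Isolated.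
Variables (n r : nat).
Hypothesis r1 : (1 < r)%N.
Implicit Types (G : {set {set 'I_n}}) (v w a : 'I_n) (L e : {set 'I_n}).
Implicit Types q : 'I_n * {set 'I_n}.

Definition star_set q : {set 'I_n} := q.1 |: q.2.

(** No further edge meets the star. The isolated stars of a graph are disjoint, which brings
their number close to a Poisson variable. *)
Definition isolated_star G q :=
  star_shape r q && ([set e in G | ~~ [disjoint e & star_set q]]%SET == star q.1 q.2).

Lemma card_star_set q : star_shape r q -> #|star_set q| = r.+1.
Proof. by case/andP => qL /eqP qr; rewrite /star_set cardsU1 qL qr. Qed.

Lemma touchP e (U : {set 'I_n}) :
  reflect (exists2 a, a \in e & a \in U) (~~ [disjoint e & U]).
Proof.
rewrite -finset.setI_eq0; apply: (iffP (set0Pn _)) => -[a]; last first.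
  by move=> ae aU; exists a; rewrite inE ae.
by rewrite inE => /andP[]; exists a.
Qed.

Lemma isolatedP G q e a : isolated_star G q -> e \in G -> a \in e -> a \in star_set q ->
  e \in star q.1 q.2.
Proof.
case/andP => _ /eqP <- eG ae aq; rewrite inE eG; apply/touchP.
by exists a.
Qed.

Lemma isolated_sub G q : isolated_star G q -> star q.1 q.2 \subset G.
Proof.
by case/andP => _ /eqP <-; apply/fintype.subsetP => e; rewrite inE => /andP[].
Qed.

Lemma isolated_centers G q q' a : isolated_star G q -> isolated_star G q' ->
  a \in star_set q -> a \in star_set q' -> q.1 \in star_set q'.
Proof.
move=> iq iq'; rewrite {1}/star_set !inE => /orP[/eqP-> //|aL aq'].
have e1 : [set q.1; a]%SET \in star q.1 q.2 by apply: imset_f.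
have /(isolatedP iq') : [set q.1; a]%SET \in G.
  exact: (fintype.subsetP (isolated_sub iq)).
move=> /(_ a); rewrite !inE eqxx orbT => /(_ isT aq')/star_vertices/fintype.subsetP h.
by have := h q.1; rewrite !inE eqxx /=; apply.
Qed.

Lemma isolated_inj G q q' a : isolated_star G q -> isolated_star G q' ->
  a \in star_set q -> a \in star_set q' -> q = q'.
Proof.
move=> iq iq' aq aq'.
have sub x y : isolated_star G x -> isolated_star G y -> x.1 \in star_set y ->
    star x.1 x.2 \subset star y.1 y.2.
  move=> ix iy xy; apply/fintype.subsetP => e ex.
  apply: (isolatedP iy _ (star_center ex) xy).
  exact: (fintype.subsetP (isolated_sub ix)).
have E : star q.1 q.2 = star q'.1 q'.2.
  apply/eqP; rewrite finset.eqEsubset !sub //.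
    exact: (isolated_centers iq' iq aq' aq).
  exact: (isolated_centers iq iq' aq aq').
case/andP: iq => /andP[q1 /eqP q2] _; case/andP: iq' => /andP[q1' /eqP q2'] _.
have [] := star_inj r1 q1 q1' q2 q2' E.
by case: q {q1 q2 aq E} => ? ?; case: q' {q1' q2' aq'} => ? ? /= -> ->.
Qed.

Lemma isolated_disjoint G q q' : isolated_star G q -> isolated_star G q' ->
  ~~ [disjoint star q.1 q.2 & star q'.1 q'.2] -> q = q'.
Proof.
move=> iq iq'; rewrite -finset.setI_eq0 => /set0Pn[e].
rewrite inE => /andP[e1 e2]; apply: (isolated_inj iq iq' (a := q.1)).
  by rewrite !inE eqxx.
exact: (fintype.subsetP (star_vertices e2) _ (star_center e1)).
Qed.

Definition nbhd G v := [set w | (w != v) && ([set v; w] \in G)]%SET.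

Lemma nbhd_sym G v w : (w \in nbhd G v) = (v \in nbhd G w).
Proof. by rewrite !inE eq_sym finset.setUC. Qed.

Lemma isolated_degree G q : isolated_star G q -> degree G q.1 = r.
Proof.
move=> iq; have /andP[/andP[qL /eqP qr] _] := iq.
suff : nbhd G q.1 = q.2 by rewrite /degree /nbhd => ->.
apply/eqP; rewrite finset.eqEsubset star_sub_nbhd qL isolated_sub // !andbT.
apply/fintype.subsetP => w; rewrite inE => /andP[wq wG].
have : [set q.1; w]%SET \in star q.1 q.2.
  by apply: (isolatedP iq wG (a := q.1)); rewrite !inE eqxx.
case/imsetP => w' w'L.
by move=> /set2_inj->; rewrite // !inE //; apply: contraNneq qL => <-.
Qed.

(** A star together with one further edge at one of its vertices. It has r + 1 edges and
hence is rare when the mean degree is small. *)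
Definition flawed_shape (t : 'I_n * {set 'I_n} * {set 'I_n}) :=
  [&& star_shape r t.1, t.2 \in edges n, t.2 \notin star t.1.1 t.1.2
    & ~~ [disjoint t.2 & star_set t.1]].

Definition flawed_edges (t : 'I_n * {set 'I_n} * {set 'I_n}) :=
  t.2 |: star t.1.1 t.1.2.

Variable K : nat.

Definition flawed G v :=
  [&& degree G v < K, [forall w in nbhd G v, degree G w < K]%N
    & [exists L, exists e, flawed_shape (v, L, e) && (flawed_edges (v, L, e) \subset G)]]%N.

(** A vertex of degree below K is adjacent to a vertex of degree at least K, or it is
flawed, or its stars are isolated; in the last case there is at most one. *)
Lemma bin_degree_le G v : G \in graphs n -> (degree G v < K)%N ->
  ('C(degree G v, r) <=
   K ^ r * (\sum_(w | K <= degree G w) (w \in nbhd G v)) + K ^ r * flawed G v +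
   #|[set L | isolated_star G (v, L) &
       [forall w in star_set (v, L), degree G w < K]%N]%SET|)%N.
Proof.
move=> GE vK.
have CK : ('C(degree G v, r) <= K ^ r)%N.
  have r0 : (0 < r)%N by exact: ltnW.
  by apply: (leq_trans (bin_le_expn _ _)); rewrite leq_exp2r //; exact: ltnW.
have [/existsP[w /andP[wv wK]]|noB] :=
    boolP [exists w, (w \in nbhd G v) && (K <= degree G w)%N].
  by rewrite (bigD1 w) //= wv mulnDr muln1 -!addnA (leq_trans CK) // leq_addr.
have nK w : w \in nbhd G v -> (degree G w < K)%N.
  by move=> wv; rewrite ltnNge; apply: contra noB => wK; apply/existsP; exists w; rewrite wv.
have [vr|rv] := ltnP (degree G v) r; first by rewrite bin_small.
have [L] : exists L, L \in [set L : {set 'I_n} | (L \subset nbhd G v) && (#|L| == r)]%SET.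
  by apply/set0Pn; rewrite -card_gt0 cards_draws bin_gt0.
rewrite inE => /andP[Lv Lr].
have /andP[vL sG] : (v \notin L) && (star v L \subset G) by rewrite -star_sub_nbhd.
have [iL|niL] := boolP (isolated_star G (v, L)).
  rewrite (isolated_degree iL) binn (leq_trans _ (leq_addl _ _)) // card_gt0.
  apply/set0Pn; exists L; rewrite inE iL; apply/forall_inP => w.
  by rewrite !inE /= => /orP[/eqP-> //|/(fintype.subsetP Lv)/nK].
suff -> : flawed G v by rewrite muln1 (leq_trans CK) // -addnA addnCA leq_addr.
apply/and3P; split=> //; first exact/forall_inP.
have shL : star_shape r (v, L) by rewrite /star_shape vL.
have : ~~ ([set e in G | ~~ [disjoint e & star_set (v, L)]]%SET \subset star v L).
  apply: contra niL => h; rewrite /isolated_star shL /= finset.eqEsubset h /=.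
  apply/fintype.subsetP => e ev; rewrite inE (fintype.subsetP sG) //=; apply/touchP.
  by exists v; [exact: star_center ev|rewrite !inE eqxx].
case/fintype.subsetPn => e; rewrite inE => /andP[eG eV] eS.
apply/existsP; exists L; apply/existsP; exists e.
rewrite /flawed_shape shL /= eS eV finset.subUset finset.sub1set eG sG !andbT.
by move: GE; rewrite inE => /fintype.subsetP->.
Qed.

Lemma nb_stars_le G : G \in graphs n ->
  (nb_stars r G <=
   \sum_(v | K <= degree G v) 'C(degree G v, r) +
   K ^ r * (\sum_(v | K <= degree G v) degree G v + #|[set v | flawed G v]%SET|) +
   #|[set q | isolated_star G q & [forall w in star_set q, degree G w < K]%N]%SET|)%N.
Proof.
move=> GE; rewrite nb_starsE // (bigID (fun v => K <= degree G v)%N) /= -addnA leq_add2l.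
apply: (@leq_trans (\sum_v
  (K ^ r * (\sum_(w | K <= degree G w) (w \in nbhd G v)) + K ^ r * flawed G v +
   #|[set L | isolated_star G (v, L) &
       [forall w in star_set (v, L), degree G w < K]%N]%SET|))%N).
  rewrite big_mkcond; apply: leq_sum => v _; case: ifP => //.
  by rewrite -ltnNge => vK; exact: bin_degree_le.
rewrite !big_split /= -!big_distrr /= mulnDr; apply: leq_add; last first.
  under eq_bigr do rewrite -sum1_card.
  rewrite pair_big_dep /= -sum1_card; apply/eq_leq/eq_bigl => -[v L].
  by rewrite !inE.
apply: leq_add; rewrite leq_mul2l; apply/orP; right.
  rewrite exchange_big; apply/eq_leq/eq_bigr => w _.
  rewrite /degree -sum1_card [RHS]big_mkcond; apply: eq_bigr => v _.
  by rewrite nbhd_sym /nbhd; case: (_ \in _).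
by rewrite -sum1_card [leqRHS]big_mkcond; apply: leq_sum => v _; rewrite inE; case: ifP.
Qed.

Context {R : realType}.
Variable p : R.
Hypothesis hp : 0 < p <= 1.
Let hp' : 0 <= p <= 1. Proof. by case/andP: hp => /ltW-> ->. Qed.
Let p0 : 0 < p. Proof. by case/andP: hp. Qed.

Lemma sum_flawed_shape :
  \sum_(t | flawed_shape t) p ^+ #|flawed_edges t| <=
  r.+1%:R * (n%:R * p) * mu_stars n r p.
Proof.
rewrite -sum_star_shape mulr_sumr.
rewrite (eq_bigl (fun t => star_shape r t.1 && [&& t.2 \in edges n,
   t.2 \notin star t.1.1 t.1.2 & ~~ [disjoint t.2 & star_set t.1]])) //.
rewrite -(pair_big_dep (fun q => star_shape r q) (fun q e => [&& e \in edges n,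
   e \notin star q.1 q.2 & ~~ [disjoint e & star_set q]])
   (fun q e => p ^+ #|flawed_edges (q, e)|)) /=.
apply: ler_sum => q qr.
apply: (@le_trans _ _ (\sum_(e : {set 'I_n} | ~~ [disjoint e & star_set q] && (e \in edges n)) p * p ^+ #|star q.1 q.2|)).
  rewrite big_mkcond [leRHS]big_mkcond; apply: ler_sum => e _.
  case: (e \in edges n); case: (boolP (e \in star q.1 q.2)); case: (disjoint _ _) => //= eS.
    by rewrite mulr_ge0 ?exprn_ge0 // ltW.
  by rewrite /flawed_edges /= cardsU1 eS exprS.
rewrite -mulr_suml ler_wpM2r ?exprn_ge0 ?(ltW p0) // sumr_const.
rewrite mulrA -[leLHS]mulr_natl ler_wpM2r ?(ltW p0) // -natrM ler_nat -(card_star_set qr).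
apply: (@leq_trans #|[set e : {set 'I_n} | [exists a in star_set q, (a \in e) && (e \in edges n)]]%SET|).
  apply: subset_leq_card; apply/fintype.subsetP => e.
  move=> /andP[/touchP[a ae aq] eE]; rewrite inE; apply/exists_inP.
  by exists a; rewrite // ae.
apply: card_exists_le => a _.
have -> : [set e : {set 'I_n} | (a \in e) && (e \in edges n)]%SET = [set e in edges n | a \in e]%SET.
  by apply/setP => e; rewrite !inE andbC.
by rewrite edges_at card_in_imset ?cardsC1 ?card_ord ?leq_pred //; exact: set2_inj.
Qed.

(** Flawed vertices and their neighbours have degree below K, so that a configuration meets
few others and the packing bound applies. *)
Lemma flawed_tail (k : nat) (s : R) : 0 <= s -> (0 < K)%N ->
  gnp_prob p (fun G => r.+3 * K * k <= #|[set v | flawed G v]%SET|)%N * (1 + s) ^+ k <=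
  expR (s * (r.+1%:R * (n%:R * p) * mu_stars n r p)).
Proof.
move=> s0 K0; have C0 : (0 < r.+3 * K)%N by rewrite muln_gt0.
have := @packing_tail R n p hp' _ flawed_shape flawed_edges (fun=> 1) 1 (edges n).
move=> /(_ _ _ _ (fun G => r.+3 * K * k <= #|[set v | flawed G v]%SET|)%N _ k s C0 s0) H.
rewrite gnp_probE.
have E : (fun G => ((r.+3 * K * k <= #|[set v | flawed G v]%SET|)%N)%:R) =
  (fun G => 1 * ((r.+3 * K * k <= #|[set v | flawed G v]%SET|)%N)%:R : R).
  by apply/funext => G; rewrite mul1r.
rewrite E; apply: (le_trans (H _ _ _ _)) => {E H}.
- by [].
- move=> B BE; rewrite mul1r; under eq_fun do rewrite mul1r.
  by rewrite /gnp_expectation gnp_sub.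
- move=> t /and4P[/andP[tL _] tE _ _].
  by rewrite finset.subUset finset.sub1set tE star_sub_edges.
- move=> G GE evG.
  pose f v : {set 'I_n} * {set 'I_n} := odflt (finset.set0, finset.set0)
    [pick t | flawed_shape (v, t.1, t.2) && (flawed_edges (v, t.1, t.2) \subset G)].
  have fP v : flawed G v -> flawed_shape (v, (f v).1, (f v).2) &&
      (flawed_edges (v, (f v).1, (f v).2) \subset G).
    case/and3P => _ _ /existsP[L /existsP[e h]]; rewrite /f; case: pickP => //=.
    by move=> /(_ (L, e)); rewrite /= h.
  pose J := [set (v, (f v).1, (f v).2) | v in [set v | flawed G v]%SET]%SET.
  exists J; split.
  - by move=> t /imsetP[v]; rewrite inE => /fP h ->.
  - move=> t /imsetP[v]; rewrite inE => vF tE.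
    have /andP[/and4P[sh eE eS eV] AG] := fP _ vF; rewrite -tE in sh eE eS eV AG.
    pose U := star_set t.1 :|: t.2.
    have U3 : (#|U| <= r.+3)%N.
      apply: (leq_trans (leq_card_setU _ _)); rewrite card_star_set //.
      by move: eE; rewrite inE => /eqP->; rewrite addn2.
    pose Q a v' := (degree G a < K)%N && (v' \in a |: nbhd G a).
    apply: (@leq_trans #|[set v' | [exists a in U, Q a v']]%SET|); last first.
      apply: (leq_trans (card_exists_le (c := K) _)); last by rewrite leq_mul2r U3 orbT.
      move=> a _; rewrite /Q; case: ltnP => aK; last first.
        by rewrite (_ : [set _ | _]%SET = finset.set0) ?cards0 //; apply/setP => y; rewrite !inE.
      rewrite (_ : [set _ | _]%SET = a |: nbhd G a); last by apply/setP => y; rewrite !inE.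
      by rewrite cardsU1 /nbhd inE eqxx.
    rewrite -[leqRHS](card_imset _ (f := fun v => (v, (f v).1, (f v).2))); last first.
      by move=> x y [].
    apply: subset_leq_card; apply/fintype.subsetP => t'; rewrite inE => /andP[].
    move=> /imsetP[v']; rewrite inE => vF' tE'.
    have /andP[/and4P[sh' eE' eS' eV'] AG'] := fP _ vF'; rewrite -tE' in sh' eE' eS' eV' AG'.
    rewrite -finset.setI_eq0 => /set0Pn[g]; rewrite inE => /andP[gt gt'].
    rewrite tE'; apply: imset_f; rewrite inE.
    have [a ag at'] : exists2 a, a \in g & a \in star_set t'.1.
      move: gt'; rewrite !inE => /orP[/eqP->|gt']; first exact/touchP.
      by exists t'.1.1; [exact: star_center gt'|rewrite !inE eqxx].
    have aU : a \in U.
      move: gt; rewrite /U !inE => /orP[/eqP gE|/star_vertices/fintype.subsetP/(_ _ ag)].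
        by rewrite -gE ag orbT.
      by rewrite !inE => ->.
    apply/exists_inP; exists a => //; rewrite /Q.
    have /and3P[vK /forall_inP nK _] := vF'.
    rewrite tE' !inE /= in at' sh' AG'.
    case/orP: at' => [/eqP->|aL]; first by rewrite vK setU11.
    move: AG'; rewrite finset.subUset => /andP[_ sG].
    have aN : a \in nbhd G v'.
      have /fintype.subsetP : (f v').1 \subset nbhd G v'.
        by rewrite star_sub_nbhd sG; move: sh' => /andP[/= ->].
      by apply.
    by rewrite nK // finset.in_setU1 nbhd_sym aN orbT.
  - by rewrite card_imset // => x y [].
rewrite mul1r ler_expR; apply: (@le_trans _ _ (s * \sum_(t | flawed_shape t) p ^+ #|flawed_edges t|)).
  rewrite ler_wpM2r //; first by apply: sumr_ge0 => t _; rewrite exprn_ge0 // ltW.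
  by rewrite ler_pdivrMr ?ltr0n // ler_peMr // ler1n.
by rewrite ler_wpM2l // sum_flawed_shape.
Qed.

End Isolated.

(** * Large degrees together with isolated stars *)

Lemma nat_threshold {R : realType} (Y : R) :
  exists y : nat, forall m : nat, (Y <= m%:R) = (y <= m)%N.
Proof.
have ex : exists m : nat, Y <= m%:R.
  by exists (Num.truncn Y).+1; rewrite ltW // truncnS_gt.
case: (ex_minnP ex) => y Yy ymin; exists y => m; apply/idP/idP; first exact: ymin.
by rewrite -(ler_nat R); exact: le_trans.
Qed.

Section SparseUpper.
Context {R : realType}.
Variables (n r : nat) (p : R).
Hypothesis r1 : (1 < r)%N.
Hypothesis n0 : (0 < n)%N.
Hypothesis hp : 0 < p <= 1.
Let d := n%:R * p.
Let mu := mu_stars n r p.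

Let p0 : 0 < p. Proof. by case/andP: hp. Qed.
Let d0 : 0 < d. Proof. by rewrite mulr_gt0 // ltr0n. Qed.
Let hp' : 0 <= p <= 1. Proof. by case/andP: hp => /ltW-> ->. Qed.

(** Large degrees and isolated stars away from them involve disjoint sets of
edges, so that their prices multiply. *)
Lemma isolated_joint_tail (x : 'I_n -> nat) (y : nat) (s : R) : 0 <= s ->
  (forall i, x i != 0%N -> d <= (x i)%:R) ->
  gnp_expectation p (fun G => [forall i, x i <= degree G i]%N%:R *
    (y <= #|[set q | isolated_star r G q & [forall w in star_set q, x w == 0%N]]%SET|)%N%:R)
  * (1 + s) ^+ y <=
  expR ((\sum_i (x i)%:R) ^+ 2 / (2 * (n%:R * d)) - \sum_i dcost d (x i)) *
  expR (s * mu).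
Proof.
move=> s0 xd.
pose D := [set e in edges n | [forall w in e, x w == 0%N]]%SET.
pose P q := star_shape r q && [forall w in star_set q, x w == 0%N].
pose W G : R := ([forall i, x i <= degree G i]%N)%:R.
set M := expR (_ - _).
have := @packing_tail R n p hp' _ P (fun q => star q.1 q.2) W M D.
move=> /(_ _ _ _ (fun G => y <= #|[set q | isolated_star r G q &
   [forall w in star_set q, x w == 0%N]]%SET|)%N 1%N y s isT s0) H.
apply: (le_trans (H _ _ _ _)) => {H}.
- by move=> G; rewrite ler0n.
- move=> B BD; rewrite mulrC; apply: degree_tail => //.
    by apply: (fintype.subset_trans BD); apply/fintype.subsetP => e; rewrite inE => /andP[].
  move=> e i /(fintype.subsetP BD); rewrite inE => /andP[_ /forall_inP h] /h/eqP.
  by [].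
- move=> q /andP[/andP[qL _] /forall_inP qx]; apply/fintype.subsetP => e eq.
  rewrite inE (fintype.subsetP (star_sub_edges qL)) //=; apply/forall_inP => w we.
  by apply: qx; exact: (fintype.subsetP (star_vertices eq)).
- move=> G GE yG; exists [set q | isolated_star r G q & [forall w in star_set q, x w == 0%N]]%SET.
  split; last by rewrite mul1n.
    move=> q; rewrite inE => /andP[iq xq].
    by rewrite /P xq (isolated_sub iq) !andbT; case/andP: iq.
  move=> q; rewrite inE => /andP[iq xq]; rewrite -(cards1 q); apply: subset_leq_card.
  apply/fintype.subsetP => q'; rewrite !inE => /andP[/andP[iq' _] h].
  by apply/eqP; apply: (isolated_disjoint r1 iq' iq); rewrite disjoint_sym.
rewrite ler_wpM2l ?expR_ge0 // ler_expR divr1 ler_wpM2l // /mu -sum_star_shape.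
rewrite [leLHS]big_mkcond [leRHS]big_mkcond; apply: ler_sum => q _; rewrite /P.
by case: (star_shape r q) => //=; case: ifP => // _; rewrite exprn_ge0 // ltW.
Qed.

(** The number of stars that the isolated ones have to provide when x lists
the degrees that are at least K and at most b vertices are flawed. *)
Definition needed_stars (eps : R) (K b : nat) (x : 'I_n -> nat) : R :=
  (1 + eps) * mu - (\sum_i 'C(x i, r) + K ^ r * (\sum_i x i + b))%N%:R.

(** Either the large degrees have total cost t, or more than b vertices are flawed, or for
one of the remaining configurations x the isolated stars away from x provide what the others
lack. The parameter s, which may depend on x, balances the two prices in
[isolated_joint_tail]. *)
Lemma sparse_upper (eps h t Z : R) (K x1 b : nat) :
  0 <= h -> 2 * h <= 1 -> d <= K%:R -> (0 < K)%N -> (K <= x1)%N -> (x1 <= n)%N -> 0 <= t ->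
  0 < cost d K%:R -> 2 * ln n%:R <= h * cost d K%:R ->
  K%:R ^+ 2 * (t + cost d x1%:R) <= 2 * h * cost d K%:R ^+ 2 * (n%:R * d) ->
  t <= cost d x1%:R ->
  (forall x : 'I_n -> nat, (forall i, x i != 0%N -> (K <= x i)%N) ->
     \sum_i dcost d (x i) <= t -> exists2 s : R, 0 <= s &
     Z <= (1 - 2 * h) * (\sum_i dcost d (x i)) +
          needed_stars eps K b x * ln (1 + s) - s * mu) ->
  gnp_prob p (fun G : {set {set 'I_n}} => (1 + eps) * mu <= (nb_stars r G)%:R) <=
  expR (1 - (1 - 2 * h) * t) +
  gnp_prob p (fun G : {set {set 'I_n}} => b < #|[set v | flawed r K G v]%SET|)%N +
  expR (1 - Z).
Proof.
move=> h0 h1 dK K0 Kx1 x1n t0 cK nK tK tx1 HZ.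
pose A1 (G : {set {set 'I_n}}) := t <= \sum_(i | K%:R <= (degree G i)%:R :> R)
                               cost d (minn (degree G i) x1)%:R.
pose A2 (G : {set {set 'I_n}}) := (b < #|[set v | flawed r K G v]%SET|)%N.
pose ev (G : {set {set 'I_n}}) := (1 + eps) * mu <= (nb_stars r G)%:R.
pose A3 (G : {set {set 'I_n}}) := [&& ev G, ~~ A1 G & ~~ A2 G].
apply: (@le_trans _ _ (gnp_prob p (fun G => A1 G || A2 G) + gnp_prob p A3)).
  apply: gnp_probU => // G GE; rewrite -/(ev G) /A3 => ->.
  by case: (A1 G); case: (A2 G).
apply: lerD.
  apply: (le_trans (gnp_probU (B := A1) (C := A2) hp' _)) => //.
  by rewrite lerD2r; apply: big_tail; rewrite ?ler_nat.
pose conf (x : {ffun 'I_n -> 'I_n.+1}) :=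
  [forall i, (x i != 0 :> nat) ==> (K <= x i)%N] && (\sum_i dcost d (x i) <= t).
pose y (x : {ffun 'I_n -> 'I_n.+1}) : nat :=
  sval (cid (nat_threshold (needed_stars eps K b (fun i => x i : nat)))).
have yP (x : {ffun 'I_n -> 'I_n.+1}) m : (needed_stars eps K b (fun i => x i : nat) <= m%:R) = (y x <= m)%N.
  by rewrite /y; case: cid.
pose pen (x : {ffun 'I_n -> 'I_n.+1}) : R :=
  \prod_i (if x i == 0 :> nat then 1 else (n%:R ^+ 2)^-1).
have pen0 x : 0 <= pen x.
  by apply: prodr_ge0 => i _; case: ifP => // _; rewrite invr_ge0 exprn_ge0.
pose joint (x : {ffun 'I_n -> 'I_n.+1}) (G : {set {set 'I_n}}) : R :=
  [forall i, x i <= degree G i]%N%:R *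
    (y x <= #|[set q | isolated_star r G q &
                 [forall w in star_set q, (x w : nat) == 0%N]]%SET|)%N%:R.
rewrite gnp_probE.
apply: (@le_trans _ _ (gnp_expectation p (fun G => \sum_(x | conf x) joint x G))).
  apply: gnp_expectation_le => // G GE; case: (boolP (A3 G)) => [|_]; last first.
    by apply: sumr_ge0 => x _; rewrite /joint mulr_ge0.
  case/and3P => evG; rewrite -ltNge => A1G; rewrite -leqNgt => A2G.
  have dx1 i : (K <= degree G i)%N -> (degree G i < x1)%N.
    move=> Ki; rewrite ltnNge; apply/negP => xi; move: A1G.
    rewrite ltNge => /negP; apply; rewrite (bigD1 i) ?ler_nat //=.
    rewrite (minn_idPr xi); apply: (le_trans tx1); rewrite lerDl.
    apply: sumr_ge0 => j /andP[Kj _]; apply: cost_ge0 => //.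
    by rewrite ltr0n leq_min (leq_trans K0 Kx1) andbT; apply: (leq_trans K0); rewrite -(ler_nat R).
  pose x : {ffun 'I_n -> 'I_n.+1} :=
    [ffun i => if (K <= degree G i)%N then inord (degree G i) else ord0].
  have xE i : x i = (if K <= degree G i then degree G i else 0)%N :> nat.
    by rewrite ffunE; case: ifP => // _; rewrite inordK // ltnS ltnW // degree_lt.
  have cx : conf x.
    apply/andP; split.
      by apply/forallP => i; apply/implyP; rewrite xE; case: (leqP K (degree G i)).
    apply/ltW/(le_lt_trans _ A1G); rewrite [leRHS]big_mkcond; apply: ler_sum => i _.
    rewrite xE ler_nat; case: (leqP K (degree G i)) => Ki; last by rewrite /dcost eqxx.
    by rewrite /dcost gtn_eqF ?(leq_trans K0) // (minn_idPl (ltnW (dx1 _ Ki))).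
  rewrite (bigD1 x) //= /joint.
  have -> : [forall i, x i <= degree G i]%N.
    by apply/forallP => i; rewrite xE; case: ifP.
  have yiso : (y x <= #|[set q | isolated_star r G q &
                 [forall w in star_set q, (x w : nat) == 0%N]]%SET|)%N; last first.
    by rewrite yiso mul1r lerDl; apply: sumr_ge0 => z _; rewrite mulr_ge0.
  rewrite -yP /needed_stars lerBlDr.
  apply: (le_trans evG); rewrite -natrD ler_nat.
  apply: (leq_trans (nb_stars_le r1 K GE)); rewrite [leqRHS]addnC leq_add //; last first.
    apply: subset_leq_card; apply/fintype.subsetP => q; rewrite !inE.
    case/andP => -> /forall_inP hK; apply/forall_inP => w /hK; rewrite xE.
    by rewrite ltnNge => /negbTE->.
  apply: leq_add.
    rewrite big_mkcond; apply: leq_sum => i _; rewrite xE.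
    by case: ifP.
  rewrite leq_mul2l leq_add ?orbT //.
  by rewrite big_mkcond; apply: leq_sum => i _; rewrite xE; case: ifP.
rewrite gnp_expectation_sum.
apply: (@le_trans _ _ (\sum_(x | conf x) expR (- Z) * pen x)).
  apply: ler_sum => x /andP[/forallP xK xt].
  have {}xK i : x i != 0%N :> nat -> (K <= x i)%N by move: (xK i) => /implyP.
  have xK' i : x i != 0%N :> nat -> K%:R <= (x i)%:R :> R by move/xK; rewrite ler_nat.
  have [s s0 Zs] := HZ (fun i => x i : nat) xK xt.
  have s1 : 0 < 1 + s by lra.
  have := @isolated_joint_tail (fun i => x i : nat) (y x) s s0.
  rewrite -ler_pdivlMr ?exprn_gt0 // => joint_le.
  apply: (le_trans (joint_le _)); first by move=> i /xK'; apply: le_trans.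
  rewrite -[1 + s](lnK (x := 1 + s)) ?posrE // -expRM_natl -!expRD -expRN -expRD.
  apply: (@le_trans _ _ (expR (- Z) * expR (- (h * \sum_i dcost d (x i))))).
    rewrite -expRD ler_expR.
    have ct : \sum_i dcost d (x i) <= t + cost d x1%:R.
      by apply: (le_trans xt); rewrite lerDl (le_trans t0).
    have := config_quadratic_le n0 hp dK xK' cK ct tK.
    have : 0 <= ((y x)%:R - needed_stars eps K b (fun i => x i : nat)) * ln (1 + s).
      by rewrite mulr_ge0 ?subr_ge0 ?yP // ln_ge0 // lerDl.
    by rewrite -/d; lra.
  by rewrite ler_wpM2l ?expR_ge0 // (config_cost_le n0 hp dK).
rewrite -mulr_sumr expRD mulrC ler_wpM2r ?expR_ge0 //.
apply: le_trans (sum_configs_le n0); rewrite [leRHS](bigID conf) /= lerDl.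
by apply: sumr_ge0 => x _; exact: pen0.
Qed.

End SparseUpper.

(** * Revealing the edges at one vertex *)

Section Peel.
Context {R : realType}.
Variables (n : nat) (p : R).
Implicit Types (G : {set {set 'I_n}}) (N : {set 'I_n}) (e : {set 'I_n}).

Let up (v : 'I_n) : 'I_n.+1 := lift ord0 v.
Let upI : injective up. Proof. exact: lift_inj. Qed.

Definition join_vertex G N : {set {set 'I_n.+1}} :=
  [set up @: e | e : {set 'I_n} in G]%SET :|: [set [set ord0; up w] | w in N]%SET.

Lemma ord0_up e : ord0 \notin up @: e.
Proof. by apply/imsetP => -[w _ /eqP]; rewrite (negbTE (neq_lift _ _)). Qed.

Lemma up_join G N e : (up @: e \in join_vertex G N) = (e \in G).
Proof.
rewrite inE (mem_imset _ _ (imset_inj upI)) orbC.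
case: imsetP => // -[w _ E]; have := ord0_up e.
by rewrite E !inE eqxx.
Qed.

Lemma new_join G N w : ([set ord0; up w]%SET \in join_vertex G N) = (w \in N).
Proof.
rewrite inE; case: imsetP => [[e _ E]|_] /=.
  by have := ord0_up e; rewrite -E !inE eqxx.
apply/imsetP/idP => [[x xN /setP/(_ (up w))]|wN]; last by exists w.
rewrite !inE eqxx orbT eq_sym (negbTE (neq_lift _ _)) /= => /esym/eqP/upI->.
by [].
Qed.

Lemma join_vertex_inj G N G' N' :
  join_vertex G N = join_vertex G' N' -> G = G' /\ N = N'.
Proof.
move=> E; split; first by apply/setP => e; rewrite -(up_join G N) E up_join.
by apply/setP => w; rewrite -(new_join G N) E new_join.
Qed.

Lemma up_edge e : (up @: e \in edges n.+1) = (e \in edges n).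
Proof. by rewrite !inE card_imset. Qed.

Lemma join_vertex_graph G N : G \in graphs n -> join_vertex G N \in graphs n.+1.
Proof.
rewrite !inE => GE; rewrite finset.subUset; apply/andP; split.
  apply/fintype.subsetP => e /imsetP[f fG ->].
  by rewrite up_edge (fintype.subsetP GE).
apply/fintype.subsetP => e /imsetP[w _ ->]; rewrite inE cards2.
by rewrite (neq_lift _ _).
Qed.

Lemma big_edgesS {T : Type} (idx : T) (op : Monoid.com_law idx)
    (F : {set 'I_n.+1} -> T) :
  \big[op/idx]_(e in edges n.+1) F e =
  op (\big[op/idx]_w F [set ord0; up w]%SET) (\big[op/idx]_(e in edges n) F (up @: e)).
Proof.
rewrite (bigID (fun e : {set 'I_n.+1} => ord0 \in e)) /=; congr (op _ _).
  by rewrite big_edges_at big_mkcond big_ord_recl eqxx Monoid.mul1m.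
rewrite -(big_imset _ (h := fun e : {set 'I_n} => up @: e)) /=; last first.
  by move=> x y _ _ /(imset_inj upI).
apply: eq_bigl => e; apply/andP/imsetP => [[eE e0]|[f fE ->]]; last first.
  by rewrite up_edge fE ord0_up.
have E : e = up @: (up @^-1: e).
  apply/setP => x; apply/idP/imsetP => [xe|[y]]; last by rewrite inE => ye ->.
  case: (unliftP ord0 x) xe => [y ->|->] xe; last by rewrite xe in e0.
  by exists y; rewrite // inE.
by exists (up @^-1: e); rewrite // -up_edge -E.
Qed.

Lemma join_vertex_mass G N :
  gnp_mass p (join_vertex G N) = p ^+ #|N| * (1 - p) ^+ (n - #|N|) * gnp_mass p G.
Proof.
rewrite /gnp_mass big_edgesS; congr (_ * _); last first.
  by apply: eq_bigr => e _; rewrite up_join.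
under eq_bigr do rewrite new_join.
rewrite (bigID (fun w => w \in N)) /=; congr (_ * _).
  by rewrite -prodr_const; apply: eq_bigr => w ->.
rewrite (eq_bigr (fun=> 1 - p)); last by move=> w /negbTE->.
rewrite (eq_bigl (fun w => w \in ~: N)) => [|w]; last by rewrite inE.
by rewrite prodr_const cardsCs finset.setCK card_ord.
Qed.

Variable r : nat.
Hypothesis r1 : (1 < r)%N.

(** The stars with the new centre and the old stars, whose edges avoid the new vertex, are
different. *)
Lemma join_vertex_stars G N :
  (nb_stars r G + 'C(#|N|, r) <= nb_stars r (join_vertex G N))%N.
Proof.
rewrite !nb_starsE // big_ord_recl addnC; apply: leq_add.
  suff -> : degree (join_vertex G N) ord0 = #|N| by [].
  rewrite -(card_imset (mem N) upI) /degree; apply: eq_card => x; rewrite inE.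
  case: (unliftP ord0 x) => [w ->|->].
    by rewrite eq_sym (neq_lift _ _) -/(up w) new_join (mem_imset _ _ upI).
  by rewrite eqxx; apply/esym/negbTE/imsetP => -[w _ /eqP]; rewrite (negbTE (neq_lift _ _)).
apply: leq_sum => v _; rewrite leq_bin2l //.
rewrite /degree -[leqLHS](card_imset _ upI); apply: subset_leq_card.
apply/fintype.subsetP => x /imsetP[w]; rewrite inE => /andP[wv vG] ->.
rewrite inE (inj_eq upI) wv /=.
by rewrite -(up_join G N) imsetU !imset_set1 in vG.
Qed.

Hypothesis hp : 0 <= p <= 1.

(** The edges at one vertex are independent of the others; given any x neighbours,
[join_vertex_stars] applies. *)
Lemma peel (x : nat) (z : R) :
  ('C(n, x))%:R * (p ^+ x * (1 - p) ^+ (n - x)) *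
    gnp_prob p (fun G : {set {set 'I_n}} => z <= (nb_stars r G)%:R) <=
  gnp_prob p (fun G : {set {set 'I_n.+1}} =>
    z + ('C(x, r))%:R <= (nb_stars r G)%:R).
Proof.
pose f (t : {set {set 'I_n}} * {set 'I_n}) := join_vertex t.1 t.2.
pose S := [set t : {set {set 'I_n}} * {set 'I_n} |
  [&& t.1 \in graphs n, z <= (nb_stars r t.1)%:R & #|t.2| == x]]%SET.
apply: (@le_trans _ _ (\sum_(H in f @: S) gnp_mass p H)); last first.
  rewrite /gnp_prob [leRHS]big_mkcond [leLHS]big_mkcond; apply: ler_sum => H _.
  case: imsetP => [[t]|_]; last by case: ifP => // _; rewrite gnp_mass_ge0.
  rewrite inE => /and3P[tE tz /eqP tx] ->.
  rewrite /f join_vertex_graph //= ifT //.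
  by apply: le_trans (_ : (nb_stars r t.1 + 'C(#|t.2|, r))%:R <= _);
    rewrite ?natrD ?tx ?lerD2r // -natrD -tx ler_nat join_vertex_stars.
rewrite big_imset /=; last first.
  by move=> [G N] [G' N'] _ _ /join_vertex_inj[/= -> ->].
rewrite le_eqVlt; apply/orP; left; apply/eqP.
rewrite (eq_bigl (fun t : {set {set 'I_n}} * {set 'I_n} => ((t.1 \in graphs n) && (z <= (nb_stars r t.1)%:R)) && (#|t.2| == x))).
  rewrite -(pair_big (fun G => (G \in graphs n) && (z <= (nb_stars r G)%:R))
    (fun N => #|N| == x) (fun G N => gnp_mass p (f (G, N)))) /=.
  rewrite /gnp_prob mulr_sumr; apply: eq_bigr => G _.
  rewrite (eq_bigr (fun=> p ^+ x * (1 - p) ^+ (n - x) * gnp_mass p G)); last first.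
    by move=> N /eqP Nx; rewrite /f join_vertex_mass Nx.
  rewrite sumr_const -[RHS]mulr_natl [RHS]mulrA; congr (_%:R * _ * _).
  by rewrite -[n in LHS]card_ord -card_draws; apply: eq_card => N; rewrite inE.
by move=> t; rewrite inE andbA.
Qed.

End Peel.

(** * Moments of the number of isolated stars *)

Section IsolatedMoments.
Context {R : realType}.
Variables (n r : nat) (p : R).
Hypothesis r1 : (1 < r)%N.
Hypothesis hp : 0 <= p <= 1.
Implicit Types (G B : {set {set 'I_n}}) (U : {set 'I_n}).

Definition nb_isolated G := #|[set q | isolated_star r G q]%SET|.

Lemma nb_isolated_le G : (nb_isolated G <= nb_stars r G)%N.
Proof.
rewrite nb_starsE //.
rewrite -[leqRHS](card_stars r predT); apply: subset_leq_card.
apply/fintype.subsetP => q; rewrite !inE => iq.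
by rewrite (isolated_sub iq) !andbT; case/andP: iq.
Qed.

(** Different isolated stars are disjoint: a tuple of them has as many edges as its stars
have in total. *)
Lemma isolated_moment_le m :
  gnp_expectation p (fun G => (nb_isolated G ^_ m)%:R) <= mu_stars n r p ^+ m.
Proof.
have := @npack_expectation_le R n p hp _ (star_shape r)
  (fun q => star q.1 q.2) (fun=> 1) 1 (edges n).
move=> /(_ _ _ _ m finset.set0 (finset.sub0set _)) H.
apply: (@le_trans _ _ (1 * p ^+ #|(finset.set0 : {set {set 'I_n}})| *
   (\sum_(q | star_shape r q) p ^+ #|star q.1 q.2|) ^+ m)); last first.
  by rewrite sum_star_shape cards0 expr0 !mul1r.
apply: le_trans (H _ _ _) => {H}.
- apply: gnp_expectation_le => // G GE; rewrite finset.sub0set mulr1 mul1r ler_nat.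
  apply: leq_trans (_ : 1 ^ m * nb_isolated G ^_ m <= _)%N; first by rewrite exp1n mul1n.
  apply: (@npack_ge _ _ _ _ _ [set q | isolated_star r G q]%SET).
  + by move=> q; rewrite inE => iq; rewrite (isolated_sub iq) andbT; case/andP: iq.
  + move=> q; rewrite inE => iq; rewrite -(cards1 q); apply: subset_leq_card.
    apply/fintype.subsetP => q'; rewrite !inE => /andP[iq'] h.
    by apply/eqP; apply: (isolated_disjoint r1 iq' iq); rewrite disjoint_sym.
  + rewrite mul1n; apply: subset_leq_card; apply/fintype.subsetP => q.
    by rewrite !inE => ->; rewrite /= -finset.setI_eq0 finset.setI0.
- by [].
- move=> B BE; rewrite mul1r; under eq_fun do rewrite mul1r.
  by rewrite /gnp_expectation gnp_sub.
- by move=> q /andP[qL _]; exact: star_sub_edges.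
Qed.

Definition nb_isolated_off U G :=
  #|[set q | isolated_star r G q & [disjoint star_set q & U]]%SET|.

Definition touching G U := [set e in G | ~~ [disjoint e & U]]%SET.

Lemma touchingE G U e : (e \in touching G U) = (e \in G) && ~~ [disjoint e & U].
Proof. by rewrite inE. Qed.

Lemma card_touching_edges U : (#|touching (edges n) U| <= #|U| * n)%N.
Proof.
apply: (@leq_trans #|[set e : {set 'I_n} | [exists a in U, (a \in e) && (e \in edges n)]]%SET|).
  apply: subset_leq_card; apply/fintype.subsetP => e; rewrite inE.
  move=> /andP[eE /touchP[a ae aU]]; rewrite inE; apply/exists_inP.
  by exists a; rewrite // ae.
apply: card_exists_le => a _.
have -> : [set e : {set 'I_n} | (a \in e) && (e \in edges n)]%SET =
    [set e in edges n | a \in e]%SET.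
  by apply/setP => e; rewrite !inE andbC.
by rewrite edges_at card_in_imset ?cardsC1 ?card_ord ?leq_pred //; exact: set2_inj.
Qed.

Lemma touching_prob U B : B \subset touching (edges n) U ->
  p ^+ #|B| * (1 - p) ^+ (n * #|U|) <=
  gnp_expectation p (fun G => (touching G U == B)%:R).
Proof.
have /andP[p0 p1] := hp; move=> BU.
pose w (e : {set 'I_n}) (b : bool) : R := if e \in touching (edges n) U then
  (if e \in B then b%:R else (~~ b)%:R) else 1.
have BE : B \subset edges n.
  by apply: (fintype.subset_trans BU); apply/fintype.subsetP => e; rewrite inE => /andP[].
rewrite [leRHS](_ : _ = gnp_expectation p (fun G => \prod_(e in edges n) w e (e \in G))).
  rewrite gnp_prod.
  rewrite (eq_bigr (fun e => (if e \in B then p else 1) *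
     (if e \in touching (edges n) U :\: B then 1 - p else 1))); last first.
    move=> e eE; rewrite /w finset.in_setD !touchingE eE /=; case: (boolP (e \in B)) => eB /=.
      have := fintype.subsetP BU _ eB; rewrite touchingE eE /= => ->.
      by rewrite !(mulr1, mulr0, addr0).
    by case: ifP => _; rewrite !(mulr1, mulr0, add0r, mul1r) // addrC subrK.
  rewrite big_split /=.
  have prodE (S : {set {set 'I_n}}) (c : R) : S \subset edges n ->
      \prod_(e in edges n) (if e \in S then c else 1) = c ^+ #|S|.
    move=> SE; rewrite -big_mkcondr -prodr_const; apply: eq_bigl => e.
    by case: (boolP (e \in S)) => [/(fintype.subsetP SE)->|]; rewrite ?andbF.
  rewrite !prodE //; last first.
    by apply/fintype.subsetP => e; rewrite !inE => /and3P[].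
  rewrite ler_wpM2l ?exprn_ge0 // ler_wiXn2l ?subr_ge0 ?gerBl //.
  rewrite mulnC (leq_trans _ (card_touching_edges U)) //.
  by apply: subset_leq_card; exact: finset.subsetDl.
apply: eq_bigr => G; rewrite inE => GE; congr (_ * _).
case: eqP => [E|/eqP E].
  rewrite big1 // => e eE; rewrite /w touchingE eE /=; case: ifP => // eU.
  by rewrite -E touchingE eU andbT; case: (e \in G).
have [e eE ew] : exists2 e, e \in edges n & w e (e \in G) = 0; last first.
  by rewrite (bigD1 e) //= ew mul0r.
have [h|/fintype.subsetPn[e]] := boolP (touching G U \subset B).
  move: E; rewrite finset.eqEsubset h /= => /fintype.subsetPn[e eB].
  have := fintype.subsetP BU _ eB; rewrite touchingE => /andP[eE eU].
  rewrite touchingE eU andbT => eG; exists e => //.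
  by rewrite /w touchingE eE eU eB (negbTE eG).
rewrite inE => /andP[eG eU] eB; exists e; first exact: (fintype.subsetP GE).
by rewrite /w touchingE (fintype.subsetP GE) // eU (negbTE eB) eG.
Qed.

Lemma card_shapes_off U (u : nat) : (#|U| <= u)%N ->
  ((n - u) * 'C((n - u).-1, r) <=
   #|[set q | star_shape r q & [disjoint star_set q & U]]%SET|)%N.
Proof.
move=> Uu; have nu : (n - u <= #|~: U|)%N by rewrite cardsCs finset.setCK card_ord leq_sub2l.
apply: (@leq_trans (\sum_(v in ~: U) 'C((n - u).-1, r))%N).
  by rewrite sum_nat_const leq_mul2r nu orbT.
have -> : #|[set q | star_shape r q & [disjoint star_set q & U]]%SET| =
    (\sum_(v : 'I_n) #|[set L | star_shape r (v, L) & [disjoint star_set (v, L) & U]]%SET|)%N.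
  under [RHS]eq_bigr do rewrite -sum1_card.
  by rewrite pair_big_dep /= -sum1_card; apply: eq_bigl => -[v L]; rewrite !inE.
rewrite big_mkcond; apply: leq_sum => v _; case: ifP => // vU.
apply: (@leq_trans 'C(#|(~: U) :\ v|, r)).
  by rewrite leq_bin2l // -subn1 leq_subLR (leq_trans nu) // (cardsD1 v (~: U)) vU.
rewrite -cards_draws; apply: subset_leq_card; apply/fintype.subsetP => L.
rewrite !inE => /andP[/fintype.subsetP LU Lr].
have vL : v \notin L by apply/negP => /LU; rewrite !inE eqxx.
rewrite /star_shape vL Lr /= -finset.setI_eq0 -finset.subset0.
apply/fintype.subsetP => a; rewrite !inE => /andP[/orP[/eqP->|/LU]].
  by move: vU; rewrite inE => /negbTE->.
by rewrite !inE => /andP[_ /negbTE->].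
Qed.

(** Induction on m: once the edges that touch the first star are revealed, the other stars
are sought away from U and from this star, in the same situation as before. *)
Lemma isolated_moment_off (m u : nat) U B :
  (forall e, e \in B -> e \subset U) -> B \subset touching (edges n) U ->
  (#|U| + m * r.+1 <= u)%N ->
  p ^+ #|B| * (1 - p) ^+ (n * #|U|) *
    (((n - u) * 'C((n - u).-1, r))%N%:R * p ^+ r * (1 - p) ^+ (n * r.+1)) ^+ m <=
  gnp_expectation p (fun G => (touching G U == B)%:R * (nb_isolated_off U G ^_ m)%:R).
Proof.
have /andP[p0 p1] := hp; have q0 : 0 <= 1 - p by rewrite subr_ge0.
elim: m U B => [|m IH] U B BU BE um.
  rewrite expr0 mulr1; under eq_fun do rewrite ffactn0 mulr1.
  exact: touching_prob.
set S := [set q | star_shape r q & [disjoint star_set q & U]]%SET.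
set c := _ * p ^+ r * _ in IH *.
have c0 : 0 <= c by rewrite /c !mulr_ge0 // exprn_ge0.
apply: (@le_trans _ _ (\sum_(q in S) gnp_expectation p (fun G =>
   (touching G (U :|: star_set q) == B :|: star q.1 q.2)%:R *
   (nb_isolated_off (U :|: star_set q) G ^_ m)%:R))).
  apply: (@le_trans _ _ (\sum_(q in S) (p ^+ (#|B| + r) * (1 - p) ^+ (n * (#|U| + r.+1)) * c ^+ m))).
    rewrite sumr_const -[leRHS]mulr_natl mulnDr !exprD exprS.
    have Su : ((n - u) * 'C((n - u).-1, r) <= #|S|)%N.
      apply: card_shapes_off; apply: leq_trans um; exact: leq_addr.
    have : c <= #|S|%:R * (p ^+ r * (1 - p) ^+ (n * r.+1)).
      by rewrite /c -mulrA ler_wpM2r ?ler_nat // mulr_ge0 ?exprn_ge0.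
    move=> /(ler_wpM2l (mulr_ge0 (mulr_ge0 (exprn_ge0 #|B| p0) (exprn_ge0 (n * #|U|) q0)) (exprn_ge0 m c0))).
    move=> h; rewrite [leLHS]mulrA [leLHS]mulrAC; apply: (le_trans h) => {h}.
    rewrite le_eqVlt.
    move: (c ^+ m) (p ^+ #|B|) ((1 - p) ^+ (n * #|U|)) => c1 c2 c3.
    move: (p ^+ r) ((1 - p) ^+ (n * r.+1)) (#|S|%:R : R) => c4 c5 c6.
    by apply/orP; left; apply/eqP; ring.
  apply: ler_sum => q; rewrite inE => /andP[qr qU].
  have /andP[qL /eqP q2] := qr.
  have sV e : e \in star q.1 q.2 -> e \subset star_set q by exact: star_vertices.
  have BS : [disjoint B & star q.1 q.2]%B.
    rewrite -finset.setI_eq0 -finset.subset0; apply/fintype.subsetP => e.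
    rewrite inE => /andP[/BU eU es]; have := fintype.subsetP eU _ (star_center es).
    by rewrite (disjointFr qU) // !inE eqxx.
  have -> : (#|B| + r)%N = #|B :|: star q.1 q.2|.
    by have /eqP -> : #|B :|: star q.1 q.2| == (#|B| + #|star q.1 q.2|)%N;
      rewrite ?leq_card_setU // card_star // q2.
  have UV : (#|U| + r.+1)%N = #|U :|: star_set q|.
    by have /eqP -> : #|U :|: star_set q| == (#|U| + #|star_set q|)%N;
      rewrite ?leq_card_setU 1?disjoint_sym // (card_star_set qr).
  rewrite UV; apply: IH.
  - move=> e; rewrite inE => /orP[/BU|/sV] h; apply: (fintype.subset_trans h).
      exact: finset.subsetUl.
    exact: finset.subsetUr.
  - apply/fintype.subsetP => e; rewrite !inE => /orP[eB|es].
      have := fintype.subsetP BE _ eB; rewrite !inE => /andP[-> /touchP[a ae aU]] /=.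
      by apply/touchP; exists a => //; rewrite inE aU.
    have := fintype.subsetP (star_sub_edges qL) _ es; rewrite inE => -> /=.
    apply/touchP; exists q.1; first exact: star_center es.
    by rewrite !inE eqxx orbT.
  - by rewrite -UV -addnA -mulSn.
rewrite -gnp_expectation_sum; apply: gnp_expectation_le => // G GE.
set T := [set q | isolated_star r G q & [disjoint star_set q & U]]%SET.
apply: (@le_trans _ _ (\sum_(q in T) (touching G U == B)%:R * ((#|T|.-1) ^_ m)%:R)).
  rewrite [leLHS]big_mkcond [leRHS]big_mkcond; apply: ler_sum => q _.
  case: ifP => [|_]; last by case: ifP => // _; rewrite mulr_ge0.
  rewrite inE => /andP[qr qU].
  case: (boolP (touching G (U :|: star_set q) == B :|: star q.1 q.2)) => [/eqP E|_]; last first.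
    by rewrite mul0r; case: ifP => // _; rewrite mulr_ge0.
  have memE e : (e \in touching G (U :|: star_set q)) = (e \in B) || (e \in star q.1 q.2).
    by rewrite E inE.
  have BG : touching G U = B.
    apply/setP => e; apply/idP/idP => [|eB].
      rewrite inE => /andP[eG /touchP[a ae aU]].
      have : e \in touching G (U :|: star_set q).
        by rewrite inE eG; apply/touchP; exists a => //; rewrite inE aU.
      rewrite memE => /orP[//|/star_vertices/fintype.subsetP/(_ _ ae) aq].
      by rewrite (disjointFl qU aU) in aq.
    have := memE e; rewrite eB => /idP; rewrite touchingE => /andP[eG _].
    rewrite touchingE eG /=.
    by have := fintype.subsetP BE _ eB; rewrite inE => /andP[].
  have iq : isolated_star r G q.
    rewrite /isolated_star qr /=; apply/eqP/setP => e; apply/idP/idP => [|es].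
      rewrite inE => /andP[eG /touchP[a ae aq]].
      have : e \in touching G (U :|: star_set q).
        by rewrite inE eG; apply/touchP; exists a => //; rewrite inE aq orbT.
      rewrite memE => /orP[/BU/fintype.subsetP/(_ _ ae) aU|//].
      by rewrite (disjointFl qU aU) in aq.
    have := memE e; rewrite es orbT => /idP; rewrite touchingE => /andP[eG _].
    rewrite inE eG /=.
    apply/touchP; exists q.1; first exact: star_center es.
    by rewrite !inE eqxx.
  rewrite BG eqxx !mul1r inE iq qU /= ler_nat.
  have qT : q \in T by rewrite inE iq qU.
  have : (nb_isolated_off (U :|: star_set q) G <= #|T|.-1)%N.
    rewrite (cardsD1 q T) qT /=; apply: subset_leq_card; apply/fintype.subsetP => q'.
    rewrite inE => /andP[iq']; rewrite disjointsUr => /andP[dU dq].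
    rewrite !inE iq' dU !andbT; apply/eqP => E'.
    by have := disjointFr dq (x := q.1); rewrite E' !inE eqxx => /(_ isT).
  by elim: (m) => // k IHk h; rewrite !ffactnSr leq_mul ?IHk // leq_sub2r.
rewrite sumr_const -[leLHS]mulr_natl mulrCA ler_wpM2l // -natrM ler_nat.
by rewrite /nb_isolated_off -/T ffactnS.
Qed.

Lemma isolated_moment_ge (m u : nat) : (m * r.+1 <= u)%N ->
  (((n - u) * 'C((n - u).-1, r))%N%:R * p ^+ r * (1 - p) ^+ (n * r.+1)) ^+ m <=
  gnp_expectation p (fun G => (nb_isolated G ^_ m)%:R).
Proof.
move=> mu; have := @isolated_moment_off m u finset.set0 finset.set0.
rewrite !cards0 muln0 !expr0 !mul1r => H; apply: le_trans (H _ _ _) _ => //.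
- by move=> e; rewrite inE.
- exact: finset.sub0set.
apply: gnp_expectation_le => // G _.
have -> : nb_isolated_off finset.set0 G = nb_isolated G.
  apply: eq_card => q; rewrite inE [in RHS]inE.
  have -> : [disjoint star_set q & finset.set0]%B by rewrite -finset.setI_eq0 finset.setI0.
  by rewrite andbT.
by rewrite ler_piMl // lern1 leq_b1.
Qed.

End IsolatedMoments.

(** * A Poisson lower tail from factorial moments *)

Lemma ffactnD (y m k : nat) : (y ^_ (m + k) = y ^_ m * (y - m) ^_ k)%N.
Proof.
elim: k => [|k IH]; first by rewrite addn0 ffactn0 muln1.
by rewrite addnS !ffactnSr IH mulnA subnDA.
Qed.

Lemma ffact_le_expn (y k : nat) : (y ^_ k <= y ^ k)%N.
Proof. by elim: k => // k IH; rewrite ffactnSr expnSr leq_mul // leq_subr. Qed.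

Lemma ffact_ge_expn (y k : nat) : ((y - k) ^ k <= y ^_ k)%N.
Proof.
suff H j : (j <= k)%N -> ((y - k) ^ j <= y ^_ j)%N by exact: H.
elim: j => // j IH jk; rewrite ffactnSr expnSr.
by apply: leq_mul; [exact/IH/ltnW|exact/leq_sub2l/ltnW].
Qed.

Lemma leq_ffact (x y k : nat) : (x <= y)%N -> (x ^_ k <= y ^_ k)%N.
Proof.
by move=> xy; elim: k => // k IH; rewrite !ffactnSr leq_mul // leq_sub2r.
Qed.

Section PoissonLower.
Context {R : realType}.
Implicit Types x y h : R.

Lemma ln_le_diff x : 0 < x -> ln x <= (x + 1) * ln (x + 1) - (x + 1) - (x * ln x - x).
Proof.
move=> x0; have x10 : 0 < x + 1 by lra.
have := ln_ge1BV (divr_gt0 x10 x0); rewrite ln_div ?posrE // invf_div => h.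
have : (x + 1) * (1 - x / (x + 1)) <= (x + 1) * (ln (x + 1) - ln x) by rewrite ler_pM2l.
have -> : (x + 1) * (1 - x / (x + 1)) = 1 by field; lra.
lra.
Qed.

(** A primitive of ln. *)
Definition xlnx x := x * ln x - x.

Lemma ffact_le_exp (b m : nat) : (m <= b)%N ->
  (b ^_ m)%:R <= expR (xlnx (b%:R + 1) - xlnx (b%:R + 1 - m%:R)).
Proof.
elim: m => [|m IH] mb; first by rewrite ffactn0 subr0 subrr expR0.
have bm0 : 0 < b%:R - m%:R :> R by rewrite subr_gt0 ltr_nat.
rewrite ffactnSr natrM (natrB _ (ltnW mb)).
have -> : xlnx (b%:R + 1) - xlnx (b%:R + 1 - m.+1%:R) =
  (xlnx (b%:R + 1) - xlnx (b%:R + 1 - m%:R)) +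
  (xlnx (b%:R - m%:R + 1) - xlnx (b%:R - m%:R)).
  rewrite -natr1.
  have -> : b%:R + 1 - (m%:R + 1) = b%:R - m%:R :> R by ring.
  have -> : b%:R + 1 - m%:R = b%:R - m%:R + 1 :> R by ring.
  ring.
rewrite expRD ler_pM //; [exact: ltW|by apply: IH; exact: ltnW|].
by rewrite -[leLHS]lnK ?posrE // ler_expR ln_le_diff.
Qed.

Lemma phi_incr x y : 0 <= x -> x <= y ->
  phi x <= phi y /\ phi y - phi x <= (y - x) * ln (1 + y).
Proof.
move=> x0 xy; have a0 : 0 < 1 + x by lra.
have b0 : 0 < 1 + y by lra.
have := ln_ge1BV (divr_gt0 b0 a0); rewrite ln_div ?posrE // invf_div => h1.
have := ln_ge1BV (divr_gt0 a0 b0); rewrite ln_div ?posrE // invf_div => h2.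
have : (1 + y) * (1 - (1 + x) / (1 + y)) <= (1 + y) * (ln (1 + y) - ln (1 + x)).
  by rewrite ler_pM2l.
have -> : (1 + y) * (1 - (1 + x) / (1 + y)) = y - x by field; lra.
have : (1 + x) * (1 - (1 + y) / (1 + x)) <= (1 + x) * (ln (1 + x) - ln (1 + y)).
  by rewrite ler_pM2l.
have -> : (1 + x) * (1 - (1 + y) / (1 + x)) = x - y by field; lra.
have lx : 0 <= ln (1 + x) by rewrite ln_ge0 //; lra.
have := mulr_ge0 (_ : 0 <= y - x) lx; rewrite subr_ge0 => /(_ xy).
by rewrite /phi; split; lra.
Qed.

Lemma phi0 : phi (0 : R) = 0.
Proof. by rewrite /phi addr0 ln1 mulr0 subrr. Qed.

Lemma phi_ge0 x : 0 <= x -> 0 <= phi x.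
Proof. by move=> x0; rewrite -phi0; have [] := phi_incr (lexx 0) x0. Qed.

Lemma phi_gt0 x : 0 < x -> 0 < phi x.
Proof.
move=> x0; have y0 : 0 < 1 + x by lra.
have y1 : 1 + x != 1 by rewrite gt_eqF //; lra.
have := @expR_gt1Dx R (- ln (1 + x)).
rewrite expRN lnK ?posrE // oppr_eq0 ln_eq0 // => /(_ y1) h.
have : (1 + x) * (1 + - ln (1 + x)) < (1 + x) * (1 + x)^-1 by rewrite ltr_pM2l.
by rewrite divff ?gt_eqF // /phi; lra.
Qed.

Lemma one_minus_ge_exp x : 0 <= x -> x <= 2^-1 -> expR (- (2 * x)) <= 1 - x.
Proof.
move=> x0 x1; have y0 : 0 < 1 - x by lra.
rewrite -[leRHS]lnK ?posrE // ler_expR; apply: le_trans (ln_ge1BV y0).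
rewrite lerBrDr -lerBrDl; rewrite -[leLHS]mul1r ler_pdivrMr //.
have := mulr_ge0 x0 (_ : 0 <= 1 - 2 * x); have -> : 0 <= 1 - 2 * x by lra.
move=> /(_ isT); lra.
Qed.

(** Weighting by the m-th factorial moment moves the mean from mu to about
mu + m; the moments of orders m - k and m + k show that under this weight the
values below a and above b are negligible. *)
Lemma ffact_split (a lo hi : R) (b m k Y : nat) : (k <= m)%N -> 0 <= lo -> 0 < hi ->
  hi <= b%:R - m%:R - k%:R -> a - (m%:R - k%:R) <= lo ->
  (Y ^_ m)%:R <= (b ^_ m)%:R * (a <= Y%:R)%R%:R + (Y ^_ (m - k))%:R * lo ^+ k +
                 (Y ^_ (m + k))%:R / hi ^+ k.
Proof.
move=> km lo0 hi0 hib alo.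
have hk : 0 < hi ^+ k by rewrite exprn_gt0.
have s2 : 0 <= (Y ^_ (m - k))%:R * lo ^+ k by rewrite mulr_ge0 ?exprn_ge0.
have s3 : 0 <= (Y ^_ (m + k))%:R / hi ^+ k by rewrite divr_ge0 // ltW.
have [aY|Ya] := leP a Y%:R; rewrite /= ?mulr0 ?mulr1; last first.
  have : (Y ^_ m)%:R <= (Y ^_ (m - k))%:R * lo ^+ k; last by lra.
  rewrite -{1}(subnK km) ffactnD natrM ler_wpM2l //.
  apply: (@le_trans _ _ ((Y - (m - k)) ^ k)%:R); first by rewrite ler_nat ffact_le_expn.
  rewrite natrX lerXn2r ?nnegrE //; have [h|h] := leqP (m - k)%N Y.
    by rewrite natrB // natrB //; lra.
  by rewrite (eqP (_ : (Y - (m - k) == 0)%N)) // subn_eq0 ltnW.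
have [Yb|bY] := leqP Y b.
  have : (Y ^_ m)%:R <= (b ^_ m)%:R :> R by rewrite ler_nat leq_ffact.
  lra.
have : (Y ^_ m)%:R <= (Y ^_ (m + k))%:R / hi ^+ k; last first.
  by move=> h; have : 0 <= (b ^_ m)%:R :> R by []; lra.
rewrite ler_pdivlMr // ffactnD natrM ler_wpM2l //.
have bY' : b%:R <= Y%:R :> R by rewrite ler_nat ltnW.
have mkY : (m + k <= Y)%N by rewrite -(ler_nat R) natrD; lra.
apply: (@le_trans _ _ ((Y - m - k) ^ k)%:R); last by rewrite ler_nat ffact_ge_expn.
rewrite natrX lerXn2r ?nnegrE ?(ltW hi0) // -subnDA natrB // natrD; lra.
Qed.

(** When E j is close to mu ^ j, the last two terms of [ffact_split] lose a factor
exponential in k against the m-th moment. The first term then is of the order of mu ^ m, and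
the quotient of mu ^ m and b ^_ m gives phi. *)
Lemma moments_lower (h e1 mu z P : R) (E : nat -> R) (m k b : nat)  :
  0 < h -> h <= 1 -> 0 < mu -> 0 <= P -> (k <= m)%N -> (m <= b)%N ->
  (forall j, 0 <= E j <= mu ^+ j) -> (expR (- z) * mu) ^+ m <= E m ->
  E m <= (b ^_ m)%:R * P + E (m - k)%N * ((1 - h / 2) * mu) ^+ k +
                 E (m + k)%N / ((1 + h / 2) * mu) ^+ k ->
  ln 4 + z * m%:R <= k%:R * ln (1 + h / 2) ->
  mu <= b%:R + 1 - m%:R -> b%:R + 1 <= (1 + e1) * mu ->
  expR (- (ln 2 + z * m%:R + mu * phi e1)) <= P.
Proof.
move=> h0 h1 mu0 P0 km mb Emu Em EmP lnk mub bmu.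
have hh : 0 < 1 + h / 2 by lra.
have lh : 0 <= 1 - h / 2 by lra.
have E1 : E (m - k)%N * ((1 - h / 2) * mu) ^+ k <= mu ^+ m / (1 + h / 2) ^+ k.
  apply: (@le_trans _ _ (mu ^+ (m - k) * (((1 + h / 2)^-1) * mu) ^+ k)).
    have /andP[Ej0 Ej] := Emu (m - k)%N; apply: ler_pM => //.
    - by rewrite exprn_ge0 // mulr_ge0 // ltW.
    rewrite lerXn2r ?nnegrE ?mulr_ge0 ?invr_ge0 ?(ltW mu0) ?(ltW hh) //.
    rewrite ler_wpM2r ?(ltW mu0) // -[leRHS]mul1r ler_pdivlMr //.
    have := mulr_ge0 (ltW h0) (ltW h0); lra.
  by rewrite exprMn mulrCA -exprD subnK // exprVn mulrC.
have E2 : E (m + k)%N / ((1 + h / 2) * mu) ^+ k <= mu ^+ m / (1 + h / 2) ^+ k.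
  rewrite exprMn ler_pdivrMr ?mulr_gt0 ?exprn_gt0 //.
  have /andP[_ Ej] := Emu (m + k)%N; apply: (le_trans Ej); rewrite exprD mulrA ler_wpM2r ?exprn_ge0 ?(ltW mu0) //.
  by rewrite divfK // gt_eqF // exprn_gt0.
have small : 4 * (mu ^+ m / (1 + h / 2) ^+ k) <= (expR (- z) * mu) ^+ m.
  rewrite exprMn mulrCA [leRHS]mulrC ler_wpM2l ?exprn_ge0 ?(ltW mu0) //.
  rewrite ler_pdivrMr ?exprn_gt0 // -[X in _ * X ^+ k](lnK (x := 1 + h / 2)) ?posrE //.
  rewrite -!expRM_natl -expRD -[leLHS]lnK ?posrE // ler_expR; lra.
have half : (expR (- z) * mu) ^+ m <= 2 * ((b ^_ m)%:R * P) by lra.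
have := ffact_le_exp mb => ble.
have big : expR (- z * m%:R) * mu ^+ m <=
    2 * (expR (xlnx (b%:R + 1) - xlnx (b%:R + 1 - m%:R)) * P).
  rewrite exprMn -expRM_natr in half; apply: (le_trans half).
  by rewrite ler_pM2l // ler_wpM2r.
have two : (2 : R) = expR (ln 2) by rewrite lnK // posrE.
rewrite -[mu in mu ^+ m](lnK (x := mu)) ?posrE // -expRM_natl -expRD {1}two mulrA -expRD in big.
rewrite -ler_pdivrMl ?expR_gt0 // -expRN -expRD in big.
apply: le_trans big; rewrite ler_expR.
set B := b%:R + 1 in bmu mub *; set w := B - m%:R in mub *.
have B0 : 0 < B by rewrite /B ltr_pwDr.
have w0 : 0 < w by lra.
have e0 : 0 <= B / mu - 1 by rewrite subr_ge0 ler_pdivlMr // mul1r; have : 0 <= m%:R :> R by []; rewrite /w in mub; lra.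
have e1' : B / mu - 1 <= e1 by rewrite lerBlDr ler_pdivrMr // [e1 + 1]addrC.
have [phie _] := phi_incr e0 e1'.
have f0 : 0 <= w / mu - 1 by rewrite subr_ge0 ler_pdivlMr // mul1r.
have := phi_ge0 f0.
have : mu * phi (B / mu - 1) <= mu * phi e1 by rewrite ler_pM2l.
have XE x : 0 < x -> mu * phi (x / mu - 1) = xlnx x - x * ln mu + mu.
  move=> x0; rewrite /phi /xlnx.
  have -> : 1 + (x / mu - 1) = x / mu by ring.
  by rewrite ln_div ?posrE //; field; rewrite gt_eqF.
rewrite (XE _ B0) => hB /(mulr_ge0 (ltW mu0)); rewrite (XE _ w0) => hw.
have : w * ln mu = B * ln mu - m%:R * ln mu by rewrite /w mulrBl.
lra.
Qed.

End PoissonLower.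

(** * Poisson deviations of the number of stars *)

Section PoissonStars.
Context {R : realType}.

Lemma mul_bin_pred_fact (m k : nat) : (m * 'C(m.-1, k) * k`! = m ^_ k.+1)%N.
Proof. by rewrite mul_bin_diag -bin_ffact factS mulnAC mulnA mulnC mulnA mulnC. Qed.

Lemma ffact_sub_ge (n u r j : nat) (de : R) : (r < n)%N -> (j <= r.+1)%N ->
  u%:R <= de * (n%:R - r%:R) -> 0 <= de -> de <= 1 ->
  (1 - de) ^+ j * (n ^_ j)%:R <= ((n - u) ^_ j)%:R.
Proof.
move=> rn jr ude d0 d1.
have nr : 0 < n%:R - r%:R :> R by rewrite subr_gt0 ltr_nat.
elim: j jr => [|j IH] jr; first by rewrite expr0 mul1r.
have unr : u%:R <= n%:R - r%:R :> R.
  by apply: (le_trans ude); rewrite -[leRHS]mul1r ler_wpM2r // ltW.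
have jr' : j%:R <= r%:R :> R by rewrite ler_nat.
have ujn : (u + j <= n)%N by rewrite -(ler_nat R) natrD; lra.
rewrite !ffactnSr exprSr !natrM mulrACA.
apply: ler_pM.
- by rewrite mulr_ge0 // exprn_ge0 // subr_ge0.
- by rewrite mulr_ge0 // subr_ge0.
- by apply: IH; exact: ltnW.
rewrite (natrB _ (leq_trans (leq_addl u j) ujn)) -subnDA (natrB _ ujn) natrD.
have : 0 <= de * (r%:R - j%:R) by rewrite mulr_ge0 // subr_ge0.
lra.
Qed.

Lemma shapes_off_ge (n u r : nat) (p de : R) : (r < n)%N -> 0 <= p -> p <= 2^-1 ->
  u%:R <= de * (n%:R - r%:R) -> 0 <= de -> de <= 2^-1 ->
  expR (- (2 * r.+1%:R * (de + n%:R * p))) * mu_stars n r p <=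
  ((n - u) * 'C((n - u).-1, r))%N%:R * p ^+ r * (1 - p) ^+ (n * r.+1).
Proof.
move=> rn p0 p1 ude d0 d1.
have rf : 0 < r`!%:R :> R by rewrite ltr0n fact_gt0.
have H := ffact_sub_ge rn (leqnn _) ude d0 (_ : de <= 1).
have {}H : (1 - de) ^+ r.+1 * (n * 'C(n.-1, r))%N%:R <=
    ((n - u) * 'C((n - u).-1, r))%N%:R :> R.
  rewrite -(ler_pM2r rf) -mulrA -!natrM !mul_bin_pred_fact; apply: H; lra.
have pr0 : 0 <= p ^+ r by rewrite exprn_ge0.
have q0 : 0 <= 1 - p by lra.
have e1 : expR (- (2 * de) * r.+1%:R) <= (1 - de) ^+ r.+1.
  by rewrite expRM_natr lerXn2r ?nnegrE ?expR_ge0 ?one_minus_ge_exp //; lra.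
have e2 : expR (- (2 * p) * (n * r.+1)%:R) <= (1 - p) ^+ (n * r.+1).
  by rewrite expRM_natr lerXn2r ?nnegrE ?expR_ge0 ?one_minus_ge_exp //; lra.
have -> : - (2 * r.+1%:R * (de + n%:R * p)) =
    - (2 * de) * r.+1%:R + - (2 * p) * (n * r.+1)%:R by rewrite natrM; ring.
rewrite expRD /mu_stars -natrM mulrAC mulrA; apply: ler_pM => //.
  by rewrite !mulr_ge0 ?expR_ge0.
rewrite ler_wpM2r //; apply: le_trans H.
by rewrite ler_wpM2r.
Qed.

Lemma ceil_nat (x : R) : 0 <= x -> exists m : nat, x <= m%:R /\ m%:R <= x + 1.
Proof.
move=> /truncn_itv/andP[x1 x2]; exists (Num.truncn x).+1; split; first exact: ltW.
by rewrite -natr1 lerD2r.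
Qed.

Lemma floor_nat (x : R) : 0 <= x -> exists m : nat, m%:R <= x /\ x <= m%:R + 1.
Proof.
move=> /truncn_itv/andP[x1 x2]; exists (Num.truncn x); split=> //.
by rewrite natr1 ltW.
Qed.

Lemma round_params (e1 h mu : R) : 0 < e1 -> 0 < h -> h <= 1 -> 4 <= h * mu ->
  exists m k b : nat, [/\ (k <= m)%N, (m <= b)%N,
    (e1 + h) * mu <= m%:R /\ m%:R <= (e1 + 2) * mu,
    k%:R <= h * mu / 2 /\ h * mu / 4 <= k%:R &
    (1 + h / 2) * mu <= b%:R - m%:R - k%:R /\ b%:R + 1 <= (1 + e1 + 3 * h) * mu].
Proof.
move=> e0 h0 h1 hmu.
have mu0 : 0 < mu by rewrite -(pmulr_rgt0 _ h0); lra.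
have hmu' : h * mu <= mu by rewrite ler_piMl // ltW.
have emu : 0 < e1 * mu by rewrite mulr_gt0.
have [m [m1 m2]] : exists m : nat, (e1 + h) * mu <= m%:R /\ m%:R <= (e1 + h) * mu + 1.
  by apply: ceil_nat; lra.
have [k [k1 k2]] : exists m : nat, m%:R <= h * mu / 2 /\ h * mu / 2 <= m%:R + 1.
  by apply: floor_nat; lra.
have [c [c1 c2]] : exists m : nat, (1 + h / 2) * mu <= m%:R /\ m%:R <= (1 + h / 2) * mu + 1.
  by apply: ceil_nat; lra.
exists m, k, (m + k + c)%N; split.
- by rewrite -(ler_nat R); lra.
- by rewrite -addnA leq_addr.
- by split=> //; lra.
- by split=> //; lra.
- by rewrite !natrD; split; lra.
Qed.

Lemma poisson_lower_aux (n r : nat) (p e1 h de : R) : (1 < r)%N -> (r < n)%N ->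
  0 <= p -> p <= 2^-1 -> 0 < e1 -> 0 < h -> h <= 1 -> 0 <= de -> de <= 2^-1 ->
  let mu := mu_stars n r p in let z := 2 * r.+1%:R * (de + n%:R * p) in
  4 <= h * mu -> (e1 + 2) * mu * r.+1%:R <= de * (n%:R - r%:R) ->
  ln 4 <= h / 8 * ln (1 + h / 2) * mu -> z * (e1 + 2) <= h / 8 * ln (1 + h / 2) ->
  expR (- (ln 2 + z * (e1 + 2) * mu + mu * phi (e1 + 3 * h))) <=
  gnp_prob p (fun G : {set {set 'I_n}} => (1 + e1) * mu <= (nb_stars r G)%:R).
Proof.
move=> r1 rn p0 p1 e0 h0 h1 de0 de1 mu z hmu ude l4 zh.
have hp : 0 <= p <= 1 by rewrite p0 /=; lra.
have [m [k [b [km mb [m1 m2] [k1 k2] [b1 b2]]]]] := round_params e0 h0 h1 hmu.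
have mu0 : 0 < mu by rewrite -(pmulr_rgt0 _ h0); lra.
have z0 : 0 <= z by rewrite /z !mulr_ge0 ?addr_ge0 ?mulr_ge0.
have lh0 : 0 < ln (1 + h / 2) by rewrite ln_gt0 //; lra.
have lo0 : 0 < (1 + h / 2) * mu by rewrite mulr_gt0 //; lra.
have up0 : 0 <= (1 - h / 2) * mu by rewrite mulr_ge0 ?(ltW mu0) //; lra.
have zm : z * m%:R <= z * (e1 + 2) * mu by rewrite -mulrA ler_wpM2l.
pose E j : R := gnp_expectation p (fun G : {set {set 'I_n}} => (nb_isolated r G ^_ j)%:R).
pose P := gnp_prob p (fun G : {set {set 'I_n}} => (1 + e1) * mu <= (nb_stars r G)%:R).
have P0 : 0 <= P by exact: gnp_prob_ge0.
apply: (@le_trans _ _ (expR (- (ln 2 + z * m%:R + mu * phi (e1 + 3 * h))))).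
  by rewrite ler_expR lerN2 lerD2r lerD2l.
apply: (@moments_lower R h (e1 + 3 * h) mu z P E m k b) => //.
- move=> j; apply/andP; split; last exact: isolated_moment_le.
  by apply: sumr_ge0 => G _; rewrite mulr_ge0 ?gnp_mass_ge0.
- apply: (le_trans _ (isolated_moment_ge n hp (leqnn (m * r.+1)%N))).
  rewrite lerXn2r ?nnegrE //.
  + by rewrite mulr_ge0 ?expR_ge0 // ltW.
  + by rewrite !mulr_ge0 ?exprn_ge0 // subr_ge0; case/andP: hp.
  apply: (@shapes_off_ge n (m * r.+1) r p de) => //.
  by rewrite natrM; apply: le_trans ude; rewrite ler_wpM2r.
- rewrite /E /P gnp_probE -gnp_expectationZ.
  have EZ (f : {set {set 'I_n}} -> R) x : gnp_expectation p f * x = gnp_expectation p (fun G => f G * x).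
    by rewrite mulrC -gnp_expectationZ; congr gnp_expectation; apply/funext => G; rewrite mulrC.
  rewrite !EZ -!gnp_expectationD; apply: gnp_expectation_le => // G _.
  apply: (le_trans (@ffact_split R ((1 + e1) * mu) ((1 - h / 2) * mu) ((1 + h / 2) * mu)
     b m k (nb_isolated r G) km _ _ _ _)) => //.
    clear -m1 k1; lra.
  rewrite !lerD2r ler_wpM2l // ler_nat; case: (boolP (_ <= (nb_isolated r G)%:R)) => // h5.
  by rewrite (le_trans h5) // ler_nat nb_isolated_le.
- apply: (@le_trans _ _ (h * mu / 4 * ln (1 + h / 2))); last by rewrite ler_wpM2r ?(ltW lh0).
  have := ler_wpM2r (ltW mu0) zh; clear -l4 zm; lra.
- have : 0 <= k%:R :> R by []; have : 0 <= h * mu by clear -hmu; lra.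
  clear -b1; lra.
- by rewrite addrA.
Qed.

(** The isolated stars alone have factorial moments close to the powers of the mean, up to
orders of the size of the mean, and these moments determine the tail. *)
Lemma poisson_lower (r : nat) (e1 eta : R) : (1 < r)%N -> 0 < e1 -> 0 < eta ->
  exists M th : R, 0 < th /\ forall (n : nat) (p : R), 0 <= p <= 1 ->
    M <= mu_stars n r p -> n%:R * p <= th -> mu_stars n r p <= th * n%:R ->
    expR (- ((phi e1 + eta) * mu_stars n r p)) <=
    gnp_prob p (fun G : {set {set 'I_n}} =>
      (1 + e1) * mu_stars n r p <= (nb_stars r G)%:R).
Proof.
move=> r1 e10 eta0.
have e3 : 0 < 12 * (e1 + 3) by lra.
pose h := Num.min 1 (eta / (12 * (e1 + 3))).
have h0 : 0 < h by rewrite lt_min ltr01 divr_gt0.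
have h1 : h <= 1 by rewrite ge_min lexx.
have h2 : h * (12 * (e1 + 3)) <= eta by rewrite -ler_pdivlMr // ge_min lexx orbT.
clearbody h.
have lh0 : 0 < ln (1 + h / 2) by rewrite ln_gt0 //; clear -h0; lra.
have c1 : 0 < h / 8 * ln (1 + h / 2) by rewrite mulr_gt0 //; clear -h0; lra.
have e2 : 0 < e1 + 2 by clear -e10; lra.
pose Z0 := Num.min (eta / 4) (h / 8 * ln (1 + h / 2)) / (e1 + 2).
have Z00 : 0 < Z0 by rewrite divr_gt0 // lt_min c1 andbT; clear -eta0; lra.
have Z0e : Z0 * (e1 + 2) = Num.min (eta / 4) (h / 8 * ln (1 + h / 2)).
  by rewrite /Z0 divfK // gt_eqF.
have Z01 : Z0 * (e1 + 2) <= eta / 4 by rewrite Z0e ge_min lexx.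
have Z02 : Z0 * (e1 + 2) <= h / 8 * ln (1 + h / 2) by rewrite Z0e ge_min lexx orbT.
clear Z0e; clearbody Z0.
have rr : 1 <= r.+1%:R :> R by rewrite ler1n.
pose D : R := 2 * r.+1%:R * (e1 + 2); have D0 : 0 < D by rewrite !mulr_gt0.
pose A : R := 2 * r.+1%:R * (D + 1).
have A1 : 1 <= A by rewrite /A mulr_ege1 //; [clear -rr|clear -D0]; lra.
have A0 : 0 < A by clear -A1; lra.
have AD : D + 1 <= A by rewrite /A ler_peMl //; [clear -D0|clear -rr]; lra.
pose th := Num.min 2^-1 Z0 / A.
have th0 : 0 < th by rewrite divr_gt0 // lt_min Z00 andbT invr_gt0.
have thA : th * A = Num.min 2^-1 Z0 by rewrite /th divfK // gt_eqF.
have thA1 : th * A <= 2^-1 by rewrite thA ge_min lexx.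
have thA2 : th * A <= Z0 by rewrite thA ge_min lexx orbT.
clear thA; clearbody th.
have thD : th * (D + 1) <= 2^-1 by apply: le_trans thA1; rewrite ler_wpM2l // ltW.
have thD0 := mulr_gt0 th0 D0.
rewrite mulrDr mulr1 in thD.
exists (2 + 2 * r%:R + 4 / h + ln 4 / (h / 8 * ln (1 + h / 2)) + 2 * ln 2 / eta), th; split=> //.
move=> n p hp Mmu npth muth; have /andP[p0 p1] := hp.
set mu := mu_stars n r p in Mmu npth muth *.
have l4 : 0 < ln 4 :> R by rewrite ln_gt0 // ltr1n.
have l2 : 0 < ln 2 :> R by rewrite ln_gt0 // ltr1n.
have q1 : 0 < 4 / h by rewrite divr_gt0.
have q2 : 0 < ln 4 / (h / 8 * ln (1 + h / 2)) by rewrite divr_gt0.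
have q3 : 0 < 2 * ln 2 / eta by rewrite divr_gt0 // mulr_gt0.
have r0 : 0 <= r%:R :> R by [].
have [M1 M2 M3 M4] : [/\ 2 + 2 * r%:R <= mu, 4 / h <= mu,
    ln 4 / (h / 8 * ln (1 + h / 2)) <= mu & 2 * ln 2 / eta <= mu].
  by move: q1 q2 q3 Mmu r0; clear; move: (4 / h) (ln 4 / _) (2 * ln 2 / eta); split; lra.
have mu0 : 0 < mu by clear -M1 r0; lra.
have th1 : th <= 2^-1 by clear -thD thD0; lra.
have nmu : mu <= 2^-1 * n%:R by apply: (le_trans muth); rewrite ler_wpM2r.
have n2r : 2 * r%:R <= n%:R :> R by clear -M1 nmu r0; lra.
have rn : (r < n)%N by rewrite -(ltr_nat R); clear -M1 nmu r0; lra.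
have n1 : 1 <= n%:R :> R by rewrite ler1n; exact: leq_ltn_trans rn.
have p2 : p <= 2^-1.
  by apply: le_trans th1; apply: le_trans npth; rewrite ler_peMl.
pose z := 2 * r.+1%:R * (D * th + n%:R * p).
have zZ : z <= Z0.
  apply: le_trans thA2; rewrite /z /A [leRHS]mulrC -[leRHS]mulrA ler_wpM2l //.
  by rewrite mulrDl mul1r lerD2l.
have zZ1 : z * (e1 + 2) <= Z0 * (e1 + 2) by rewrite ler_wpM2r // ltW.
apply: (@le_trans _ _ (expR (- (ln 2 + z * (e1 + 2) * mu + mu * phi (e1 + 3 * h))))).
  rewrite ler_expR lerN2.
  have ee : e1 <= e1 + 3 * h by clear -h0; lra.
  have [_ hb] := phi_incr (ltW e10) ee; move: hb.
  have lne : ln (1 + (e1 + 3 * h)) <= e1 + 3.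
    by apply: le_trans (le_ln1Dx _) _; clear -e10 h0 h1; lra.
  have : 3 * h * ln (1 + (e1 + 3 * h)) <= 3 * h * (e1 + 3).
    by rewrite ler_wpM2l //; clear -h0; lra.
  have -> : e1 + 3 * h - e1 = 3 * h by ring.
  move=> ha hb; have {ha}hb : phi (e1 + 3 * h) <= phi e1 + eta / 4.
    by move: hb ha h2; clear; move: (phi _) (phi _) (ln _) => *; lra.
  have := ler_wpM2l (ltW mu0) hb.
  have := ler_wpM2r (ltW mu0) (le_trans zZ1 Z01).
  have : 2 * ln 2 <= mu * eta by rewrite -ler_pdivrMr.
  clear; move: (phi (e1 + 3 * h)) (z * (e1 + 2)) => *; lra.
apply: poisson_lower_aux => //.
- by rewrite mulr_ge0 // ltW.
- by clear -thD th0; lra.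
- by rewrite mulrC -ler_pdivrMr.
- apply: (@le_trans _ _ ((e1 + 2) * (th * n%:R) * r.+1%:R)).
    by rewrite ler_wpM2r // ler_wpM2l // ltW.
  have -> : (e1 + 2) * (th * n%:R) * r.+1%:R = D * th * (n%:R / 2) by rewrite /D; field.
  have Dt : 0 <= D * th by rewrite mulr_ge0 // ltW.
  by rewrite ler_wpM2l //; clear -n2r; lra.
- by rewrite mulrC -ler_pdivrMr.
- exact: le_trans zZ1 Z02.
Qed.

End PoissonStars.

(** * Asymptotics *)

Section Growth.
Context {R : realType}.

Lemma near_natr (C : R) : \forall n \near \oo, C <= n%:R.
Proof. exact: nbhs_infty_ger. Qed.

Lemma near_ln (C : R) : \forall n \near \oo, C <= ln n%:R.
Proof.
apply: filterS (near_natr (expR C)) => n nC.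
have n0 : 0 < n%:R :> R by apply: lt_le_trans nC; exact: expR_gt0.
by rewrite -[C]expRK ler_ln ?posrE ?expR_gt0.
Qed.

Lemma near_much_less (a b : nat -> R) (C : R) : much_less a b -> (forall n, 0 <= b n) ->
  \forall n \near \oo, C * a n <= b n.
Proof.
move=> [b0 ab] bge; have C0 : 0 < `|C| + 1 by rewrite ltr_wpDl.
have e0 : 0 < (`|C| + 1)^-1 by rewrite invr_gt0.
near=> n.
have bn : 0 < b n by rewrite lt_neqAle bge andbT eq_sym; near: n.
have : `|0 - a n / b n| <= (`|C| + 1)^-1.
  by near: n; move/cvgrPdist_le : ab; apply.
rewrite sub0r normrN normrM normfV (gtr0_norm bn) ler_pdivrMr // mulrC ler_pdivlMr //.
move=> abn; apply: le_trans abn; apply: (@le_trans _ _ (`|a n| * `|C|)).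
  by rewrite mulrC -normrM ler_norm.
by rewrite ler_wpM2l // lerDl.
Unshelve. all: by end_near. Qed.

Lemma bernoulli (x : R) (k : nat) : 0 <= x -> x <= 1 -> 1 - k%:R * x <= (1 - x) ^+ k.
Proof.
move=> x0 x1; elim: k => [|k IH]; first by rewrite mul0r subr0.
rewrite exprSr; apply: (@le_trans _ _ ((1 - k%:R * x) * (1 - x))).
  have : 0 <= k%:R * x * x by rewrite !mulr_ge0.
  by rewrite -natr1; lra.
by rewrite ler_wpM2r // subr_ge0.
Qed.

Definition nroot (r : nat) (x : R) : R := x `^ r%:R^-1.

Section Root.
Variable r : nat.
Hypothesis r1 : (1 < r)%N.
Let r0 : r%:R != 0 :> R. Proof. by rewrite pnatr_eq0 -lt0n ltnW. Qed.
Let rp : 0 < r%:R :> R. Proof. by rewrite ltr0n ltnW. Qed.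

Lemma nroot_ge0 x : 0 <= nroot r x. Proof. exact: powR_ge0. Qed.

Lemma nrootK x : 0 <= x -> nroot r x ^+ r = x.
Proof.
by move=> x0; rewrite -powR_mulrn ?nroot_ge0 // /nroot -powRrM mulVf // powRr1.
Qed.

Lemma nroot_Xn x : 0 <= x -> nroot r (x ^+ r) = x.
Proof.
by move=> x0; rewrite /nroot -powR_mulrn // -powRrM divff // powRr1.
Qed.

Lemma nroot_le x y : 0 <= x -> x <= y -> nroot r x <= nroot r y.
Proof.
move=> x0 xy; apply: ge0_ler_powR; rewrite ?nnegrE ?invr_ge0 //.
exact: le_trans xy.
Qed.

Lemma le_root x y : 0 <= x -> x ^+ r <= y -> x <= nroot r y.
Proof.
by move=> x0 xy; rewrite -(nroot_Xn x0) nroot_le // exprn_ge0.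
Qed.

Lemma nroot_leX x y : 0 <= x -> 0 <= y -> x <= y ^+ r -> nroot r x <= y.
Proof. by move=> x0 y0 xy; rewrite -[leRHS]nroot_Xn // nroot_le. Qed.

Lemma nrootM x y : 0 <= x -> 0 <= y -> nroot r (x * y) = nroot r x * nroot r y.
Proof. by move=> x0 y0; rewrite /nroot powRM. Qed.

Lemma nroot_gt0 x : 0 < x -> 0 < nroot r x. Proof. exact: powR_gt0. Qed.

Lemma ln_root x : ln (nroot r x) = ln x / r%:R.
Proof. by rewrite /nroot ln_powR mulrC. Qed.

Lemma nroot_nat (n : nat) : (0 < n)%N ->
  1 <= nroot r n%:R /\ nroot r n%:R ^+ 2 <= n%:R.
Proof.
move=> n0; have n1 : 1 <= n%:R :> R by rewrite ler1n.
have w1 : 1 <= nroot r n%:R by apply: le_root => //; rewrite expr1n.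
split=> //; rewrite -[leRHS]nrootK //; exact: ler_weXn2l.
Qed.

Lemma nroot0 : nroot r 0 = 0. Proof. by rewrite /nroot powR0 // invr_neq0. Qed.

Lemma nroot1B x : 0 <= x -> x <= 1 -> 1 - x <= nroot r (1 - x).
Proof.
move=> x0 x1; apply: le_root; rewrite ?subr_ge0 //.
case: r r1 => // k _; rewrite exprS ler_piMr ?subr_ge0 //.
by rewrite exprn_ile1 ?subr_ge0 // gerBl.
Qed.

Lemma near_root (C : R) (k : nat) :
  \forall n \near \oo, C * ln n%:R ^+ k <= nroot r n%:R.
Proof.
near=> n.
have n0 : (0 < n)%N by near: n; exact: nbhs_infty_gt.
have L0 : 0 <= ln n%:R :> R by rewrite ln_ge0 // ler1n.
have nR : 0 < n%:R :> R by rewrite ltr0n.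
rewrite -[nroot r n%:R]lnK ?posrE ?nroot_gt0 // ln_root.
have x0 : 0 <= ln n%:R / r%:R :> R by rewrite divr_ge0.
apply: le_trans (expR_ge1Dxn k x0); rewrite -[leLHS]add0r lerD //.
rewrite ler_pdivlMr ?ltr0n ?fact_gt0 // expr_div_n ler_pdivlMr ?exprn_gt0 //.
have perm (x1 x2 x3 x4 : R) : x1 * x2 * x3 * x4 = x1 * x3 * x4 * x2 by ring.
rewrite perm [ln _ ^+ k.+1]exprS ler_wpM2r ?exprn_ge0 //.
by near: n; exact: near_ln.
Unshelve. all: by end_near. Qed.

End Root.

Lemma asymp_tail (P B : nat -> R) :
  (\forall n \near \oo, 0 < B n) ->
  (forall h, 0 < h -> h < 1 -> \forall n \near \oo, P n <= expR (- ((1 - h) * B n))) ->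
  (forall h, 0 < h -> h < 1 -> \forall n \near \oo, expR (- ((1 + h) * B n)) <= P n) ->
  asymp_eq (fun n => - ln (P n)) B.
Proof.
move=> B0 PU PL; apply/cvgrPdist_le => e e0.
pose h := Num.min e 2^-1.
have h0 : 0 < h by rewrite lt_min e0 invr_gt0 /=.
have h1 : h < 1 by rewrite gt_min; apply/orP; right; lra.
have he : h <= e by rewrite ge_min lexx.
near=> n.
have Bn : 0 < B n by near: n.
have U : P n <= expR (- ((1 - h) * B n)) by near: n; exact: PU.
have Lo : expR (- ((1 + h) * B n)) <= P n by near: n; exact: PL.
have Pn : 0 < P n by apply: lt_le_trans Lo; exact: expR_gt0.
move: U Lo; rewrite -[P n in X in X -> _](lnK (x := P n)) ?posrE // ler_expR => U.
rewrite -[P n in X in X -> _](lnK (x := P n)) ?posrE // ler_expR => Lo.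
apply: le_trans he; rewrite ler_distlC; apply/andP; split.
  by rewrite ler_pdivlMr //; lra.
by rewrite ler_pdivrMr //; lra.
Unshelve. all: by end_near. Qed.

End Growth.

Lemma mean_starsE' {R : realType} (r : nat) (p : nat -> R) (n : nat) : (1 < r)%N ->
  mean_stars r p n = mu_stars n r (p n).
Proof. by move=> r1; rewrite mean_starsE. Qed.

Lemma mu_stars_fact_le {R : realType} (n r : nat) (p : R) : 0 <= p ->
  r`!%:R * mu_stars n r p <= n%:R * (n%:R * p) ^+ r.
Proof.
move=> p0; rewrite /mu_stars exprMn mulrC -!mulrA ler_wpM2l // mulrC -mulrA.
rewrite [leRHS]mulrC ler_wpM2l ?exprn_ge0 // -natrM mulnC bin_ffact -natrX ler_nat.
by apply: (leq_trans (ffact_le_expn _ _)); case: r => // k; rewrite leq_exp2r // leq_pred.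
Qed.

Section Facts.
Context {R : realType}.
Variables (r : nat) (p : nat -> R).
Hypothesis r1 : (1 < r)%N.
Hypothesis hp : forall n : nat, 0 <= p n <= 1.
Hypothesis hp0 : p n @[n --> \oo] --> (0 : R).
Hypothesis hmu : much_less (fun n : nat => ln n%:R) (mean_stars r p).

Lemma near_mu (C : R) : \forall n \near \oo, C * ln n%:R <= mu_stars n r (p n).
Proof.
have h n : 0 <= mean_stars r p n by rewrite mean_starsE' // mu_stars_ge0.
by apply: filterS (near_much_less C hmu h) => n; rewrite mean_starsE'.
Qed.

Lemma near_mu_ge (C : R) : \forall n \near \oo, C <= mu_stars n r (p n).
Proof.
near=> n; have : C <= ln n%:R by near: n; exact: near_ln.
move=> /le_trans; apply; rewrite -[leLHS]mul1r.
by near: n; exact: near_mu.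
Unshelve. all: by end_near. Qed.

Lemma near_p_le (e : R) : 0 < e -> \forall n \near \oo, p n <= e.
Proof.
move=> e0; have := hp0; move/cvgrPdist_le => /(_ _ e0); apply: filterS => n.
rewrite sub0r normrN => h; apply: le_trans h; exact: ler_norm.
Qed.

Lemma near_p_gt0 : \forall n \near \oo, 0 < p n.
Proof.
apply: filterS (near_mu_ge 1) => n h; have /andP[p0 _] := hp n.
rewrite lt_neqAle p0 andbT; apply/eqP => p00; move: h.
by rewrite /mu_stars -p00 expr0n gtn_eqF ?mulr0 ?(ltnW r1) // ler10.
Qed.

Lemma near_mu_lo (h : R) : 0 < h ->
  \forall n \near \oo, (1 - h) * (n%:R * (n%:R * p n) ^+ r) <= r`!%:R * mu_stars n r (p n).
Proof.
move=> h0; near=> n; have /andP[p0 _] := hp n.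
have n0 : (r.+1 < n)%N by near: n; exact: nbhs_infty_gt.
have nR : 0 < n%:R :> R by rewrite ltr0n; exact: leq_ltn_trans n0.
have hn : r%:R * r.+1%:R / h <= n%:R by near: n; exact: near_natr.
have E : (1 - h) * n%:R ^+ r <= ('C(n.-1, r) * r`!)%N%:R.
  rewrite bin_ffact; apply: (@le_trans _ _ ((n.-1 - r) ^ r)%:R); last by rewrite ler_nat ffact_ge_expn.
  have -> : (n.-1 - r = n - r.+1)%N by rewrite -subn1 -subnDA add1n.
  rewrite natrX natrB 1?ltnW //.
  have -> : n%:R - r.+1%:R = (1 - r.+1%:R / n%:R) * n%:R :> R by field; lra.
  rewrite exprMn ler_wpM2r ?exprn_ge0 //.
  apply: le_trans (bernoulli _ _ _); last 2 first.
  - by rewrite divr_ge0.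
  - by rewrite ler_pdivrMr // mul1r ler_nat ltnW.
  rewrite lerD2l lerN2 mulrA ler_pdivrMr //.
  by rewrite -ler_pdivrMl // mulrC.
have pr : 0 <= n%:R * p n ^+ r by rewrite mulr_ge0 // exprn_ge0.
have := ler_wpM2r pr E; rewrite natrM /mu_stars exprMn.
move=> /le_trans h1; apply: le_trans (h1 _ _); last by rewrite le_eqVlt; apply/orP; left; apply/eqP; ring.
by rewrite le_eqVlt; apply/orP; left; apply/eqP; ring.
Unshelve. all: by end_near. Qed.

(** A vertex of degree nroot r a * rt n carries about the share a of the mean number of
stars. *)
Definition rt n : R := nroot r (r`!%:R * mu_stars n r (p n)).

Lemma rt_le n : rt n <= nroot r n%:R * (n%:R * p n).
Proof.
have /andP[p0 _] := hp n; rewrite /rt.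
apply: nroot_leX => //.
- by rewrite mulr_ge0 // mu_stars_ge0.
- by rewrite mulr_ge0 ?nroot_ge0 // mulr_ge0.
by rewrite exprMn nrootK // mu_stars_fact_le.
Qed.

Lemma near_rt_ge (h : R) : 0 < h -> h <= 1 ->
  \forall n \near \oo, (1 - h) * (nroot r n%:R * (n%:R * p n)) <= rt n.
Proof.
move=> h0 h1; apply: filterS (near_mu_lo h0) => n hn; have /andP[p0 _] := hp n.
apply: le_root => //.
  by rewrite !mulr_ge0 ?subr_ge0 ?nroot_ge0.
apply: le_trans hn; rewrite !exprMn nrootK // ler_wpM2r ?mulr_ge0 ?exprn_ge0 //.
have h2 : 0 <= 1 - h by rewrite subr_ge0.
by rewrite -[leRHS](nrootK r1 h2) lerXn2r ?nnegrE ?nroot_ge0 // nroot1B ?(ltW h0).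
Qed.

Lemma rtK n : rt n ^+ r = r`!%:R * mu_stars n r (p n).
Proof. by rewrite nrootK // mulr_ge0 // mu_stars_ge0. Qed.

Lemma near_rt (C : R) : \forall n \near \oo, C <= rt n.
Proof.
have C0 : 0 <= Num.max C 0 by rewrite le_max lexx orbT.
apply: filterS (near_mu_ge (Num.max C 0 ^+ r)) => n h.
apply: (@le_trans _ _ (Num.max C 0)); first by rewrite le_max lexx.
apply: le_root => //; apply: (le_trans h); rewrite ler_peMl ?mu_stars_ge0 //.
by rewrite ler1n fact_gt0.
Qed.

Lemma psi_rt (eps : R) n : 0 <= eps ->
  psi r eps * mu_stars n r (p n) `^ r%:R^-1 = r%:R^-1 * (nroot r eps * rt n).
Proof.
move=> e0; rewrite /psi -mulrA; congr (_ * _); rewrite -/(nroot r _) -/(nroot r _) /rt.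
have perm (a b c : R) : a * b * c = b * (a * c) by ring.
have m0 := mu_stars_ge0 n r (hp n).
by rewrite (nrootM r (ler0n _ _) e0) (nrootM r (ler0n _ _) m0); exact: perm.
Qed.

End Facts.

(** * The cost of a given number of stars *)

Section CostLinear.
Context {R : realType}.
Variable r : nat.
Hypothesis r1 : (1 < r)%N.

Lemma ln_le_small (de : R) : 0 < de ->
  exists Y0 : R, 0 < Y0 /\ forall Y, Y0 <= Y -> ln Y <= de * Y.
Proof.
move=> de0; have c0 : 0 < 2 / de by rewrite divr_gt0.
exists (2 * (2 / de) / de); split; first by rewrite divr_gt0 // mulr_gt0.
move=> Y Y0; have Yp : 0 < Y by apply: lt_le_trans Y0; rewrite divr_gt0 // mulr_gt0.
have E : Y / (2 / de) = de * Y / 2 by field; rewrite gt_eqF.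
have := @ln_sublinear R (Y / (2 / de)) (divr_gt0 Yp c0).
rewrite ln_div ?posrE // E => h1; have := ln_sublinear c0 => h2.
have : 2 * (2 / de) <= de * Y by rewrite [de * Y]mulrC -ler_pdivrMr.
lra.
Qed.

(** A vertex of degree x is at least as expensive as the proportion
(x / X) ^ r of a vertex of degree X: cost grows more slowly than x ^ r. *)
Lemma cost_linear (h : R) : 0 < h ->
  exists Y0 : R, 0 < Y0 /\ forall d x X : R, 0 < d -> (1 + h) * d <= x -> x <= X ->
    Y0 * d <= X -> (x / X) ^+ r * (X * (ln (X / d) - 1)) <= cost d x.
Proof.
move=> h0; pose e2 : R := expR 2.
have e20 : 0 < e2 := expR_gt0 _.
pose de := phi h / e2 ^+ r.
have ph0 : 0 < phi h := phi_gt0 h0.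
have de0 : 0 < de by rewrite divr_gt0 // exprn_gt0.
have de2 : 0 < de / 2 by rewrite divr_gt0.
have [Y0 [Y00 HY]] := ln_le_small de2.
pose Y1 := Num.max 1 Y0.
exists Y1; split; first by rewrite lt_max ltr01.
move=> d x X d0 hx xX YX.
have Y1X : Y1 <= X / d by rewrite ler_pdivlMr.
have X1 : 1 <= X / d by apply: le_trans Y1X; rewrite le_max lexx.
have X2 : ln (X / d) <= de / 2 * (X / d).
  by apply: HY; apply: le_trans Y1X; rewrite le_max lexx orbT.
have hd : 0 < (1 + h) * d by rewrite mulr_gt0 // ltr_pwDl // ltW.
have x0 : 0 < x by apply: lt_le_trans hx.
have X0 : 0 < X by apply: lt_le_trans xX.
have xX1 : 0 < x / X by rewrite divr_gt0.
have xXle : x / X <= 1 by rewrite ler_pdivrMr // mul1r.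
have [k rE] : exists k, r = k.+2 by case: (r) r1 => [//|[//|k]]; exists k.
rewrite rE.
have [x2|x2] := leP (e2 * d) x.
  have lx : 2 <= ln (x / d).
    by rewrite -[leLHS]expRK ler_ln ?posrE ?expR_gt0 ?divr_gt0 // ler_pdivlMr.
  have lXx : ln (X / d) - 1 <= (ln (x / d) - 1) * (X / x).
    have t1 : 1 <= X / x by rewrite ler_pdivlMr // mul1r.
    have := @ln_sublinear R (X / x) (lt_le_trans ltr01 t1).
    have := le_ln1Dx (_ : -1 < X / x - 1).
    have -> : -1 < X / x - 1 by lra.
    have -> : 1 + (X / x - 1) = X / x by ring.
    move=> /(_ isT) h1 _; rewrite (ln_divD d0 x0 X0).
    have : 0 <= (ln (x / d) - 2) * (X / x - 1) by rewrite mulr_ge0 //; lra.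
    by lra.
  apply: (@le_trans _ _ ((x / X) ^+ k.+2 * (X * ((ln (x / d) - 1) * (X / x))))).
    rewrite ler_wpM2l ?exprn_ge0 ?(ltW xX1) // ler_wpM2l //; exact: ltW.
  have -> : (x / X) ^+ k.+2 * (X * ((ln (x / d) - 1) * (X / x))) =
      (x / X) ^+ k * (x * (ln (x / d) - 1)).
    by rewrite !exprS; field; rewrite !gt_eqF.
  apply: (@le_trans _ _ (1 * (x * (ln (x / d) - 1)))).
    rewrite ler_wpM2r ?exprn_ile1 ?(ltW xX1) //.
    by rewrite mulr_ge0 ?(ltW x0) //; lra.
  rewrite /cost; lra.
have hdx : d <= (1 + h) * d by rewrite ler_peMl ?(ltW d0) // lerDl ltW.
apply: le_trans (cost_le d0 hdx hx).
have -> : cost d ((1 + h) * d) = d * phi h.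
  by rewrite /cost /phi mulfK ?gt_eqF //; ring.
apply: (@le_trans _ _ ((x / X) ^+ k.+2 * (X * (de * (X / d))))).
  rewrite ler_wpM2l ?exprn_ge0 ?(ltW xX1) // ler_wpM2l ?(ltW X0) //.
  have : 0 <= de / 2 * (X / d) by rewrite mulr_ge0 ?(ltW de2) //; lra.
  lra.
have -> : (x / X) ^+ k.+2 * (X * (de * (X / d))) = (x / X) ^+ k * ((x / d) ^+ 2 * (d * de)).
  by rewrite !exprS; field; rewrite !gt_eqF.
have xd2 : x / d <= e2 by rewrite ler_pdivrMr // ltW.
have xd0 : 0 < x / d by rewrite divr_gt0.
have dde : 0 <= d * de by rewrite mulr_ge0 // ltW.
have e21 : 1 <= e2 by rewrite -expR0 ler_expR.
apply: (@le_trans _ _ (1 * (e2 ^+ k.+2 * (d * de)))).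
  have A1 : (x / X) ^+ k <= 1 by rewrite exprn_ile1 // ltW.
  have A2 : (x / d) ^+ 2 <= e2 ^+ k.+2.
    apply: (@le_trans _ _ (e2 ^+ 2)); last by rewrite ler_weXn2l.
    by rewrite lerXn2r ?nnegrE ?(ltW xd0) ?(ltW e20).
  apply: ler_pM => //; first by rewrite exprn_ge0 // ltW.
    by rewrite mulr_ge0 // exprn_ge0 // ltW.
  by rewrite ler_wpM2r.
rewrite mul1r le_eqVlt; apply/orP; left; apply/eqP.
have E : e2 ^+ k.+2 != 0 by rewrite gt_eqF // exprn_gt0.
by rewrite /de rE; move: (e2 ^+ k.+2) E => z E; field.
Qed.

(** By [cost_linear] stars are cheapest at the largest degree that is allowed. A degree
beyond x1 is truncated to x1, which is harmless if one vertex of degree x1 suffices. *)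
Lemma sum_cost_ge (n x1 : nat) (h d K ta M Y0 : R) (x : 'I_n -> nat) :
  0 < d -> 0 < h -> (1 + h) * d <= K -> K <= x1%:R -> Y0 * d <= x1%:R ->
  (forall d x X : R, 0 < d -> (1 + h) * d <= x -> x <= X ->
    Y0 * d <= X -> (x / X) ^+ r * (X * (ln (X / d) - 1)) <= cost d x) ->
  0 <= x1%:R * (ln (x1%:R / d) - 1) -> (forall i, x i < n)%N ->
  (ta <= 1) || (n <= x1)%N -> ta * x1%:R ^+ r <= r`!%:R * M ->
  M <= \sum_(i | K <= (x i)%:R) ('C(x i, r))%:R ->
  ta * (x1%:R * (ln (x1%:R / d) - 1)) <=
    \sum_(i | K <= (x i)%:R) cost d (minn (x i) x1)%:R.
Proof.
move=> d0 h0 hK Kx1 Yx1 HY c0 xn ta1 taM MC.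
have x10 : 0 < x1%:R :> R.
  by apply: lt_le_trans Kx1; apply: lt_le_trans hK; rewrite mulr_gt0 // ltr_pwDl // ltW.
have x1r : 0 < x1%:R ^+ r :> R by rewrite exprn_gt0.
set c := x1%:R * _ in c0 *.
have main : ta * x1%:R ^+ r <= \sum_(i | K <= (x i)%:R) (minn (x i) x1)%:R ^+ r.
  have [/existsP[i /andP[Ki xi]]|H] :=
      boolP [exists i, (K <= (x i)%:R) && (x1 <= x i)%N].
    rewrite (bigD1 i) //= (minn_idPr xi) ler_wpDr //; first by apply: sumr_ge0 => j _; exact: exprn_ge0.
    case/orP: ta1 => ta1; first by rewrite ler_piMl // ltW.
    by have := leq_trans ta1 xi; rewrite leqNgt xn.
  apply: (le_trans taM); apply: (@le_trans _ _ (r`!%:R * \sum_(i | K <= (x i)%:R) ('C(x i, r))%:R)).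
    by rewrite ler_wpM2l.
  rewrite mulr_sumr; apply: ler_sum => i Ki.
  have xi : (x i <= x1)%N.
    by rewrite leqNgt; apply: contra H => xi; apply/existsP; exists i; rewrite Ki ltnW.
  by rewrite (minn_idPl xi) -natrM mulnC bin_ffact -natrX ler_nat ffact_le_expn.
apply: (@le_trans _ _ (\sum_(i | K <= (x i)%:R) ((minn (x i) x1)%:R / x1%:R) ^+ r * c)).
  rewrite -mulr_suml ler_wpM2r //.
  under eq_bigr do rewrite expr_div_n.
  by rewrite -mulr_suml ler_pdivlMr.
apply: ler_sum => i Ki; apply: HY => //.
  by apply: (le_trans hK); rewrite natr_min le_min Ki.
by rewrite ler_nat geq_minr.
Qed.

End CostLinear.

(** The stars that are not centred at degrees below K have to be paid for by degrees at
least K. *)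
Lemma upper_by_cost {R : realType} (n r x1 : nat) (p eps h c0 K t : R) :
  (1 < r)%N -> (0 < n)%N -> 0 < p <= 1 -> 0 <= h -> 2 * h <= 1 -> 0 < c0 ->
  n%:R * p <= K -> K <= x1%:R -> (x1 <= n)%N -> 0 <= t ->
  c0 * K <= cost (n%:R * p) K -> 2 * ln n%:R <= h * cost (n%:R * p) K ->
  t + cost (n%:R * p) x1%:R <= 2 * h * c0 ^+ 2 * (n%:R * (n%:R * p)) ->
  (forall x : 'I_n -> nat, (forall i, x i < n)%N ->
     (eps - h) * mu_stars n r p <= \sum_(i | K <= (x i)%:R) ('C(x i, r))%:R ->
     t <= \sum_(i | K <= (x i)%:R) cost (n%:R * p) (minn (x i) x1)%:R) ->
  gnp_prob p (fun G : {set {set 'I_n}} => (1 + eps) * mu_stars n r p <= (nb_stars r G)%:R)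
  <= gnp_prob p (fun G : {set {set 'I_n}} => (1 + h) * mu_stars n r p <=
     (\sum_(v | ((degree G v)%:R < K)%R) 'C(degree G v, r))%N%:R) +
  expR (1 - (1 - 2 * h) * t).
Proof.
move=> r1 n0 hp h0 h1 c00 dK Kx1 x1n t0 cK nK tx det.
have hp' : 0 <= p <= 1 by case/andP: hp => /ltW-> ->.
have d0 : 0 < n%:R * p by rewrite mulr_gt0 ?ltr0n //; case/andP: hp.
have K0 : 0 < K by apply: lt_le_trans dK.
apply: (@le_trans _ _ (gnp_prob p (fun G : {set {set 'I_n}} => (1 + h) * mu_stars n r p <=
     (\sum_(v | ((degree G v)%:R < K)%R) 'C(degree G v, r))%N%:R) +
   gnp_prob p (fun G : {set {set 'I_n}} => t <= \sum_(i | K <= (degree G i)%:R)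
     cost (n%:R * p) (minn (degree G i) x1)%:R))); last first.
  rewrite lerD2l; apply: big_tail => //.
    by apply: lt_le_trans cK; rewrite mulr_gt0.
  have -> : 2 * h * cost (n%:R * p) K ^+ 2 * (n%:R * (n%:R * p)) =
    cost (n%:R * p) K ^+ 2 * (2 * h * (n%:R * (n%:R * p))) by ring.
  apply: (@le_trans _ _ (K ^+ 2 * (2 * h * c0 ^+ 2 * (n%:R * (n%:R * p))))).
    by rewrite ler_wpM2l // exprn_ge0 // ltW.
  have -> : K ^+ 2 * (2 * h * c0 ^+ 2 * (n%:R * (n%:R * p))) =
    (c0 * K) ^+ 2 * (2 * h * (n%:R * (n%:R * p))) by ring.
  rewrite ler_wpM2r //; first by apply: mulr_ge0; [rewrite mulr_ge0|rewrite mulr_ge0 // ltW].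
  have cK0 : 0 <= c0 * K by rewrite mulr_ge0 // ltW.
  by rewrite lerXn2r ?nnegrE //; exact: le_trans cK.
apply: gnp_probU => // G GE.
rewrite nb_starsE // (bigID (fun v => (degree G v)%:R < K)) /= natrD => XG.
have [//|bulk] := leP ((1 + h) * mu_stars n r p) _.
apply: (det (fun i => degree G i)); first exact: degree_lt.
rewrite natr_sum in bulk; rewrite !natr_sum in XG.
under [leRHS]eq_bigl do rewrite leNgt.
lra.
Qed.

(** * Stars at vertices of moderate degree *)

Section Bulk.
Context {R : realType}.
Variables (r : nat) (p : nat -> R).
Hypothesis r1 : (1 < r)%N.
Hypothesis hp : forall n : nat, 0 <= p n <= 1.
Hypothesis hp0 : p n @[n --> \oo] --> (0 : R).
Hypothesis hmu : much_less (fun n : nat => ln n%:R) (mean_stars r p).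

Definition bulk_prob (h K : R) n := gnp_prob (p n) (fun G : {set {set 'I_n}} =>
  (1 + h) * mu_stars n r (p n) <=
     (\sum_(v | ((degree G v)%:R < K)%R) 'C(degree G v, r))%N%:R).

(** If every degree exceeds its mean by at most this proportion, then the number of stars
exceeds its mean by little more than the proportion h / 2. *)
Definition dense_gap (h : R) := nroot r (1 + h / 2) - 1.

Lemma dense_gap_gt0 h : 0 < h -> 0 < dense_gap h.
Proof.
move=> h0; rewrite subr_gt0 ltNge; apply/negP => le1.
have h2 : 0 <= 1 + h / 2 by lra.
have := exprn_ile1 r (nroot_ge0 r (1 + h / 2)) le1.
by rewrite (nrootK r1 h2); lra.
Qed.

Lemma near_bulk_dense h : 0 < h ->
  \forall n \near \oo, bulk_prob h ((1 + dense_gap h) * (n%:R * p n)) n <= 0.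
Proof.
move=> h0; have q0 : 0 < h / (4 * (1 + h)) by rewrite divr_gt0 //; lra.
near=> n; have /andP[p0 _] := hp n.
have mun : 1 <= mu_stars n r (p n) by near: n; exact: near_mu_ge.
have rf : 1 <= r`!%:R :> R by rewrite ler1n fact_gt0.
have lo : (1 - h / (4 * (1 + h))) * (n%:R * (n%:R * p n) ^+ r) <=
    r`!%:R * mu_stars n r (p n) by near: n; exact: near_mu_lo.
set K := (1 + dense_gap h) * _.
have K0 : 0 <= K.
  by rewrite mulr_ge0 // ?mulr_ge0 //; have := dense_gap_gt0 h0; lra.
have KE : n%:R * K ^+ r = (1 + h / 2) * (n%:R * (n%:R * p n) ^+ r).
  rewrite /K exprMn /dense_gap [1 + _]addrC subrK nrootK //; first by ring.
  lra.
rewrite /bulk_prob /gnp_prob big1 // => G /andP[_]; apply: contraTeq => _.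
rewrite -ltNge -(ltr_pM2l (lt_le_trans ltr01 rf)).
apply: (@le_lt_trans _ _ (n%:R * K ^+ r)).
  rewrite natr_sum mulr_sumr.
  apply: (@le_trans _ _ (\sum_(v : 'I_n) K ^+ r)); last by rewrite sumr_const card_ord mulr_natl.
  rewrite big_mkcond; apply: ler_sum => v _; case: ifP => [vK|_]; last exact: exprn_ge0.
  rewrite -natrM mulnC bin_ffact; apply: (@le_trans _ _ ((degree G v) ^ r)%:R).
    by rewrite ler_nat ffact_le_expn.
  by rewrite natrX lerXn2r ?nnegrE // ltW.
rewrite KE [r`!%:R * _]mulrCA; set x := n%:R * _ ^+ r in lo *.
set y := r`!%:R * _ in lo *.
have y0 : 0 < y by rewrite /y mulr_gt0 // (lt_le_trans ltr01).
have h4 : 0 < 4 * (1 + h) by lra.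
have lo' : (4 + 3 * h) * x <= 4 * (1 + h) * y.
  have -> : (4 + 3 * h) * x = 4 * (1 + h) * ((1 - h / (4 * (1 + h))) * x).
    by field; lra.
  by rewrite ler_pM2l.
have [x0|x0] := leP x 0.
  apply: (@le_lt_trans _ _ 0); last by rewrite mulr_gt0 //; lra.
  have h2 : 0 <= 1 + h / 2 by lra.
  exact: mulr_ge0_le0.
have : 0 < h * x by rewrite mulr_gt0.
have : 4 * ((1 + h / 2) * x) = 4 * x + 2 * (h * x) by field.
have : (4 + 3 * h) * x = 4 * x + 3 * (h * x) by ring.
have : 4 * (1 + h) * y = 4 * ((1 + h) * y) by ring.
move: lo'; clear; move: (_ * x) => ?; lra.
Unshelve. all: by end_near. Qed.

Hypothesis HQ : forall A : R,
  \forall n \near \oo, A * (rt r p n * ln n%:R) <= mu_stars n r (p n).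

(** For a small mean degree the threshold K is taken as large as possible with
the bulk still concentrated at the required speed. *)
Lemma near_bulk_sparse (h A C de : R) : 0 < h -> 0 <= A -> 0 < C -> 0 < de ->
  \forall n \near \oo, n%:R * p n <= C * ln n%:R ->
    exists K, [/\ 2 * (n%:R * p n) <= K, K <= cost (n%:R * p n) K,
      2 * ln n%:R <= h * cost (n%:R * p n) K, K <= de * rt r p n &
      bulk_prob h K n <= expR (- (A * (rt r p n * ln n%:R)))].
Proof.
move=> h0 A0 C0 de0.
have ph0 : 0 < phi h := phi_gt0 h0.
have rr0 : 0 < r%:R :> R by rewrite ltr0n ltnW.
have r2 : 0 < r.+1%:R :> R by [].
pose c := phi h / (2 * r.+1%:R * (A + 1)).
have A1 : 0 < A + 1 by lra.
have c0 : 0 < c by rewrite divr_gt0 // !mulr_gt0.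
pose B1 : R := 2 + 8 * r%:R / h.
have B10 : 2 <= B1 by rewrite lerDl divr_ge0 ?mulr_ge0 ?(ltW h0) ?(ltW rr0).
pose B2 : R := expR 2 * C + 2 / h + 2.
have e20 : 0 < expR 2 :> R := expR_gt0 _.
have B20 : 0 < B2 by rewrite /B2; have := mulr_gt0 e20 C0; have := divr_gt0 (ltr0n R 2) h0; lra.
have rf : 0 < r`!%:R :> R by rewrite ltr0n fact_gt0.
pose D := 2 * r`!%:R * B2 ^+ r / c.
have D0 : 0 < D by rewrite divr_gt0 // !mulr_gt0 // exprn_gt0.
near=> n => dC.
have n0 : (0 < n)%N by near: n; exact: nbhs_infty_gt.
have pn : 0 < p n by near: n; exact: (near_p_gt0 r1 hp hmu).
have L1 : 1 + 4 * r%:R <= ln n%:R :> R by near: n; exact: near_ln.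
have L2 : c / (de ^+ r * r`!%:R) + h <= ln n%:R by near: n; exact: near_ln.
have ro1 : 1 <= rt r p n by near: n; exact: (near_rt r1 hp hmu).
have w2 : D ^+ 2 * ln n%:R ^+ (2 * r.+1) <= nroot r n%:R by near: n; exact: near_root.
have rolo : (1 - 2^-1) * (nroot r n%:R * (n%:R * p n)) <= rt r p n.
  by near: n; apply: (near_rt_ge r1 hp); rewrite ?invr_gt0 // invf_le1 ?ler1n.
have muB : B1 ^+ r / c * (rt r p n * ln n%:R) <= mu_stars n r (p n).
  by near: n; exact: HQ.
have roK : rt r p n ^+ r = r`!%:R * mu_stars n r (p n) by exact: rtK.
have [w1 _] := nroot_nat (R := R) r1 n0.
set d := n%:R * p n in dC rolo *; set L := ln n%:R in dC L1 L2 muB w2 *.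
set mu := mu_stars n r (p n) in muB roK *.
set ro := rt r p n in roK muB rolo ro1 *; set w := nroot r _ in w1 w2 rolo *.
have d0 : 0 < d by rewrite mulr_gt0 ?ltr0n.
have w0 : 0 < w by lra.
have Lpos : 0 < L by lra.
have roL : c / (de ^+ r * r`!%:R) + h <= ro * L.
  by apply: (le_trans L2); rewrite ler_peMl // ltW.
have roLp : 0 < ro * L by rewrite mulr_gt0 //; lra.
have rop : 0 < ro by lra.
have mu0 : 0 < mu by rewrite -(pmulr_rgt0 _ rf) -roK exprn_gt0.
pose Kr := c * mu / (ro * L).
have Kr0 : 0 < Kr by rewrite divr_gt0 // mulr_gt0.
have KrE : mu / Kr = ro * L / c by rewrite /Kr; field; rewrite !gt_eqF.
pose K := nroot r Kr.
have KK : K ^+ r = Kr by rewrite nrootK // ltW.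
have K0 : 0 < K by rewrite nroot_gt0.
have B1K : B1 <= K.
  apply: (le_root r1); first by clear -r1 hp hp0 hmu HQ B10; lra.
  by rewrite /Kr ler_pdivlMr // -ler_pdivrMl // mulrA [c^-1 * _]mulrC.
have K1 : 1 <= K by clear -r1 hp hp0 hmu HQ B10 B1K; lra.
have dr : 0 < de ^+ r * r`!%:R by rewrite mulr_gt0 // exprn_gt0.
have Kde : K <= de * ro.
  apply: nroot_leX => //; [exact: ltW|by rewrite mulr_ge0 // ltW|].
  have cle : c <= de ^+ r * r`!%:R * (ro * L).
    by rewrite mulrC -ler_pdivrMr //; clear -r1 hp hp0 hmu HQ roL h0; lra.
  rewrite exprMn roK /Kr ler_pdivrMr //.
  have -> : de ^+ r * (r`!%:R * mu) * (ro * L) = de ^+ r * r`!%:R * (ro * L) * mu by ring.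
  by rewrite ler_wpM2r // ltW.
have bulk : bulk_prob h K n <= expR (- (A * (ro * L))).
  pose c1 := Num.truncn Kr.
  have /andP[c11 _] := truncn_itv (ltW Kr0).
  have c10 : (0 < c1)%N.
    by rewrite truncn_ge_nat ?(ltW Kr0) // -KK exprn_ege1.
  have c1R : 0 < c1%:R :> R by rewrite ltr0n.
  apply: (le_trans (@bulk_tail n r R (p n) (hp n) h K c1 (ltW h0) c10 _)).
    move=> x xK; rewrite truncn_ge_nat ?(ltW Kr0) //.
    apply: (@le_trans _ _ (x ^ r)%:R); first by rewrite ler_nat bin_le_expn.
    by rewrite natrX -KK lerXn2r ?nnegrE ?(ltW K0) // ltW.
  rewrite -/mu natrM.
  apply: (@le_trans _ _ (expR h * expR (- ((2 * (A + 1)) * (ro * L))))); last first.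
    rewrite -expRD ler_expR.
    have : 0 < c / (de ^+ r * r`!%:R) by rewrite divr_gt0.
    have : 0 <= A * (ro * L) by rewrite mulr_ge0 // ltW.
    move: roL; clear -r1 hp hp0 hmu HQ h0; move: (ro * L) => z; lra.
  apply: ler_pM; rewrite ?expR_ge0 ?expR_ge1Dx //; first by clear -r1 hp hp0 hmu HQ h0; lra.
  rewrite ler_expR lerN2.
  have -> : 2 * (A + 1) * (ro * L) = ro * L / c / r.+1%:R * phi h.
    by rewrite /c; field; rewrite !gt_eqF.
  rewrite ler_wpM2r ?(ltW ph0) // -KrE -mulrA -invfM.
  have q1 : 0 < c1%:R * r.+1%:R :> R by exact: mulr_gt0.
  have q2 : 0 < Kr * r.+1%:R by exact: mulr_gt0.
  rewrite ler_wpM2l ?(ltW mu0) // [r.+1%:R * _]mulrC lef_pV2 ?posrE //.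
  by rewrite ler_wpM2r.
have costK x : 0 <= x -> x + 1 <= ln (K / d) -> K * x <= cost d K.
  move=> x0 xK; have := ler_wpM2l (ltW K0) xK; rewrite /cost; clear -r1 hp hp0 hmu HQ d0; lra.
exists K; have [dw|dw] := leP (d ^+ 2 * w) 1.
  have d1 : d <= 1.
    rewrite leNgt; apply/negP => d1; have : 1 < d ^+ 2 * w.
      apply: (lt_le_trans d1); apply: (@le_trans _ _ (d ^+ 2)).
        by rewrite expr2 ler_peMr // ltW.
      by rewrite ler_peMr // exprn_ge0 // ltW.
    by rewrite ltNge dw.
  have lnd : ln d <= - (L / r%:R) / 2.
    have : ln (d ^+ 2 * w) <= 0 by rewrite ln_le0.
    rewrite lnM ?posrE ?exprn_gt0 ?nroot_gt0 ?ltr0n // lnXn // ln_root -/L mulr2n.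
    clear -r1 hp hp0 hmu HQ; lra.
  have Lr : 4 * r%:R <= L by clear -r1 hp hp0 hmu HQ L1; lra.
  have Lr4 : 1 <= L / (4 * r%:R) by rewrite ler_pdivlMr ?mulr_gt0 // mul1r.
  have LrE : L / r%:R = 4 * (L / (4 * r%:R)) by field; rewrite gt_eqF.
  have lnKd : L / (4 * r%:R) + 1 <= ln (K / d).
    rewrite ln_div ?posrE //; have : 0 <= ln K by rewrite ln_ge0.
    clear -r1 hp hp0 hmu HQ LrE lnd Lr4; lra.
  have cK := costK _ (le_trans ler01 Lr4) lnKd.
  split=> //; first by clear -r1 hp hp0 hmu HQ d1 B10 B1K; lra.
    by apply: le_trans cK; rewrite ler_peMr // ltW.
  apply: (@le_trans _ _ (h * (B1 * (L / (4 * r%:R))))); last first.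
    rewrite ler_wpM2l ?(ltW h0) //; apply: le_trans cK.
    by rewrite ler_wpM2r // (le_trans ler01).
  have -> : h * (B1 * (L / (4 * r%:R))) = 2 * L + h * (2 * (L / (4 * r%:R))).
    by rewrite /B1; field; rewrite !gt_eqF.
  have x0 := le_trans ler01 Lr4.
  by rewrite lerDl mulr_ge0 ?(ltW h0) // mulr_ge0.
have DL : D * L ^+ r.+1 <= w * d.
  have DL0 := mulr_ge0 (ltW D0) (exprn_ge0 r.+1 (ltW Lpos)).
  have wd0 := mulr_ge0 (ltW w0) (ltW d0).
  rewrite -ler_sqr ?nnegrE //.
  rewrite exprMn -exprM [(r.+1 * 2)%N]mulnC; apply: (le_trans w2).
  have -> : (w * d) ^+ 2 = w * (d ^+ 2 * w) by ring.
  by rewrite ler_peMr ?nroot_ge0 // ltW.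
have BLK : B2 * L <= K.
  apply: (le_root r1); first exact: mulr_ge0 (ltW B20) (ltW Lpos).
  rewrite /Kr ler_pdivlMr // -ler_pdivrMl // exprMn.
  have muro : ro / r`!%:R * ro <= mu.
    rewrite mulrAC ler_pdivrMr // [leRHS]mulrC -roK -expr2.
    by rewrite ler_weXn2l.
  apply: le_trans muro; rewrite mulrA [c^-1 * _]mulrC.
  have -> : B2 ^+ r * L ^+ r / c * (ro * L) = (B2 ^+ r / c * L ^+ r.+1) * ro.
    by rewrite exprS; ring.
  rewrite ler_wpM2r ?(ltW rop) // ler_pdivlMr //.
  have -> : B2 ^+ r / c * L ^+ r.+1 * r`!%:R = (D * L ^+ r.+1) / 2 by rewrite /D; field; rewrite gt_eqF.
  lra.
have C2 : 0 < 2 / h by rewrite divr_gt0.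
have eC : 0 < expR 2 * C by rewrite mulr_gt0.
have LK : expR 2 * d <= K.
  apply: le_trans BLK; apply: (@le_trans _ _ (expR 2 * C * L)).
    by rewrite -mulrA ler_wpM2l // ltW.
  by rewrite ler_wpM2r ?(ltW Lpos) // /B2; lra.
have lnKd : 1 + 1 <= ln (K / d).
  rewrite -[leLHS]expRK ler_ln ?posrE ?expR_gt0 ?divr_gt0 // ler_pdivlMr //.
have cK := costK _ ler01 lnKd; rewrite mulr1 in cK.
split=> //.
  apply: le_trans LK; rewrite ler_wpM2r ?(ltW d0) //.
  by apply: le_trans (expR_ge1Dx _); lra.
apply: (@le_trans _ _ (h * (2 / h * L))).
  by rewrite mulrA mulrCA divff ?mulr1 // gt_eqF.
rewrite ler_wpM2l ?(ltW h0) //; apply: le_trans cK; apply: le_trans BLK.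
by rewrite ler_wpM2r ?(ltW Lpos) // /B2; lra.
Unshelve. all: by end_near. Qed.

End Bulk.

(** * Upper bound: one vertex of large degree *)

(** Here d is the mean degree, w stands for n ^ (1 / r), L / rr = ln w, and E ro is the
degree of a vertex that carries the whole excess; x1 is this degree rounded down. *)
Lemma single_vertex_numeric {R : realType} (a E re Y0 g ro w d L kap c2 rr : R) :
  0 < a -> a < 1 -> 0 < E -> E <= re -> 0 < d -> 1 <= w -> 2 <= rr -> 1 <= L -> 0 < c2 ->
  ln w = L / rr -> (1 - 2^-1) * (w * d) <= ro -> ro <= w * d ->
  kap = E / 4 -> (1 - ln kap) * (rr / a) <= L -> 2 * ln re <= L ->
  2 / E + a^-1 / E <= ro -> (Y0 + 2 + g) / kap <= w -> 0 < Y0 -> 0 < g ->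
  (2 * re + 1) / c2 * L <= w ->
  exists x1 : nat, [/\ x1%:R <= E * ro, E / 2 * ro <= x1%:R,
    Y0 * d <= x1%:R /\ (1 + g) * d <= x1%:R,
    (1 - a) * (E * ro) * ((1 - a) * (L / rr)) <= x1%:R * (ln (x1%:R / d) - 1) &
    x1%:R * (ln (x1%:R / d) - 1) + cost d x1%:R <= c2 * (w ^+ 2 * d)].
Proof.
move=> a0 a1 E0 Ere d0 w1 rr2 L1 c20 lnw rolo rohi kE L2 L3 ro1 Yw Y00 g0 Lw.
have w0 : 0 < w by lra.
have wd0 : 0 < w * d by rewrite mulr_gt0.
have kap0 : 0 < kap by rewrite kE; lra.
have re0 : 0 < re by lra.
have aV0 : 0 < a^-1 by rewrite invr_gt0.
have [X2 Xa] : 2 <= E * ro /\ a^-1 <= E * ro.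
  have q1 : 0 < 2 / E by rewrite divr_gt0.
  have q2 : 0 < a^-1 / E by rewrite divr_gt0.
  by split; rewrite mulrC -ler_pdivrMr //; clear -ro1 q1 q2; lra.
have X0 : 0 <= E * ro by clear -X2; lra.
have aX : 1 <= a * (E * ro) by rewrite -ler_pdivrMl // mulr1.
have /andP[x11 x12] := truncn_itv X0; set x1 := Num.truncn _ in x11 x12.
rewrite -natr1 in x12.
have xhalf : E / 2 * ro <= x1%:R by clear -X2 x12; lra.
have kwx : kap * w * d <= x1%:R.
  have : E * ((1 - 2^-1) * (w * d)) <= E * ro by rewrite ler_wpM2l // ltW.
  by rewrite kE; clear -xhalf; lra.
have Yx : (Y0 + 2 + g) * d <= x1%:R.
  apply: le_trans kwx; rewrite ler_wpM2r ?(ltW d0) // mulrC -ler_pdivrMr //.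
have Yd0 : 0 < Y0 * d by rewrite mulr_gt0.
have gd0 : 0 < g * d by rewrite mulr_gt0.
have x10 : 0 < x1%:R :> R by clear -Yx Yd0 gd0 d0; lra.
have lnk : (1 - a) * (L / rr) <= ln (x1%:R / d) - 1.
  have h1 : ln (kap * w) <= ln (x1%:R / d).
    by rewrite ler_ln ?posrE ?mulr_gt0 ?divr_gt0 // ?invr_gt0 // ler_pdivlMr.
  have : 1 - ln kap <= a * (L / rr).
    have ra : 0 < rr / a by rewrite divr_gt0 //; clear -rr2; lra.
    have -> : a * (L / rr) = L / (rr / a) by field; clear -rr2 a0; lra.
    by rewrite ler_pdivlMr.
  rewrite lnM ?posrE // lnw in h1; move: h1; clear; move: (L / rr) => z; lra.
have Lrr : L / rr <= L / 2.
  rewrite ler_wpM2l //; first by clear -L1; lra.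
  by rewrite lef_pV2 ?posrE //; clear -rr2; lra.
have Lrr0 : 0 <= L / rr by rewrite divr_ge0 //; clear -rr2 L1; lra.
have xre : x1%:R <= re * (w * d).
  apply: (le_trans x11); apply: ler_pM => //; clear -E0 ro1 rolo wd0; lra.
have lnhi : ln (x1%:R / d) <= L.
  have : ln (x1%:R / d) <= ln (re * w).
    rewrite ler_ln ?posrE ?divr_gt0 ?mulr_gt0 //.
    by rewrite ler_pdivrMr // -mulrA.
  by rewrite lnM ?posrE // lnw; clear -L3 Lrr; lra.
exists x1; split=> //.
- by split; [clear -Yx gd0 d0|clear -Yx Yd0 d0]; lra.
- apply: ler_pM => //.
  + by rewrite mulr_ge0 //; clear -a1; lra.
  + by rewrite mulr_ge0 //; clear -a1; lra.
  + clear -aX x12; lra.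
have xL : x1%:R * ln (x1%:R / d) <= re * (w * d) * L.
  apply: ler_pM => //.
  have : 0 <= (1 - a) * (L / rr) by rewrite mulr_ge0 //; clear -a1; lra.
  by clear -lnk; lra.
apply: (@le_trans _ _ ((2 * re + 1) * L * (w * d))).
  have : d <= w * d * L.
    by apply: (@le_trans _ _ (w * d)); [rewrite ler_peMl // ltW|rewrite ler_peMr // ltW].
  rewrite /cost; clear -xL x10; lra.
have -> : c2 * (w ^+ 2 * d) = c2 * w * (w * d) by ring.
rewrite ler_wpM2r ?(ltW wd0) // -ler_pdivrMl // mulrA [_^-1 * _]mulrC //.
Qed.

Section UpperSingleVertex.
Context {R : realType}.
Variables (r : nat) (p : nat -> R).
Hypothesis r1 : (1 < r)%N.
Hypothesis hp : forall n : nat, 0 <= p n <= 1.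
Hypothesis hp0 : p n @[n --> \oo] --> (0 : R).
Hypothesis hmu : much_less (fun n : nat => ln n%:R) (mean_stars r p).

Definition tail_prob (eps : R) n := gnp_prob (p n) (fun G : {set {set 'I_n}} =>
  (1 + eps) * mu_stars n r (p n) <= (nb_stars r G)%:R).

Lemma expR1_ge2 : 2 <= expR 1 :> R.
Proof. by apply: le_trans (expR_ge1Dx _); lra. Qed.

Lemma sum_exp_le (a b c : R) : c + 1 <= a -> c + 2 <= b ->
  expR (- a) + expR (1 - b) <= expR (- c).
Proof.
move=> ca cb; have e1 := expR1_ge2; have c0 : 0 < expR (- c) := expR_gt0 _.
have h x : c + 1 <= x -> expR (- x) <= expR (- c) / 2.
  move=> cx; rewrite ler_pdivlMr //; apply: le_trans (_ : expR (- x) * expR 1 <= _).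
    by rewrite ler_wpM2l ?expR_ge0.
  by rewrite -expRD ler_expR; lra.
have -> : 1 - b = - (b - 1) by ring.
have := h a ca; have := h (b - 1); have -> : c + 1 <= b - 1 by lra.
by move=> /(_ isT); lra.
Qed.

(** The price per edge at the threshold degree (1 + dense_gap h) d. *)
Definition dense_c (h : R) := phi (dense_gap r h) / (1 + dense_gap r h).

Lemma dense_c_gt0 h : 0 < h -> 0 < dense_c h.
Proof.
move=> h0; have g0 := dense_gap_gt0 r1 h0.
by rewrite divr_gt0 ?phi_gt0 // addr_gt0.
Qed.

Lemma cost_dense (h d : R) : 0 < h -> 0 < d ->
  cost d ((1 + dense_gap r h) * d) = dense_c h * ((1 + dense_gap r h) * d) /\
  cost d ((1 + dense_gap r h) * d) = phi (dense_gap r h) * d.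
Proof.
move=> h0 d0; have g0 := dense_gap_gt0 r1 h0.
have E : cost d ((1 + dense_gap r h) * d) = phi (dense_gap r h) * d.
  by rewrite /cost mulfK ?gt_eqF // /phi; ring.
split=> //; rewrite E /dense_c mulrA divfK // gt_eqF // addr_gt0 //.
Qed.

(** When the mean degree is well above ln n, the threshold can be a constant multiple of the
mean degree, below which the number of stars is deterministically bounded. *)
Lemma dense_upper (n x1 : nat) (eps h t : R) : (0 < n)%N -> 0 < p n -> 0 < h -> 2 * h <= 1 ->
  bulk_prob r p h ((1 + dense_gap r h) * (n%:R * p n)) n <= 0 ->
  2 / (h * phi (dense_gap r h)) * ln n%:R <= n%:R * p n ->
  (1 + dense_gap r h) * (n%:R * p n) <= x1%:R -> (x1 <= n)%N -> 0 <= t ->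
  t + cost (n%:R * p n) x1%:R <= 2 * h * dense_c h ^+ 2 * (n%:R * (n%:R * p n)) ->
  (forall x : 'I_n -> nat, (forall i, x i < n)%N ->
     (eps - h) * mu_stars n r (p n) <=
       \sum_(i | (1 + dense_gap r h) * (n%:R * p n) <= (x i)%:R) ('C(x i, r))%:R ->
     t <= \sum_(i | (1 + dense_gap r h) * (n%:R * p n) <= (x i)%:R)
             cost (n%:R * p n) (minn (x i) x1)%:R) ->
  tail_prob eps n <= expR (1 - (1 - 2 * h) * t).
Proof.
move=> n0 pn h0 h1 bulk Ld Kx1 x1n t0 tx det.
have d0 : 0 < n%:R * p n by rewrite mulr_gt0 ?ltr0n.
have [E1 E2] := cost_dense h0 d0; have g0 := dense_gap_gt0 r1 h0.
have ph0 := phi_gt0 g0.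
have /andP[_ p1] := hp n.
have pn1 : 0 < p n <= 1 by rewrite pn p1.
have := @upper_by_cost R n r x1 (p n) eps h (dense_c h) _ t r1 n0 pn1 (ltW h0) h1
  (dense_c_gt0 h0) _ Kx1 x1n t0.
move=> H; apply: le_trans (H _ _ _ tx det) _.
- by rewrite ler_peMl ?(ltW d0) // lerDl ltW.
- by rewrite E1.
- rewrite E2 mulrA -ler_pdivrMl ?mulr_gt0 // mulrC.
  by rewrite mulrAC.
- by rewrite -[leRHS]add0r lerD2r.
Qed.

Section SingleVertex.
Variable eps : R.
Hypothesis eps0 : 0 < eps.
Hypothesis HQ : forall A : R,
  \forall n \near \oo, A * (rt r p n * ln n%:R) <= mu_stars n r (p n).
Hypothesis HS : forall A : R, \forall n \near \oo, A * rt r p n <= n%:R.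

(** A single vertex of large degree is the cheapest source of excess stars. *)
Lemma single_vertex_regime_upper (et : R) : 0 < et -> et < 1 ->
  \forall n \near \oo, tail_prob eps n <=
    expR (- ((1 - et) * (r%:R^-1 * (nroot r eps * rt r p n) * ln n%:R))).
Proof.
move=> et0 et1.
have r0 : 0 < r%:R :> R by rewrite ltr0n ltnW.
pose a := et / 16; have a0 : 0 < a by rewrite divr_gt0.
have a1 : a <= 16^-1 by rewrite /a ler_pdivrMr // mulVf //; lra.
pose h : R := Num.min 1 eps * a.
have m0 : 0 < Num.min 1 eps by rewrite lt_min ltr01.
have h0 : 0 < h by rewrite mulr_gt0.
have ha : h <= a by rewrite ler_piMl ?(ltW a0) // ge_min lexx.
have heps : h <= eps * a by rewrite ler_wpM2r ?(ltW a0) // ge_min lexx orbT.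
have h2 : 2 * h <= 1 by lra.
pose E := nroot r (eps - h).
have Elo : (1 - a) * nroot r eps <= E.
  have a10 : 0 <= 1 - a by lra.
  apply: (@le_trans _ _ (nroot r ((1 - a) * eps))).
    rewrite nrootM ?(ltW eps0) // ler_wpM2r ?nroot_ge0 // nroot1B ?(ltW a0) //; lra.
  apply: nroot_le => //; first by rewrite mulr_ge0 // ltW.
  lra.
have eh : 0 <= eps - h.
  rewrite subr_ge0; apply: (le_trans heps); rewrite ler_piMr ?(ltW eps0) //.
  by apply: (le_trans a1); rewrite invf_le1 // ler1n.
have Ere : E <= nroot r eps by apply: nroot_le => //; clear -r1 hp hp0 hmu HQ HS h0; lra.
have re0 : 0 < nroot r eps := nroot_gt0 r eps0.
have E0 : 0 < E by apply: lt_le_trans Elo; rewrite mulr_gt0 //; lra.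
have g0 := dense_gap_gt0 r1 h0.
have [Y0 [Y00 HY]] := cost_linear r1 g0.
have dc0 := dense_c_gt0 h0.
pose c0 : R := Num.min 1 (dense_c h).
have c00 : 0 < c0 by rewrite lt_min ltr01.
have c01 : c0 <= 1 by rewrite ge_min lexx.
have c0d : c0 <= dense_c h by rewrite ge_min lexx orbT.
pose kap := E / 4; have kap0 : 0 < kap by rewrite divr_gt0.
pose A := nroot r eps / r%:R + 1.
have A0 : 0 <= A by rewrite addr_ge0 // divr_ge0 // ltW.
have ph0 := phi_gt0 g0.
pose C := 2 / (h * phi (dense_gap r h)).
have C0 : 0 < C by rewrite divr_gt0 // mulr_gt0.
have hc0 : 0 < 2 * h * c0 ^+ 2 by rewrite !mulr_gt0 // exprn_gt0.
near=> n.
have n0 : (0 < n)%N by near: n; exact: nbhs_infty_gt.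
have pn : 0 < p n by near: n; exact: (near_p_gt0 r1 hp hmu).
have bulkd : bulk_prob r p h ((1 + dense_gap r h) * (n%:R * p n)) n <= 0.
  by near: n; exact: near_bulk_dense.
have bulks : n%:R * p n <= C * ln n%:R ->
    exists K, [/\ 2 * (n%:R * p n) <= K, K <= cost (n%:R * p n) K,
      2 * ln n%:R <= h * cost (n%:R * p n) K, K <= E / 2 * rt r p n &
      bulk_prob r p h K n <= expR (- (A * (rt r p n * ln n%:R)))].
  by near: n; apply: near_bulk_sparse => //; rewrite divr_gt0.
have L1 : 1 <= ln n%:R :> R by near: n; exact: near_ln.
have L2 : (1 - ln kap) * (r%:R / a) <= ln n%:R by near: n; exact: near_ln.
have L3 : 2 * ln (nroot r eps) <= ln n%:R by near: n; exact: near_ln.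
have rt1 : 2 / E + a^-1 / E <= rt r p n by near: n; exact: (near_rt r1 hp hmu).
have rt2 : 4 * r%:R / (nroot r eps * et) + 2 <= rt r p n.
  by near: n; exact: (near_rt r1 hp hmu).
have rolo : (1 - 2^-1) * (nroot r n%:R * (n%:R * p n)) <= rt r p n.
  by near: n; apply: (near_rt_ge r1 hp); rewrite ?invr_gt0 // invf_le1 ?ler1n.
have w1 : (Y0 + 2 + dense_gap r h) / kap * ln n%:R ^+ 0 <= nroot r n%:R.
  by near: n; exact: near_root.
have w2 : (2 * nroot r eps + 1) / (2 * h * c0 ^+ 2) * ln n%:R ^+ 1 <= nroot r n%:R.
  by near: n; exact: near_root.
have En : E * rt r p n <= n%:R by near: n; exact: HS.
have rohi : rt r p n <= nroot r n%:R * (n%:R * p n) by exact: rt_le.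
have rK : rt r p n ^+ r = r`!%:R * mu_stars n r (p n) by exact: rtK.
have [w10 w1n] := nroot_nat (R := R) r1 n0.
have lnw : ln (nroot r n%:R) = ln n%:R / r%:R :> R by exact: ln_root.
have d0 : 0 < n%:R * p n by rewrite mulr_gt0 ?ltr0n.
have mu0 : 0 <= mu_stars n r (p n) by exact: mu_stars_ge0.
have re2 : (2 : R) <= r%:R by rewrite ler_nat.
rewrite expr0 mulr1 in w1; rewrite expr1 in w2.
have w1' : (Y0 + 2 + dense_gap r h) / kap <= nroot r n%:R by [].
have a11 : a < 1 by clear -r1 hp hp0 hmu HQ HS a1; lra.
have [x1 [x1X Xx1 [Yx1 gx1] tlo thi]] := single_vertex_numeric a0 a11 E0 Ere d0 w10 re2
   L1 hc0 lnw rolo rohi (erefl _) L2 L3 rt1 w1' Y00 g0 w2.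
have x1n : (x1 <= n)%N by rewrite -(ler_nat R); apply: le_trans En.
pose t := x1%:R * (ln (x1%:R / (n%:R * p n)) - 1).
pose R2 := r%:R^-1 * (nroot r eps * rt r p n) * ln n%:R.
have ro0 : 0 < rt r p n.
  have q := divr_gt0 (mulr_gt0 (ltr0n R 4) r0) (mulr_gt0 re0 et0).
  by clear -r1 hp hp0 hmu HQ HS rt2 q; lra.
have R20 : 0 < R2.
  rewrite /R2 !mulr_gt0 ?invr_gt0 //; clear -r1 hp hp0 hmu HQ HS L1; lra.
have Lr0 : 0 <= ln n%:R / r%:R :> R.
  by rewrite divr_ge0 ?(ltW r0) //; clear -r1 hp hp0 hmu HQ HS L1; lra.
have tR : (1 - 3 * a) * R2 <= t.
  apply: le_trans tlo.
  have a10 : 0 <= 1 - a by clear -r1 hp hp0 hmu HQ HS a1; lra.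
  apply: (@le_trans _ _ ((1 - a) ^+ 3 * R2)).
    rewrite ler_wpM2r ?(ltW R20) // bernoulli ?(ltW a0) //.
    by clear -r1 hp hp0 hmu HQ HS a1; lra.
  have -> : (1 - a) ^+ 3 * R2 = (1 - a) * (((1 - a) * nroot r eps) * rt r p n) * ((1 - a) * (ln n%:R / r%:R)).
    by rewrite /R2; ring.
  apply: ler_wpM2r; first by apply: mulr_ge0.
  by apply: ler_wpM2l => //; apply: ler_wpM2r => //; exact: ltW.
have t0 : 0 <= t.
  apply: le_trans tR; rewrite mulr_ge0 ?(ltW R20) //.
  by clear -r1 hp hp0 hmu HQ HS a1; lra.
have R2a : 2 <= 8 * a * R2.
  have q : 4 * r%:R / (nroot r eps * et) <= rt r p n by clear -r1 hp hp0 hmu HQ HS rt2; lra.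
  have q2 : 2 <= 8 * a * (r%:R^-1 * (nroot r eps * rt r p n)).
    have -> : 8 * a * (r%:R^-1 * (nroot r eps * rt r p n)) =
       rt r p n / (4 * r%:R / (nroot r eps * et)) * 2.
      by rewrite /a; field; rewrite !gt_eqF.
    by rewrite ler_peMl // ler_pdivlMr ?mul1r // divr_gt0 // mulr_gt0.
  rewrite /R2 mulrA; apply: (le_trans q2); rewrite ler_peMr //.
  exact: le_trans (ler0n R 2) q2.
have tfin : (1 - et) * R2 + 2 <= (1 - 2 * h) * t.
  apply: (@le_trans _ _ ((1 - 2 * a) * ((1 - 3 * a) * R2))); last first.
    apply: ler_pM => //; [| |by clear -r1 hp hp0 hmu HQ HS ha; lra].
    - by clear -r1 hp hp0 hmu HQ HS a1; lra.
    - by rewrite mulr_ge0 ?(ltW R20) //; clear -r1 hp hp0 hmu HQ HS a1; lra.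
  have aa : 0 <= a * a * R2 by rewrite mulr_ge0 ?(ltW R20) // mulr_ge0 // ltW.
  have -> : (1 - et) * R2 = R2 - 16 * a * R2 by rewrite /a; field.
  by clear -r1 hp hp0 hmu HQ HS aa R2a; lra.
have pn1 : 0 < p n <= 1 by rewrite pn; case/andP: (hp n).
have n0R : 0 <= n%:R * (n%:R * p n) by rewrite mulr_ge0 // ltW.
have tx c : c0 <= c -> t + cost (n%:R * p n) x1%:R <= 2 * h * c ^+ 2 * (n%:R * (n%:R * p n)).
  move=> cc; apply: (le_trans thi); apply: (@le_trans _ _ (2 * h * c0 ^+ 2 * (n%:R * (n%:R * p n)))).
    by rewrite ler_wpM2l ?(ltW hc0) // ler_wpM2r // ltW.
  apply: ler_wpM2r => //; apply: ler_wpM2l; first by rewrite mulr_ge0 // ltW.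
  by rewrite lerXn2r ?nnegrE ?(ltW c00) // (le_trans (ltW c00)).
have det K : (1 + dense_gap r h) * (n%:R * p n) <= K -> K <= x1%:R ->
    forall x : 'I_n -> nat, (forall i, x i < n)%N ->
    (eps - h) * mu_stars n r (p n) <= \sum_(i | K <= (x i)%:R) ('C(x i, r))%:R ->
    t <= \sum_(i | K <= (x i)%:R) cost (n%:R * p n) (minn (x i) x1)%:R.
  move=> gK Kx1 x xn xM; rewrite -[t]mul1r.
  apply: (sum_cost_ge d0 g0 gK Kx1 Yx1 HY t0 xn _ _ xM); first by rewrite lexx.
  rewrite mul1r mulrCA -rK.
  rewrite -[eps - h](nrootK r1 eh) -exprMn lerXn2r ?nnegrE //.
  by rewrite mulr_ge0 ?nroot_ge0 // ltW.
have [dC|dC] := leP (n%:R * p n) (C * ln n%:R); last first.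
  apply: le_trans (dense_upper n0 pn h0 h2 bulkd (ltW dC) gx1 x1n t0 (tx _ c0d) (det _ (lexx _) gx1)) _.
  by rewrite -/R2 ler_expR; clear -r1 hp hp0 hmu HQ HS tfin; lra.
have [K [K2 KK KL KE Kb]] := bulks dC.
have g1 : dense_gap r h <= 1.
  rewrite /dense_gap lerBlDr; apply: nroot_leX => //; first by clear -r1 hp hp0 hmu HQ HS h0; lra.
  apply: (@le_trans _ _ (1 + 1)); first by clear -r1 hp hp0 hmu HQ HS h2; lra.
  by apply: ler_eXnr; [exact: ltnW|rewrite lerDl].
have gK : (1 + dense_gap r h) * (n%:R * p n) <= K.
  apply: le_trans K2; rewrite ler_wpM2r ?(ltW d0) //.
  by clear -r1 hp hp0 hmu HQ HS g1; lra.
have Kx1 := le_trans KE Xx1.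
have dK : n%:R * p n <= K by apply: le_trans gK; rewrite ler_peMl ?(ltW d0) // lerDl ltW.
have K0 : 0 < K by apply: lt_le_trans dK.
have c0K : c0 * K <= cost (n%:R * p n) K by apply: le_trans KK; rewrite ler_piMl // ltW.
apply: le_trans (upper_by_cost r1 n0 pn1 (ltW h0) h2 c00 dK Kx1 x1n t0 c0K KL
   (tx _ (lexx _)) (det _ gK Kx1)) _.
apply: le_trans (lerD Kb (lexx _)) _; apply: sum_exp_le => //.
have -> : A * (rt r p n * ln n%:R) = R2 + rt r p n * ln n%:R.
  by rewrite /A /R2; field; rewrite gt_eqF.
have : 1 <= rt r p n * ln n%:R.
  rewrite mulr_ege1 //; have q := divr_gt0 (mulr_gt0 (ltr0n R 4) r0) (mulr_gt0 re0 et0).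
  by clear -r1 hp hp0 hmu HQ HS rt2 q; lra.
have := mulr_gt0 et0 R20; rewrite -/R2.
by clear -r1 hp hp0 hmu HQ HS; lra.
Unshelve. all: by end_near. Qed.

End SingleVertex.
End UpperSingleVertex.

(** * Upper bound: an unbounded number of full vertices *)

Section UpperDense.
Context {R : realType}.
Variables (r : nat) (p : nat -> R).
Hypothesis r1 : (1 < r)%N.
Hypothesis hp : forall n : nat, 0 <= p n <= 1.
Hypothesis hp0 : p n @[n --> \oo] --> (0 : R).
Hypothesis hmu : much_less (fun n : nat => ln n%:R) (mean_stars r p).
Variable eps : R.
Hypothesis eps0 : 0 < eps.
(* The mean number of stars at a vertex is at least of order n ^ (r - 1). *)
Variable b : R.
Hypothesis b0 : 0 < b.
Hypothesis HB : \forall n \near \oo, b <= n%:R * p n ^+ r.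

Lemma near_np (A : R) (k : nat) : \forall n \near \oo, A * ln n%:R ^+ k <= n%:R * p n.
Proof.
have rb := nroot_gt0 r b0.
near=> n; have /andP[p0 _] := hp n.
have n0 : (0 < n)%N by near: n; exact: nbhs_infty_gt.
have w2 : A / nroot r b * ln n%:R ^+ k <= nroot r n%:R by near: n; exact: near_root.
have bn : b <= n%:R * p n ^+ r by near: n; exact: HB.
have [w1 wn] := nroot_nat (R := R) r1 n0.
have wp : nroot r b <= nroot r n%:R * p n.
  rewrite -[p n](nroot_Xn r1 p0) -nrootM ?exprn_ge0 //.
  by apply: nroot_le => //; exact: ltW.
have w0 : 0 < nroot r (n%:R : R) by apply: lt_le_trans w1.
apply: (@le_trans _ _ (nroot r n%:R * (nroot r n%:R * p n))); last first.
  by rewrite mulrA -expr2 ler_wpM2r.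
have -> : A * ln n%:R ^+ k = A / nroot r b * ln n%:R ^+ k * nroot r b.
  by field; rewrite gt_eqF.
apply: (@le_trans _ _ (nroot r n%:R * nroot r b)); first by rewrite ler_wpM2r // ltW.
by rewrite ler_wpM2l // ltW.
Unshelve. all: by end_near. Qed.

Lemma near_lnV (A : R) : \forall n \near \oo, A <= ln (p n)^-1.
Proof.
near=> n; have pn : 0 < p n by near: n; exact: (near_p_gt0 r1 hp hmu).
have pe : p n <= expR (- A) by near: n; apply: near_p_le => //; exact: expR_gt0.
rewrite -[leLHS]expRK ler_ln ?posrE ?expR_gt0 ?invr_gt0 //.
by rewrite -[leLHS]invrK -expRN lef_pV2 ?posrE ?expR_gt0.
Unshelve. all: by end_near. Qed.

Lemma near_lnV_le : \forall n \near \oo, ln (p n)^-1 <= ln n%:R.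
Proof.
near=> n; have pn : 0 < p n by near: n; exact: (near_p_gt0 r1 hp hmu).
have nb : b^-1 <= n%:R by near: n; exact: near_natr.
have bn : b <= n%:R * p n ^+ r by near: n; exact: HB.
have n1 : (1 < n)%N by near: n; exact: nbhs_infty_gt.
have nR : 0 < n%:R :> R by rewrite ltr0n ltnW.
have p1 : p n <= 1 by case/andP: (hp n).
rewrite ler_ln ?posrE ?invr_gt0 // -[leRHS]invrK lef_pV2 ?posrE ?invr_gt0 //.
have pr : p n ^+ r <= p n ^+ 2 by rewrite ler_wiXn2l // ltW.
rewrite -ler_sqr ?nnegrE ?invr_ge0 ?(ltW nR) ?(ltW pn) //.
apply: le_trans pr; rewrite expr2 -[leRHS](mulKf (x := n%:R)) ?gt_eqF //.
rewrite ler_wpM2l ?invr_ge0 ?(ltW nR) //; apply: le_trans bn.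
by rewrite -[leRHS]invrK lef_pV2 ?posrE ?invr_gt0.
Unshelve. all: by end_near. Qed.

Lemma near_dense_ineq (C : R) : \forall n \near \oo, C * ln n%:R <= n%:R * p n.
Proof. by apply: filterS (near_np C 1) => n; rewrite expr1. Qed.

(* The contexts below are large; the goal alone, with the hypotheses put into it, is what
linear arithmetic gets to see. *)
Local Ltac goal_lra := clear -r1 hp hp0 hmu eps0 b0 HB; lra.

(** When the mean degree is large, stars at full degree are the most efficient,
and any number of them can be present. *)
Lemma dense_regime_upper (et : R) : 0 < et -> et < 1 ->
  (forall A : R, \forall n \near \oo, A <= n%:R * p n ^+ r) ->
  \forall n \near \oo, tail_prob r p eps n <=
    expR (- ((1 - et) * (eps * n%:R ^+ 2 * p n ^+ r * ln (p n)^-1))).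
Proof.
move=> et0 et1 HA.
pose a : R := et / 16; have a0 : 0 < a by rewrite divr_gt0.
have a1 : a <= 16^-1 by rewrite /a ler_pdivrMr // mulVf //; lra.
pose h : R := Num.min 1 eps * a.
have m0 : 0 < Num.min 1 eps by rewrite lt_min ltr01.
have h0 : 0 < h by rewrite mulr_gt0.
have ha : h <= a by rewrite ler_piMl ?(ltW a0) // ge_min lexx.
have heps : h <= eps * a by rewrite ler_wpM2r ?(ltW a0) // ge_min lexx orbT.
have h2 : 2 * h <= 1 by lra.
have g0 := dense_gap_gt0 r1 h0.
have [Y0 [Y00 HY]] := cost_linear r1 g0.
have dc0 := dense_c_gt0 r1 h0.
have ph0 := phi_gt0 g0.
pose C : R := 2 / (h * phi (dense_gap r h)).
pose D : R := 2 * h * dense_c r h ^+ 2.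
have D0 : 0 < D by rewrite mulr_gt0 ?exprn_gt0 // mulr_gt0.
have D4 : 0 < D / (4 * eps) by rewrite divr_gt0 // mulr_gt0.
have [Y1 [Y10 HY1]] := ln_le_small D4.
have g10 : 0 < 1 + dense_gap r h by rewrite addr_gt0.
have a10 : 0 < 1 - a by lra.
near=> n.
have n0 : (0 < n)%N by near: n; exact: nbhs_infty_gt.
have pn : 0 < p n by near: n; exact: (near_p_gt0 r1 hp hmu).
have bulkd : bulk_prob r p h ((1 + dense_gap r h) * (n%:R * p n)) n <= 0.
  by near: n; exact: near_bulk_dense.
have dC : C * ln n%:R <= n%:R * p n by near: n; exact: near_dense_ineq.
have dD : 4 / D * ln n%:R <= n%:R * p n by near: n; exact: near_dense_ineq.
have nD : 4 / D <= n%:R by near: n; exact: near_natr.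
have lnp1 : a^-1 <= ln (p n)^-1 by near: n; exact: near_lnV.
have lnpn : ln (p n)^-1 <= ln n%:R by near: n; exact: near_lnV_le.
have pg : p n <= (1 + dense_gap r h)^-1.
  by near: n; apply: near_p_le => //; rewrite invr_gt0.
have pY : p n <= Y0^-1 by near: n; apply: near_p_le => //; rewrite invr_gt0.
have pY1 : p n <= Y1^-1 by near: n; apply: near_p_le => //; rewrite invr_gt0.
have np1 : (a^-1)^-1 <= n%:R * p n ^+ r by near: n; exact: HA.
have np2 : 2 / (a * eps) <= n%:R * p n ^+ r by near: n; exact: HA.
have mlo : (1 - a) * (n%:R * (n%:R * p n) ^+ r) <= r`!%:R * mu_stars n r (p n).
  by near: n; exact: near_mu_lo.
have mhi := mu_stars_fact_le n r (ltW pn).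
have nR : 0 < n%:R :> R by rewrite ltr0n.
have d0 : 0 < n%:R * p n by rewrite mulr_gt0.
set l := ln (p n)^-1 in lnp1 lnpn *.
have aV : 1 <= a^-1.
  rewrite -[leLHS]invr1 lef_pV2 ?posrE //; apply: (le_trans a1).
  by rewrite invf_le1 // ler1n.
have l1 : 1 <= l by apply: le_trans lnp1.
have lE : ln (n%:R / (n%:R * p n)) = l by congr ln; field; rewrite !gt_eqF.
have eh : 0 <= eps - h.
  rewrite subr_ge0; apply: (le_trans heps); rewrite ler_piMr ?(ltW eps0) //.
  by apply: (le_trans a1); rewrite invf_le1 // ler1n.
have nr0 : 0 < n%:R ^+ r :> R by rewrite exprn_gt0.
pose z := n%:R * p n ^+ r.
have z0 : 0 < z by rewrite mulr_gt0 // exprn_gt0.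
pose tau := r`!%:R * ((eps - h) * mu_stars n r (p n)) / n%:R ^+ r.
have mE : n%:R * (n%:R * p n) ^+ r = z * n%:R ^+ r by rewrite exprMn /z; ring.
have tauE : tau = (eps - h) * (r`!%:R * mu_stars n r (p n) / n%:R ^+ r).
  by rewrite /tau; field; rewrite gt_eqF.
have [tlo thi] : (eps - h) * ((1 - a) * z) <= tau /\ tau <= eps * z.
  rewrite tauE; split.
    by rewrite ler_wpM2l // ler_pdivlMr // -mulrA -mE.
  apply: ler_pM => //.
  - by rewrite divr_ge0 ?(ltW nr0) // mulr_ge0 // mu_stars_ge0.
  - by rewrite gerBl ltW.
  - by rewrite ler_pdivrMr // -mE.
have tau0 : 0 <= tau by apply: le_trans tlo; rewrite mulr_ge0 // mulr_ge0 // ltW.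
pose t := tau * (n%:R * (l - 1)).
have l10 : 0 <= l - 1 by rewrite subr_ge0.
have nl0 : 0 <= n%:R * (l - 1) by rewrite mulr_ge0.
have t0 : 0 <= t by rewrite mulr_ge0.
pose R4 := eps * n%:R ^+ 2 * p n ^+ r * l.
have R4E : R4 = eps * z * (n%:R * l) by rewrite /R4 /z; ring.
have R40 : 0 < R4.
  rewrite R4E mulr_gt0 // mulr_gt0 //; exact: lt_le_trans l1.
have tR : (1 - 3 * a) * R4 <= t.
  apply: (@le_trans _ _ ((1 - a) ^+ 3 * R4)).
    rewrite ler_wpM2r ?(ltW R40) // bernoulli ?(ltW a0) // (le_trans a1) //.
    by rewrite invf_le1 // ler1n.
  have -> : (1 - a) ^+ 3 * R4 = ((1 - a) * eps * ((1 - a) * z)) * (n%:R * ((1 - a) * l)).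
    by rewrite R4E; ring.
  apply: ler_pM.
  - exact: (mulr_ge0 (mulr_ge0 (ltW a10) (ltW eps0)) (mulr_ge0 (ltW a10) (ltW z0))).
  - exact: (mulr_ge0 (ltW nR) (mulr_ge0 (ltW a10) (le_trans ler01 l1))).
  - apply: le_trans tlo; apply: ler_wpM2r; first exact: (mulr_ge0 (ltW a10) (ltW z0)).
    by move: heps; goal_lra.
  - rewrite ler_wpM2l //.
    have : 1 <= a * l by rewrite -ler_pdivrMl // mulr1.
    by goal_lra.
have R4a : 2 <= 8 * a * R4.
  have q : 2 <= eps * z * a.
    by rewrite -mulrA mulrCA [eps * a]mulrC -ler_pdivrMr // mulr_gt0.
  rewrite R4E; apply: (le_trans q).
  have -> : 8 * a * (eps * z * (n%:R * l)) = eps * z * a * (8 * (n%:R * l)) by ring.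
  rewrite ler_peMr //; first exact: le_trans (ler0n R 2) q.
  by rewrite mulr_ege1 ?ler1n // mulr_ege1 // ler1n.
have tfin : (1 - et) * R4 + 2 <= (1 - 2 * h) * t.
  apply: (@le_trans _ _ ((1 - 2 * a) * ((1 - 3 * a) * R4))); last first.
    apply: ler_pM => //.
    - by move: a1; goal_lra.
    - by rewrite mulr_ge0 ?(ltW R40) //; move: a1; goal_lra.
    - by move: ha; goal_lra.
  have aa : 0 <= a * a * R4 by rewrite mulr_ge0 ?(ltW R40) // mulr_ge0 // ltW.
  have -> : (1 - et) * R4 = R4 - 16 * a * R4 by rewrite /a; field.
  by move: aa R4a; goal_lra.
have gx : (1 + dense_gap r h) * (n%:R * p n) <= n%:R.
  by rewrite mulrCA ler_piMr // mulrC -ler_pdivlMr // mul1r.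
have Yx : Y0 * (n%:R * p n) <= n%:R.
  by rewrite mulrCA ler_piMr // mulrC -ler_pdivlMr // mul1r.
have tx : t + cost (n%:R * p n) n%:R <= D * (n%:R * (n%:R * p n)).
  have h1 : t <= D / 4 * (n%:R * (n%:R * p n)).
    have pl : p n * l <= D / (4 * eps).
      rewrite mulrC -ler_pdivlMr //; apply: HY1.
      by rewrite -[leLHS]invrK lef_pV2 ?posrE ?invr_gt0.
    have zp : z <= n%:R * p n * p n.
      rewrite /z -mulrA ler_wpM2l // -expr2 ler_wiXn2l // ?(ltW pn) //.
      by case/andP: (hp n).
    apply: (@le_trans _ _ (eps * (n%:R * p n * p n) * (n%:R * l))).
      apply: ler_pM => //; first by apply: (le_trans thi); rewrite ler_wpM2l // ltW.
      by rewrite ler_wpM2l // gerBl.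
    have -> : eps * (n%:R * p n * p n) * (n%:R * l) = (eps * (p n * l)) * (n%:R * (n%:R * p n)) by ring.
    rewrite ler_wpM2r ?mulr_ge0 ?(ltW pn) //.
    have -> : D / 4 = eps * (D / (4 * eps)) by field; rewrite gt_eqF.
    by rewrite ler_wpM2l // ltW.
  have h3 : n%:R * l <= D / 4 * (n%:R * (n%:R * p n)).
    rewrite mulrCA ler_wpM2l //; apply: (le_trans lnpn).
    by rewrite -ler_pdivrMl ?divr_gt0 // invf_div.
  have h4 : n%:R * p n <= D / 4 * (n%:R * (n%:R * p n)).
    by rewrite mulrA ler_peMl ?(ltW d0) // -ler_pdivrMl ?divr_gt0 // mulr1 invf_div.
  have -> : D * (n%:R * (n%:R * p n)) = 4 * (D / 4 * (n%:R * (n%:R * p n))) by field.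
  rewrite /cost lE; move: h1 h3 h4 nR nl0; clear -r1 hp hp0 hmu eps0 b0 HB.
  by move: (D / 4 * _) => x; lra.
apply: le_trans (dense_upper r1 hp (x1 := n) n0 pn h0 h2 bulkd dC gx (leqnn n) t0 tx _) _.
  move=> x xn xM; rewrite /t -lE.
  apply: (sum_cost_ge d0 g0 (lexx _) gx Yx HY _ xn _ _ xM).
  - by rewrite lE.
  - by rewrite leqnn orbT.
  - by rewrite /tau divfK // gt_eqF.
by rewrite -/R4 ler_expR; move: tfin; goal_lra.
Unshelve. all: by end_near. Qed.

End UpperDense.

(** * Power sums of numbers in the unit interval *)

Section FloorRoot.
Context {R : realType}.
Variable r : nat.
Hypothesis r1 : (1 < r)%N.

(** The cost, in units of a full vertex, of stars worth a times those of a full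
vertex: as many full vertices as possible and one further vertex. *)
Definition floor_root (a : R) : R := nroot r (frac_part a) + (Num.floor a)%:~R.

Lemma frac_part_itv (a : R) : 0 <= frac_part a < 1.
Proof.
have /andP[h1 h2] := floor_itv a; rewrite /frac_part subr_ge0 h1 /=.
by rewrite ltrBlDr addrC -[1]/(1%:~R) -intrD.
Qed.

Lemma floor_root_def (k : int) (f : R) : 0 <= f < 1 -> floor_root (k%:~R + f) = nroot r f + k%:~R.
Proof.
move=> /andP[f0 f1]; rewrite /floor_root /frac_part.
have -> : Num.floor (k%:~R + f) = k.
  by apply: floor_def; rewrite lerDl f0 intrD ltrD2l.
by rewrite [k%:~R + f]addrC addrK.
Qed.

Lemma floor_rootE (a : R) : exists (k : int) (v : R), [/\ 0 <= v, v < 1, a = k%:~R + v ^+ r &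
  floor_root a = v + k%:~R].
Proof.
have /andP[f0 f1] := frac_part_itv a.
exists (Num.floor a), (nroot r (frac_part a)); split=> //; first exact: nroot_ge0.
  rewrite ltNge; apply/negP => h; move: f1; rewrite -(nrootK r1 f0) ltNge.
  by rewrite exprn_ege1.
by rewrite nrootK // /frac_part addrC subrK.
Qed.

Lemma exprD_ge (u v : R) (k : nat) : 0 <= u -> 0 <= v -> (0 < k)%N ->
  v ^+ k + u ^+ k <= (v + u) ^+ k.
Proof.
move=> u0 v0; case: k => // k _; elim: k => [|k IH]; first by rewrite !expr1.
rewrite [leRHS]exprS; apply: (@le_trans _ _ ((v + u) * (v ^+ k.+1 + u ^+ k.+1))).
  rewrite mulrDl !mulrDr -!exprS.
  have : 0 <= v * u ^+ k.+1 by rewrite mulr_ge0 // exprn_ge0.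
  have : 0 <= u * v ^+ k.+1 by rewrite mulr_ge0 // exprn_ge0.
  lra.
by rewrite ler_wpM2l // addr_ge0.
Qed.

(** With the sum kept fixed, the power sum of two numbers in the unit interval is largest
when one of them is 1. *)
Lemma expr_majorize (u v : R) (k : nat) : 0 <= u <= 1 -> 0 <= v <= 1 -> 1 <= u + v ->
  v ^+ k + u ^+ k <= 1 + (u + v - 1) ^+ k.
Proof.
move=> /andP[u0 u1] /andP[v0 v1] uv; set c := u + v - 1.
have c0 : 0 <= c by rewrite /c; lra.
suff : u ^+ k - c ^+ k <= 1 ^+ k - v ^+ k by rewrite expr1n; lra.
rewrite !subrXX; have -> : u - c = 1 - v by rewrite /c; ring.
rewrite ler_wpM2l ?subr_ge0 //; apply: ler_sum => i _.
rewrite expr1n mul1r -[leRHS]mul1r; apply: ler_pM; rewrite ?exprn_ge0 //.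
  by rewrite exprn_ile1.
by rewrite lerXn2r ?nnegrE //; rewrite /c; lra.
Qed.

(** If the fractional part overflows, then one vertex becomes full and [expr_majorize]
compares what is left. *)
Lemma floor_root_step (a u : R) : 0 <= u <= 1 ->
  floor_root (a + u ^+ r) <= floor_root a + u.
Proof.
move=> u01; have /andP[u0 u1] := u01.
have r0 : (0 < r)%N by exact: ltnW.
have [k [v [v0 v1 aE ->]]] := floor_rootE a.
have ur1 : u ^+ r <= 1 by rewrite exprn_ile1.
have ur0 : 0 <= u ^+ r by rewrite exprn_ge0.
have vr0 : 0 <= v ^+ r by rewrite exprn_ge0.
have vr1 : v ^+ r < 1 by rewrite exprn_ilt1 // -lt0n.
have [lt1|ge1] := ltP (v ^+ r + u ^+ r) 1.
  rewrite aE -addrA floor_root_def; last by rewrite lt1 andbT addr_ge0.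
  have : nroot r (v ^+ r + u ^+ r) <= v + u.
    by apply: nroot_leX; rewrite ?addr_ge0 ?exprD_ge.
  lra.
have -> : a + u ^+ r = (k + 1)%:~R + (v ^+ r + u ^+ r - 1) by rewrite aE intrD; ring.
rewrite floor_root_def; last by apply/andP; split; lra.
have uv : 1 <= u + v.
  have : u ^+ r <= u by rewrite ler_iXnr.
  have : v ^+ r <= v by rewrite ler_iXnr // ltW.
  lra.
have : nroot r (v ^+ r + u ^+ r - 1) <= u + v - 1.
  apply: nroot_leX; rewrite ?subr_ge0 //.
  have := @expr_majorize u v r u01 _ uv; rewrite v0 (ltW v1) => /(_ isT); lra.
rewrite intrD; lra.
Qed.

Lemma floor_root0 : floor_root 0 = 0.
Proof.
have := @floor_root_def 0 0; rewrite addr0 /nroot powR0 ?addr0.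
  by apply; rewrite lexx ltr01.
by rewrite invr_neq0 // pnatr_eq0 -lt0n ltnW.
Qed.

Lemma floor_root_sum (I : finType) (P : pred I) (u : I -> R) :
  (forall i, P i -> 0 <= u i <= 1) ->
  floor_root (\sum_(i | P i) u i ^+ r) <= \sum_(i | P i) u i.
Proof.
move=> u01; elim/big_rec2: _ => [|i y x Pi xy]; first by rewrite floor_root0.
rewrite addrC; apply: (le_trans (floor_root_step _ (u01 _ Pi))).
by rewrite addrC lerD2l.
Qed.

Lemma floor_root_le (a b : R) : a <= b -> floor_root a <= floor_root b.
Proof.
move=> ab; have [k [v [v0 v1 aE ->]]] := floor_rootE a.
have [l [w [w0 w1 bE ->]]] := floor_rootE b.
have r0 : (0 < r)%N by exact: ltnW.
have wr1 : w ^+ r < 1 by rewrite exprn_ilt1 // -lt0n.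
have vr0 : 0 <= v ^+ r by rewrite exprn_ge0.
have kl : (k <= l)%R.
  rewrite -ltzD1 -(ltr_int R) intrD; lra.
move: kl; rewrite le_eqVlt => /orP[/eqP kl|kl].
  rewrite -kl lerD2r -(ler_pXn2r (n := r)) ?nnegrE //.
  by move: ab; rewrite aE bE kl; lra.
have : (k + 1 <= l)%R by rewrite lezD1.
rewrite -(ler_int R) intrD; lra.
Qed.

Lemma floor_root_sub (s t : R) : 0 <= t <= 1 -> floor_root s <= floor_root (s - t) + nroot r t.
Proof.
move=> /andP[t0 t1]; have := @floor_root_step (s - t) (nroot r t).
rewrite nrootK // subrK => h; apply: h.
by rewrite nroot_ge0 /=; apply: nroot_leX; rewrite ?expr1n.
Qed.

Lemma floor_root_gt0 (s : R) : 0 < s -> 0 < floor_root s.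
Proof.
move=> s0; have := floor_root_le (ltW s0); rewrite floor_root0 le_eqVlt.
case/orP => // /eqP E; have [k [v [v0 v1 sE G]]] := floor_rootE s.
rewrite G in E; have r0 : (0 < r)%N by exact: ltnW.
have vr1 : v ^+ r < 1 by rewrite exprn_ilt1 // -lt0n.
have vr0 : 0 <= v ^+ r by rewrite exprn_ge0.
have k0 : (0 <= k)%R by rewrite -ltzD1 -(ltr_int R) intrD; lra.
move: k0; rewrite -(ler_int R) => k0.
have [vz kz] : v = 0 /\ k%:~R = 0 :> R by split; lra.
by move: s0; rewrite sE vz kz expr0n gtn_eqF // addr0 ltxx.
Qed.

End FloorRoot.

(** * Upper bound: a bounded number of full vertices *)

Section FullVertices.
Context {R : realType}.
Variables (r : nat) (p : nat -> R).
Hypothesis r1 : (1 < r)%N.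

(** A small degree x pays at least the proportion (x / (de n)) ^ r of the cost of a degree
de n, which per star is much more than what a full vertex pays; a large degree x pays the
proportion x / n of the cost of a full vertex. *)
Lemma sum_cost_floor_root (n : nat) (d g de Y0 c s h V : R) (x : 'I_n -> nat) :
  (0 < n)%N -> 0 < d -> 0 < de -> de <= 1 -> 0 <= c -> c <= ln (de * n%:R / d) - 1 ->
  (forall d x X : R, 0 < d -> (1 + g) * d <= x -> x <= X ->
    Y0 * d <= X -> (x / X) ^+ r * (X * (ln (X / d) - 1)) <= cost d x) ->
  Y0 * d <= de * n%:R ->
  (forall i, (x i < n)%N) -> (forall i, (1 + g) * d <= (x i)%:R -> 0 < (x i)%:R :> R) ->
  s * n%:R ^+ r <= r`!%:R * \sum_(i | (1 + g) * d <= (x i)%:R) ('C(x i, r))%:R ->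
  de * V <= h -> V <= floor_root r (s - h) -> 0 <= V ->
  V * (n%:R * c) <= \sum_(i | (1 + g) * d <= (x i)%:R) cost d (x i)%:R.
Proof.
move=> n0 d0 de0 de1 c0 cle HY YX xn xp0 sM deV VG V0.
have nR : 0 < n%:R :> R by rewrite ltr0n.
pose P i := ((1 + g) * d <= (x i)%:R)%R; pose u i : R := (x i)%:R / n%:R.
have u0 i : 0 <= u i by rewrite divr_ge0.
have u1 i : u i <= 1 by rewrite ler_pdivrMr // mul1r ler_nat ltnW.
have nc0 : 0 <= n%:R * c by rewrite mulr_ge0 // ltW.
pose big i := (de * n%:R <= (x i)%:R)%R.
have sU : s <= \sum_(i | P i) u i ^+ r.
  have nr0 : 0 < n%:R ^+ r :> R by rewrite exprn_gt0.
  rewrite -(ler_pM2r nr0); apply: (le_trans sM).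
  rewrite mulr_sumr mulr_suml; apply: ler_sum => i _.
  rewrite -exprMn divfK ?gt_eqF // -natrM mulnC bin_ffact -natrX ler_nat.
  exact: ffact_le_expn.
rewrite [leRHS](bigID big) /=; rewrite (bigID big) /= in sU.
have LB : (\sum_(i | P i && big i) u i) * (n%:R * c) <= \sum_(i | P i && big i) cost d (x i)%:R.
  rewrite mulr_suml; apply: ler_sum => i /andP[Pi bi].
  have xi : 0 < (x i)%:R :> R by apply: xp0.
  have -> : u i * (n%:R * c) = (x i)%:R * c by rewrite /u; field; rewrite gt_eqF.
  have cx : c <= ln ((x i)%:R / d) - 1.
    apply: (le_trans cle); rewrite lerD2r ler_ln ?posrE ?divr_gt0 ?mulr_gt0 //.
    by rewrite ler_pM2r ?invr_gt0.
  have := ler_wpM2l (ltW xi) cx; rewrite /cost; lra.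
have SB : (\sum_(i | P i && ~~ big i) u i ^+ r) / de * (n%:R * c) <=
    \sum_(i | P i && ~~ big i) cost d (x i)%:R.
  rewrite -mulrA mulr_suml; apply: ler_sum => i /andP[Pi]; rewrite -ltNge => bi.
  apply: le_trans (HY d (x i)%:R (de * n%:R) d0 Pi (ltW bi) YX).
  have -> : (x i)%:R / (de * n%:R) = u i / de by rewrite /u; field; rewrite !gt_eqF.
  rewrite [(u i / de) ^+ r]exprMn -[leRHS]mulrA -[de * n%:R * (_ - 1)]mulrA ler_wpM2l ?exprn_ge0 //.
  have dr : de^-1 * de^-1 <= de^-1 ^+ r.
    by rewrite -expr2 ler_weXn2l // invf_ge1.
  apply: (@le_trans _ _ (de^-1 * de^-1 * (de * (n%:R * c)))).
    by rewrite -[X in _ <= X]mulrA mulKf // gt_eqF.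
  apply: ler_pM => //.
  - by rewrite mulr_ge0 // invr_ge0 ltW.
  - by rewrite mulr_ge0 // ltW.
  - by rewrite ler_pM2l // ler_pM2l.
apply: le_trans (lerD LB SB).
have U0 : 0 <= \sum_(i | P i && big i) u i by apply: sumr_ge0.
have W0 : 0 <= \sum_(i | P i && ~~ big i) u i ^+ r by apply: sumr_ge0 => i _; rewrite exprn_ge0.
rewrite -mulrDl ler_wpM2r //.
have [hW|hW] := leP h (\sum_(i | P i && ~~ big i) u i ^+ r).
  apply: ler_wpDl => //; rewrite ler_pdivlMr // mulrC; exact: le_trans hW.
apply: ler_wpDr; first by rewrite divr_ge0 // ltW.
apply: (le_trans VG); apply: le_trans (floor_root_sum r1 _); last by move=> i _; rewrite u0 u1.
by apply: floor_root_le => //; lra.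
Qed.

Hypothesis hp : forall n : nat, 0 <= p n <= 1.
Hypothesis hp0 : p n @[n --> \oo] --> (0 : R).
Hypothesis hmu : much_less (fun n : nat => ln n%:R) (mean_stars r p).
Variables (eps rho : R).
Hypothesis eps0 : 0 < eps.
Hypothesis rho0 : 0 < rho.
Hypothesis HR : n%:R * p n ^+ r @[n --> \oo] --> rho.

Lemma near_rho (a : R) : 0 < a -> \forall n \near \oo,
  rho - a <= n%:R * p n ^+ r /\ n%:R * p n ^+ r <= rho + a.
Proof.
move=> a0; have := HR; move/cvgrPdist_le => /(_ _ a0); apply: filterS => n.
by rewrite ler_distlC => /andP[].
Qed.

Lemma near_rho_ge : \forall n \near \oo, rho / 2 <= n%:R * p n ^+ r.
Proof.
have h : 0 < rho / 2 by rewrite divr_gt0.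
by apply: filterS (near_rho h) => n [? _]; lra.
Qed.

Lemma near_lnV_ge (C a : R) : 0 < a ->
  \forall n \near \oo, (1 - a) * (ln n%:R / r%:R) + C <= ln (p n)^-1.
Proof.
move=> a0; have rr0 : 0 < r%:R :> R by rewrite ltr0n ltnW.
near=> n; have pn : 0 < p n by near: n; exact: (near_p_gt0 r1 hp hmu).
have n0 : (0 < n)%N by near: n; exact: nbhs_infty_gt.
have nR : 0 < n%:R :> R by rewrite ltr0n.
have [_ Hrho] : rho - rho <= n%:R * p n ^+ r /\ n%:R * p n ^+ r <= rho + rho.
  by near: n; exact: near_rho.
have L1 : (ln (rho + rho) / r%:R + C) * (r%:R / a) <= ln n%:R by near: n; exact: near_ln.
have H : ln n%:R - r%:R * ln (p n)^-1 <= ln (rho + rho).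
  rewrite lnV ?posrE // mulrN opprK mulr_natl -lnXn // -lnM ?posrE ?exprn_gt0 //.
  by rewrite ler_ln ?posrE ?addr_gt0 ?mulr_gt0 ?exprn_gt0.
have : ln n%:R / r%:R - ln (p n)^-1 <= ln (rho + rho) / r%:R.
  by rewrite ler_pdivlMr // mulrBl divfK ?gt_eqF // [ln (p n)^-1 * _]mulrC.
have : ln (rho + rho) / r%:R + C <= a * (ln n%:R / r%:R).
  have -> : a * (ln n%:R / r%:R) = ln n%:R / (r%:R / a) by field; rewrite !gt_eqF.
  by rewrite ler_pdivlMr // divr_gt0.
lra.
Unshelve. all: by end_near. Qed.

Let b0 : 0 < rho / 2. Proof. by rewrite divr_gt0. Qed.

Local Ltac goal_lra := clear -r1 hp hp0 hmu eps0 rho0 HR b0; lra.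

(** The constant de separates the degrees that are comparable with n from smaller ones. It
is so small that the latter either carry a negligible number of stars or are more expensive
than the full vertices. *)
Lemma full_vertices_regime_upper (et : R) : 0 < et -> et < 1 ->
  \forall n \near \oo, tail_prob r p eps n <=
    expR (- ((1 - et) * (r%:R^-1 * floor_root r (eps * rho) * (n%:R * ln n%:R)))).
Proof.
move=> et0 et1; have rr0 : 0 < r%:R :> R by rewrite ltr0n ltnW.
pose s : R := eps * rho; have s0 : 0 < s by rewrite mulr_gt0.
pose G := floor_root r s; have G0 : 0 < G by exact: floor_root_gt0.
pose a : R := et / 16; have a0 : 0 < a by rewrite divr_gt0.
have a1 : a <= 16^-1 by rewrite /a ler_pdivrMr // mulVf //; lra.
pose h' : R := Num.min 1 ((a * G) ^+ r) / 2.
have m0 : 0 < Num.min 1 ((a * G) ^+ r) by rewrite lt_min ltr01 exprn_gt0 // mulr_gt0.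
have h'0 : 0 < h' by rewrite divr_gt0.
have h'1 : 2 * h' <= 1 by rewrite /h' mulrC divfK // ge_min lexx.
have h'2 : nroot r (2 * h') <= a * G.
  apply: nroot_leX => //; [exact: mulr_ge0 (ler0n _ 2) (ltW h'0)|exact: mulr_ge0 (ltW a0) (ltW G0)|].
  by rewrite /h' [2 * _]mulrC divfK // ge_min lexx orbT.
pose V := (1 - a) * G.
have a10 : 0 < 1 - a by lra.
have V0 : 0 < V by rewrite mulr_gt0.
have VG : V <= floor_root r (s - 2 * h').
  have := @floor_root_sub R r r1 s (2 * h'); rewrite h'1 mulr_ge0 ?(ltW h'0) // => /(_ isT).
  by rewrite /V -/G; lra.
pose de : R := Num.min 1 (h' / V).
have de0 : 0 < de by rewrite lt_min ltr01 divr_gt0.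
have de1 : de <= 1 by rewrite ge_min lexx.
have deV : de * V <= h' by rewrite -ler_pdivlMr // ge_min lexx orbT.
pose k : R := h' / (4 * s + 4 * eps + 4 * rho + 4); have den0 : 0 < 4 * s + 4 * eps + 4 * rho + 4.
  by rewrite (addr_gt0 (addr_gt0 (addr_gt0 (mulr_gt0 _ s0) (mulr_gt0 _ eps0)) (mulr_gt0 _ rho0))).
have k0 : 0 < k by rewrite divr_gt0.
pose h : R := Num.min (Num.min a k) (Num.min eps rho).
have h0 : 0 < h by rewrite !lt_min a0 k0 eps0.
have ha : h <= a by rewrite !ge_min lexx.
have hk : h <= k by rewrite !ge_min lexx orbT.
have heps : h <= eps by rewrite !ge_min lexx !orbT.
have hrho : h <= rho by rewrite !ge_min lexx !orbT.
have h2 : 2 * h <= 1 by lra.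
have hs : h * (4 * s + 4 * eps + 4 * rho + 4) <= h' by rewrite -ler_pdivlMr.
have g0 := dense_gap_gt0 r1 h0.
have [Y0 [Y00 HY]] := cost_linear r1 g0.
have dc0 := dense_c_gt0 r1 h0.
have ph0 := phi_gt0 g0.
pose C : R := 2 / (h * phi (dense_gap r h)).
pose D : R := 2 * h * dense_c r h ^+ 2.
have D0 : 0 < D by rewrite mulr_gt0 ?exprn_gt0 // mulr_gt0.
have g10 : 0 < 1 + dense_gap r h by rewrite addr_gt0.
have HB := near_rho_ge.
near=> n.
have n0 : (0 < n)%N by near: n; exact: nbhs_infty_gt.
have pn : 0 < p n by near: n; exact: (near_p_gt0 r1 hp hmu).
have bulkd : bulk_prob r p h ((1 + dense_gap r h) * (n%:R * p n)) n <= 0.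
  by near: n; exact: near_bulk_dense.
have dC : C * ln n%:R <= n%:R * p n by near: n; exact: (near_dense_ineq r1 hp b0 HB).
have dD : (4 * G + 4) / D * ln n%:R <= n%:R * p n by near: n; exact: (near_dense_ineq r1 hp b0 HB).
have nD : 4 / D <= n%:R by near: n; exact: near_natr.
have lnpn : ln (p n)^-1 <= ln n%:R by near: n; exact: (near_lnV_le r1 hp hmu b0 HB).
have clo : (1 - a) * (ln n%:R / r%:R) + (1 - ln de) <= ln (p n)^-1.
  by near: n; exact: near_lnV_ge.
have Ln1 : 1 + r%:R * (2 / (8 * a * G)) <= ln n%:R by near: n; exact: near_ln.
have pg : p n <= (1 + dense_gap r h)^-1.
  by near: n; apply: near_p_le => //; rewrite invr_gt0.
have pY : p n <= de / Y0 by near: n; apply: near_p_le => //; rewrite divr_gt0.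
have [rlo rhi] : rho - h <= n%:R * p n ^+ r /\ n%:R * p n ^+ r <= rho + h.
  by near: n; exact: near_rho.
have mlo : (1 - h) * (n%:R * (n%:R * p n) ^+ r) <= r`!%:R * mu_stars n r (p n).
  by near: n; exact: near_mu_lo.
have nR : 0 < n%:R :> R by rewrite ltr0n.
have n1 : 1 <= n%:R :> R by rewrite ler1n.
have d0 : 0 < n%:R * p n by rewrite mulr_gt0.
have eh : 0 <= eps - h.
  by rewrite subr_ge0.
set l := ln (p n)^-1 in lnpn clo.
have lE : ln (n%:R / (n%:R * p n)) = l by congr ln; field; rewrite !gt_eqF.
pose c := l + ln de - 1.
have cE : ln (de * n%:R / (n%:R * p n)) - 1 = c.
  rewrite /c -lE ln_div ?posrE ?mulr_gt0 // ln_div ?posrE // [ln (de * _)]lnM ?posrE //; ring.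
have L0 : 0 < ln n%:R :> R.
  apply: lt_le_trans Ln1; rewrite ltr_wpDr // mulr_ge0 ?(ltW rr0) // divr_ge0 //.
  by rewrite mulr_ge0 ?(ltW G0) // mulr_ge0 // ltW.
have cL : (1 - a) * (ln n%:R / r%:R) <= c by rewrite /c; move: clo; goal_lra.
have c0 : 0 <= c by apply: le_trans cL; rewrite mulr_ge0 ?(ltW a10) // divr_ge0 // ltW.
have cl : c <= l by rewrite /c; have := ln_le0 de1; goal_lra.
pose t := V * (n%:R * c).
have t0 : 0 <= t by rewrite mulr_ge0 ?(ltW V0) // mulr_ge0.
pose R3 := r%:R^-1 * G * (n%:R * ln n%:R).
have R30 : 0 < R3 by rewrite mulr_gt0 // mulr_gt0 // invr_gt0.
have tR : (1 - 2 * a) * R3 <= t.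
  apply: (@le_trans _ _ ((1 - a) ^+ 2 * R3)).
    by rewrite ler_wpM2r ?(ltW R30) // bernoulli ?(ltW a0) // (le_trans a1) // invf_le1 // ler1n.
  have -> : (1 - a) ^+ 2 * R3 = V * (n%:R * ((1 - a) * (ln n%:R / r%:R))).
    by rewrite /R3 /V; ring.
  by rewrite /t ler_wpM2l ?(ltW V0) // ler_wpM2l // ltW.
have R3a : 2 <= 8 * a * R3.
  have aG : 0 < 8 * a * G by rewrite mulr_gt0 // mulr_gt0.
  have q : r%:R * (2 / (8 * a * G)) <= ln n%:R by move: Ln1; goal_lra.
  rewrite (_ : 8 * a * R3 = (8 * a * G / r%:R * ln n%:R) * n%:R); last by rewrite /R3; ring.
  rewrite -[leLHS]mulr1; apply: ler_pM => //.
  rewrite -ler_pdivrMl ?divr_gt0 //; apply: le_trans q; rewrite le_eqVlt; apply/orP; left; apply/eqP.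
  by field; rewrite !gt_eqF.
have tfin : (1 - et) * R3 + 2 <= (1 - 2 * h) * t.
  apply: (@le_trans _ _ ((1 - 2 * a) * ((1 - 2 * a) * R3))); last first.
    apply: ler_pM => //.
    - by move: a1; goal_lra.
    - by rewrite mulr_ge0 ?(ltW R30) //; move: a1; goal_lra.
    - by move: ha; goal_lra.
  have aa : 0 <= a * a * R3 by rewrite mulr_ge0 ?(ltW R30) // mulr_ge0 // ltW.
  have -> : (1 - et) * R3 = R3 - 16 * a * R3 by rewrite /a; field.
  have : 0 < a * R3 by rewrite mulr_gt0.
  by move: aa R3a; goal_lra.
have gx : (1 + dense_gap r h) * (n%:R * p n) <= n%:R.
  by rewrite mulrCA ler_piMr ?(ltW nR) // mulrC -ler_pdivlMr // mul1r.
have Yx : Y0 * (n%:R * p n) <= de * n%:R.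
  by rewrite mulrCA [leRHS]mulrC ler_pM2l // mulrC -ler_pdivlMr.
have tx : t + cost (n%:R * p n) n%:R <= D * (n%:R * (n%:R * p n)).
  have h1 : t + n%:R * l <= D / 4 * (n%:R * (n%:R * p n)).
    apply: (@le_trans _ _ ((G + 1) * (n%:R * ln n%:R))).
      rewrite mulrDl mul1r; apply: lerD; last by rewrite ler_pM2l.
      apply: ler_pM => //; rewrite ?(ltW V0) ?mulr_ge0 ?(ltW nR) //.
        by rewrite /V ler_piMl ?(ltW G0) // gerBl ltW.
      by rewrite ler_pM2l //; exact: le_trans lnpn.
    rewrite mulrCA [leRHS]mulrCA ler_pM2l // -ler_pdivrMl ?divr_gt0 //.
    rewrite (_ : (D / 4)^-1 * ((G + 1) * ln n%:R) = (4 * G + 4) / D * ln n%:R) //.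
    by field; rewrite !gt_eqF.
  have h4 : n%:R * p n <= D / 4 * (n%:R * (n%:R * p n)).
    by rewrite mulrA ler_peMl ?(ltW d0) // -ler_pdivrMl ?divr_gt0 // mulr1 invf_div.
  have -> : D * (n%:R * (n%:R * p n)) = 4 * (D / 4 * (n%:R * (n%:R * p n))) by field.
  rewrite /cost lE; move: h1 h4 nR d0; clear -r1 hp hp0 hmu eps0 rho0 HR b0; move: (D / 4 * _) => x; lra.
apply: le_trans (dense_upper r1 hp (x1 := n) n0 pn h0 h2 bulkd dC gx (leqnn n) t0 tx _) _.
  move=> x xn xM.
  rewrite (eq_bigr (fun i => cost (n%:R * p n) (x i)%:R)); last first.
    by move=> i _; rewrite (minn_idPl (ltnW (xn i))).
  pose s' := r`!%:R * ((eps - h) * mu_stars n r (p n)) / n%:R ^+ r.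
  have nr0 : 0 < n%:R ^+ r :> R by rewrite exprn_gt0.
  have s's : s - 2 * h' <= s' - h'.
    have : (eps - h) * ((1 - h) * (rho - h)) <= s'.
      rewrite /s' [r`!%:R * _]mulrCA -[leRHS]mulrA ler_wpM2l // ler_pdivlMr //; apply: le_trans mlo.
      rewrite -mulrA ler_wpM2l ?subr_ge0 //; first by move: (h2) (h0); goal_lra.
      by rewrite exprMn mulrCA [leRHS]mulrC ler_wpM2r // ltW.
    have : 0 <= (eps - h) * (h * h) by rewrite !mulr_ge0 // ltW.
    have : 0 <= h * h * (rho + 1) by rewrite !mulr_ge0 ?(ltW h0) ?addr_ge0 // ltW.
    have : 0 < h * s by rewrite mulr_gt0.
    have : 0 < h * eps by rewrite mulr_gt0.
    have : 0 < h * rho by rewrite mulr_gt0.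
    by rewrite -/s in hs *; move: hs; rewrite /s; clear -r1 hp hp0 hmu eps0 rho0 HR b0; nra.
  apply: (sum_cost_floor_root (s := s') n0 d0 de0 de1 c0 _ HY Yx xn _ _ deV _ (ltW V0)).
  - by rewrite cE.
  - by move=> i; apply: lt_le_trans; rewrite mulr_gt0.
  - by rewrite /s' divfK ?gt_eqF // ler_wpM2l.
  - exact: le_trans VG (floor_root_le r1 s's).
by rewrite -/s -/G -/R3 ler_expR; move: tfin; goal_lra.
Unshelve. all: by end_near. Qed.

End FullVertices.

(** * Upper bound: the Poisson regime *)

Section SparseRegime.
Context {R : realType}.
Variables (r : nat) (p : nat -> R).
Hypothesis r1 : (1 < r)%N.

Lemma sum_dcost_ge (n K : nat) (d l : R) (x : 'I_n -> nat) : 0 < d -> (0 < K)%N ->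
  l <= ln (K%:R / d) - 1 -> (forall i, x i != 0%N -> K%:R <= (x i)%:R :> R) ->
  (\sum_i x i)%N%:R * l <= \sum_i dcost d (x i).
Proof.
move=> d0 K0 lK xK; rewrite natr_sum mulr_suml; apply: ler_sum => i _; rewrite /dcost.
case: ifPn => [/eqP->|xi]; first by rewrite mul0r.
have KR : 0 < K%:R :> R by rewrite ltr0n.
have x0 := lt_le_trans KR (xK i xi).
have lx : l <= ln ((x i)%:R / d) - 1.
  apply: (le_trans lK); rewrite lerD2r ler_ln ?posrE ?divr_gt0 //.
  by rewrite ler_pM2r ?invr_gt0 // xK.
have := ler_wpM2l (ltW x0) lx; rewrite /cost; lra.
Qed.

(** By superadditivity of x ^ r, a given total degree carries the most stars when it is
concentrated on one vertex. *)
Lemma nroot_sum_bin_le (n : nat) (x : 'I_n -> nat) :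
  nroot r (r`!%:R * (\sum_i 'C(x i, r))%N%:R) <= (\sum_i x i)%N%:R :> R.
Proof.
apply: nroot_leX => //.
rewrite -natrX -natrM ler_nat big_distrr /=.
elim/big_rec2: _ => [|i y z _ yz]; first by [].
apply: (leq_trans (leq_add (leqnn _) yz)).
rewrite mulnC bin_ffact; apply: (leq_trans (leq_add (ffact_le_expn _ _) (leqnn _))).
rewrite -(ler_nat R) natrD !natrX natrD addrC [(x i)%:R + _]addrC exprD_ge //.
exact: ltnW.
Qed.

(** A configuration of large degrees carries a share de of the mean at a price of at least
nroot r de * (rt * (ln n / r)); the rest of the excess has to come from isolated stars, whose
number has Poisson tails.  This is the optimisation problem in the definition of the rate. *)
Lemma sparse_config_cost (n K b : nat) (q eps I eta u l L : R) (x : 'I_n -> nat) :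
  let mu := mu_stars n r q in let d := n%:R * q in
  let Y de := nroot r de * (nroot r (r`!%:R * mu) * (L / r%:R)) in
  0 < mu -> 0 < d -> (0 < K)%N -> 0 < eps -> 0 < I -> 0 < eta -> 0 <= u -> 2 * u <= 1 -> 0 <= L ->
  (1 - u) * (L / r%:R) <= l -> I * K%:R ^+ r / eta <= l -> l <= ln (K%:R / d) - 1 ->
  (forall de, 0 <= de -> de <= eps -> (1 - eta) * I * mu <= phi (eps - de) * mu + Y de) ->
  K%:R ^+ r * b%:R <= eta * mu -> eta * (I + 2 * ln (1 + eps)) <= u * I ->
  (forall i, x i != 0%N -> (K <= x i)%N) -> \sum_i dcost d (x i) <= I * mu ->
  exists2 s : R, 0 <= s & (1 - 4 * u) * (I * mu) <= (1 - 2 * u) * (\sum_i dcost d (x i)) +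
          needed_stars r q eps K b x * ln (1 + s) - s * mu.
Proof.
move=> mu d Y mu0 d0 K0 eps0 I0 eta0 u0 u1 L0 lu lI lK HI bK etaI xK St.
have rr0 : 0 < r%:R :> R by rewrite ltr0n ltnW.
have KR : 0 < K%:R :> R by rewrite ltr0n.
set S := \sum_i dcost d (x i) in St *.
pose X : R := (\sum_i x i)%N%:R.
have XS : X * l <= S.
  by apply: (sum_dcost_ge d0 K0 lK) => i xi; rewrite ler_nat xK.
have X0 : 0 <= X by rewrite /X.
have XK : K%:R ^+ r * X <= eta * mu.
  have := le_trans XS St; have := ler_wpM2l X0 lI => h1 /(le_trans h1).
  have -> : X * (I * K%:R ^+ r / eta) = I / eta * (K%:R ^+ r * X) by ring.
  by rewrite -ler_pdivlMl ?divr_gt0 // invf_div mulrA divfK ?gt_eqF.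
pose N : R := (\sum_i 'C(x i, r))%N%:R; pose de := N / mu.
have N0 : 0 <= N by rewrite /N.
have de0 : 0 <= de by rewrite divr_ge0 // ltW.
have rfm : 0 <= r`!%:R * mu by rewrite mulr_ge0 // ltW.
have deX : nroot r de * nroot r (r`!%:R * mu) <= X.
  rewrite -nrootM // (_ : de * _ = r`!%:R * N); first exact: nroot_sum_bin_le.
  by rewrite /de; field; rewrite gt_eqF.
have SY : (1 - u) * Y de <= S.
  apply: le_trans XS; apply: (@le_trans _ _ (X * ((1 - u) * (L / r%:R)))); last by rewrite ler_wpM2l.
  have LR : 0 <= L / r%:R by rewrite divr_ge0 // ltW.
  rewrite /Y [X * _]mulrCA ler_wpM2l //.
    by move: u1; clear -r1; lra.
  by rewrite mulrA ler_wpM2r.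
pose ee : R := 2 * eta * ln (1 + eps).
have le0 : 0 <= ln (1 + eps) by rewrite ln_ge0 // lerDl ltW.
have ee0 : 0 <= ee by rewrite mulr_ge0 // mulr_ge0 // ltW.
have u10 : 0 <= 1 - u by move: u1; clear -r1; lra.
have u20 : 0 <= 1 - 2 * u by rewrite subr_ge0.
have fin Q : (1 - eta) * I * mu - ee * mu <= Q ->
    (1 - 4 * u) * (I * mu) <= (1 - 2 * u) * ((1 - u) * Q).
  move=> HQ; apply: le_trans (ler_wpM2l u20 (ler_wpM2l u10 HQ)).
  apply: (@le_trans _ _ ((1 - 2 * u) * ((1 - u) * ((1 - u) * (I * mu))))); last first.
    rewrite ler_wpM2l // ler_wpM2l //.
    have := ler_wpM2r (ltW mu0) etaI; rewrite /ee; clear -r1; lra.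
  have Im : 0 <= I * mu by rewrite mulr_ge0 // ltW.
  rewrite mulrA mulrA ler_wpM2r //.
  have : 0 <= u * u * (2 - 2 * u + 3) by rewrite mulr_ge0 ?mulr_ge0 //; move: u1; clear -r1; lra.
  have -> : (1 - 2 * u) * (1 - u) * (1 - u) = 1 - 4 * u + u * u * (2 - 2 * u + 3) by ring.
  by clear -r1; lra.
have [dee|dee] := leP de eps; last first.
  exists 0 => //; rewrite addr0 ln1 mulr0 mul0r subr0 addr0.
  apply: (le_trans (fin (Y eps) _)).
    have := HI eps (ltW eps0) (lexx _); rewrite subrr phi0 mul0r add0r.
    by apply: le_trans; rewrite gerBl mulr_ge0 // ltW.
  rewrite ler_wpM2l //; apply: le_trans SY; rewrite ler_wpM2l // /Y ler_wpM2r //.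
    by rewrite mulr_ge0 ?nroot_ge0 // divr_ge0 // ltW.
  by apply: nroot_le; rewrite ?ltW.
pose e : R := Num.max 0 (eps - de - 2 * eta).
have e0 : 0 <= e by rewrite le_max lexx.
have ele : e <= eps - de by rewrite ge_max subr_ge0 dee gerBl mulr_ge0 // ltW.
have ege : eps - de - 2 * eta <= e by rewrite le_max lexx orbT.
have lne : 0 <= ln (1 + e) by rewrite ln_ge0 // lerDl.
exists e => //.
have [_ ph] := phi_incr e0 ele.
have phe : phi (eps - de) - phi e <= ee.
  apply: (le_trans ph); rewrite /ee; apply: ler_pM.
  - by rewrite subr_ge0.
  - by rewrite ln_ge0 // lerDl subr_ge0.
  - by move: ege; clear -r1; lra.
  - rewrite ler_ln ?posrE; [|by rewrite ltr_wpDr // subr_ge0|by rewrite addr_gt0].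
    by rewrite lerD2l gerBl.
have need : phi e * mu <= needed_stars r q eps K b x * ln (1 + e) - e * mu.
  have -> : phi e * mu = (1 + e) * mu * ln (1 + e) - e * mu by rewrite /phi; ring.
  rewrite lerD2r; have [ez|ez] := leP (eps - de - 2 * eta) 0.
    have -> : e = 0 by rewrite /e; apply/max_idPl.
    by rewrite addr0 ln1 !mulr0.
  have eE : e = eps - de - 2 * eta by rewrite /e; apply/max_idPr/ltW.
  rewrite ler_wpM2r // /needed_stars -/mu natrD -/N natrM natrX natrD -/X mulrDr eE.
  have -> : N = de * mu by rewrite /de divfK // gt_eqF.
  by move: XK bK; clear -r1; lra.
apply: (@le_trans _ _ ((1 - 2 * u) * ((1 - u) * (Y de + phi e * mu)))).
  apply: fin; have := HI de de0 dee; have := ler_wpM2r (ltW mu0) phe.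
  by clear -r1; lra.
have pm : 0 <= phi e * mu by rewrite mulr_ge0 ?phi_ge0 // ltW.
rewrite -addrA; apply: (@le_trans _ _ ((1 - 2 * u) * S + phi e * mu)); last by rewrite lerD2l.
rewrite mulrDr mulrDr; apply: lerD; first by rewrite ler_wpM2l.
rewrite mulrA ler_piMl //.
have : 0 <= u * (3 - 2 * u) by rewrite mulr_ge0 //; move: u1; clear -r1; lra.
by clear -r1; lra.
Qed.

Hypothesis hp : forall n : nat, 0 <= p n <= 1.
Hypothesis hp0 : p n @[n --> \oo] --> (0 : R).
Hypothesis hmu : much_less (fun n : nat => ln n%:R) (mean_stars r p).
Variable C : R.
Hypothesis C0 : 0 < C.
(* The mean is at most of order log n ^ (r / (r - 1)). *)
Hypothesis HM : \forall n \near \oo, mu_stars n r (p n) <= C * (rt r p n * ln n%:R).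

Definition log_const : R := C ^+ r * r`!%:R.

Lemma near_mu_log : \forall n \near \oo, mu_stars n r (p n) <= log_const * ln n%:R ^+ r.
Proof.
near=> n.
have m1 : 1 <= mu_stars n r (p n) by near: n; exact: near_mu_ge.
have M : mu_stars n r (p n) <= C * (rt r p n * ln n%:R) by near: n; exact: HM.
set m := mu_stars n r (p n) in m1 M *.
have m0 : 0 < m by lra.
have mm : m * m <= m ^+ r by rewrite -expr2 ler_weXn2l.
rewrite -(ler_pM2r m0); apply: (le_trans mm).
have : m ^+ r <= (C * (rt r p n * ln n%:R)) ^+ r.
  by rewrite lerXn2r ?nnegrE ?(ltW m0) // (le_trans (ltW m0)).
move=> /le_trans; apply; rewrite !exprMn rtK // -/m /log_const.
by rewrite le_eqVlt; apply/orP; left; apply/eqP; ring.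
Unshelve. all: by end_near. Qed.

Lemma log_const_gt0 : 0 < log_const.
Proof. by rewrite mulr_gt0 ?exprn_gt0 // ltr0n fact_gt0. Qed.

(** Up to logarithmic factors the mean degree is at most n ^ (- 1 / r). *)
Lemma near_lnd (a A : R) : 0 < a ->
  \forall n \near \oo, (1 - a) * (ln n%:R / r%:R) + A <= ln (n%:R * p n)^-1.
Proof.
move=> a0; have rr0 : 0 < r%:R :> R by rewrite ltr0n ltnW.
have lc0 := log_const_gt0.
have rf : 0 < r`!%:R :> R by rewrite ltr0n fact_gt0.
pose Q := 2 * r`!%:R * log_const; have Q0 : 0 < Q by exact: mulr_gt0 (mulr_gt0 (ltr0n _ 2) rf) lc0.
have a20 : 0 < a / (2 * r%:R) by rewrite divr_gt0 // mulr_gt0.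
have h20 : 0 < 2^-1 :> R by rewrite invr_gt0.
have [Y0 [_ HY]] := ln_le_small a20.
near=> n.
have pn : 0 < p n by near: n; exact: (near_p_gt0 r1 hp hmu).
have n0 : (0 < n)%N by near: n; exact: nbhs_infty_gt.
have M : mu_stars n r (p n) <= log_const * ln n%:R ^+ r by near: n; exact: near_mu_log.
have mlo : (1 - 2^-1) * (n%:R * (n%:R * p n) ^+ r) <= r`!%:R * mu_stars n r (p n).
  by near: n; exact: near_mu_lo.
have L0 : 1 <= ln n%:R :> R by near: n; exact: near_ln.
have LY : Y0 <= ln n%:R by near: n; exact: near_ln.
have LQ : (ln Q / r%:R + A) * (2 * r%:R / a) <= ln n%:R by near: n; exact: near_ln.
have nR : 0 < n%:R :> R by rewrite ltr0n.
have d0 : 0 < n%:R * p n by rewrite mulr_gt0.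
set d := n%:R * p n in mlo d0 *; set L := ln n%:R in L0 LY LQ M *.
have Lp : 0 < L by lra.
have nQ : n%:R * d ^+ r <= Q * L ^+ r.
  have -> : Q * L ^+ r = 2 * (r`!%:R * (log_const * L ^+ r)) by rewrite /Q; ring.
  have := ler_wpM2l (ltW rf) M; move: mlo; lra.
have : ln (n%:R * d ^+ r) <= ln (Q * L ^+ r).
  by rewrite ler_ln ?posrE ?mulr_gt0 ?exprn_gt0.
have dr0 : 0 < d ^+ r by exact: exprn_gt0.
have Lr0 : 0 < L ^+ r by exact: exprn_gt0.
rewrite (lnM (x := n%:R)) ?posrE // (lnM (x := Q)) ?posrE // (lnXn r d0) (lnXn r Lp) -/L.
rewrite -[ln d *+ r]mulr_natr -[ln L *+ r]mulr_natr => H.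
have H2 : L / r%:R + ln d <= ln Q / r%:R + ln L.
  rewrite -(ler_pM2r rr0) !mulrDl !divfK ?gt_eqF //.
have H3 : ln L <= a / (2 * r%:R) * L by exact: HY.
have H4 : ln Q / r%:R + A <= a / (2 * r%:R) * L.
  have -> : a / (2 * r%:R) * L = L / (2 * r%:R / a) by field; rewrite !gt_eqF.
  by rewrite ler_pdivlMr // divr_gt0 // mulr_gt0.
have E : (1 - a) * (L / r%:R) = L / r%:R - 2 * (a / (2 * r%:R) * L) by field; rewrite gt_eqF.
rewrite E [ln d^-1]lnV ?posrE //; move: H2 H3 H4; clear -r1 hp hp0 hmu C0 HM; lra.
Unshelve. all: by end_near. Qed.

(** The expected number of flawed vertices is of order d mu, and d is at most a negative
power of n: a small multiple of mu of them is as unlikely as required. *)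
Lemma near_flawed (K : nat) (A e : R) : (0 < K)%N -> 0 <= A -> 0 < e ->
  \forall n \near \oo, exists b : nat, b%:R <= e * mu_stars n r (p n) /\
    gnp_prob (p n) (fun G : {set {set 'I_n}} => b < #|[set v | flawed r K G v]%SET|)%N <=
    expR (- (A * mu_stars n r (p n))).
Proof.
move=> K0 A0 e0; have rr0 : 0 < r%:R :> R by rewrite ltr0n ltnW.
have a0 : 0 < 2^-1 :> R by rewrite invr_gt0.
pose e1 := e / (r.+3 * K)%:R; have q0 : 0 < (r.+3 * K)%:R :> R by rewrite ltr0n muln_gt0.
have e10 : 0 < e1 by rewrite divr_gt0.
near=> n.
have pn : 0 < p n by near: n; exact: (near_p_gt0 r1 hp hmu).
have n0 : (0 < n)%N by near: n; exact: nbhs_infty_gt.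
have m1 : 2 / e1 <= mu_stars n r (p n) by near: n; exact: near_mu_ge.
have ld : (1 - 2^-1) * (ln n%:R / r%:R) + (2 / e1 * (r.+1%:R + A)) <= ln (n%:R * p n)^-1.
  by near: n; exact: near_lnd.
have L0 : 0 <= ln n%:R :> R by near: n; exact: near_ln.
have d0 : 0 < n%:R * p n by rewrite mulr_gt0 ?ltr0n.
set d := n%:R * p n in d0 ld; set m := mu_stars _ _ _ in m1 *.
have m0 : 0 < m by apply: lt_le_trans m1; rewrite divr_gt0.
pose k := Num.truncn (e1 * m).
have em0 : 0 <= e1 * m by rewrite mulr_ge0 // ltW.
have /andP[k1 k2] := truncn_itv em0; rewrite -/k in k1 k2.
exists (r.+3 * K * k)%N; split.
  by rewrite natrM mulrC -ler_pdivlMr // mulrAC -/e1.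
have hp1 : 0 < p n <= 1 by rewrite pn; case/andP: (hp n).
have s0 : 0 <= d^-1 by rewrite invr_ge0 ltW.
have := @flawed_tail n r K R (p n) hp1 k _ s0 K0.
rewrite -/d -/m => F.
apply: (@le_trans _ _ (gnp_prob (p n) (fun G : {set {set 'I_n}} =>
   r.+3 * K * k <= #|[set v | flawed r K G v]%SET|)%N)).
  by apply: gnp_prob_le; rewrite ?hp // => G _; exact: ltnW.
have w0 : 0 < (1 + d^-1) ^+ k by rewrite exprn_gt0 // ltr_wpDr.
move: F; rewrite -ler_pdivlMr // => /le_trans; apply.
rewrite ler_pdivrMr // -[(1 + d^-1) ^+ k]lnK ?posrE // -expRD ler_expR lnXn ?ltr_wpDr //.
have -> : d^-1 * (r.+1%:R * d * m) = r.+1%:R * m by field; rewrite gt_eqF.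
have ldd : 2 / e1 * (r.+1%:R + A) <= ln (1 + d^-1).
  apply: (@le_trans _ _ (ln d^-1)).
    apply: le_trans ld; rewrite lerDr mulr_ge0 ?divr_ge0 ?(ltW rr0) //; lra.
  by rewrite ler_ln ?posrE ?ltr_wpDr ?invr_gt0 // lerDr.
have kR : e1 * m / 2 <= k%:R.
  have : 2 <= e1 * m by rewrite -ler_pdivrMl // mulrC.
  by move: k2; rewrite -natr1; clear -r1 hp hp0 hmu C0 HM; lra.
rewrite -mulr_natl; have B0 : 0 <= 2 / e1 * (r.+1%:R + A).
  by rewrite mulr_ge0 ?divr_ge0 ?addr_ge0 // ltW.
have : (r.+1%:R + A) * m <= k%:R * ln (1 + d^-1).
  apply: (@le_trans _ _ (e1 * m / 2 * (2 / e1 * (r.+1%:R + A)))).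
    by rewrite le_eqVlt; apply/orP; left; apply/eqP; field; rewrite gt_eqF.
  by apply: ler_pM => //; rewrite divr_ge0.
clear -r1 hp hp0 hmu C0 HM; lra.
Unshelve. all: by end_near. Qed.

Variables eps I : R.
Hypothesis eps0 : 0 < eps.
Hypothesis I0 : 0 < I.
Hypothesis HI : forall eta : R, 0 < eta -> \forall n \near \oo, forall de, 0 <= de -> de <= eps ->
  (1 - eta) * I * mu_stars n r (p n) <=
  phi (eps - de) * mu_stars n r (p n) + nroot r de * (rt r p n * (ln n%:R / r%:R)).

Local Ltac goal_lra := clear -r1 hp hp0 hmu C0 HM eps0 I0 HI; lra.

(** The threshold K for large degrees can be a constant: the mean degree is at most a
negative power of n, so that a degree K already costs a multiple of K ln n. *)
Lemma poisson_regime_upper (et : R) : 0 < et -> et < 1 ->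
  \forall n \near \oo, tail_prob r p eps n <=
    expR (- ((1 - et) * (I * mu_stars n r (p n)))).
Proof.
move=> et0 et1; have rr0 : 0 < r%:R :> R by rewrite ltr0n ltnW.
pose u : R := et / 16; have u0 : 0 < u by rewrite divr_gt0.
have u1 : u <= 16^-1 by rewrite /u ler_pdivrMr // mulVf //; lra.
have le0 : 0 <= ln (1 + eps) by rewrite ln_ge0 // lerDl ltW.
have den0 : 0 < I + 2 * ln (1 + eps) by rewrite ltr_wpDr // mulr_ge0.
pose eta : R := u * I / (I + 2 * ln (1 + eps)).
have eta0 : 0 < eta by rewrite divr_gt0 // mulr_gt0.
have etaI : eta * (I + 2 * ln (1 + eps)) <= u * I by rewrite /eta divfK // gt_eqF.
pose K := (Num.truncn (4 * r%:R / u)).+1.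
have K0 : (0 < K)%N by [].
have KR : 0 < K%:R :> R by [].
have Ku : 4 * r%:R <= u * K%:R.
  have q : 0 <= 4 * r%:R / u by exact: divr_ge0 (mulr_ge0 (ler0n _ 4) (ltW rr0)) (ltW u0).
  by rewrite [u * _]mulrC -ler_pdivrMr //; have /andP[_ /ltW] := truncn_itv q.
have KrR : 0 < K%:R ^+ r :> R by exact: exprn_gt0.
have eK0 : 0 < eta / K%:R ^+ r by rewrite divr_gt0.
pose lc := log_const; have lc0 : 0 < lc := log_const_gt0.
pose B : R := I * K%:R ^+ r / eta + (2 * u)^-1 + 2.
have u2V : 0 < (2 * u)^-1 by rewrite invr_gt0; exact: mulr_gt0 (ltr0n _ 2) u0.
have B1 : I * K%:R ^+ r / eta <= B - 1.
  by rewrite /B; move: u2V; lra.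
have B2 : (2 * u)^-1 <= B - 1.
  rewrite /B; have : 0 < I * K%:R ^+ r / eta := divr_gt0 (mulr_gt0 I0 KrR) eta0.
  lra.
have B3 : 1 <= B - 1.
  rewrite /B; move: u2V.
  have : 0 < I * K%:R ^+ r / eta := divr_gt0 (mulr_gt0 I0 KrR) eta0.
  lra.
pose x0c : R := I * lc + K%:R + 1.
have x0c0 : 0 < x0c by rewrite /x0c; have := mulr_gt0 I0 lc0; lra.
near=> n.
have pn : 0 < p n by near: n; exact: (near_p_gt0 r1 hp hmu).
have n0 : (0 < n)%N by near: n; exact: nbhs_infty_gt.
have m1 : 8 / (et * I) + 1 <= mu_stars n r (p n) by near: n; exact: near_mu_ge.
have mlog : mu_stars n r (p n) <= lc * ln n%:R ^+ r by near: n; exact: near_mu_log.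
have ld : (1 - u) * (ln n%:R / r%:R) + B <= ln (n%:R * p n)^-1.
  by near: n; exact: near_lnd.
have ro1 : 1 <= rt r p n by near: n; exact: (near_rt r1 hp hmu).
have L1 : 1 <= ln n%:R :> R by near: n; exact: near_ln.
have w2 : (3 * x0c) * ln n%:R ^+ r.+1 <= nroot r n%:R by near: n; exact: near_root.
have HIn : forall de, 0 <= de -> de <= eps -> (1 - eta) * I * mu_stars n r (p n) <=
  phi (eps - de) * mu_stars n r (p n) + nroot r de * (rt r p n * (ln n%:R / r%:R)).
  by near: n; exact: HI.
have [b [bm bP]] : exists b : nat, b%:R <= eta / K%:R ^+ r * mu_stars n r (p n) /\
    gnp_prob (p n) (fun G : {set {set 'I_n}} => b < #|[set v | flawed r K G v]%SET|)%N <=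
    expR (- (I * mu_stars n r (p n))).
  by near: n; apply: near_flawed => //; exact: ltW.
have rle := rt_le r1 hp n.
have [w1 wn] := nroot_nat (R := R) r1 n0.
have nR : 0 < n%:R :> R by rewrite ltr0n.
have d0 : 0 < n%:R * p n by rewrite mulr_gt0.
have pn1 : 0 < p n <= 1 by rewrite pn; case/andP: (hp n).
rewrite /tail_prob.
set m := mu_stars n r (p n) in m1 mlog HIn bm bP *.
have etI : 0 < 8 / (et * I) by rewrite divr_gt0 // mulr_gt0.
have m0 : 0 < m by move: m1 etI; goal_lra.
set d := n%:R * p n in ld rle d0 *.
set w := nroot r _ in w1 wn w2 rle *.
have w0 : 0 < w by apply: lt_le_trans w1.
set L := ln n%:R in ld L1 w2 HIn mlog *.
have Lp : 0 < L by apply: lt_le_trans L1.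
pose l := ln (K%:R / d) - 1.
have lE : ln d^-1 - 1 <= l.
  rewrite /l lerD2r ler_ln ?posrE ?divr_gt0 ?invr_gt0 //.
  by rewrite ler_peMl ?invr_ge0 ?(ltW d0) // ler1n.
have LR0 : 0 <= (1 - u) * (L / r%:R).
  by rewrite mulr_ge0 ?divr_ge0 ?(ltW Lp) ?(ltW rr0) //; move: u1; goal_lra.
have lB : (1 - u) * (L / r%:R) + (B - 1) <= l.
  by move: lE ld; goal_lra.
have lL : (1 - u) * (L / r%:R) <= l by move: lB B3; goal_lra.
have lB' : B - 1 <= l by move: lB LR0; goal_lra.
have l1 : 1 <= l by apply: le_trans lB'.
have d1 : d <= 1.
  rewrite leNgt; apply/negP => d1; have : ln d^-1 < 0.
    by rewrite lnV ?posrE // oppr_lt0 ln_gt0.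
  by move: ld LR0 B3; goal_lra.
have costK x : K%:R <= x -> x * l <= cost d x.
  move=> Kx; have x0 : 0 < x by apply: lt_le_trans Kx.
  have lx : l <= ln (x / d) - 1.
    rewrite /l lerD2r ler_ln ?posrE ?divr_gt0 //.
    by rewrite ler_pM2r ?invr_gt0.
  by have := ler_wpM2l (ltW x0) lx; rewrite /cost; move: d0; goal_lra.
have cK := costK _ (lexx K%:R).
have K1 : 1 <= K%:R :> R by rewrite ler1n.
have cK1 : 1 <= cost d K%:R by apply: le_trans cK; rewrite mulr_ege1.
pose t := I * m; have t0 : 0 < t by rewrite mulr_gt0.
pose x1 := (Num.truncn t + K)%N.+1.
have /andP[tr1 tr2] := truncn_itv (ltW t0).
have tx : t <= x1%:R.
  by apply/ltW/(lt_le_trans tr2); rewrite ler_nat ltnS leq_addr.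
have Kx1 : (K <= x1)%N by rewrite leqW // leq_addl.
have Lr1 : 1 <= L ^+ r by rewrite exprn_ege1.
have xL : x1%:R <= x0c * L ^+ r.
  rewrite /x1 -natr1 natrD /x0c.
  have : t <= I * lc * L ^+ r by rewrite /t -mulrA ler_wpM2l // ltW.
  have : K%:R <= K%:R * L ^+ r by rewrite ler_peMr.
  by move: tr1 Lr1; clear -r1 hp hp0 hmu C0 HM eps0 I0 HI; move: (L ^+ r) => z; lra.
have xL0 : 0 <= x0c * L ^+ r by rewrite mulr_ge0 ?(ltW x0c0) // exprn_ge0 // ltW.
have xw : 3 * (x0c * L ^+ r * L) <= w.
  by apply: le_trans w2; rewrite exprS le_eqVlt; apply/orP; left; apply/eqP; ring.
have xLL : x0c * L ^+ r <= x0c * L ^+ r * L by rewrite ler_peMr.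
have x1w : x1%:R <= w.
  by move: xL xw xLL xL0; goal_lra.
have wwn : w <= n%:R by apply: le_trans wn; rewrite expr2 ler_peMl // ltW.
have x1n : (x1 <= n)%N by rewrite -(ler_nat R) (le_trans x1w).
have wd : 1 <= w * d by apply: le_trans ro1 rle.
have x1R : 0 < x1%:R :> R by rewrite ltr0n.
have cx1 : cost d x1%:R <= x1%:R * (L + L) + 1.
  have : ln (x1%:R / d) <= L + L.
    rewrite /L -lnM ?posrE // ler_ln ?posrE ?divr_gt0 ?mulr_gt0 //.
    rewrite ler_pdivrMr //; apply: (le_trans x1w); apply: (@le_trans _ _ n%:R) => //.
    rewrite -mulrA ler_peMr ?(ltW nR) //; apply: (le_trans wd).
    by rewrite ler_wpM2r // ltW.
  move=> h1; have := ler_wpM2l (ltW x1R) h1; rewrite /cost.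
  by move: d1 x1R; goal_lra.
have wnd : w <= n%:R * d.
  apply: (@le_trans _ _ (w * (w * d))); first by rewrite ler_peMr // ltW.
  by rewrite mulrA ler_wpM2r ?(ltW d0) // -expr2.
have x01 : 1 <= x0c.
  by rewrite /x0c; have := mulr_gt0 I0 lc0; move: KR; goal_lra.
have tcw : t + cost d x1%:R <= n%:R * d.
  apply: le_trans wnd; apply: le_trans xw.
  have q1 : t + 1 <= x0c * L ^+ r.
    have : t <= I * lc * L ^+ r by rewrite /t -mulrA ler_wpM2l // ltW.
    have : 0 <= K%:R * L ^+ r by rewrite mulr_ge0 // (le_trans _ Lr1).
    by move: Lr1; rewrite /x0c; clear -r1 hp hp0 hmu C0 HM eps0 I0 HI; move: (L ^+ r) => z; lra.
  have := ler_wpM2r (ltW Lp) xL.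
  by move: q1 cx1 xLL; clear -r1 hp hp0 hmu C0 HM eps0 I0 HI; move: (x0c * L ^+ r) => z; lra.
have K2 : K%:R ^+ 2 * (t + cost d x1%:R) <= 2 * u * cost d K%:R ^+ 2 * (n%:R * d).
  have Kl0 : 0 <= K%:R * l by rewrite mulr_ge0 // (le_trans _ l1).
  have : (K%:R * l) ^+ 2 <= cost d K%:R ^+ 2.
    by rewrite ler_sqr ?nnegrE // (le_trans Kl0).
  have nd0 : 0 <= n%:R * d by rewrite mulr_ge0 // ltW.
  move=> h1; apply: (@le_trans _ _ (2 * u * (K%:R * l) ^+ 2 * (n%:R * d))); last first.
    by rewrite ler_wpM2r // ler_wpM2l // mulr_ge0 // ltW.
  rewrite (_ : 2 * u * (K%:R * l) ^+ 2 * (n%:R * d) = K%:R ^+ 2 * (2 * u * l ^+ 2 * (n%:R * d))); last by ring.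
  rewrite ler_wpM2l ?exprn_ge0 //; apply: (le_trans tcw); rewrite ler_peMl //.
  have u20 : 0 < 2 * u by rewrite mulr_gt0.
  rewrite -ler_pdivrMl // mulr1; apply: (le_trans (le_trans B2 lB')).
  by rewrite expr2 ler_peMr // (le_trans _ l1).
have nK : 2 * L <= u * cost d K%:R.
  apply: (@le_trans _ _ (u * (K%:R * l))); last by rewrite ler_wpM2l // ltW.
  apply: (@le_trans _ _ (u * (K%:R * (L / r%:R / 2)))); last first.
    rewrite ler_wpM2l ?(ltW u0) // ler_wpM2l //; apply: le_trans lL.
    rewrite mulrC ler_wpM2r ?divr_ge0 ?(ltW Lp) ?(ltW rr0) //.
    by move: u1; goal_lra.
  have -> : u * (K%:R * (L / r%:R / 2)) = u * K%:R * (L / r%:R / 2) by ring.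
  have -> : 2 * L = 4 * r%:R * (L / r%:R / 2) by field; rewrite gt_eqF.
  by rewrite ler_wpM2r // divr_ge0 // divr_ge0 // ltW.
have tc : t <= cost d x1%:R.
  apply: (le_trans tx); apply: le_trans (costK _ _); last by rewrite ler_nat.
  by rewrite ler_peMr // ltW.
have u2 : 2 * u <= 1 by move: u1; goal_lra.
have bK : K%:R ^+ r * b%:R <= eta * m.
  by rewrite mulrC -ler_pdivlMr // mulrAC.
have lI : I * K%:R ^+ r / eta <= l by apply: le_trans lB'.
apply: (le_trans (@sparse_upper R n r (p n) r1 n0 pn1 eps u t ((1 - 4 * u) * t) K x1 b
  (ltW u0) u2 (le_trans d1 K1) K0 Kx1 x1n (ltW t0) (lt_le_trans ltr01 cK1) nK K2 tc _)).
  move=> x xK St.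
  exact: (@sparse_config_cost n K b (p n) eps I eta u l L x m0 d0 K0 eps0 I0 eta0 (ltW u0) u2
    (ltW Lp) lL lI (lexx _) HIn bK etaI xK St).
have tm : 8 <= et * t.
  rewrite /t mulrA -ler_pdivrMl ?mulr_gt0 // mulrC.
  by move: m1; goal_lra.
have uE : et = 16 * u by rewrite /u; field.
apply: (@le_trans _ _ (3 * expR (1 - (1 - 4 * u) * t))).
  have e1 : expR (1 - (1 - 2 * u) * t) <= expR (1 - (1 - 4 * u) * t).
    by rewrite ler_expR; have := mulr_gt0 u0 t0; goal_lra.
  have e2 : expR (- t) <= expR (1 - (1 - 4 * u) * t).
    by rewrite ler_expR; have := mulr_gt0 u0 t0; goal_lra.
  by move: bP e1 e2; rewrite -/t; goal_lra.
apply: (@le_trans _ _ (expR 2 * expR (1 - (1 - 4 * u) * t))).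
  by rewrite ler_wpM2r ?expR_ge0 //; have := @expR_ge1Dx R 2; goal_lra.
rewrite -expRD ler_expR -/t.
by move: tm; rewrite uE; goal_lra.
Unshelve. all: by end_near. Qed.

End SparseRegime.

(** * Lower bounds by planting vertices of large degree *)

Section Plant.
Context {R : realType}.
Variables (r : nat) (q : R).
Hypothesis r1 : (1 < r)%N.
Hypothesis hq : 0 <= q <= 1.

Definition star_tail (z : R) (n : nat) : R :=
  gnp_prob q (fun G : {set {set 'I_n}} => z <= (nb_stars r G)%:R).

Lemma star_tail_ge0 z n : 0 <= star_tail z n.
Proof. exact: gnp_prob_ge0. Qed.

Lemma star_tail_le z z' n : z <= z' -> star_tail z' n <= star_tail z n.
Proof. by move=> zz; apply: gnp_prob_le => // G _; apply: le_trans. Qed.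

Let q0 : 0 <= q. Proof. by case/andP: hq. Qed.
Let q1 : q <= 1. Proof. by case/andP: hq. Qed.

Lemma peel_full (k N : nat) (z : R) :
  q ^+ (k * (k + N)) * star_tail z N <= star_tail (z + (k * 'C(N, r))%N%:R) (k + N).
Proof.
elim: k => [|k IH]; first by rewrite mul0n expr0 mul1r mul0n addr0.
have := @peel R (k + N)%N q r r1 hq (k + N)%N (z + (k * 'C(N, r))%N%:R).
rewrite binn mul1r subnn expr0 mulr1 => H.
have zz : z + (k.+1 * 'C(N, r))%N%:R <= z + (k * 'C(N, r))%N%:R + 'C(k + N, r)%:R.
  by rewrite -addrA -natrD lerD2l ler_nat mulSn addnC leq_add2l leq_bin2l // leq_addl.
apply: le_trans (star_tail_le (k + N).+1 zz); apply: le_trans H.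
apply: (@le_trans _ _ (q ^+ (k + N) * (q ^+ (k * (k + N)) * star_tail z N))).
  rewrite mulrA -exprD ler_wpM2r ?star_tail_ge0 //; apply: ler_wiXn2l => //.
  by rewrite addSn mulSn mulnS; lia.
by rewrite ler_wpM2l // exprn_ge0.
Qed.

(** A vertex of degree x and then k full vertices are joined to a random graph on N
vertices. *)
Lemma plant (k N x : nat) (z : R) :
  q ^+ (k * (k + N.+1)) * ('C(N, x)%:R * (q ^+ x * (1 - q) ^+ (N - x)) * star_tail z N) <=
  star_tail (z + 'C(x, r)%:R + (k * 'C(N, r))%N%:R) (k + N.+1).
Proof.
apply: (@le_trans _ _ (star_tail (z + 'C(x, r)%:R + (k * 'C(N.+1, r))%N%:R) (k + N.+1))); last first.
  by apply: star_tail_le; rewrite lerD2l ler_nat leq_mul // leq_bin2l.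
apply: le_trans (peel_full k N.+1 _).
by rewrite ler_wpM2l ?exprn_ge0 //; exact: peel.
Qed.

(** The number of stars is at most n ^ (r + 1), so that the probability of being near the
mean or above it is not smaller than a power of n. *)
Lemma crude_lower (h : R) (n : nat) : 0 <= h -> h <= 1 -> (0 < n)%N ->
  h * mu_stars n r q <= n%:R ^+ r.+1 * star_tail ((1 - h) * mu_stars n r q) n.
Proof.
move=> h0 h1 n0; set m := mu_stars n r q.
have m0 : 0 <= m by exact: mu_stars_ge0.
suff E : m <= (1 - h) * m + n%:R ^+ r.+1 * star_tail ((1 - h) * m) n by lra.
have E : gnp_expectation q (fun G : {set {set 'I_n}} => (nb_stars r G)%:R) = m by exact: gnp_nb_stars.
rewrite -[leLHS]E /star_tail gnp_probE -gnp_expectationZ.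
rewrite -[X in X + _](@gnp_expectation_cst R n q) -gnp_expectationD.
apply: gnp_expectation_le => // G GE.
case: (leP ((1 - h) * m) _) => [_|/ltW lt1]; last by rewrite mulr0 addr0.
have h10 : 0 <= 1 - h by rewrite subr_ge0.
rewrite mulr1; apply: (ler_wpDl (mulr_ge0 h10 m0)); rewrite -natrX ler_nat nb_starsE //.
apply: (@leq_trans (\sum_(v : 'I_n) n ^ r)); last by rewrite sum_nat_const card_ord expnS.
apply: leq_sum => v _; apply: (leq_trans (bin_le_expn _ _)).
by rewrite leq_exp2r ?(ltnW r1) // ltnW // degree_lt.
Qed.

Lemma mu_stars_le (N n : nat) : (N <= n)%N -> mu_stars N r q <= mu_stars n r q.
Proof.
move=> Nn; rewrite /mu_stars ler_wpM2r ?exprn_ge0 // -!natrM ler_nat leq_mul //.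
by rewrite leq_bin2l // -!subn1 leq_sub2r.
Qed.

Lemma expn_sub_ge (n j k : nat) : (j <= n)%N -> (0 < n)%N ->
  (1 - k%:R * j%:R / n%:R) * n%:R ^+ k <= ((n - j) ^ k)%:R :> R.
Proof.
move=> jn n0; have nR : 0 < n%:R :> R by rewrite ltr0n.
rewrite natrX natrB //.
have -> : n%:R - j%:R = (1 - j%:R / n%:R) * n%:R :> R by field; rewrite gt_eqF.
rewrite exprMn ler_wpM2r ?exprn_ge0 // -mulrA bernoulli ?divr_ge0 //.
by rewrite ler_pdivrMr // mul1r ler_nat.
Qed.

Lemma mu_stars_sub (n j : nat) : (j + r.+1 < n)%N ->
  (1 - r.+1%:R * (j + r.+1)%N%:R / n%:R) * mu_stars n r q <= mu_stars (n - j) r q.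
Proof.
move=> jn; have n0 : (0 < n)%N by exact: leq_ltn_trans jn.
have rf : 0 < r`!%:R :> R by rewrite ltr0n fact_gt0.
have [lt0|ge0] := leP 0 (1 - r.+1%:R * (j + r.+1)%N%:R / n%:R :> R); last first.
  apply: (@le_trans _ _ 0); last exact: mu_stars_ge0.
  by rewrite mulr_le0_ge0 ?mu_stars_ge0 // ltW.
rewrite -(ler_pM2l rf) mulrCA.
apply: (le_trans (ler_wpM2l lt0 (mu_stars_fact_le n r q0))).
have -> : n%:R * (n%:R * q) ^+ r = n%:R ^+ r.+1 * q ^+ r by rewrite exprMn exprS; ring.
rewrite mulrA /mu_stars mulrA ler_wpM2r ?exprn_ge0 //.
apply: (le_trans (expn_sub_ge r.+1 (ltnW jn) n0)).
rewrite -!natrM ler_nat mulnCA [(r`! * _)%N]mulnC bin_ffact expnS.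
apply: leq_mul; first by rewrite leq_sub2l // leq_addr.
apply: leq_trans (ffact_ge_expn _ _); rewrite leq_exp2r ?(ltnW r1) //; lia.
Qed.

Lemma bin_ge_expn (N x : nat) : (x <= N)%N -> (N ^ x <= 'C(N, x) * x ^ x)%N.
Proof.
move=> xN; have H j : (j <= x)%N -> (N ^ j * x ^_ j <= N ^_ j * x ^ j)%N.
  elim: j => [|j IH] jx; first by rewrite !ffactn0.
  rewrite !ffactnSr !expnSr.
  have -> : (N ^ j * N * (x ^_ j * (x - j)) = N ^ j * x ^_ j * (N * (x - j)))%N by lia.
  have -> : (N ^_ j * (N - j) * (x ^ j * x) = N ^_ j * x ^ j * ((N - j) * x))%N by lia.
  apply: leq_mul; first exact/IH/ltnW.
  by rewrite mulnBr mulnBl leq_sub2l // [leqRHS]mulnC leq_mul.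
have := H x (leqnn x); rewrite ffactnn -bin_ffact => h.
by rewrite -(leq_pmul2r (fact_gt0 x)) (leq_trans h) // mulnAC.
Qed.

(** The estimate (N / x) ^ x <= 'C(N, x) loses a factor exponential in x, which does not
matter when x is much larger than the mean degree. *)
Lemma plant_price (n N x : nat) : (0 < x)%N -> (x <= N)%N -> (N <= n)%N -> (n <= 2 * N)%N ->
  0 < q -> 2 * q <= 1 ->
  expR (- (x%:R * ln (2 * x%:R / (n%:R * q)) + 2 * (n%:R * q))) <=
  'C(N, x)%:R * (q ^+ x * (1 - q) ^+ (N - x)).
Proof.
move=> x0 xN Nn nN qp q2.
have xR : 0 < x%:R :> R by rewrite ltr0n.
have N0 : (0 < N)%N by exact: leq_trans xN.
have NR : 0 < N%:R :> R by rewrite ltr0n.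
have nR : 0 < n%:R :> R by rewrite ltr0n; exact: leq_trans Nn.
have d0 : 0 < n%:R * q by rewrite mulr_gt0.
rewrite opprD expRD [leRHS]mulrA; apply: ler_pM; rewrite ?expR_ge0 //.
  have Nq : n%:R * q / (2 * x%:R) <= N%:R * q / x%:R.
    rewrite ler_pdivrMr ?mulr_gt0 // mulrA.
    have -> : N%:R * q / x%:R * 2 * x%:R = 2 * N%:R * q by field; rewrite gt_eqF.
    by rewrite ler_pM2r // -natrM ler_nat.
  have y0 : 0 < n%:R * q / (2 * x%:R) by rewrite divr_gt0 // mulr_gt0.
  rewrite -mulrN -lnV ?posrE ?divr_gt0 ?mulr_gt0 // invf_div expRM_natl lnK ?posrE //.
  apply: (@le_trans _ _ ((N%:R * q / x%:R) ^+ x)).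
    by rewrite lerXn2r ?nnegrE ?(ltW y0) // (le_trans (ltW y0)).
  rewrite mulrAC exprMn ler_wpM2r ?exprn_ge0 // expr_div_n ler_pdivrMr ?exprn_gt0 //.
  by rewrite -!natrX -natrM ler_nat bin_ge_expn.
have e1 : expR (- (2 * q)) <= 1 - q by apply: one_minus_ge_exp; lra.
apply: (@le_trans _ _ ((1 - q) ^+ N)); last first.
  by apply: ler_wiXn2l; rewrite ?leq_subr ?subr_ge0 // gerBl.
apply: (@le_trans _ _ (expR (- (2 * q)) ^+ N)); last first.
  by rewrite lerXn2r ?nnegrE ?expR_ge0 ?subr_ge0.
rewrite -expRM_natl ler_expR mulrN lerN2 mulrCA ler_wpM2l // ler_wpM2r //.
by rewrite ler_nat.
Qed.

(** By [crude_lower] the remaining graph contributes nearly the mean at a polynomial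
price. *)
Lemma plant_tail (n k N x : nat) (h eps : R) : n = (k + N.+1)%N ->
  (0 < x)%N -> (x <= N)%N -> (n <= 2 * N)%N -> 0 < q -> 2 * q <= 1 -> 0 <= eps ->
  0 < h -> 2 * h <= 1 -> 2 <= h * mu_stars n r q ->
  r.+1%:R * (k.+1 + r.+1)%N%:R <= h * n%:R ->
  (1 + eps) * mu_stars n r q <=
    (1 - 2 * h) * mu_stars n r q + 'C(x, r)%:R + (k * 'C(N, r))%N%:R ->
  expR (- (k%:R * (n%:R * ln q^-1) + x%:R * ln (2 * x%:R / (n%:R * q))
           + 2 * (n%:R * q) + r.+1%:R * ln n%:R)) <=
  star_tail ((1 + eps) * mu_stars n r q) n.
Proof.
move=> nE x0 xN nN qp q2 e0 h0 h2 hm jn need.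
have N0 : (0 < N)%N by exact: leq_trans xN.
have Nn : (N <= n)%N by rewrite nE (leq_trans (leqnSn N)) // leq_addl.
have n0 : (0 < n)%N by exact: leq_trans Nn.
have nR : 0 < n%:R :> R by rewrite ltr0n.
have NR : 0 < N%:R :> R by rewrite ltr0n.
set m := mu_stars n r q in hm need *.
have m0 : 0 <= m by exact: mu_stars_ge0.
have NE : N = (n - k.+1)%N by rewrite nE addnS -addSn addKn.
have jn' : (k.+1 + r.+1 < n)%N.
  rewrite -(ltr_nat R); apply: (@lt_le_trans _ _ (r.+1%:R * (k.+1 + r.+1)%N%:R)).
    by rewrite ltr_pMl ?ltr0n // ltr1n ltnS ltnW.
  apply: (le_trans jn); rewrite ler_piMl ?(ltW nR) //; lra.
have mN : (1 - h) * m <= mu_stars N r q.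
  rewrite NE; apply: le_trans (mu_stars_sub jn'); rewrite ler_wpM2r //.
  by rewrite lerD2l lerN2 ler_pdivrMr.
have z1 : (1 - 2 * h) * m <= (1 - h) * mu_stars N r q.
  apply: (@le_trans _ _ ((1 - h) * ((1 - h) * m))).
    have : 0 <= h * h * m := mulr_ge0 (mulr_ge0 (ltW h0) (ltW h0)) m0.
    by clear; lra.
  by rewrite ler_wpM2l //; lra.
apply: le_trans (star_tail_le n need); rewrite nE.
apply: le_trans (plant k N x _); rewrite -nE.
apply: le_trans (ler_wpM2l _ (ler_wpM2l _ (star_tail_le N z1))); last 2 first.
- by rewrite exprn_ge0.
- by rewrite mulr_ge0 // mulr_ge0 ?exprn_ge0 // subr_ge0.
have T : expR (- (r.+1%:R * ln n%:R)) <= star_tail ((1 - h) * mu_stars N r q) N.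
  have nr0 : 0 < n%:R ^+ r.+1 :> R by rewrite exprn_gt0.
  rewrite -mulrN -lnV ?posrE // expRM_natl lnK ?posrE ?invr_gt0 // exprVn.
  rewrite -[leLHS]mulr1 ler_pdivrMl //.
  apply: (@le_trans _ _ (h * mu_stars N r q)).
    apply: (@le_trans _ _ (h * ((1 - h) * m))); last by rewrite ler_wpM2l // ltW.
    by have := ler_wpM2r m0 (mulr_ge0 (ltW h0) (_ : 0 <= 1 - 2 * h)); lra.
  apply: le_trans (crude_lower _ _ N0) _; rewrite ?(ltW h0) //; first lra.
  by rewrite ler_wpM2r ?star_tail_ge0 // lerXn2r ?nnegrE ?ler_nat.
have F := plant_price x0 xN Nn nN qp q2.
rewrite !opprD -!addrA expRD.
apply: ler_pM; rewrite ?expR_ge0 //.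
  rewrite mulrA -natrM -mulrN -lnV ?posrE ?invr_gt0 // invrK expRM_natl lnK ?posrE //.
by rewrite addrA expRD; apply: ler_pM; rewrite ?expR_ge0 // -opprD.
Qed.

Lemma plant_tail_expn (n k x : nat) (h eps : R) :
  (0 < x)%N -> (k + x < n)%N -> 0 < q -> 2 * q <= 1 -> 0 <= eps ->
  0 < h -> 2 * h <= 1 -> 2 <= h * mu_stars n r q ->
  r.+1%:R * (k.+1 + r.+1)%N%:R <= h * n%:R ->
  (eps + 2 * h) * (n%:R * (n%:R * q) ^+ r) <= ((x - r) ^ r)%:R + (1 - h) * k%:R * n%:R ^+ r ->
  expR (- (k%:R * (n%:R * ln q^-1) + x%:R * ln (2 * x%:R / (n%:R * q))
           + 2 * (n%:R * q) + r.+1%:R * ln n%:R)) <=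
  star_tail ((1 + eps) * mu_stars n r q) n.
Proof.
move=> x0 kx qp q2 e0 h0 h2 hm jn need.
have n0 : (0 < n)%N by exact: leq_ltn_trans kx.
have nR : 0 < n%:R :> R by rewrite ltr0n.
have rf : 0 < r`!%:R :> R by rewrite ltr0n fact_gt0.
pose N := (n - k.+1)%N.
have kn : (k < n)%N by exact: leq_ltn_trans (leq_addr _ _) kx.
have nE : n = (k + N.+1)%N by rewrite -addSnnS subnKC.
have xN : (x <= N)%N by rewrite /N leq_subRL ?addSn.
have jh : r.+1%:R * (k.+1 + r.+1)%N%:R <= n%:R / 2 :> R.
  by apply: (le_trans jn); have := ler_wpM2r (ltW nR) h2; lra.
have jn2 : (2 * (k.+1 + r.+1) <= n)%N.
  rewrite -(ler_nat R) natrM.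
  have : (k.+1 + r.+1)%N%:R <= r.+1%:R * (k.+1 + r.+1)%N%:R :> R by rewrite ler_peMl // ler1n.
  by move: jh; clear -r1 hq q0 q1; lra.
have nN : (n <= 2 * N)%N.
  have k2 : (2 * k.+1 <= n)%N by rewrite (leq_trans _ jn2) // leq_mul2l leq_addr.
  by rewrite /N mulnBr [(2 * n)%N]mul2n -addnn -addnBA // leq_addr.
apply: (plant_tail nE x0 xN nN qp q2 e0 h0 h2 hm jn).
set m := mu_stars n r q in hm *.
have m0 : 0 <= m by exact: mu_stars_ge0.
suff : (eps + 2 * h) * m <= 'C(x, r)%:R + (k * 'C(N, r))%N%:R by lra.
rewrite -(ler_pM2l rf).
apply: (@le_trans _ _ ((eps + 2 * h) * (n%:R * (n%:R * q) ^+ r))).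
  rewrite mulrCA ler_wpM2l //; first by rewrite addr_ge0 // mulr_ge0 // ltW.
  exact: mu_stars_fact_le.
apply: (le_trans need); rewrite mulrDr; apply: lerD.
  by rewrite -natrM ler_nat mulnC bin_ffact ffact_ge_expn.
rewrite natrM mulrCA mulrAC -[_ * _ * k%:R]mulrC ler_wpM2l // -natrM mulnC bin_ffact.
apply: (@le_trans _ _ ((n - (k.+1 + r)) ^ r)%:R); last first.
  by rewrite ler_nat subnDA; exact: ffact_ge_expn.
apply: le_trans (expn_sub_ge r _ n0); last first.
  by rewrite (leq_trans _ jn2) // (leq_trans (leq_add (leqnn _) (leqnSn _))) // leq_pmull.
rewrite ler_wpM2r ?exprn_ge0 // lerD2l lerN2 ler_pdivrMr //; apply: le_trans jn.
by rewrite -!natrM ler_nat leq_mul // leq_add2l.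
Qed.

End Plant.

(** * Lower bounds in the four regimes *)

Section LowerSingleVertex.
Context {R : realType}.
Variables (r : nat) (p : nat -> R).
Hypothesis r1 : (1 < r)%N.
Hypothesis hp : forall n : nat, 0 <= p n <= 1.
Hypothesis hp0 : p n @[n --> \oo] --> (0 : R).
Hypothesis hmu : much_less (fun n : nat => ln n%:R) (mean_stars r p).
Variable eps : R.
Hypothesis eps0 : 0 < eps.

Let rr0 : 0 < r%:R :> R. Proof. by rewrite ltr0n ltnW. Qed.

(** A degree of order rt exceeds its mean by a factor of order n ^ (1 / r) at most. *)
Lemma near_ln_ratio (A a : R) : 0 < A -> 0 < a -> \forall n \near \oo,
  forall y : R, 0 < y -> y <= A * rt r p n -> ln (2 * y / (n%:R * p n)) <= (1 + a) * (ln n%:R / r%:R).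
Proof.
move=> A0 a0; near=> n => y y0 yA.
have pn : 0 < p n by near: n; exact: (near_p_gt0 r1 hp hmu).
have n0 : (0 < n)%N by near: n; exact: nbhs_infty_gt.
have L1 : ln (2 * A) * (r%:R / a) <= ln n%:R by near: n; exact: near_ln.
have d0 : 0 < n%:R * p n by rewrite mulr_gt0 ?ltr0n.
have A20 : 0 < 2 * A by rewrite mulr_gt0.
have w0 : 0 < nroot r (n%:R : R) by rewrite nroot_gt0 // ltr0n.
apply: (@le_trans _ _ (ln (2 * A * nroot r n%:R))).
  have Y1 : 0 < 2 * y / (n%:R * p n) by rewrite divr_gt0 // mulr_gt0.
  have Y2 : 0 < 2 * A * nroot r n%:R by rewrite mulr_gt0.
  rewrite ler_ln ?posrE // ler_pdivrMr //.
  rewrite -!mulrA ler_wpM2l //; apply: (le_trans yA); rewrite ler_wpM2l ?(ltW A0) //.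
  exact: rt_le.
rewrite (lnM A20 w0) ln_root [(1 + a) * _]mulrDl [1 * (_ / _)]mul1r [leLHS]addrC lerD2l.
have -> : a * (ln n%:R / r%:R) = ln n%:R / (r%:R / a) by field; rewrite !gt_eqF.
by rewrite ler_pdivlMr // divr_gt0.
Unshelve. all: by end_near. Qed.

Local Ltac goal_lra := clear -r1 hp hp0 hmu eps0 rr0; lra.

(** One vertex carries the whole excess. *)
Lemma single_vertex_regime_lower (et : R) : 0 < et -> et < 1 ->
  (forall A : R, \forall n \near \oo, A * rt r p n <= n%:R) ->
  \forall n \near \oo, expR (- ((1 + et) * (r%:R^-1 * (nroot r eps * rt r p n) * ln n%:R)))
    <= tail_prob r p eps n.
Proof.
move=> et0 et1 HS; pose a : R := et / 16; have a0 : 0 < a by rewrite divr_gt0.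
have a1 : a <= 16^-1 by rewrite /a ler_pdivrMr // mulVf //; lra.
have re0 := nroot_gt0 r eps0.
pose h : R := Num.min 8^-1 (a * eps / (2 + 2 * eps)).
have den0 : 0 < 2 + 2 * eps by exact: addr_gt0 (ltr0n _ 2) (mulr_gt0 (ltr0n _ 2) eps0).
have h0 : 0 < h by rewrite lt_min invr_gt0 ltr0n divr_gt0 // mulr_gt0.
have h8 : h <= 8^-1 by rewrite ge_min lexx.
have h2 : 2 * h <= 1 by move: h8; goal_lra.
have h10 : 0 < 1 - h by move: h8; goal_lra.
have hE : h * (2 + 2 * eps) <= a * eps by rewrite -ler_pdivlMr // ge_min lexx orbT.
pose E := nroot r ((eps + 2 * h) / (1 - h)).
have q0 : 0 <= (eps + 2 * h) / (1 - h) by rewrite divr_ge0 ?(ltW h10) // addr_ge0 ?(ltW eps0) // mulr_ge0 // ltW.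
have E0 : 0 <= E by exact: nroot_ge0.
have Ele : E <= (1 + a) * nroot r eps.
  apply: nroot_leX => //; first by rewrite mulr_ge0 ?(ltW re0) //; lra.
  rewrite exprMn nrootK ?(ltW eps0) // ler_pdivrMr //.
  have a1r : 1 + a <= (1 + a) ^+ r by rewrite ler_eXnr ?(ltnW r1) // lerDl ltW.
  apply: (@le_trans _ _ ((1 + a) * eps * (1 - h))).
    have : a * (h * eps) <= h * eps by rewrite ler_piMl ?mulr_ge0 ?(ltW h0) ?(ltW eps0) //; lra.
    lra.
  by rewrite ler_wpM2r ?(ltW h10) // ler_wpM2r // ltW.
pose A : R := (1 + 2 * a) * nroot r eps; have A0 : 0 < A by rewrite mulr_gt0 //; lra.
near=> n.
have pn : 0 < p n by near: n; exact: (near_p_gt0 r1 hp hmu).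
have n0 : (0 < n)%N by near: n; exact: nbhs_infty_gt.
have p2 : p n <= 2^-1 by near: n; apply: near_p_le => //; rewrite invr_gt0.
have hm : 2 / h <= mu_stars n r (p n) by near: n; exact: near_mu_ge.
have nh : r.+1%:R * (1 + r.+1)%N%:R / h <= n%:R by near: n; exact: near_natr.
have mlo : (1 - h) * (n%:R * (n%:R * p n) ^+ r) <= r`!%:R * mu_stars n r (p n).
  by near: n; exact: near_mu_lo.
have rt1 : r.+1%:R / (a * nroot r eps) * (r%:R + 1) <= rt r p n by near: n; exact: (near_rt r1 hp hmu).
have rt2 : 1 <= rt r p n by near: n; exact: (near_rt r1 hp hmu).
have An : (A + 1) * rt r p n <= n%:R by near: n; exact: HS.
have lnr : forall y : R, 0 < y -> y <= A * rt r p n ->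
    ln (2 * y / (n%:R * p n)) <= (1 + a) * (ln n%:R / r%:R).
  by near: n; exact: near_ln_ratio.
have dlo : (1 - 2^-1) * (nroot r n%:R * (n%:R * p n)) <= rt r p n.
  by near: n; apply: (near_rt_ge r1 hp); rewrite ?invr_gt0 // invf_le1 ?ler1n.
have L1 : 4 * r%:R / (a * nroot r eps) <= ln n%:R by near: n; exact: near_ln.
have [w1 _] := nroot_nat (R := R) r1 n0.
have nR : 0 < n%:R :> R by rewrite ltr0n.
have d0 : 0 < n%:R * p n by rewrite mulr_gt0.
have are : 0 < a * nroot r eps by rewrite mulr_gt0.
have rtK' := rtK r1 hp n.
set ro := rt r p n in rt1 rt2 An lnr dlo rtK' *; set L := ln n%:R in lnr L1 *.
have ro0 : 0 < ro by apply: lt_le_trans rt2.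
have Lp : 0 < L by apply: lt_le_trans L1; rewrite divr_gt0 // mulr_gt0.
have rt1' : r.+1%:R <= a * nroot r eps * ro.
  have q : r.+1%:R / (a * nroot r eps) <= ro.
    apply: le_trans rt1; rewrite ler_peMr ?divr_ge0 ?(ltW are) //.
    by rewrite lerDr ltW.
  by rewrite mulrC -ler_pdivrMr.
have [m0 [m01 m02]] := ceil_nat (mulr_ge0 E0 (ltW ro0)).
pose x := (m0 + r)%N.
have x0 : (0 < x)%N by rewrite addn_gt0 (ltnW r1) orbT.
have xR : 0 < x%:R :> R by rewrite ltr0n.
have xA : x%:R <= A * ro.
  rewrite /x natrD /A; have := ler_wpM2r (ltW ro0) Ele; move: rt1' m02.
  by rewrite -natr1; goal_lra.
have xn : (0 + x < n)%N.
  rewrite add0n -(ltr_nat R); apply: (le_lt_trans xA); apply: lt_le_trans An.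
  by rewrite ltr_pM2r // ltrDl.
have H := @plant_tail_expn R r (p n) r1 (hp n) n 0 x h eps x0 xn pn.
apply: le_trans (H _ (ltW eps0) h0 h2 _ _ _).
- rewrite ler_expR lerN2 mul0r add0r.
  set T := r%:R^-1 * (nroot r eps * ro) * L.
  have TE : T = nroot r eps * ro * (L / r%:R) by rewrite /T; ring.
  have LR0 : 0 <= L / r%:R by rewrite divr_ge0 // ltW.
  have T0 : 0 <= T by rewrite TE mulr_ge0 // mulr_ge0 // ltW.
  have aT : 0 <= a * T by rewrite mulr_ge0 // ltW.
  have etE : et = 16 * a by rewrite /a; field.
  have T1 : x%:R * ln (2 * x%:R / (n%:R * p n)) <= (1 + 4 * a) * T.
    apply: (@le_trans _ _ (A * ro * ((1 + a) * (L / r%:R)))).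
      apply: (@le_trans _ _ (x%:R * ((1 + a) * (L / r%:R)))).
        by rewrite ler_wpM2l // lnr.
      rewrite ler_wpM2r // mulr_ge0 //; lra.
    have -> : A * ro * ((1 + a) * (L / r%:R)) = (1 + 2 * a) * (1 + a) * T by rewrite TE /A; ring.
    rewrite ler_wpM2r //; have : 0 <= a * (1 - 2 * a) by rewrite mulr_ge0 ?(ltW a0) //; lra.
    by goal_lra.
  have T2 : 2 * (n%:R * p n) <= a * T.
    have d4 : 2 * (n%:R * p n) <= 4 * ro.
      have := ler_wpM2r (ltW d0) w1; move: dlo; goal_lra.
    apply: (le_trans d4).
    have -> : a * T = L / (r%:R / (a * nroot r eps)) * ro by rewrite TE; field; rewrite !gt_eqF.
    rewrite ler_pM2r // ler_pdivlMr ?divr_gt0 //.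
    by rewrite mulrA.
  have T3 : r.+1%:R * L <= 8 * a * T.
    have -> : 8 * a * T = (a * nroot r eps * ro * 8 / r%:R) * L by rewrite TE; ring.
    rewrite ler_pM2r // ler_pdivlMr //.
    have h3 : r.+1%:R * (r%:R + 1) <= a * nroot r eps * ro.
      by rewrite [a * _ * ro]mulrC -ler_pdivrMr // mulrAC.
    have h4 : 0 <= a * nroot r eps * ro by exact: mulr_ge0 (ltW are) (ltW ro0).
    apply: (@le_trans _ _ (r.+1%:R * (r%:R + 1))).
      by rewrite ler_wpM2l // lerDl.
    by move: h3 h4; goal_lra.
  rewrite -/T -/L etE; move: aT T1 T2 T3.
  by goal_lra.
- by lra.
- by rewrite mulrC -ler_pdivrMr.
- by rewrite [h * _]mulrC -ler_pdivrMr.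
rewrite mulr0 mul0r addr0 /x addnK natrX.
apply: (@le_trans _ _ ((E * ro) ^+ r)); last by rewrite lerXn2r ?nnegrE // mulr_ge0 // ltW.
rewrite [(E * ro) ^+ r]exprMn /E nrootK // rtK' [leRHS]mulrAC ler_pdivlMr // -mulrA ler_wpM2l //.
  by rewrite addr_ge0 ?(ltW eps0) // mulr_ge0 // ltW.
by rewrite mulrC.
Unshelve. all: by end_near. Qed.

End LowerSingleVertex.

Section LowerDense.
Context {R : realType}.
Variables (r : nat) (p : nat -> R).
Hypothesis r1 : (1 < r)%N.
Hypothesis hp : forall n : nat, 0 <= p n <= 1.
Hypothesis hp0 : p n @[n --> \oo] --> (0 : R).
Hypothesis hmu : much_less (fun n : nat => ln n%:R) (mean_stars r p).
Variable eps : R.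
Hypothesis eps0 : 0 < eps.

Let rr0 : 0 < r%:R :> R. Proof. by rewrite ltr0n ltnW. Qed.

Local Ltac goal_lra := clear -r1 hp hp0 hmu eps0 rr0; lra.

(** Full vertices carry the excess; the vertex of degree x = r in [plant_tail_expn] is a
negligible addition. *)
Lemma dense_regime_lower (et : R) : 0 < et -> et < 1 ->
  (forall A : R, \forall n \near \oo, A <= n%:R * p n ^+ r) ->
  \forall n \near \oo, expR (- ((1 + et) * (eps * n%:R ^+ 2 * p n ^+ r * ln (p n)^-1)))
    <= tail_prob r p eps n.
Proof.
move=> et0 et1 HA; pose a : R := et / 16; have a0 : 0 < a by rewrite divr_gt0.
have a1 : a <= 16^-1 by rewrite /a ler_pdivrMr // mulVf //; lra.
pose h : R := Num.min 8^-1 (a * eps / (2 + 2 * eps)).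
have den0 : 0 < 2 + 2 * eps by exact: addr_gt0 (ltr0n _ 2) (mulr_gt0 (ltr0n _ 2) eps0).
have h0 : 0 < h by rewrite lt_min invr_gt0 ltr0n divr_gt0 // mulr_gt0.
have h8 : h <= 8^-1 by rewrite ge_min lexx.
have h2 : 2 * h <= 1 by move: h8; goal_lra.
have h10 : 0 < 1 - h by move: h8; goal_lra.
have hE : h * (2 + 2 * eps) <= a * eps by rewrite -ler_pdivlMr // ge_min lexx orbT.
pose E := (eps + 2 * h) / (1 - h).
have e2h : 0 <= eps + 2 * h by exact: addr_ge0 (ltW eps0) (mulr_ge0 (ler0n _ 2) (ltW h0)).
have E0 : 0 <= E by rewrite divr_ge0 // ltW.
have Ele : E <= (1 + a) * eps.
  rewrite ler_pdivrMr //.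
  have : a * (h * eps) <= h * eps.
    by rewrite ler_piMl ?mulr_ge0 ?(ltW h0) ?(ltW eps0) //; move: a1; goal_lra.
  by move: hE; goal_lra.
pose g : R := h / (2 * r.+1%:R * ((1 + a) * eps)).
have ae0 : 0 < a * eps by rewrite mulr_gt0.
have a1e : 0 < (1 + a) * eps by rewrite mulr_gt0 // addr_gt0.
have g0 : 0 < g by rewrite divr_gt0 // !mulr_gt0 // addr_gt0.
near=> n.
have pn : 0 < p n by near: n; exact: (near_p_gt0 r1 hp hmu).
have n0 : (r.+1 < n)%N by near: n; exact: nbhs_infty_gt.
have p2 : p n <= 2^-1 by near: n; apply: near_p_le => //; rewrite invr_gt0.
have pg : p n <= g by near: n; exact: near_p_le.
have hm : 2 / h <= mu_stars n r (p n) by near: n; exact: near_mu_ge.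
have nh : 2 * r.+1%:R * (2 + r.+1)%N%:R / h <= n%:R by near: n; exact: near_natr.
have z1 : (a * eps)^-1 * (4 + 2 * r%:R) + 1 <= n%:R * p n ^+ r by near: n; exact: HA.
have lp1 : ln 2 + 1 + ln (2 * r%:R) <= ln (p n)^-1 by near: n; exact: (near_lnV r1 hp hp0 hmu).
have /andP[_ p1] := hp n.
have nR : 0 < n%:R :> R by rewrite ltr0n (leq_ltn_trans _ n0).
have n1 : 1 <= n%:R :> R by rewrite ler1n (leq_ltn_trans _ n0).
have d0 : 0 < n%:R * p n by rewrite mulr_gt0.
pose z := n%:R * p n ^+ r; have z0 : 0 < z by rewrite mulr_gt0 // exprn_gt0.
have zd : z <= n%:R * p n.
  by rewrite ler_pM2l // -[leRHS]expr1 ler_wiXn2l // ?(ltW pn) // ltnW.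
have r42 : 0 <= 4 + 2 * r%:R :> R by exact: addr_ge0 (ler0n _ 4) (mulr_ge0 (ler0n _ 2) (ltW rr0)).
have ab0 : 0 <= (a * eps)^-1 * (4 + 2 * r%:R).
  by apply: mulr_ge0 => //; rewrite invr_ge0; exact: ltW.
have z1' : 1 <= z by move: z1 ab0; rewrite -/z; goal_lra.
have d1 : 1 <= n%:R * p n by apply: le_trans zd.
set l := ln (p n)^-1 in lp1 *.
have l2r : 0 <= ln (2 * r%:R) :> R by rewrite ln_ge0 // -natrM ler1n (leq_trans (ltnW r1)) // leq_pmull.
have l20 : 0 <= ln 2 :> R by rewrite ln_ge0 // ler1n.
have l1 : 1 <= l by move: lp1 l2r l20; goal_lra.
have [k [k1 k2]] := ceil_nat (mulr_ge0 E0 (ltW z0)).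
have zab : 4 + 2 * r%:R <= a * eps * z.
  by rewrite -ler_pdivrMl //; move: z1; rewrite -/z; goal_lra.
have kz : k%:R <= (1 + 2 * a) * eps * z.
  have := ler_wpM2r (ltW z0) Ele; have := zab; have : 0 <= r%:R :> R by [].
  by move: k2; goal_lra.
have kn : r.+1%:R * (k.+1 + r.+1)%N%:R <= h * n%:R.
  have q1 : r.+1%:R * ((1 + a) * eps * z) <= h * n%:R / 2.
    apply: (@le_trans _ _ (r.+1%:R * ((1 + a) * eps * (n%:R * g)))).
      rewrite ler_wpM2l // ler_wpM2l ?(ltW a1e) //; apply: (le_trans zd).
      by rewrite ler_pM2l.
    by rewrite le_eqVlt; apply/orP; left; apply/eqP; rewrite /g; field; rewrite !gt_eqF // addr_gt0.
  have q2 : r.+1%:R * (2 + r.+1)%N%:R <= h * n%:R / 2 :> R.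
    by rewrite ler_pdivlMr // [h * _]mulrC -ler_pdivrMr //; apply: le_trans nh; rewrite le_eqVlt; apply/orP; left; apply/eqP; ring.
  have q3 : (k.+1 + r.+1)%N%:R <= (1 + a) * eps * z + (2 + r.+1)%N%:R.
    rewrite addSn -addnS natrD [(2 + _)%N%:R]natrD -[r.+2%:R]natr1.
    by have := ler_wpM2r (ltW z0) Ele; move: k2; goal_lra.
  by have := ler_wpM2l (ler0n R r.+1) q3; move: q1 q2; goal_lra.
have krn : (k + r < n)%N.
  rewrite -(ltr_nat R).
  have q4 : (k.+1 + r.+1)%N%:R <= r.+1%:R * (k.+1 + r.+1)%N%:R :> R by rewrite ler_peMl // ler1n.
  have q5 : (k + r)%N%:R < (k.+1 + r.+1)%N%:R :> R by rewrite ltr_nat addSn addnS ltnW.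
  have q6 : h * n%:R <= n%:R by rewrite ler_piMl ?(ltW nR) //; move: h8; goal_lra.
  by move: q4 q5 q6 kn; goal_lra.
have H := @plant_tail_expn R r (p n) r1 (hp n) n k r h eps (ltnW r1) krn pn.
have lnn : ln n%:R <= n%:R :> R by apply: ltW; exact: ln_sublinear.
apply: le_trans (H _ (ltW eps0) h0 h2 _ kn _).
- rewrite ler_expR lerN2 -/l.
  set T := eps * n%:R ^+ 2 * p n ^+ r * l.
  have TE : T = eps * z * (n%:R * l) by rewrite /T /z; ring.
  have nl0 : 0 <= n%:R * l by rewrite mulr_ge0 ?(ltW nR) // (le_trans _ l1).
  have T0 : 0 <= T by rewrite TE mulr_ge0 // mulr_ge0 // ltW.
  have nl : n%:R <= n%:R * l by rewrite ler_peMr // ltW.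
  have T1 : k%:R * (n%:R * l) <= (1 + 2 * a) * T.
    by rewrite TE [leRHS]mulrA [(1 + 2 * a) * (eps * z)]mulrA ler_wpM2r.
  have T2 : (4 + 2 * r%:R) * (n%:R * l) <= a * T.
    by rewrite TE [leRHS]mulrA [a * (eps * z)]mulrA ler_wpM2r.
  have T3 : r%:R * ln (2 * r%:R / (n%:R * p n)) <= r%:R * (n%:R * l).
    rewrite ler_wpM2l //; apply: (@le_trans _ _ (ln (2 * r%:R))).
      have r20 : 0 < 2 * r%:R :> R by rewrite mulr_gt0.
      rewrite ler_ln ?posrE ?divr_gt0 // ler_pdivrMr // ler_peMr // ltW.
    apply: (@le_trans _ _ l); last by rewrite ler_peMl // (le_trans _ l1).
    by move: lp1 l20; goal_lra.
  have T4 : r.+1%:R * ln n%:R <= r.+1%:R * n%:R :> R by rewrite ler_wpM2l.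
  have T5 : n%:R * p n <= n%:R by rewrite ler_piMr // ltW.
  have etE : et = 16 * a by rewrite /a; field.
  have aT : 0 <= a * T by rewrite mulr_ge0 // ltW.
  rewrite -natr1 in T4; have rn : 0 <= r%:R * n%:R :> R by rewrite mulr_ge0.
  rewrite -/T etE -[r.+1%:R]natr1.
  move: aT T1 T2 T3 T4 T5 nR rn.
  have := mulr_ge0 (ltW rr0) nl0.
  have : r%:R * n%:R <= r%:R * (n%:R * l) by rewrite ler_wpM2l.
  by move: nl nl0; goal_lra.
- by move: p2; goal_lra.
- by rewrite mulrC -ler_pdivrMr.
rewrite subnn exp0n ?(ltnW r1) //.
rewrite add0r.
have -> : n%:R * (n%:R * p n) ^+ r = z * n%:R ^+ r by rewrite exprMn /z; ring.
rewrite mulrA ler_wpM2r ?exprn_ge0 //.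
by move: k1; rewrite /E mulrAC ler_pdivrMr // [k%:R * _]mulrC.
Unshelve. all: by end_near. Qed.

End LowerDense.

Section LowerFullVertices.
Context {R : realType}.
Variables (r : nat) (p : nat -> R).
Hypothesis r1 : (1 < r)%N.
Hypothesis hp : forall n : nat, 0 <= p n <= 1.
Hypothesis hp0 : p n @[n --> \oo] --> (0 : R).
Hypothesis hmu : much_less (fun n : nat => ln n%:R) (mean_stars r p).
Variables eps rho : R.
Hypothesis eps0 : 0 < eps.
Hypothesis rho0 : 0 < rho.
Hypothesis HR : n%:R * p n ^+ r @[n --> \oo] --> rho.

Let rr0 : 0 < r%:R :> R. Proof. by rewrite ltr0n ltnW. Qed.

Local Ltac goal_lra := clear -r1 hp hp0 hmu eps0 rho0 rr0 HR; lra.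

Lemma near_lnV_upper (C a : R) : 0 < a ->
  \forall n \near \oo, ln (p n)^-1 + C <= (1 + a) * (ln n%:R / r%:R).
Proof.
move=> a0; near=> n; have pn : 0 < p n by near: n; exact: (near_p_gt0 r1 hp hmu).
have n0 : (0 < n)%N by near: n; exact: nbhs_infty_gt.
have nR : 0 < n%:R :> R by rewrite ltr0n.
have Hrho : rho / 2 <= n%:R * p n ^+ r by near: n; exact: near_rho_ge.
have L1 : (C - ln (rho / 2) / r%:R) * (r%:R / a) <= ln n%:R by near: n; exact: near_ln.
have H : ln (rho / 2) <= ln n%:R - r%:R * ln (p n)^-1.
  rewrite lnV ?posrE // mulrN opprK mulr_natl -lnXn // -lnM ?posrE ?exprn_gt0 //.
  by rewrite ler_ln ?posrE ?divr_gt0 ?mulr_gt0 ?exprn_gt0.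
have : ln (rho / 2) / r%:R <= ln n%:R / r%:R - ln (p n)^-1.
  by rewrite ler_pdivrMr // mulrBl divfK ?gt_eqF // [ln (p n)^-1 * _]mulrC.
have : C - ln (rho / 2) / r%:R <= a * (ln n%:R / r%:R).
  have -> : a * (ln n%:R / r%:R) = ln n%:R / (r%:R / a) by field; rewrite !gt_eqF.
  by rewrite ler_pdivlMr // divr_gt0.
by goal_lra.
Unshelve. all: by end_near. Qed.

(** As many full vertices as the excess is worth, and one more vertex for the fractional
part. *)
Lemma full_vertices_regime_lower (et : R) : 0 < et -> et < 1 ->
  \forall n \near \oo,
    expR (- ((1 + et) * (r%:R^-1 * floor_root r (eps * rho) * (n%:R * ln n%:R))))
    <= tail_prob r p eps n.
Proof.
move=> et0 et1; pose a : R := et / 16; have a0 : 0 < a by rewrite divr_gt0.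
have a1 : a <= 16^-1 by rewrite /a ler_pdivrMr // mulVf //; lra.
pose s : R := eps * rho; have s0 : 0 < s by rewrite mulr_gt0.
have /andP[f0 f1] := frac_part_itv s; set f := frac_part s in f0 f1.
have [k kE] : exists k : nat, (Num.floor s)%:~R = k%:R :> R.
  have F0 : (0 <= Num.floor s)%R by rewrite floor_ge0 ltW.
  by exists `|Num.floor s|%N; rewrite -[in LHS](gez0_abs F0).
have sE : s = f + k%:R by rewrite /f /frac_part kE subrK.
pose G := floor_root r s; have G0 : 0 < G by exact: floor_root_gt0.
have GE : G = nroot r f + k%:R by rewrite /G /floor_root kE.
have aG0 : 0 < a * G by rewrite mulr_gt0.
pose eta : R := Num.min ((1 - f) / 2) ((a * G) ^+ r).
have eta0 : 0 < eta by rewrite lt_min divr_gt0 ?subr_gt0 // exprn_gt0.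
have eta1 : f + eta < 1.
  have : eta <= (1 - f) / 2 by rewrite ge_min lexx.
  by move: f1; goal_lra.
have fe0 : 0 <= f + eta by rewrite addr_ge0 // ltW.
have eta2 : nroot r eta <= a * G.
  by apply: nroot_leX; rewrite ?(ltW eta0) ?(ltW aG0) // ge_min lexx orbT.
pose v := nroot r (f + eta); have v0 : 0 <= v := nroot_ge0 _ _.
have v1 : v < 1.
  rewrite ltNge; apply/negP => v1; move: eta1; rewrite -(nrootK r1 fe0) ltNge => /negP; apply.
  exact: exprn_ege1.
have vle : v <= nroot r f + nroot r eta.
  apply: nroot_leX => //; first by rewrite addr_ge0 ?nroot_ge0.
  have := exprD_ge (nroot_ge0 r eta) (nroot_ge0 r f) (ltnW r1).
  by rewrite (nrootK r1 f0) (nrootK r1 (ltW eta0)).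
pose den : R := eps + 2 * rho + 2 + k%:R.
have den0 : 0 < den.
  rewrite /den; have : 0 <= k%:R :> R by [].
  by move: eps0 rho0; goal_lra.
pose h : R := Num.min 8^-1 (eta / den).
have h0 : 0 < h by rewrite lt_min invr_gt0 ltr0n divr_gt0.
have h8 : h <= 8^-1 by rewrite ge_min lexx.
have h2 : 2 * h <= 1 by move: h8; goal_lra.
have hE : h * den <= eta by rewrite -ler_pdivlMr // ge_min lexx orbT.
have bal : (eps + 2 * h) * (rho + h) <= f + eta + (1 - h) * k%:R.
  have hh : h * h <= h by rewrite ler_piMl ?(ltW h0) //; move: h8; goal_lra.
  have : (eps + 2 * h) * (rho + h) = s + h * (eps + 2 * rho) + 2 * (h * h) by rewrite /s; ring.
  move: hE; rewrite /den sE; move: hh; goal_lra.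
have v10 : 0 < 1 - v by rewrite subr_gt0.
near=> n.
have pn : 0 < p n by near: n; exact: (near_p_gt0 r1 hp hmu).
have n0 : (0 < n)%N by near: n; exact: nbhs_infty_gt.
have p2 : p n <= 2^-1 by near: n; apply: near_p_le => //; rewrite invr_gt0.
have hm : 2 / h <= mu_stars n r (p n) by near: n; exact: near_mu_ge.
have nh : r.+1%:R * (k.+1 + r.+1)%N%:R / h <= n%:R by near: n; exact: near_natr.
have nk : (k + r + 2)%N%:R / (1 - v) <= n%:R by near: n; exact: near_natr.
have nG : r.+1%:R * (r%:R + 1) / (a * G) <= n%:R by near: n; exact: near_natr.
have [_ zhi] : rho - h <= n%:R * p n ^+ r /\ n%:R * p n ^+ r <= rho + h.
  by near: n; exact: near_rho.
have l1 : ln (p n)^-1 + 0 <= (1 + a) * (ln n%:R / r%:R) by near: n; exact: near_lnV_upper.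
have l2 : ln (p n)^-1 + ln 2 <= (1 + a) * (ln n%:R / r%:R) by near: n; exact: near_lnV_upper.
have L1 : 1 + r%:R * 2 / (a * G) <= ln n%:R by near: n; exact: near_ln.
have nR : 0 < n%:R :> R by rewrite ltr0n.
have d0 : 0 < n%:R * p n by rewrite mulr_gt0.
have p1 : p n <= 1 by case/andP: (hp n).
rewrite addr0 in l1.
set l := ln (p n)^-1 in l1 l2 *; set L := ln n%:R in l1 l2 L1 *.
have LG : r%:R * 2 <= a * G * L.
  have : r%:R * 2 / (a * G) <= L by move: L1; goal_lra.
  by rewrite ler_pdivrMr // [L * _]mulrC.
have Lp : 0 < L.
  have : 0 < r%:R * 2 / (a * G) by rewrite divr_gt0 // mulr_gt0.
  by move: L1; goal_lra.
have [m0 [m01 m02]] := ceil_nat (mulr_ge0 v0 (ltW nR)).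
pose x := (m0 + r)%N.
have x0 : (0 < x)%N by rewrite addn_gt0 (ltnW r1) orbT.
have xR : 0 < x%:R :> R by rewrite ltr0n.
have kx : (k + x < n)%N.
  rewrite -(ltr_nat R) /x !natrD; move: nk; rewrite ler_pdivrMr // !natrD.
  by move: m02; goal_lra.
have xn : x%:R <= n%:R :> R by rewrite ler_nat ltnW // (leq_ltn_trans (leq_addl _ _) kx).
have rG : r.+1%:R * (r%:R + 1) <= a * G * n%:R.
  by rewrite [a * G * _]mulrC -ler_pdivrMr.
have rG1 : r.+1%:R <= a * G * n%:R.
  by apply: le_trans rG; rewrite ler_peMr // lerDr ltW.
have rG2 : r.+1%:R * r%:R <= a * G * n%:R.
  by apply: le_trans rG; rewrite ler_wpM2l // lerDl.
have xv : x%:R <= (nroot r f + 2 * (a * G)) * n%:R.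
  have := ler_wpM2r (ltW nR) (le_trans vle (lerD (lexx _) eta2)).
  rewrite /x natrD; move: rG1; rewrite -natr1; move: m02; goal_lra.
have H := @plant_tail_expn R r (p n) r1 (hp n) n k x h eps x0 kx pn.
apply: le_trans (H _ (ltW eps0) h0 h2 _ _ _).
- rewrite ler_expR lerN2 -/l -/L.
  set T := r%:R^-1 * floor_root r (eps * rho) * (n%:R * L).
  have TE : T = G * n%:R * (L / r%:R) by rewrite /T -/s -/G; ring.
  have LR0 : 0 <= L / r%:R by rewrite divr_ge0 // ltW.
  have T0 : 0 <= T.
    by rewrite TE; apply: mulr_ge0 LR0; exact: mulr_ge0 (ltW G0) (ltW nR).
  have aT : 0 <= a * T by rewrite mulr_ge0 // ltW.
  have a11 : 0 <= 1 + a by rewrite addr_ge0 // ltW.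
  have T1 : k%:R * (n%:R * l) <= (1 + a) * (k%:R * n%:R * (L / r%:R)).
    rewrite [leRHS]mulrCA -[k%:R * n%:R * _]mulrA ler_wpM2l // ler_wpM2l ?(ltW nR) //.
  have T2 : x%:R * ln (2 * x%:R / (n%:R * p n)) <=
      (1 + a) * ((nroot r f + 2 * (a * G)) * n%:R * (L / r%:R)).
    have lx : ln (2 * x%:R / (n%:R * p n)) <= (1 + a) * (L / r%:R).
      apply: le_trans l2; rewrite /l -lnM ?posrE ?invr_gt0 // [_^-1 * 2]mulrC.
      have Y1 : 0 < 2 * x%:R / (n%:R * p n) by rewrite divr_gt0 // mulr_gt0.
      have Y2 : 0 < 2 / p n by rewrite divr_gt0.
      rewrite ler_ln ?posrE // ler_pdivrMr //.
      have -> : 2 / p n * (n%:R * p n) = 2 * n%:R by field; rewrite gt_eqF.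
      by rewrite ler_wpM2l.
    rewrite [leRHS]mulrCA; apply: (@le_trans _ _ (x%:R * ((1 + a) * (L / r%:R)))).
      by rewrite ler_wpM2l.
    by rewrite ler_wpM2r // mulr_ge0.
  have T3 : 2 * (n%:R * p n) <= a * T.
    apply: (@le_trans _ _ (2 * n%:R)); first by rewrite ler_wpM2l // ler_piMr // ltW.
    have -> : a * T = a * G * L / r%:R * n%:R by rewrite TE; ring.
    by rewrite ler_wpM2r ?(ltW nR) // ler_pdivlMr // [2 * _]mulrC.
  have T4 : r.+1%:R * L <= a * T.
    have -> : a * T = a * G * n%:R / r%:R * L by rewrite TE; ring.
    by rewrite ler_wpM2r ?(ltW Lp) // ler_pdivlMr.
  have E : (1 + a) * (k%:R * n%:R * (L / r%:R)) +
     (1 + a) * ((nroot r f + 2 * (a * G)) * n%:R * (L / r%:R)) = (1 + a) * (1 + 2 * a) * T.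
    have fE : nroot r f = G - k%:R by rewrite GE addrK.
    by rewrite TE fE; ring.
  have aaT : a * a * T <= a * T.
    by rewrite -[a * a * T]mulrA ler_piMl //; move: a1; goal_lra.
  have etE : et = 16 * a by rewrite /a; field.
  rewrite etE; move: aT aaT T1 T2 T3 T4 E.
  by goal_lra.
- by move: p2; goal_lra.
- by rewrite mulrC -ler_pdivrMr.
- by rewrite [h * _]mulrC -ler_pdivrMr.
have -> : n%:R * (n%:R * p n) ^+ r = n%:R * p n ^+ r * n%:R ^+ r by rewrite exprMn; ring.
have nr0 : 0 <= n%:R ^+ r :> R by rewrite exprn_ge0.
apply: (@le_trans _ _ ((f + eta + (1 - h) * k%:R) * n%:R ^+ r)).
  rewrite mulrA ler_wpM2r //; apply: le_trans bal; rewrite ler_wpM2l //.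
  by rewrite addr_ge0 ?(ltW eps0) // mulr_ge0 // ltW.
rewrite mulrDl lerD2r /x addnK natrX -(nrootK r1 fe0) -/v -exprMn.
by rewrite lerXn2r ?nnegrE // mulr_ge0 // ltW.
Unshelve. all: by end_near. Qed.

End LowerFullVertices.

Section LowerPoisson.
Context {R : realType}.
Variables (r : nat) (p : nat -> R).
Hypothesis r1 : (1 < r)%N.
Hypothesis hp : forall n : nat, 0 <= p n <= 1.
Hypothesis hp0 : p n @[n --> \oo] --> (0 : R).
Hypothesis hmu : much_less (fun n : nat => ln n%:R) (mean_stars r p).
Variable C : R.
Hypothesis C0 : 0 < C.
Hypothesis HM : \forall n \near \oo, mu_stars n r (p n) <= C * (rt r p n * ln n%:R).
Variables eps I : R.
Hypothesis eps0 : 0 < eps.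
Hypothesis I0 : 0 < I.
Hypothesis HL : forall eta : R, 0 < eta -> exists de : R, [/\ 0 <= de, de <= eps &
  \forall n \near \oo, phi (eps - de) * mu_stars n r (p n) +
      nroot r de * (rt r p n * (ln n%:R / r%:R)) <= (1 + eta) * I * mu_stars n r (p n)].

Let rr0 : 0 < r%:R :> R. Proof. by rewrite ltr0n ltnW. Qed.

Local Ltac goal_lra := clear -r1 hp hp0 hmu C0 HM eps0 I0 HL rr0; lra.

Lemma near_d_le (th : R) : 0 < th -> \forall n \near \oo, n%:R * p n <= th.
Proof.
move=> th0; have a0 : 0 < 2^-1 :> R by rewrite invr_gt0.
near=> n; have pn : 0 < p n by near: n; exact: (near_p_gt0 r1 hp hmu).
have n0 : (0 < n)%N by near: n; exact: nbhs_infty_gt.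
have ld : (1 - 2^-1) * (ln n%:R / r%:R) + - ln th <= ln (n%:R * p n)^-1.
  by near: n; exact: (near_lnd r1 hp hmu C0 HM).
have L0 : 0 <= ln n%:R :> R by near: n; exact: near_ln.
have d0 : 0 < n%:R * p n by rewrite mulr_gt0 ?ltr0n.
rewrite -ler_ln ?posrE //; move: ld; rewrite lnV ?posrE //.
have : 0 <= (1 - 2^-1) * (ln n%:R / r%:R) :> R.
  rewrite mulr_ge0 ?divr_ge0 ?(ltW rr0) //; lra.
goal_lra.
Unshelve. all: by end_near. Qed.

(** One vertex carries the share de of the mean, and the remaining graph has a Poisson
excess of stars. *)
Lemma poisson_regime_lower (et : R) : 0 < et -> et < 1 ->
  \forall n \near \oo, expR (- ((1 + et) * (I * mu_stars n r (p n)))) <= tail_prob r p eps n.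
Proof.
move=> et0 et1; pose a : R := et / 16; have a0 : 0 < a by rewrite divr_gt0.
have a1 : a <= 16^-1 by rewrite /a ler_pdivrMr // mulVf //; lra.
have [de [de0 dee HLn]] := HL a0.
have l0 : 0 <= ln (2 + eps) by rewrite ln_ge0 //; lra.
have l10 : 0 < 1 + ln (2 + eps) by lra.
have aI : 0 < a * I by rewrite mulr_gt0.
pose eta : R := Num.min 1 (a * I / (1 + ln (2 + eps))).
have eta0 : 0 < eta by rewrite lt_min ltr01 divr_gt0.
have eta1 : eta <= 1 by rewrite ge_min lexx.
have etaI : eta * (1 + ln (2 + eps)) <= a * I by rewrite -ler_pdivlMr // ge_min lexx orbT.
pose e1 : R := eps - de + eta.
have e10 : 0 < e1 by rewrite ltr_wpDl // subr_ge0.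
have [M [th [th0 PL]]] := @poisson_lower R r e1 eta r1 e10 eta0.
have e20 : 0 < 2 + eps by rewrite addr_gt0.
pose h : R := Num.min 2^-1 (eta / (2 + eps)).
have h0 : 0 < h by rewrite lt_min invr_gt0 ltr0n divr_gt0.
have h2 : h <= 2^-1 by rewrite ge_min lexx.
have hE : h * (2 + eps) <= eta by rewrite -ler_pdivlMr // ge_min lexx orbT.
have re0 := nroot_ge0 r eps.
pose A : R := nroot r eps + r%:R + 1; have A0 : 0 < A.
  by rewrite /A; move: re0 rr0; goal_lra.
pose lc : R := log_const r C.
near=> n.
have pn : 0 < p n by near: n; exact: (near_p_gt0 r1 hp hmu).
have n0 : (1 < n)%N by near: n; exact: nbhs_infty_gt.
have p2 : p n <= 2^-1 by near: n; apply: near_p_le => //; rewrite invr_gt0.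
have m1 : 2 * Num.max M 0 <= mu_stars n r (p n) by near: n; exact: near_mu_ge.
have m2 : 2 / (a * I) <= mu_stars n r (p n) by near: n; exact: near_mu_ge.
have m3 : 2 * (r%:R + 1) / (a * I) * ln n%:R <= mu_stars n r (p n) by near: n; exact: near_mu.
have nh : r.+1%:R * (1 + r.+1)%N%:R / h <= n%:R by near: n; exact: near_natr.
have nj : (1 + r.+1 < n)%N by near: n; exact: nbhs_infty_gt.
have dth : n%:R * p n <= th by near: n; exact: near_d_le.
have d1 : n%:R * p n <= 1 by near: n; exact: near_d_le.
have mlog : mu_stars n r (p n) <= lc * ln n%:R ^+ r by near: n; exact: (near_mu_log r1 hp hmu HM).
have wl : (2 * lc / th) * ln n%:R ^+ r <= nroot r n%:R by near: n; exact: near_root.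
have wA : (A + 1) * ln n%:R ^+ 0 <= nroot r n%:R by near: n; exact: near_root.
have L0 : 0 <= ln n%:R :> R by near: n; exact: near_ln.
have rt1 : 1 <= rt r p n by near: n; exact: (near_rt r1 hp hmu).
have lnr : forall y : R, 0 < y -> y <= A * rt r p n ->
    ln (2 * y / (n%:R * p n)) <= (1 + a) * (ln n%:R / r%:R).
  by near: n; exact: near_ln_ratio.
have HLm : phi (eps - de) * mu_stars n r (p n) +
    nroot r de * (rt r p n * (ln n%:R / r%:R)) <= (1 + a) * I * mu_stars n r (p n) by near: n.
have [w1 wn] := nroot_nat (R := R) r1 (ltnW n0).
have rtK' := rtK r1 hp n; have rle := rt_le r1 hp n.
have nR : 0 < n%:R :> R by rewrite ltr0n ltnW.
have d0 : 0 < n%:R * p n by rewrite mulr_gt0.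
rewrite expr0 mulr1 in wA.
have m0 : 0 <= mu_stars n r (p n) by exact: mu_stars_ge0.
rewrite /tail_prob -/(star_tail r (p n) _ n).
pose N := (n - 1)%N; have nE : n = (0 + N.+1)%N by rewrite add0n /N subn1 prednK // ltnW.
have mN := mu_stars_sub r1 (hp n) nj; rewrite -/N in mN.
have mNm : mu_stars N r (p n) <= mu_stars n r (p n) by apply: mu_stars_le => //; exact: leq_subr.
set m := mu_stars n r (p n) in m1 m2 m3 mlog HLm rtK' m0 mN mNm *.
set ro := rt r p n in rt1 lnr HLm rtK' rle *; set L := ln n%:R in m3 mlog wl L0 lnr HLm *.
set w := nroot r n%:R in wl wA w1 wn rle *.
have w0 : 0 < w by apply: lt_le_trans w1.
have {}mN : (1 - h) * m <= mu_stars N r (p n).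
  apply: le_trans mN; rewrite ler_wpM2r // lerD2l lerN2 ler_pdivrMr //.
  by rewrite [h * _]mulrC -ler_pdivrMr.
have ro0 : 0 < ro by apply: lt_le_trans rt1.
have [m0' [x1 x2]] := ceil_nat (mulr_ge0 (nroot_ge0 r de) (ltW ro0)).
pose x := (m0' + r)%N.
have x0 : (0 < x)%N by rewrite addn_gt0 (ltnW r1) orbT.
have xR : 0 < x%:R :> R by rewrite ltr0n.
have rde : nroot r de <= nroot r eps by apply: nroot_le.
have xde : x%:R <= nroot r de * ro + (r%:R + 1).
  by rewrite /x natrD; move: x2; goal_lra.
have xA : x%:R <= A * ro.
  apply: (le_trans xde); have := ler_wpM2r (ltW ro0) rde.
  have : r%:R + 1 <= (r%:R + 1) * ro by rewrite ler_peMr // addr_ge0 // ltW.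
  by rewrite /A; goal_lra.
have wwn : w <= n%:R by apply: le_trans wn; rewrite expr2 ler_peMl // ltW.
have xN : (x <= N)%N.
  rewrite -ltnS (_ : N.+1 = n) // -(ltr_nat R).
  apply: (@le_lt_trans _ _ (A * w)).
    apply: (le_trans xA); rewrite ler_wpM2l ?(ltW A0) //; apply: (le_trans rle).
    by rewrite ler_piMr // ltW.
  apply: (@lt_le_trans _ _ (w * w)); last by rewrite -expr2.
  rewrite ltr_pM2r //; apply: lt_le_trans wA; by rewrite ltrDl.
have Nn : (N <= n)%N by exact: leq_subr.
have nN : (n <= 2 * N)%N.
  by rewrite {1}nE add0n mul2n -addnn -addn1 leq_add2l (leq_trans _ xN).
have q2 : 2 * p n <= 1 by move: p2; goal_lra.
have F := plant_price r1 (hp n) x0 xN Nn nN pn q2.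
have NR : n%:R <= 2 * N%:R :> R by rewrite -natrM ler_nat.
have P1 : expR (- ((phi e1 + eta) * mu_stars N r (p n))) <=
    star_tail r (p n) ((1 + e1) * mu_stars N r (p n)) N.
  apply: PL; first exact: hp.
  - have : M <= Num.max M 0 by rewrite le_max lexx.
    have : 2^-1 * m <= (1 - h) * m.
      by rewrite ler_wpM2r //; move: h2; goal_lra.
    by move: m1 mN; goal_lra.
  - by apply: le_trans dth; rewrite ler_pM2r // ler_nat.
  - apply: (le_trans mNm); apply: (le_trans mlog).
    have q : 2 * (lc * L ^+ r) <= th * n%:R.
      rewrite -ler_pdivrMl //; apply: le_trans wwn; apply: le_trans wl.
      by rewrite le_eqVlt; apply/orP; left; apply/eqP; ring.
    by have := ler_wpM2l (ltW th0) NR; move: q; goal_lra.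
have need : (1 + eps) * m <= (1 + e1) * mu_stars N r (p n) + 'C(x, r)%:R + (0 * 'C(N, r))%N%:R.
  have rf : 0 < r`!%:R :> R by rewrite ltr0n fact_gt0.
  have Cx : de * m <= 'C(x, r)%:R.
    rewrite -(ler_pM2l rf) -natrM [(r`! * _)%N]mulnC bin_ffact.
    apply: (@le_trans _ _ (m0' ^ r)%:R); last first.
      by rewrite ler_nat; apply: leq_trans (ffact_ge_expn _ _); rewrite /x addnK.
    rewrite mulrCA -rtK' -[de](nrootK r1 de0) -exprMn natrX.
    by rewrite lerXn2r ?nnegrE // mulr_ge0 ?nroot_ge0 // ltW.
  rewrite mul0n addr0.
  have : (1 + e1) * ((1 - h) * m) <= (1 + e1) * mu_stars N r (p n).
    by rewrite ler_wpM2l // addr_ge0 // ltW.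
  have : (1 + eps - de) * m <= (1 + e1) * ((1 - h) * m).
    rewrite [leRHS]mulrA ler_wpM2r // /e1.
    have : h * (1 + eps - de + eta) <= h * (2 + eps).
      by rewrite ler_wpM2l ?(ltW h0) //; move: de0 eta1; goal_lra.
    by move: hE; goal_lra.
  by move: Cx; goal_lra.
apply: le_trans (star_tail_le r (hp n) n need).
have PP := @plant R r (p n) r1 (hp n) 0 N x ((1 + e1) * mu_stars N r (p n)).
rewrite -nE mul0n expr0 mul1r in PP.
apply: le_trans PP; apply: le_trans (ler_pM (expR_ge0 _) (expR_ge0 _) F P1).
rewrite -expRD ler_expR -opprD lerN2.
have ed0 : 0 <= eps - de by rewrite subr_ge0.
have [_ ph] := @phi_incr R (eps - de) e1 ed0 (ler_wpDr (ltW eta0) (lexx _)).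
have phe : phi e1 + eta <= phi (eps - de) + a * I.
  move: ph.
  have -> : e1 - (eps - de) = eta by rewrite /e1; ring.
  have : eta * ln (1 + e1) <= eta * ln (2 + eps).
    rewrite ler_wpM2l ?(ltW eta0) // ler_ln ?posrE //; last by rewrite addr_gt0.
    by rewrite /e1; move: de0 eta1; goal_lra.
  by move: etaI; goal_lra.
have ph0 : 0 <= phi (eps - de) by rewrite phi_ge0 // subr_ge0.
have T1 : (phi e1 + eta) * mu_stars N r (p n) <= phi (eps - de) * m + a * I * m.
  rewrite -mulrDl; apply: ler_pM => //; last exact: mu_stars_ge0.
  by rewrite addr_ge0 ?phi_ge0 // ltW.
have LR0 : 0 <= L / r%:R by rewrite divr_ge0 // ltW.
have T2 : x%:R * ln (2 * x%:R / (n%:R * p n)) <=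
    (1 + a) * (nroot r de * (ro * (L / r%:R))) + a * I * m.
  apply: (@le_trans _ _ (x%:R * ((1 + a) * (L / r%:R)))).
    by rewrite ler_wpM2l // lnr.
  apply: (@le_trans _ _ ((nroot r de * ro + (r%:R + 1)) * ((1 + a) * (L / r%:R)))).
    by rewrite ler_wpM2r // mulr_ge0 // addr_ge0 // ltW.
  have -> : (nroot r de * ro + (r%:R + 1)) * ((1 + a) * (L / r%:R)) =
    (1 + a) * (nroot r de * (ro * (L / r%:R))) + (r%:R + 1) * ((1 + a) * (L / r%:R)) by ring.
  rewrite lerD2l; apply: (@le_trans _ _ (2 * (r%:R + 1) * L)).
    rewrite [2 * _]mulrC -mulrA ler_wpM2l ?addr_ge0 ?(ltW rr0) //.
    apply: ler_pM => //; first by rewrite addr_ge0 // ltW.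
      by move: a1; goal_lra.
    by rewrite ler_piMr // invf_le1 // ler1n ltnW.
  by move: m3; rewrite mulrAC ler_pdivrMr // [m * _]mulrC.
have T3 : 2 * (n%:R * p n) <= a * I * m.
  apply: (@le_trans _ _ 2); first by rewrite ler_piMr.
  by move: m2; rewrite ler_pdivrMr // [m * _]mulrC.
have Im0 : 0 <= I * m by rewrite mulr_ge0 // ltW.
have aIm : 0 <= a * (I * m) by rewrite mulr_ge0 // ltW.
have aaIm : a * a * (I * m) <= a * (I * m).
  by rewrite -[a * a * _]mulrA ler_piMl //; move: a1; goal_lra.
have pm : 0 <= a * (phi (eps - de) * m).
  by rewrite mulr_ge0 ?(ltW a0) // mulr_ge0.
have a10 : 0 <= 1 + a by rewrite addr_ge0 // ltW.
have T4 := ler_wpM2l a10 HLm.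
have etE : et = 16 * a by rewrite /a; field.
rewrite etE; move: T1 T2 T3 T4 aIm aaIm pm.
by goal_lra.
Unshelve. all: by end_near. Qed.

End LowerPoisson.

(** * From the hypotheses on the mean to the four regimes *)

Section Rates.
Context {R : realType}.
Variables (r : nat) (p : nat -> R).
Hypothesis r1 : (1 < r)%N.
Hypothesis hp : forall n : nat, 0 <= p n <= 1.
Hypothesis hp0 : p n @[n --> \oo] --> (0 : R).
Hypothesis hmu : much_less (fun n : nat => ln n%:R) (mean_stars r p).
Variable eps : R.
Hypothesis eps0 : 0 < eps.

Let rr0 : 0 < r%:R :> R. Proof. by rewrite ltr0n ltnW. Qed.
Let r10 : 0 < r%:R - 1 :> R. Proof. by rewrite subr_gt0 ltr1n. Qed.
Let beta : R := r%:R / (r%:R - 1).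

Lemma powR_neg_le (x y e : R) : 0 < x -> x <= y -> e < 0 -> y `^ e <= x `^ e.
Proof.
move=> x0 xy e0; have y0 := lt_le_trans x0 xy.
by rewrite -ler_ln ?posrE ?powR_gt0 // !ln_powR ler_nM2l // ler_ln.
Qed.

Lemma upper_tailE n : upper_tail r eps p n = tail_prob r p eps n.
Proof. by rewrite /upper_tail /tail_prob mean_starsE'. Qed.

Lemma mean_ge0 n : 0 <= mean_stars r p n.
Proof. by rewrite mean_starsE' // mu_stars_ge0. Qed.

Lemma powR_beta (L : R) : 0 <= L -> (L `^ beta) ^+ r.-1 = L ^+ r.
Proof.
move=> L0; rewrite -powR_mulrn ?powR_ge0 // -powRrM.
have -> : beta * r.-1%:R = r%:R.
  have -> : r.-1%:R = r%:R - 1 :> R by rewrite -subn1 natrB // ltnW.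
  by rewrite /beta divfK // gt_eqF.
by rewrite powR_mulrn.
Qed.

Lemma near_rt_log_ge (c : R) : 0 <= c ->
  (\forall n \near \oo, mu_stars n r (p n) <= (c + 1) * ln n%:R `^ beta) ->
  \forall n \near \oo, mu_stars n r (p n) <= nroot r ((c + 1) ^+ r.-1) * (rt r p n * ln n%:R).
Proof.
move=> c0 H; have c10 : 0 <= c + 1 by rewrite addr_ge0.
near=> n.
have M : mu_stars n r (p n) <= (c + 1) * ln n%:R `^ beta by near: n.
have L0 : 0 <= ln n%:R :> R by near: n; exact: near_ln.
have rtK' := rtK r1 hp n; have m0 := mu_stars_ge0 n r (hp n).
set m := mu_stars n r (p n) in M rtK' m0 *.
have rt0 : 0 <= rt r p n := nroot_ge0 _ _.
have rhs0 : 0 <= nroot r ((c + 1) ^+ r.-1) * (rt r p n * ln n%:R).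
  by rewrite mulr_ge0 ?nroot_ge0 // mulr_ge0.
rewrite -(ler_pXn2r (n := r)) ?nnegrE ?(ltnW r1) //.
rewrite [(nroot r _ * _) ^+ r]exprMn nrootK ?exprn_ge0 // [(rt r p n * _) ^+ r]exprMn rtK'.
have E : m ^+ r = m ^+ r.-1 * m by rewrite -exprSr prednK // ltnW.
have m1 : m ^+ r.-1 <= (c + 1) ^+ r.-1 * ln n%:R ^+ r.
  rewrite -powR_beta // -exprMn; apply: lerXn2r => //; rewrite nnegrE.
  exact: mulr_ge0 c10 (powR_ge0 _ _).
rewrite E; apply: (le_trans (ler_wpM2r m0 m1)).
rewrite -mulrA ler_wpM2l ?exprn_ge0 // [leLHS]mulrC; apply: ler_wpM2r; first exact: exprn_ge0.
by rewrite ler_peMl // ler1n fact_gt0.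
Unshelve. all: by end_near. Qed.

Lemma near_rt_log_le (A : R) :
  much_less (fun n : nat => ln n%:R `^ beta) (mean_stars r p) ->
  \forall n \near \oo, A * (rt r p n * ln n%:R) <= mu_stars n r (p n).
Proof.
move=> H; pose A1 := `|A| + 1; have A10 : 1 <= A1 by rewrite lerDr.
have rf : 1 <= r`!%:R :> R by rewrite ler1n fact_gt0.
pose B : R := A1 ^+ r * r`!%:R.
have B1 : 1 <= B by rewrite mulr_ege1 // exprn_ege1.
have HB := near_much_less B H mean_ge0.
have HB' : \forall n \near \oo, B * ln n%:R `^ beta <= mu_stars n r (p n).
  by apply: filterS HB => n; rewrite mean_starsE'.
near=> n.
have M : B * ln n%:R `^ beta <= mu_stars n r (p n) by near: n.
have L0 : 0 <= ln n%:R :> R by near: n; exact: near_ln.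
have rtK' := rtK r1 hp n; have m0 := mu_stars_ge0 n r (hp n).
set m := mu_stars n r (p n) in M rtK' m0 *.
have rt0 : 0 <= rt r p n := nroot_ge0 _ _.
have rL : 0 <= rt r p n * ln n%:R by rewrite mulr_ge0.
apply: (@le_trans _ _ (A1 * (rt r p n * ln n%:R))).
  by rewrite ler_wpM2r // /A1 (le_trans (ler_norm A)) // lerDl.
have A1p : 0 <= A1 by apply: le_trans A10.
have lhs0 := mulr_ge0 A1p rL.
rewrite -(ler_pXn2r (n := r)) ?nnegrE ?(ltnW r1) //.
rewrite [(A1 * _) ^+ r]exprMn [(rt r p n * _) ^+ r]exprMn rtK'.
have E : m ^+ r = m ^+ r.-1 * m by rewrite -exprSr prednK // ltnW.
have m1 : B * ln n%:R ^+ r <= m ^+ r.-1.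
  have BL : 0 <= B * ln n%:R `^ beta by rewrite mulr_ge0 ?powR_ge0 // (le_trans _ B1).
  apply: (@le_trans _ _ ((B * ln n%:R `^ beta) ^+ r.-1)); last first.
    by rewrite lerXn2r ?nnegrE // (le_trans BL).
  rewrite exprMn powR_beta // ler_wpM2r ?exprn_ge0 // ler_eXnr //.
  by rewrite -subn1 subn_gt0.
rewrite E; apply: le_trans (ler_wpM2r m0 m1).
by rewrite /B le_eqVlt; apply/orP; left; apply/eqP; ring.
Unshelve. all: by end_near. Qed.

Lemma near_rt_n (A : R) : much_less (mean_stars r p) (fun n : nat => n%:R ^+ r) ->
  \forall n \near \oo, A * rt r p n <= n%:R.
Proof.
move=> H; pose A1 := `|A| + 1; have A10 : 0 < A1 by rewrite ltr_wpDl.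
have HB := near_much_less (A1 ^+ r * r`!%:R) H (fun n => exprn_ge0 r (ler0n R n)).
have HB' : \forall n \near \oo, A1 ^+ r * r`!%:R * mu_stars n r (p n) <= n%:R ^+ r.
  by apply: filterS HB => n; rewrite mean_starsE'.
near=> n.
have M : A1 ^+ r * r`!%:R * mu_stars n r (p n) <= n%:R ^+ r.
  by near: n.
have m0 := mu_stars_ge0 n r (hp n).
have rt0 : 0 <= rt r p n := nroot_ge0 _ _.
apply: (@le_trans _ _ (A1 * rt r p n)).
  by rewrite ler_wpM2r // /A1 (le_trans (ler_norm A)) // lerDl.
have lhs0 := mulr_ge0 (ltW A10) rt0.
rewrite -(ler_pXn2r (n := r)) ?nnegrE ?(ltnW r1) //.
by rewrite exprMn (rtK r1 hp) mulrA.
Unshelve. all: by end_near. Qed.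

Lemma near_full_ge (A : R) : much_less (fun n : nat => n%:R ^+ r) (mean_stars r p) ->
  \forall n \near \oo, A <= n%:R * p n ^+ r.
Proof.
move=> H; have HB := near_much_less `|A| H mean_ge0.
have HB' : \forall n \near \oo, `|A| * n%:R ^+ r <= mu_stars n r (p n).
  by apply: filterS HB => n; rewrite mean_starsE'.
near=> n.
have M : `|A| * n%:R ^+ r <= mu_stars n r (p n) by near: n.
have n0 : (0 < n)%N by near: n; exact: nbhs_infty_gt.
have /andP[p0 _] := hp n.
have rf : 1 <= r`!%:R :> R by rewrite ler1n fact_gt0.
have nr0 : 0 < n%:R ^+ r :> R by rewrite exprn_gt0 // ltr0n.
apply: (le_trans (ler_norm A)); rewrite -(ler_pM2r nr0); apply: (le_trans M).
apply: (@le_trans _ _ (r`!%:R * mu_stars n r (p n))).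
  by rewrite ler_peMl // mu_stars_ge0.
apply: (le_trans (mu_stars_fact_le n r p0)).
by rewrite exprMn le_eqVlt; apply/orP; left; apply/eqP; ring.
Unshelve. all: by end_near. Qed.

Lemma cvg_rho (rho : R) : mean_stars r p n / ('C(n, r))%:R @[n --> \oo] --> rho ->
  n%:R * p n ^+ r @[n --> \oo] --> rho.
Proof.
move=> H; apply/cvgrPdist_le => e e0.
have e20 : 0 < e / 2 by rewrite divr_gt0.
have er0 : 0 < e / 2 / r%:R by rewrite divr_gt0.
near=> n.
have n0 : (r < n)%N by near: n; exact: nbhs_infty_gt.
have h1 : `|rho - mean_stars r p n / ('C(n, r))%:R| <= e / 2.
  by near: n; move/cvgrPdist_le : H; apply.
have h2 : p n <= e / 2 / r%:R by near: n; exact: near_p_le.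
have /andP[p0 p1] := hp n.
have C0 : ('C(n, r))%:R != 0 :> R by rewrite pnatr_eq0 -lt0n bin_gt0 ltnW.
have E : mean_stars r p n / ('C(n, r))%:R = n%:R * p n ^+ r - r%:R * p n ^+ r.
  rewrite mean_starsE' // /mu_stars -natrM mul_bin_down natrM natrB ?(ltnW n0) //.
  by field.
move: h1; rewrite E => h1.
have -> : rho - n%:R * p n ^+ r = rho - (n%:R * p n ^+ r - r%:R * p n ^+ r) + - (r%:R * p n ^+ r) by ring.
apply: (le_trans (ler_normD _ _)); rewrite normrN (ger0_norm (mulr_ge0 _ _)) ?exprn_ge0 //.
have : r%:R * p n ^+ r <= e / 2.
  rewrite mulrC -ler_pdivlMr //; apply: le_trans h2.
  by apply: ler_iXnr => //; exact: ltnW.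
by move: h1; clear -r1 hp hp0 hmu eps0 rr0 r10; lra.
Unshelve. all: by end_near. Qed.

Section Poisson.
Variable c : R.
Hypothesis c0 : 0 <= c.
Hypothesis Hc : mean_stars r p n / ln n%:R `^ beta @[n --> \oo] --> c.

Let sc n := mu_stars n r (p n) / ln n%:R `^ beta.
Let kap : R := nroot r r`!%:R / r%:R.

Let kap0 : 0 < kap.
Proof. by rewrite divr_gt0 // nroot_gt0 // ltr0n fact_gt0. Qed.

Let sc_cvg : sc n @[n --> \oo] --> c.
Proof.
suff -> : sc = (fun n => mean_stars r p n / ln n%:R `^ beta) by [].
by apply/funext => n; rewrite /sc mean_starsE'.
Qed.

Lemma near_mu_beta : \forall n \near \oo, mu_stars n r (p n) <= (c + 1) * ln n%:R `^ beta.
Proof.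
near=> n; have L0 : 1 <= ln n%:R :> R by near: n; exact: near_ln.
have : `|c - sc n| <= 1 by near: n; move/cvgrPdist_le : sc_cvg; apply.
rewrite ler_distlC => /andP[_]; rewrite /sc ler_pdivrMr // powR_gt0 //.
exact: lt_le_trans L0.
Unshelve. all: by end_near. Qed.

(** The origin of the exponent 1 / r - 1 in the rate: when mu is sc n times ln n ^ beta, the
price of a large degree, which is a multiple of mu ^ (1 / r) * ln n, becomes a multiple of
mu. *)
Lemma near_rt_sc : \forall n \near \oo, 0 < sc n /\
  rt r p n * (ln n%:R / r%:R) = kap * sc n `^ (r%:R^-1 - 1) * mu_stars n r (p n).
Proof.
near=> n; have L1 : 1 <= ln n%:R :> R by near: n; exact: near_ln.
have m1 : 1 <= mu_stars n r (p n) by near: n; exact: near_mu_ge.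
have L0 : 0 < ln n%:R :> R by apply: lt_le_trans L1.
have m0 : 0 < mu_stars n r (p n) by apply: lt_le_trans m1.
have Lb0 : 0 < ln n%:R `^ beta :> R by rewrite powR_gt0.
have s0 : 0 < sc n by rewrite divr_gt0.
split=> //; rewrite /rt nrootM ?(ltW m0) // /kap.
have E : nroot r (mu_stars n r (p n)) * ln n%:R = sc n `^ (r%:R^-1 - 1) * mu_stars n r (p n).
  have mE : mu_stars n r (p n) = sc n * ln n%:R `^ beta by rewrite /sc divfK // gt_eqF.
  have nz : r%:R - 1 != 0 :> R by rewrite gt_eqF.
  have rz : r%:R != 0 :> R by rewrite gt_eqF.
  have b1 : 0 < nroot r (mu_stars n r (p n)) * ln n%:R by rewrite mulr_gt0 // nroot_gt0.
  have b2 : 0 < sc n `^ (r%:R^-1 - 1) * mu_stars n r (p n).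
    by apply: mulr_gt0 => //; exact: powR_gt0.
  apply: ln_inj; [exact: b1|exact: b2|].
  have a1 : 0 < nroot r (mu_stars n r (p n)) by exact: nroot_gt0.
  have a2 : 0 < sc n `^ (r%:R^-1 - 1) by exact: powR_gt0.
  have lm : ln (mu_stars n r (p n)) = ln (sc n) + beta * ln (ln n%:R).
    by rewrite {1}mE (lnM s0 Lb0) ln_powR.
  rewrite (lnM a1 L0) (lnM a2 m0) ln_root ln_powR lm /beta.
  by move: (ln (sc n)) (ln (ln n%:R)) => x y; field; rewrite rz nz.
transitivity (nroot r r`!%:R / r%:R * (nroot r (mu_stars n r (p n)) * ln n%:R)); first by ring.
by rewrite E; ring.
Unshelve. all: by end_near. Qed.

Lemma psi_kap (de g : R) : 0 <= de -> psi r de * g = nroot r de * (kap * g).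
Proof.
move=> de0; rewrite /psi -/(nroot r _) nrootM ?ler0n // /kap; ring.
Qed.

Lemma rate_gt0 : 0 < rate r c eps.
Proof.
have [c00|cp] := eqVneq c 0; first by rewrite /rate c00 eqxx phi_gt0.
have cp0 : 0 < c by rewrite lt_neqAle eq_sym cp.
have [d dI [-> _]] := rate_min (ltnW r1) cp0 eps0.
move: dI; rewrite in_itv /= => /andP[d0 de]; rewrite /rate_fun psi_kap //.
have g0 : 0 < kap * c `^ (r%:R^-1 - 1) by rewrite mulr_gt0 // powR_gt0.
have p0 : 0 <= phi (eps - d) by rewrite phi_ge0 // subr_ge0.
move: d0; rewrite le_eqVlt => /orP[/eqP <-|d0].
  by rewrite subr0 ltr_pwDl ?phi_gt0 // mulr_ge0 ?nroot_ge0 // ltW.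
by rewrite ltr_wpDl // mulr_gt0 // nroot_gt0.
Qed.

Lemma near_sc_pow (eta : R) : 0 < c -> 0 < eta -> \forall n \near \oo,
  (1 - eta) * c `^ (r%:R^-1 - 1) <= sc n `^ (r%:R^-1 - 1) /\
  sc n `^ (r%:R^-1 - 1) <= (1 + eta) * c `^ (r%:R^-1 - 1).
Proof.
move=> cp eta0; have g0 : 0 < c `^ (r%:R^-1 - 1) by rewrite powR_gt0.
have cont : {for c, continuous (fun x : R => x `^ (r%:R^-1 - 1))}.
  apply: differentiable_continuous; apply/derivable1_diffP.
  by apply: derivable_powR; rewrite in_itv /= andbT.
have CV : sc n `^ (r%:R^-1 - 1) @[n --> \oo] --> c `^ (r%:R^-1 - 1).
  exact: (continuous_cvg _ cont sc_cvg).
have := CV; move/cvgrPdist_le => /(_ _ (mulr_gt0 eta0 g0)).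
apply: filterS => n; rewrite ler_distlC => /andP[h1 h2].
by split; move: h1 h2; clear -r1 hp hp0 hmu eps0 rr0 r10 c0 Hc kap0 sc_cvg; lra.
Qed.

(** For c = 0 every positive share of the mean is too expensive for one vertex, so that only
shares near 0 matter, where phi is continuous. For c > 0 the rate is a minimum over the
shares. *)
Lemma near_rate_lower (eta : R) : 0 < eta ->
  \forall n \near \oo, forall de, 0 <= de -> de <= eps ->
  (1 - eta) * rate r c eps * mu_stars n r (p n) <=
  phi (eps - de) * mu_stars n r (p n) + nroot r de * (rt r p n * (ln n%:R / r%:R)).
Proof.
move=> eta0; have [c00|cp] := eqVneq c 0.
  have phe0 := phi_gt0 eps0.
  have le0 : 0 < ln (1 + eps) by rewrite ln_gt0 // ltrDl.
  pose d0 : R := eta * phi eps / ln (1 + eps).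
  have d00 : 0 < d0 by rewrite divr_gt0 // mulr_gt0.
  pose A : R := phi eps / (kap * nroot r d0).
  have kd0 : 0 < kap * nroot r d0 by rewrite mulr_gt0 // nroot_gt0.
  have A0 : 0 < A by rewrite divr_gt0.
  have ex0 : r%:R^-1 - 1 != 0 :> R by rewrite lt_eqF // subr_lt0 invf_lt1 // ltr1n.
  have ex1 : r%:R^-1 - 1 < 0 :> R by rewrite subr_lt0 invf_lt1 // ltr1n.
  pose e : R := A `^ (r%:R^-1 - 1)^-1.
  have e0 : 0 < e by rewrite powR_gt0.
  near=> n => de de0 dee.
  have m0 := mu_stars_ge0 n r (hp n).
  have [s0 sE] : 0 < sc n /\
    rt r p n * (ln n%:R / r%:R) = kap * sc n `^ (r%:R^-1 - 1) * mu_stars n r (p n).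
    by near: n; exact: near_rt_sc.
  have se : `|c - sc n| <= e by near: n; move/cvgrPdist_le : sc_cvg; apply.
  have {}se : sc n <= e by move: se; rewrite c00 sub0r normrN gtr0_norm.
  have sA : A <= sc n `^ (r%:R^-1 - 1).
    have -> : A = e `^ (r%:R^-1 - 1) by rewrite /e -powRrM mulVf // powRr1 // ltW.
    exact: powR_neg_le.
  rewrite /rate c00 eqxx sE; have eta1 : 0 <= eta * phi eps by rewrite mulr_ge0 // ltW.
  have ph0 : 0 <= phi (eps - de) by rewrite phi_ge0 // subr_ge0.
  have Y0 : 0 <= nroot r de * (kap * sc n `^ (r%:R^-1 - 1) * mu_stars n r (p n)).
    by rewrite mulr_ge0 ?nroot_ge0 // mulr_ge0 // mulr_ge0 ?powR_ge0 // ltW.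
  have [dd|dd] := leP de d0.
    apply: ler_wpDr => //; rewrite ler_wpM2r //.
    have ed0 : 0 <= eps - de by rewrite subr_ge0.
    have ee : eps - de <= eps by rewrite gerBl.
    have [_] := phi_incr ed0 ee; have -> : eps - (eps - de) = de by ring.
    have : de * ln (1 + eps) <= eta * phi eps by rewrite -ler_pdivlMr.
    by clear -r1 hp hp0 hmu eps0 rr0 r10 c0 Hc kap0 sc_cvg; lra.
  apply: ler_wpDl; first exact: mulr_ge0.
  rewrite mulrA ler_wpM2r //; apply: (@le_trans _ _ (phi eps)).
    by move: eta1; clear -r1 hp hp0 hmu eps0 rr0 r10 c0 Hc kap0 sc_cvg; lra.
  have -> : phi eps = nroot r d0 * (kap * A) by rewrite /A; field; rewrite !gt_eqF // nroot_gt0.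
  apply: (ler_pM (nroot_ge0 r d0) (mulr_ge0 (ltW kap0) (ltW A0))).
    exact: (@nroot_le R r d0 de (ltW d00) (ltW dd)).
  by rewrite ler_wpM2l // ltW.
have cp0 : 0 < c by rewrite lt_neqAle eq_sym cp.
near=> n => de de0 dee.
have m0 := mu_stars_ge0 n r (hp n).
have [s0 sE] : 0 < sc n /\
  rt r p n * (ln n%:R / r%:R) = kap * sc n `^ (r%:R^-1 - 1) * mu_stars n r (p n).
  by near: n; exact: near_rt_sc.
have [sl _] : (1 - eta) * c `^ (r%:R^-1 - 1) <= sc n `^ (r%:R^-1 - 1) /\
  sc n `^ (r%:R^-1 - 1) <= (1 + eta) * c `^ (r%:R^-1 - 1) by near: n; exact: near_sc_pow.
have [d dI [rE dmin]] := rate_min (ltnW r1) cp0 eps0.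
have ph0 : 0 <= phi (eps - de) by rewrite phi_ge0 // subr_ge0.
have rle : rate r c eps <= phi (eps - de) + nroot r de * (kap * c `^ (r%:R^-1 - 1)).
  by rewrite rE -psi_kap //; apply: dmin; rewrite in_itv /= de0.
rewrite sE mulrA -mulrDl ler_wpM2r //.
have [eta1|eta1] := leP 1 eta.
  apply: (@le_trans _ _ 0).
    by rewrite mulr_le0_ge0 ?subr_le0 // ltW // rate_gt0.
  rewrite addr_ge0 // mulr_ge0 ?nroot_ge0 // mulr_ge0 ?powR_ge0 ?(ltW kap0) //.
have e10 : 0 <= 1 - eta by rewrite subr_ge0 ltW.
apply: (le_trans (ler_wpM2l e10 rle)); rewrite mulrDr; apply: lerD.
  by rewrite ler_piMl // gerBl ltW.
rewrite mulrCA ler_wpM2l ?nroot_ge0 // mulrCA ler_wpM2l // ltW //.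
Unshelve. all: by end_near. Qed.

Lemma near_rate_upper (eta : R) : 0 < eta -> exists de : R, [/\ 0 <= de, de <= eps &
  \forall n \near \oo, phi (eps - de) * mu_stars n r (p n) +
      nroot r de * (rt r p n * (ln n%:R / r%:R)) <=
      (1 + eta) * rate r c eps * mu_stars n r (p n)].
Proof.
move=> eta0; have [c00|cp] := eqVneq c 0.
  exists 0; split; [by []|exact: ltW|].
  apply: nearW => n; rewrite subr0 nroot0 // mul0r addr0 /rate c00 eqxx.
  rewrite ler_wpM2r ?mu_stars_ge0 // ler_peMl ?phi_ge0 ?(ltW eps0) //.
  by rewrite lerDl ltW.
have cp0 : 0 < c by rewrite lt_neqAle eq_sym cp.
have [d dI [rE dmin]] := rate_min (ltnW r1) cp0 eps0.
move: (dI); rewrite in_itv /= => /andP[d0 de].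
exists d; split=> //; near=> n.
have m0 := mu_stars_ge0 n r (hp n).
have [s0 sE] : 0 < sc n /\
  rt r p n * (ln n%:R / r%:R) = kap * sc n `^ (r%:R^-1 - 1) * mu_stars n r (p n).
  by near: n; exact: near_rt_sc.
have [_ su] : (1 - eta) * c `^ (r%:R^-1 - 1) <= sc n `^ (r%:R^-1 - 1) /\
  sc n `^ (r%:R^-1 - 1) <= (1 + eta) * c `^ (r%:R^-1 - 1) by near: n; exact: near_sc_pow.
have ph0 : 0 <= phi (eps - d) by rewrite phi_ge0 // subr_ge0.
rewrite sE mulrA -mulrDl ler_wpM2r // rE /rate_fun psi_kap // mulrDr; apply: lerD.
  by rewrite ler_peMl // lerDl ltW.
by rewrite [leRHS]mulrCA ler_wpM2l ?nroot_ge0 // [leRHS]mulrCA ler_wpM2l // ltW.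
Unshelve. all: by end_near. Qed.

End Poisson.
End Rates.

Theorem theorem1 (R : realType) (r : nat) (hr : (2 <= r)%N)
    (eps : R) (heps : 0 < eps)
    (p : nat -> R) (hp : forall n : nat, 0 <= p n <= 1)
    (hp0 : p n @[n --> \oo] --> (0 : R))
    (hmu : much_less (fun n : nat => ln n%:R) (mean_stars r p)) :
  [/\ forall c : R, 0 <= c ->
        mean_stars r p n / ln n%:R `^ (r%:R / (r%:R - 1)) @[n --> \oo] --> c ->
        asymp_eq (fun n : nat => - ln (upper_tail r eps p n))
                 (fun n : nat => rate r c eps * mean_stars r p n),
      much_less (fun n : nat => ln n%:R `^ (r%:R / (r%:R - 1)))
                (mean_stars r p) ->
        much_less (mean_stars r p) (fun n : nat => n%:R ^+ r) ->
        asymp_eq (fun n : nat => - ln (upper_tail r eps p n))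
                 (fun n : nat =>
                    psi r eps * mean_stars r p n `^ r%:R^-1 * ln n%:R),
      forall rho : R, 0 < rho ->
        mean_stars r p n / ('C(n, r))%:R @[n --> \oo] --> rho ->
        asymp_eq (fun n : nat => - ln (upper_tail r eps p n))
                 (fun n : nat =>
                    r%:R^-1 * (frac_part (eps * rho) `^ r%:R^-1
                               + (Num.floor (eps * rho))%:~R)
                    * (n%:R * ln n%:R))
    & much_less (fun n : nat => n%:R ^+ r) (mean_stars r p) ->
        asymp_eq (fun n : nat => - ln (upper_tail r eps p n))
                 (fun n : nat => eps * n%:R ^+ 2 * p n ^+ r * ln (p n)^-1)].
Proof.
have r0 : 0 < r%:R :> R by rewrite ltr0n ltnW.
have tailE : upper_tail r eps p = tail_prob r p eps.
  by apply/funext => n; rewrite upper_tailE.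
have meanE : mean_stars r p = (fun n => mu_stars n r (p n)).
  by apply/funext => n; rewrite mean_starsE'.
rewrite tailE; split.
- move=> c c0 Hc.
  have I0 := rate_gt0 hr heps c0.
  have HM := near_rt_log_ge hr hp c0 (near_mu_beta hr Hc).
  have C0 : 0 < nroot r ((c + 1) ^+ r.-1) by rewrite nroot_gt0 // exprn_gt0 // ltr_wpDl.
  rewrite meanE; apply: asymp_tail.
  + near=> n; rewrite mulr_gt0 //; apply: (@lt_le_trans _ _ 1) => //.
    by near: n; exact: near_mu_ge.
  + move=> h h0 h1; apply: (poisson_regime_upper hr hp hmu C0 HM heps I0) => // eta eta0.
    exact: near_rate_lower.
  + move=> h h0 h1; apply: (poisson_regime_lower hr hp hp0 hmu C0 HM heps I0) => // eta eta0.
    exact: near_rate_upper.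
- move=> H1 H2.
  have HQ A := near_rt_log_le hr hp A H1.
  have HS A := near_rt_n hr hp A H2.
  have -> : (fun n => psi r eps * mean_stars r p n `^ r%:R^-1 * ln n%:R) =
      (fun n => r%:R^-1 * (nroot r eps * rt r p n) * ln n%:R).
    by apply/funext => n; rewrite mean_starsE' // psi_rt // ltW.
  apply: asymp_tail.
  + near=> n; rewrite mulr_gt0 //.
      rewrite mulr_gt0 ?invr_gt0 //; apply: (mulr_gt0 (nroot_gt0 r heps)).
      apply: (@lt_le_trans _ _ 1) => //.
      by near: n; exact: (near_rt hr hp hmu).
    by apply: (@lt_le_trans _ _ 1) => //; near: n; exact: near_ln.
  + by move=> h h0 h1; exact: single_vertex_regime_upper.
  + by move=> h h0 h1; exact: single_vertex_regime_lower.
- move=> rho rho0 H; have HR := cvg_rho hr hp hp0 H.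
  apply: asymp_tail.
  + near=> n; apply: mulr_gt0.
      by rewrite mulr_gt0 ?invr_gt0 //; apply: (floor_root_gt0 hr); rewrite mulr_gt0.
    apply: mulr_gt0; first by rewrite ltr0n; near: n; exact: nbhs_infty_gt.
    by apply: (@lt_le_trans _ _ 1) => //; near: n; exact: near_ln.
  + by move=> h h0 h1; exact: full_vertices_regime_upper.
  + by move=> h h0 h1; exact: full_vertices_regime_lower.
- move=> H; have HA A := near_full_ge hr hp A H.
  apply: asymp_tail.
  + near=> n; have pn : 0 < p n by near: n; exact: (near_p_gt0 hr hp hmu).
    have n0 : 0 < n%:R :> R by rewrite ltr0n; near: n; exact: nbhs_infty_gt.
    apply: mulr_gt0; first by rewrite !mulr_gt0 // exprn_gt0.
    apply: (@lt_le_trans _ _ 1) => //; near: n; exact: (near_lnV hr hp hp0 hmu).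
  + by move=> h h0 h1; exact: (dense_regime_upper hr hp hp0 hmu heps ltr01 (HA 1)).
  + by move=> h h0 h1; exact: dense_regime_lower.
Unshelve. all: by end_near. Qed.
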